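(* There is an algorithm that, given as input a set $P$ of $n$ points in $\mathbb R^d$, a starting point $s$, a budget $B>0$, and an accuracy parameter $\delta\in(0,1)$, computes in time $n^{O(1/\delta)}(\log n)^{(d/\delta)^{O(d)}}$ a path that starts at $s$, has length at most $B$, and visits at least $(1-\delta)k_{\mathrm{opt}}$ points of $P$, where $k_{\mathrm{opt}}$ is the maximum possible number of points of $P$ that can be visited by a path starting at $s$ of length at most $B$.
   Context: A path is a sequence of points $\langle p_1,\ldots,p_k\rangle$ in $\mathbb R^d$; its length is $\sum_{j=1}^{k-1}\|p_{j+1}-p_j\|$ (Euclidean norm). The points of $P$ visited by a path are those of $P$ appearing in the sequence. This is the rooted orienteering problem in Euclidean space. *)

(* Defs.v *)
From HB Require Import structures.
From mathcomp Require Import all_boot all_order all_algebra.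
From mathcomp Require Import all_classical all_reals all_analysis.

Set Implicit Arguments.
Unset Strict Implicit.
Unset Printing Implicit Defensive.
Import Order.TTheory GRing.Theory Num.Theory.

Local Open Scope ring_scope.

(* The library norm on 'rV[R]_d is the maximum norm. *)
Definition enorm (R : realType) (d : nat) (x : 'rV[R]_d) : R :=
  Num.sqrt (\sum_(i < d) x 0 i ^+ 2).

Definition path_length (R : realType) (d : nat) (q : seq 'rV[R]_d) : R :=
  \sum_(j < (size q).-1) enorm (q`_j.+1 - q`_j).

Definition starts_at (R : realType) (d : nat) (s : 'rV[R]_d)
    (q : seq 'rV[R]_d) : Prop :=
  ohead q = Some s.

(* A finite point set is given by a duplicate-free enumeration P, so that
   counting over P counts distinct points. *)
Definition num_visited (R : realType) (d : nat) (P q : seq 'rV[R]_d) : nat :=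
  count (fun p => p \in q) P.

Definition k_opt (R : realType) (d : nat) (P : seq 'rV[R]_d) (s : 'rV[R]_d)
    (B : R) : nat :=
  \max_(k < (size P).+1 |
        `[< exists q, [/\ starts_at s q, path_length q <= B
                        & num_visited P q = k] >]) k.

(* Real RAM.  A machine has two infinite memories, one of natural numbers and
   one of exact real numbers.  Cells are addressed directly by a numeral of
   the program, or indirectly through the contents of a nat cell.  As is usual
   in computational geometry, +, -, *, /, square root and comparison of reals
   take unit time.  There is no floor function and no way to turn a real into
   a nat other than branching on comparisons; nats only have addition and
   truncated subtraction, since unit-cost multiplication of unbounded integers
   (or floor) would make the uniform cost measure unreasonably powerful. *)
Inductive instr : Type :=
| NConst of nat & nat           (* N[x] := c *)
| NAdd of nat & nat & nat       (* N[x] := N[y] + N[z] *)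
| NSub of nat & nat & nat       (* N[x] := N[y] - N[z] *)
| NLoad of nat & nat            (* N[x] := N[N[y]] *)
| NStore of nat & nat           (* N[N[x]] := N[y] *)
| RZero of nat                  (* R[x] := 0 *)
| ROne of nat                   (* R[x] := 1 *)
| RAdd of nat & nat & nat       (* R[x] := R[y] + R[z] *)
| RSub of nat & nat & nat       (* R[x] := R[y] - R[z] *)
| RMul of nat & nat & nat       (* R[x] := R[y] * R[z] *)
| RDiv of nat & nat & nat       (* R[x] := R[y] / R[z] *)
| RSqrt of nat & nat            (* R[x] := sqrt R[y] *)
| RLoad of nat & nat            (* R[x] := R[N[y]] *)
| RStore of nat & nat.          (* R[N[x]] := R[y] *)

Inductive test : Type :=
| NLe of nat & nat              (* N[x] <= N[y] *)
| NLt of nat & nat              (* N[x] < N[y] *)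
| RLe of nat & nat              (* R[x] <= R[y] *)
| RLt of nat & nat.             (* R[x] < R[y] *)

Inductive program : Type :=
| Skip
| Do of instr
| Seq of program & program
| If of test & program & program
| While of test & program.

Record memory (R : realType) : Type :=
  Memory { nmem : nat -> nat; rmem : nat -> R }.

Definition upd (T : Type) (f : nat -> T) (x : nat) (v : T) : nat -> T :=
  fun y => if y == x then v else f y.

Definition setN (R : realType) (m : memory R) (x v : nat) : memory R :=
  Memory (upd (nmem m) x v) (rmem m).

Definition setR (R : realType) (m : memory R) (x : nat) (v : R) : memory R :=
  Memory (nmem m) (upd (rmem m) x v).

Definition exec_instr (R : realType) (i : instr) (m : memory R) : memory R :=
  let N := nmem m in
  let r := rmem m in
  match i with
  | NConst x c => setN m x c
  | NAdd x y z => setN m x (N y + N z)%N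
  | NSub x y z => setN m x (N y - N z)%N
  | NLoad x y => setN m x (N (N y))
  | NStore x y => setN m (N x) (N y)
  | RZero x => setR m x 0
  | ROne x => setR m x 1
  | RAdd x y z => setR m x (r y + r z)
  | RSub x y z => setR m x (r y - r z)
  | RMul x y z => setR m x (r y * r z)
  | RDiv x y z => setR m x (r y / r z)
  | RSqrt x y => setR m x (Num.sqrt (r y))
  | RLoad x y => setR m x (r (N y))
  | RStore x y => setR m (N x) (r y)
  end.

Definition eval_test (R : realType) (b : test) (m : memory R) : bool :=
  match b with
  | NLe x y => (nmem m x <= nmem m y)%N
  | NLt x y => (nmem m x < nmem m y)%N
  | RLe x y => rmem m x <= rmem m y
  | RLt x y => rmem m x < rmem m y
  end.

(* exec c m t m' : started in memory m, program c halts after t time units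
   (one per instruction and one per evaluated test) in memory m'. *)
Inductive exec (R : realType) :
    program -> memory R -> nat -> memory R -> Prop :=
| exec_Skip m : exec Skip m 1 m
| exec_Do i m : exec (Do i) m 1 (exec_instr i m)
| exec_Seq c1 c2 m1 m2 m3 t1 t2 :
    exec c1 m1 t1 m2 -> exec c2 m2 t2 m3 ->
    exec (Seq c1 c2) m1 (t1 + t2)%N m3
| exec_IfT b c1 c2 m m' t :
    eval_test b m -> exec c1 m t m' -> exec (If b c1 c2) m t.+1 m'
| exec_IfF b c1 c2 m m' t :
    ~~ eval_test b m -> exec c2 m t m' -> exec (If b c1 c2) m t.+1 m'
| exec_WhileF b c m :
    ~~ eval_test b m -> exec (While b c) m 1 m
| exec_WhileT b c m1 m2 m3 t1 t2 :
    eval_test b m1 -> exec c m1 t1 m2 -> exec (While b c) m2 t2 m3 ->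
    exec (While b c) m1 (t1 + t2).+1 m3.

Lemma exec_deterministic (R : realType) c (m : memory R) t1 m1 t2 m2 :
  exec c m t1 m1 -> exec c m t2 m2 -> t1 = t2 /\ m1 = m2.
Proof.
move=> e1; elim: e1 t2 m2 => {c m t1 m1}.
- by move=> m t2 m2 e2; inversion e2.
- by move=> i m t2 m2 e2; inversion e2.
- move=> c1 c2 m1 m2 m3 t1 t2 _ IH1 _ IH2 t' m' e2; inversion e2; subst.
  have [? ?] := IH1 _ _ ltac:(eassumption); subst.
  by have [-> ->] := IH2 _ _ ltac:(eassumption).
- move=> b c1 c2 m m' t bT _ IH t' m2 e2; inversion e2; subst.
    by have [-> ->] := IH _ _ ltac:(eassumption).
  by exfalso; eapply elimN; [exact: idP | eassumption | exact: bT].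
- move=> b c1 c2 m m' t bF _ IH t' m2 e2; inversion e2; subst.
    by exfalso; eapply elimN; [exact: idP | exact: bF | eassumption].
  by have [-> ->] := IH _ _ ltac:(eassumption).
- move=> b c m bF t' m2 e2; inversion e2; subst => //.
  by exfalso; eapply elimN; [exact: idP | exact: bF | eassumption].
- move=> b c m1 m2 m3 t1 t2 bT _ IH1 _ IH2 t' m' e2; inversion e2; subst.
    by exfalso; eapply elimN; [exact: idP | eassumption | exact: bT].
  have [? ?] := IH1 _ _ ltac:(eassumption); subst.
  by have [-> ->] := IH2 _ _ ltac:(eassumption).
Qed.

Definition coords (R : realType) (d : nat) (p : 'rV[R]_d) : seq R :=
  [seq p 0 j | j <- enum 'I_d].

(* Input: n and d in the first two nat cells; B, delta and the coordinates of
   s and of the points of P in consecutive real cells; 0 elsewhere. *)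
Definition input_memory (R : realType) (d : nat) (P : seq 'rV[R]_d)
    (s : 'rV[R]_d) (B delta : R) : memory R :=
  Memory (nth 0%N [:: size P; d])
         (nth 0 ([:: B; delta] ++ flatten [seq coords p | p <- s :: P])).

(* Output: the number of points of the path in nat cell 0, their coordinates
   in consecutive real cells from cell 0 on. *)
Definition output_path (R : realType) (d : nat) (m : memory R) :
    seq 'rV[R]_d :=
  mkseq (fun i => \row_(j < d) rmem m (i * d + j)%N) (nmem m 0%N).

(* n^(c1/delta) * (log n)^((d/delta)^(c2 d)).  Asymptotic bounds are about
   large n; the literal formula is used for n >= 3 (where log n > 1, so that
   it does not degenerate), and its value at 3 for the remaining n. *)
Definition time_bound (R : realType) (c1 c2 : nat) (n d : nat) (delta : R) :
    R :=
  let N : R := (maxn n 3)%:R in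
  N `^ (c1%:R / delta) * ln N `^ ((d%:R / delta) `^ (c2%:R * d%:R)).

(* Submission.v *)
(** An optimal path is cut into u = ceil(1/delta) pieces with equally many points, and the interior of the piece of largest excess (length minus distance of its ends) is dropped: this loses a delta-fraction of the points and frees a u-th of the total excess E, so it suffices to find a path of length at most the optimum plus E/u.  The scale E0 of E is guessed from four points.  All points are rounded, in slanted coordinates that are nearly monotone along every piece and whose large gaps are compressed, to a grid of width about E0/n, and a randomly shifted quadtree is put on the grid.  Backward moves of a piece are paid for by its excess, so uncrossing the multiply crossed facets (2-opt moves) costs, on average over the shifts, only a fraction of E; afterwards every cell is crossed polylogarithmically often through portals, apart from at most two exact crossings per piece.  A dynamic program over the quadtree then finds the path.  It is written as a function on lists; the predicate [pf] says that a function is computed by a RAM program in time polynomial in a ghost bound Z, and is closed under the list combinators used. *)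

(* The excess of a step is its length minus its component along the chord of its piece. It is
   determined by four input points, and the largest one lies between E/n and E, so the scale of E
   occurs in a list of O(n^4) numbers; when E = 0 the rounding must lose nothing, and the smallest
   positive distance serves instead. Two costs in the quadtree behave differently. Uncrossing at
   level j costs about 2^j per removed crossing, but the mean number of counted crossings halves
   from level to level, so this cost telescopes, provided the walk repaired so far depends only on
   the low bits of the shift. The portal detours do not telescope: they lose a factor for the number
   of levels, which the portal depth mu' absorbs, and this brings in log n. A crossing made only
   once by a piece involves no backward move and cannot be charged, so it is left exact and its
   endpoints are guessed among all points, whence n^(O(1/delta)). The machine has no floor: rounding
   is repeated subtraction, so gaps are compressed to keep the grid polynomial. *)
From HB Require Import structures.
From mathcomp Require Import all_boot all_order all_algebra.
From mathcomp Require Import boolp reals.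
From mathcomp Require Import zify ring lra.

(** * The dynamic program over a binary hierarchy of cells *)

Module DP.
Set Implicit Arguments.
Unset Strict Implicit.
Unset Printing Implicit Defensive.
Import Order.TTheory GRing.Theory Num.Theory.
Local Open Scope nat_scope.

Lemma mem_iota0 n x : (x \in iota 0 n) = (x < n).
Proof. by rewrite (mem_iota 0 n). Qed.

(** Words are the supply of guesses of the algorithm: scripts for joining strands, choices of
    endpoints, tilts of the coordinates. Their number [b ^ l] is what the running time pays for. *)
Definition words (b l : nat) : seq (seq nat) :=
  iter l (fun ws => flatten [seq [seq x :: w | w <- ws] | x <- iota 0 b]) [:: [::]].

Lemma mem_words b l w : (w \in words b l) = (size w == l) && all (fun x => x < b) w.
Proof.
elim: l w => [|l IH] w; first by rewrite inE; case: w.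
rewrite /words iterS -/(words b l); apply/flatten_mapP/idP => /=.
  move=> [x]; rewrite mem_iota0 => xb /mapP [v]; rewrite IH => /andP [/eqP sv av] ->.
  by rewrite /= sv eqxx av andbT.
case: w => // x w /=; rewrite eqSS andbCA => /andP [xb h].
by exists x; rewrite ?mem_iota0 //; apply: map_f; rewrite IH.
Qed.

Lemma size_words b l : size (words b l) = b ^ l.
Proof.
elim: l => [|l IH] //; rewrite /words iterS -/(words b l) expnS size_flatten.
rewrite /shape -map_comp (@eq_map _ _ _ (fun=> b ^ l)); last first.
  by move=> x /=; rewrite size_map IH.
by rewrite sumnE big_map big_const_seq count_predT size_iota iter_addn_0 mulnC.
Qed.

(** One coordinate is halved at a time, in cyclic order: [d] steps make one quadtree level, and each
    cell has at most two children, so a join involves only two items. The rotation spares the step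
    from knowing which axis is next. *)
Definition hstep (u : seq nat) : seq nat := rcons (behead u) (head 0 u)./2.
Definition lvl (L : nat) (U : seq (seq nat)) := [seq iter L hstep u | u <- U].
(** A cell is named by the first point lying in it, so empty cells never occur and equality of cells
    is equality of naturals. *)
Definition repr (cs : seq (seq nat)) (p : nat) := index (nth [::] cs p) cs.
Definition samec (cs : seq (seq nat)) (p q : nat) := nth [::] cs p == nth [::] cs q.

(** A partial solution in one cell: the name of the cell, the number of points credited, and the
    strands, that is, the parts of the path inside the cell as lists of point indices. *)
Definition item := (nat * (nat * seq (seq nat)))%type.
(** Portals are input points: the representatives of the finer cells [zs] inside the cell of [p].
    Strands therefore remain lists of input points. *)
Definition portals (cs zs : seq (seq nat)) (p : nat) : seq nat :=
  [seq q <- iota 0 (size cs) | samec cs q p && (repr zs q == q)].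

(** A letter below the number of blocks glues that block in front; any other letter is a separator
    that opens a new strand. Joining strands thus becomes an enumeration of words. *)
Definition bstep (blocks : seq (seq nat)) (c : nat) (acc : seq (seq nat)) :=
  if c < size blocks then (nth [::] blocks c ++ head [::] acc) :: behead acc
  else [::] :: acc.
Definition build (blocks : seq (seq nat)) (w : seq nat) : seq (seq nat) :=
  [seq q <- foldr (bstep blocks) [:: [::]] w | q != [::]].

Definition cand (cs zs : seq (seq nat)) (K J : item) (w : seq nat) : item :=
  (repr cs K.1, (K.2.1 + J.2.1,
    build (K.2.2 ++ J.2.2 ++ [seq [:: z] | z <- portals cs zs K.1]) w)).

(** Old strands are used exactly once each, while portals may be repeated or left out. A missing
    sibling is encoded by pairing [K] with an empty item in its own cell, which the second condition
    admits. *)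
Definition okc (cs : seq (seq nat)) (K J : item) (w : seq nat) : bool :=
  [&& samec cs K.1 J.1, (K.1 != J.1) || ((J.2.1 == 0) && nilp J.2.2),
   uniq [seq c <- w | c < size K.2.2 + size J.2.2] &
   all (fun c => c \in w) (iota 0 (size K.2.2 + size J.2.2))].

Definition terms (st : seq (seq nat)) : seq (nat * nat) :=
  [seq (head 0 q, last 0 q) | q <- st].

Definition keyt := (nat * (nat * seq (nat * nat)))%type.
Definition keyof (it : item) : keyt := (it.1, (it.2.1, terms it.2.2)).

(** Endpoints of strands are taken from the portals and from [XS] further points [E], meant for
    exact crossings and the ends of the walk. [E] is guessed among all points, and this is the
    source of the factor n^(O(1/delta)). *)
Definition keys (XS PB Rs : nat) (cs zs : seq (seq nat)) : seq keyt :=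
  let N := size cs in
  flatten [seq flatten [seq flatten [seq flatten [seq flatten [seq
    [seq (p, (k, zip [seq nth 0 (E ++ portals cs zs p) c | c <- ca]
                     [seq nth 0 (E ++ portals cs zs p) c | c <- cb]))
      | cb <- words (XS + PB) j]
      | ca <- words (XS + PB) j]
      | j <- iota 0 Rs.+1]
      | E <- words N XS]
      | k <- iota 0 N]
      | p <- iota 0 N].

(** A star around [p] collects all points of a lowest cell. Its legs are no longer than the diameter
    of the cell, and both ends of the strand are [p]. *)
Definition tour (cs : seq (seq nat)) (p : nat) : seq nat :=
  p :: flatten [seq [:: q; p] | q <- iota 0 (size cs) & samec cs q p].
(** Index 0 is the start, which may lie outside the point set, so it is never credited. *)
Definition weight (cs : seq (seq nat)) (p : nat) : nat :=
  count (fun q => (0 < q) && samec cs q p) (iota 0 (size cs)).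

(** The trivial strands [[:: p]] let the walk pass the cell several times; as [c < Rs], there are at
    most [Rs] strands together with the tour. *)
Definition leaves (Rs : nat) (cs : seq (seq nat)) : seq item :=
  flatten [seq [seq (p, (weight cs p, tour cs p :: nseq c [:: p])) | c <- iota 0 Rs]
          | p <- iota 0 (size cs) & repr cs p == p].

Section DPreal.
Variable R : realFieldType.
Implicit Types (ds : seq (seq R)).

Definition dm ds (i j : nat) : R := nth 0%R (nth [::] ds i) j.

Fixpoint plen_rec ds (x : nat) (q : seq nat) : R :=
  if q is y :: q' then (dm ds x y + plen_rec ds y q')%R else 0%R.
Definition plen ds (q : seq nat) : R :=
  if q is x :: q' then plen_rec ds x q' else 0%R.
Definition tlen ds (st : seq (seq nat)) : R := (\sum_(q <- st) plen ds q)%R.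

Definition better ds (acc : seq item) (c : item) : seq item :=
  if acc is b :: _ then (if (tlen ds b.2.2 <= tlen ds c.2.2)%R then acc else [:: c])
  else [:: c].
Definition pickmin ds (l : seq item) : seq item := foldl (better ds) [::] l.

Definition allcands (cs zs : seq (seq nat)) (T : seq item) (W : seq (seq nat)) :
    seq item :=
  flatten [seq flatten [seq [seq cand cs zs K J w | w <- W & okc cs K J w]
     | J <- (K.1, (0, [::])) :: T] | K <- T].

Definition stepT ds (XS PB Rs : nat) (W : seq (seq nat)) (cs zs : seq (seq nat))
    (T : seq item) : seq item :=
  let C := allcands cs zs T W in
  flatten [seq pickmin ds [seq c <- C | keyof c == key] | key <- keys XS PB Rs cs zs].

Fixpoint tableL ds (XS PB Rs mu : nat) (W : seq (seq nat)) (U : seq (seq nat))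
    (L : nat) : seq item :=
  if L is L'.+1 then
    stepT ds XS PB Rs W (lvl L U) (lvl (L - mu) U) (tableL ds XS PB Rs mu W U L')
  else leaves Rs (lvl 0 U).

Lemma pickmin_sub ds l c : c \in pickmin ds l -> c \in l.
Proof.
suff h a : c \in foldl (better ds) a l -> (c \in a) || (c \in l).
  by move/h.
elim: l a => [|x l IH] a /=; first by rewrite orbF.
move/IH; rewrite inE => /orP [|->]; last by rewrite !orbT.
rewrite /better; case: a => [|b a]; first by rewrite inE => /eqP->; rewrite eqxx.
case: ifP => _; first by move=> ->.
by rewrite inE => /eqP ->; rewrite eqxx !orbT.
Qed.

Lemma pickmin_min ds l c : c \in l ->
  exists2 b, b \in pickmin ds l & (tlen ds b.2.2 <= tlen ds c.2.2)%R.
Proof.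
suff h a : size a <= 1 -> c \in a ++ l ->
    exists2 b, b \in foldl (better ds) a l & (tlen ds b.2.2 <= tlen ds c.2.2)%R.
  by move=> cl; apply: (h [::]).
elim: l a c => [|x l IH] a c sa; first by rewrite cats0; exists c.
rewrite mem_cat inE orbA => /orP [h|cl]; last first.
  apply: IH; last by rewrite mem_cat cl orbT.
  by case: a sa => [|b [|? ?]] //= _; case: ifP.
case: a sa h => [|b [|//]] _ /=; rewrite ?inE.
  by move=> /eqP ->; apply: IH; rewrite ?mem_head.
case: ifPn => [le|]; last rewrite -ltNge => /ltW le.
  move=> /orP [] /eqP ->; first by apply: IH; rewrite ?mem_head.
  by have [||b' h1 h2] := IH [:: b] b; rewrite ?mem_head //; exists b' => //; apply: le_trans le.
move=> /orP [] /eqP ->; last by apply: IH; rewrite ?mem_head.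
by have [||b' h1 h2] := IH [:: x] x; rewrite ?mem_head //; exists b' => //; apply: le_trans le.
Qed.

Lemma mem_allcands cs zs T W c : reflect
  (exists K J w, [/\ K \in T, J \in (K.1, (0, [::])) :: T, w \in W, okc cs K J w &
     c = cand cs zs K J w]) (c \in allcands cs zs T W).
Proof.
apply: (iffP flatten_mapP) => [[K IT /flatten_mapP [J JT /mapP [w]]]|].
  by rewrite mem_filter => /andP [ok wW] ->; exists K, J, w.
move=> [K [J [w [IT JT wW ok ->]]]]; exists K => //; apply/flatten_mapP.
by exists J => //; apply: map_f; rewrite mem_filter ok.
Qed.

End DPreal.

Lemma samec_lvl U L p q : p < size U -> q < size U ->
  samec (lvl L U) p q = (iter L hstep (nth [::] U p) == iter L hstep (nth [::] U q)).
Proof. by move=> pU qU; rewrite /samec /lvl !(nth_map [::]). Qed.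

Lemma samecS U L p q : p < size U -> q < size U ->
  samec (lvl L U) p q -> samec (lvl L.+1 U) p q.
Proof.
by move=> pU qU; rewrite !samec_lvl // !iterS => /eqP ->.
Qed.

Lemma samec_refl cs p : samec cs p p. Proof. exact: eqxx. Qed.
Lemma samec_sym cs p q : samec cs p q = samec cs q p. Proof. exact: eq_sym. Qed.
Lemma samec_trans cs p q r : samec cs p q -> samec cs q r -> samec cs p r.
Proof. by rewrite /samec => /eqP ->. Qed.

Lemma repr_lt cs p : p < size cs -> repr cs p < size cs.
Proof. by move=> pc; rewrite index_mem mem_nth. Qed.

Lemma samec_repr cs p : p < size cs -> samec cs (repr cs p) p.
Proof. by move=> pc; rewrite /samec nth_index // mem_nth. Qed.

Lemma repr_eq cs p q : samec cs p q -> repr cs p = repr cs q.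
Proof. by rewrite /samec /repr => /eqP ->. Qed.

Lemma repr_id cs p : p < size cs -> repr cs (repr cs p) = repr cs p.
Proof. by move=> pc; apply: repr_eq; exact: samec_repr. Qed.

Lemma mem_build bl w x : x \in flatten (build bl w) =
  has (fun c => (c < size bl) && (x \in nth [::] bl c)) w.
Proof.
rewrite /build; set f := foldr _ _ _.
have -> : (x \in flatten [seq q <- f | q != [::]]) = (x \in flatten f).
  by elim: f => //= q f IH; case: q => [|y q] //=; rewrite !inE !mem_cat IH.
rewrite {}/f; elim: w => //= c w <-; rewrite {1}/bstep; case: ifP => //= _.
by case: (foldr _ _ w) => [|y l] /=; rewrite !mem_cat ?in_nil ?orbF ?orbA.
Qed.

Lemma build_nil bl w q : q \in build bl w -> q != [::].
Proof. by rewrite mem_filter => /andP []. Qed.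

(** The list [s] certifies the credited count: distinct positive indices, all lying on the strands.
    It is what turns the number in an item into visited points. *)
Definition sound (cs : seq (seq nat)) (it : item) :=
  [/\ it.1 < size cs, repr cs it.1 = it.1,
      (forall q, q \in it.2.2 -> q != [::]),
      (forall x, x \in flatten it.2.2 -> x < size cs /\ samec cs x it.1) &
      exists s, [/\ uniq s, size s = it.2.1 &
        forall x, x \in s -> 0 < x /\ x \in flatten it.2.2]].

Lemma mem_tour cs p x : x \in tour cs p =
  (x == p) || ((x < size cs) && samec cs x p).
Proof.
rewrite /tour inE; case: eqP => //= xp; apply/flatten_mapP/idP.
  move=> [q]; rewrite mem_filter mem_iota0 !inE => /andP [h l].
  by move=> /orP [/eqP ->|/eqP //]; rewrite h l.
by move=> /andP [l h]; exists x; rewrite ?mem_filter ?mem_iota0 ?h ?l ?mem_head.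
Qed.

Lemma leaves_sound Rs cs it : it \in leaves Rs cs -> sound cs it.
Proof.
move=> /flatten_mapP [p]; rewrite mem_filter mem_iota0 => /andP [/eqP rp pc].
move=> /mapP [c _ ->]; have mT := mem_tour cs p.
have nT : tour cs p != [::] by [].
move: (tour cs p) mT nT => T mT nT; split=> //=.
- by move=> q; rewrite inE => /orP [/eqP ->|/nseqP [->]].
- move=> x; rewrite mem_cat mT => /orP [|].
    by move=> /orP [/eqP ->|/andP //]; rewrite samec_refl.
  by move=> /flattenP [q /nseqP [-> _]]; rewrite inE => /eqP ->; rewrite samec_refl.
- exists [seq q <- iota 0 (size cs) | (0 < q) && samec cs q p]; split.
  + by rewrite filter_uniq // iota_uniq.
  + by rewrite size_filter.
  + move=> x; rewrite mem_filter mem_iota0 => /andP [/andP [x0 sx] xc].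
    by rewrite mem_cat mT xc sx orbT.
Qed.

(** Every old strand is reused, so both certificates survive, and they are disjoint because the two
    cells of level [L] have different representatives. *)
Lemma cand_sound U L zs K J w : sound (lvl L U) K ->
  sound (lvl L U) J \/ J = (K.1, (0, [::])) -> okc (lvl L.+1 U) K J w ->
  sound (lvl L.+1 U) (cand (lvl L.+1 U) zs K J w).
Proof.
have sz k : size (lvl k U) = size U by rewrite size_map.
move=> [Ic Ir In Ix [sI [uI zI mI]]] sJ /and4P [sIJ nIJ _ /allP al].
have Jc : J.1 < size (lvl L U) by case: sJ => [[]|->].
have Jx x : x \in flatten J.2.2 -> x < size (lvl L U) /\ samec (lvl L U) x J.1.
  by case: sJ => [[_ _ _ h _]|->] //; exact: h.
rewrite sz in Ic Jc.
have rc : repr (lvl L.+1 U) K.1 < size (lvl L.+1 U) by rewrite repr_lt ?sz.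
have sr : samec (lvl L.+1 U) K.1 (repr (lvl L.+1 U) K.1).
  by rewrite samec_sym samec_repr ?sz.
split; rewrite /cand /=; rewrite ?repr_id ?sz //.
- by rewrite -(sz L.+1).
- by move=> q; exact: build_nil.
- move=> x; set bl := _ ++ _; rewrite mem_build => /hasP [c _ /andP [cs xc]].
  have : x \in flatten bl by apply/flattenP; exists (nth [::] bl c); rewrite ?mem_nth.
  rewrite !flatten_cat !mem_cat => /or3P [/Ix [xs h]|/Jx [xs h]|].
  + rewrite sz in xs; split=> //; apply: samec_trans sr; exact: samecS.
  + rewrite sz in xs; split=> //; apply: samec_trans sr.
    by rewrite samec_sym; apply: (samec_trans sIJ); rewrite samec_sym; exact: samecS.
  + move=> /flattenP [q /mapP [z]]; rewrite mem_filter mem_iota0 sz.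
    move=> /andP [/andP [h _] zl] ->; rewrite inE => /eqP ->; split=> //.
    exact: samec_trans sr.
- set bl := _ ++ _.
  have usd x : x \in flatten K.2.2 \/ x \in flatten J.2.2 -> x \in flatten (build bl w).
    have h : forall x, x \in flatten (K.2.2 ++ J.2.2) -> x \in flatten (build bl w).
      move=> {}x /flattenP [q /(nthP [::]) [c cs <-] xq]; rewrite mem_build.
      apply/hasP; exists c; first by apply: al; rewrite mem_iota0 -size_cat.
      by rewrite /bl catA size_cat ltn_addr //= nth_cat cs.
    by move=> hx; apply: h; rewrite flatten_cat mem_cat; case: hx => ->; rewrite ?orbT.
  case: (J.2.1 =P 0) => [J0|/eqP J0].
    exists sI; split=> //; first by rewrite J0 addn0.
    by move=> x /mI [x0 xI]; split=> //; apply: usd; left.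
  case: sJ => [[_ Jr _ _ [sJ [uJ zJ mJ]]]|JE]; last by rewrite JE in J0.
  exists (sI ++ sJ); split; last 1 first.
  + move=> x; rewrite mem_cat => /orP [/mI|/mJ] [x0 h]; split=> //; apply: usd; auto.
  + rewrite cat_uniq uI uJ andbT /=; apply/hasPn => x /mJ [_ /Jx [_ hJ]].
    apply/negP => /mI [_ /Ix [_ hI]]; move: nIJ; rewrite (negPf J0) /= orbF.
    rewrite -Ir -Jr (@repr_eq _ K.1 J.1) ?eqxx //.
    by apply: samec_trans hJ; rewrite samec_sym.
  + by rewrite size_cat zI zJ.
Qed.

Lemma table_sound (R : realFieldType) (ds : seq (seq R)) XS PB Rs mu W U L it :
  it \in tableL ds XS PB Rs mu W U L -> sound (lvl L U) it.
Proof.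
elim: L it => [|L IH] it; first exact: leaves_sound.
rewrite [tableL _ _ _ _ _ _ _ _]/= => /flatten_mapP [key _ /pickmin_sub].
rewrite mem_filter => /andP [_ /mem_allcands [K [J [w [IT JT _ ok ->]]]]].
apply: cand_sound ok; first exact: IH.
by move: JT; rewrite inE => /orP [/eqP ->|/IH]; [right|left].
Qed.

Lemma size_build bl w : size (flatten (build bl w)) =
  \sum_(c <- w | c < size bl) size (nth [::] bl c).
Proof.
rewrite /build; set f := foldr _ _ _.
have -> : size (flatten [seq q <- f | q != [::]]) = size (flatten f).
  by elim: f => //= q f IH; case: q => [|y q] //=; rewrite !size_cat IH.
rewrite {}/f; elim: w => [|c w IH] /=; first by rewrite big_nil.
rewrite big_cons -IH {1}/bstep; case: ifP => //= _.
by case: (foldr _ _ w) => [|y l] /=; rewrite !size_cat ?addn0 ?addnA.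
Qed.

Lemma size_tour cs p :
  size (tour cs p) = (2 * count (fun q => samec cs q p) (iota 0 (size cs))).+1.
Proof.
rewrite /tour -size_filter; set l := filter _ _; rewrite [LHS]/=; congr _.+1.
by elim: l => //= x l ->; rewrite mulnS.
Qed.

(** The joined cells are disjoint and a script inserts at most [5 * Rs] portals, so the strand
    length per point of the cell grows linearly with the level. Polynomial running time needs such
    an a priori bound on repeated concatenation. *)
Lemma table_small (R : realFieldType) (ds : seq (seq R)) XS PB Rs mu W U L it :
  all (fun w => size w <= 5 * Rs) W ->
  it \in tableL ds XS PB Rs mu W U L -> size (flatten it.2.2) <=
    count (samec (lvl L U) it.1) (iota 0 (size U)) * (2 * size U + 1 + Rs + 5 * Rs * L).
Proof.
move=> /allP aW; elim: L it => [|L IH] it.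
  move=> /flatten_mapP [p]; rewrite mem_filter mem_iota0 => /andP [_ pc].
  have sz k : size (lvl k U) = size U by rewrite size_map.
  move=> /mapP [c]; rewrite mem_iota0 => cR ->; rewrite size_cat.
  rewrite [(_, _).1]/=; set q := count _ _; rewrite muln0 addn0.
  have q1 : 0 < q.
    by rewrite -has_count; apply/hasP; exists p; rewrite ?samec_refl // mem_iota0 -(sz 0).
  apply: (@leq_trans (2 * size U + 1 + Rs)); last by rewrite leq_pmull.
  apply: leq_add; last first.
    rewrite (_ : size _ = c) ?(ltnW cR) //.
    by elim: (c) => //= m ->.
  rewrite size_tour addn1 ltnS.
  by rewrite leq_mul2l /= (leq_trans (count_size _ _)) // size_iota sz.
rewrite [tableL _ _ _ _ _ _ _ _]/= => /flatten_mapP [key _ /pickmin_sub].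
rewrite mem_filter => /andP [_ /mem_allcands [K [J [w [KT JT wW ok ->]]]]].
have sz k : size (lvl k U) = size U by rewrite size_map.
have [Kc Kr _ _ _] := table_sound KT; rewrite sz in Kc.
move: ok => /and4P [sKJ nKJ uq _].
have [JC Jr] : J.1 < size U /\ repr (lvl L U) J.1 = J.1.
  by move: JT; rewrite inE => /orP [/eqP -> //|/table_sound [h1 h2 _ _ _]]; rewrite -(sz L).
set C := _ + Rs in IH *; rewrite [(cand _ _ _ _ _).1]/=.
set cn := fun k p => count (samec (lvl k U) p) (iota 0 (size U)).
rewrite -/(cn L.+1 _).
have cE p q : samec (lvl L.+1 U) p q -> cn L.+1 p = cn L.+1 q.
  by rewrite /cn /samec => /eqP ->.
have -> : cn L.+1 (repr (lvl L.+1 U) K.1) = cn L.+1 K.1.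
  by apply: cE; rewrite samec_repr ?sz.
have c1 : cn L K.1 <= cn L.+1 K.1.
  rewrite /cn; set P := samec (lvl L.+1 U) K.1.
  have : all (fun q => samec (lvl L U) K.1 q ==> P q) (iota 0 (size U)).
    apply/allP => q; rewrite mem_iota0 => qU; apply/implyP; exact: samecS.
  by elim: (iota _ _) => //= q l IHl /andP [h1 /IHl]; move: h1; case: samec; case: (P q) => //= _; lia.
have c0 : 0 < cn L K.1.
  by rewrite -has_count; apply/hasP; exists K.1; rewrite ?samec_refl // mem_iota0.
(* The cells of [K] and [J] are disjoint parts of the parent cell, so their point counts add up to
   at most that of the parent. *)
have main : size (flatten K.2.2) + size (flatten J.2.2) <= cn L.+1 K.1 * (C + 5 * Rs * L).
  case: (boolP (nilp J.2.2)) => [/nilP ->|J0].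
    rewrite addn0; apply: leq_trans (IH _ KT) _; by rewrite leq_mul2r c1 orbT.
  have JT' : J \in tableL ds XS PB Rs mu W U L.
    by move: JT J0; rewrite inE => /orP [/eqP -> //|].
  move: nKJ; rewrite (negPf J0) andbF orbF => nKJ.
  apply: leq_trans (leq_add (IH _ KT) (IH _ JT')) _; rewrite -mulnDl leq_mul2r; apply/orP; right.
  rewrite -/(cn L K.1) -/(cn L J.1) /cn -count_predUI [X in _ + X](_ : _ = 0) ?addn0.
    set P := samec (lvl L.+1 U) K.1.
    have : all (fun q => predU (samec (lvl L U) K.1) (samec (lvl L U) J.1) q ==> P q) (iota 0 (size U)).
      apply/allP => q; rewrite mem_iota0 => qU; apply/implyP => /orP [|h]; first exact: samecS.
      by apply: samec_trans sKJ _; exact: samecS.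
    elim: (iota _ _) => [//|q l IHl] /andP [h1 /IHl h2].
    apply: (@leq_add (predU _ _ q) _ (P q)) h2.
    by move: h1; case: (predU _ _ _); case: (P q).
  apply/eqP; rewrite -leqn0 leqNgt -has_count; apply/hasPn => q _ /=.
  apply: contra nKJ => /andP [h1 h2]; rewrite -Kr -Jr; apply/eqP/repr_eq.
  by apply: samec_trans h1 _; rewrite samec_sym.
rewrite /cand /= size_build; set bl := K.2.2 ++ _; set n0 := size K.2.2 + size J.2.2.
have zb : size bl = n0 + size (portals (lvl L.+1 U) (lvl (L.+1 - mu) U) K.1).
  by rewrite !size_cat size_map addnA.
rewrite (bigID (fun c => c < n0)) /=.
have h1 : \sum_(c <- w | (c < size bl) && (c < n0)) size (nth [::] bl c) <=
    size (flatten K.2.2) + size (flatten J.2.2).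
  rewrite (eq_bigl (fun c => c < n0)); last first.
    by move=> c; case: (ltnP c n0) => h; rewrite ?andbF // andbT zb ltn_addr.
  rewrite -size_cat -flatten_cat -big_filter; set cs := [seq c <- w | c < n0] in uq *.
  have -> : size (flatten (K.2.2 ++ J.2.2)) = \sum_(c <- iota 0 n0) size (nth [::] bl c).
    rewrite size_flatten sumnE /shape big_map (big_nth [::]) size_cat /index_iota subn0.
    rewrite big_seq [RHS]big_seq; apply: eq_bigr => c; rewrite mem_iota0 => cn0.
    by rewrite /bl catA [in RHS]nth_cat size_cat cn0.
  apply: uniq_sub_le_big => //=.
  - by move=> x y; rewrite leq_addr.
  - exact: iota_uniq.
  - by move=> c; rewrite mem_filter mem_iota0 => /andP [].
(* Letters beyond the old strands insert single portals, and a script has at most [5 * Rs]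
   letters. *)
have h2 : \sum_(c <- w | (c < size bl) && ~~ (c < n0)) size (nth [::] bl c) <= 5 * Rs.
  apply: leq_trans (aW _ wW); rewrite -[leqRHS]sum1_size [leqRHS](bigID (fun c => (c < size bl) && ~~ (c < n0))) /=.
  apply: leq_trans (leq_addr _ _); rewrite big_seq_cond [leqRHS]big_seq_cond; apply: leq_sum => c.
  move=> /andP [_ /andP [cb /negPf cn0]]; rewrite /bl catA nth_cat size_cat -/n0 cn0.
  have cn1 : n0 <= c by rewrite leqNgt cn0.
  by rewrite (nth_map 0) // ltn_subLR // -zb.
apply: leq_trans (leq_add h1 h2) _; apply: leq_trans (leq_add main (leqnn _)) _.
rewrite -/(cn L.+1 K.1); move: (leq_trans c0 c1); move: (cn L.+1 K.1) => X X0.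
have -> : 5 * Rs * L.+1 = 5 * Rs * L + 5 * Rs by rewrite mulnS addnC.
by rewrite addnA [leqRHS]mulnDr leq_add2l leq_pmull.
Qed.

(** * Cutting a list into maximal runs *)

Section Chop.
Variable T : eqType.
Implicit Types (r : rel T) (s : seq T).

Fixpoint chop r s : seq (seq T) :=
  if s is x :: s' then
    if s' is y :: _ then
      if r x y then (x :: head [::] (chop r s')) :: behead (chop r s')
      else [:: x] :: chop r s'
    else [:: [:: x]]
  else [::].

Lemma chop_cons r x y s : chop r (x :: y :: s) =
  if r x y then (x :: head [::] (chop r (y :: s))) :: behead (chop r (y :: s))
  else [:: x] :: chop r (y :: s).
Proof. by []. Qed.

Lemma chop_head r x s : exists b l, chop r (x :: s) = (x :: b) :: l.
Proof.
elim: s x => [|y s IH] x; first by exists [::], [::].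
have [b [l e]] := IH y; rewrite chop_cons e.
by case: ifP => _; [exists (y :: b), l|exists [::], ((y :: b) :: l)].
Qed.

Lemma flatten_chop r s : flatten (chop r s) = s.
Proof.
elim: s => // x [|y s] IH //; rewrite chop_cons.
have [b [l e]] := chop_head r y s; rewrite e in IH *.
by case: ifP => _ /=; move: IH => /= [->].
Qed.

Lemma chop_nil r s : [::] \notin chop r s.
Proof.
elim: s => // x [|y s] IH //; rewrite chop_cons.
have [b [l e]] := chop_head r y s; rewrite e in IH *.
by case: ifP => _ /=; move: IH; rewrite !inE.
Qed.

Lemma chop_path r s b : b \in chop r s -> sorted r b.
Proof.
elim: s b => // x [|y s] IH b; first by rewrite inE => /eqP ->.
rewrite chop_cons; have [b' [l e]] := chop_head r y s; rewrite e in IH *.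
case: ifP => rxy /=; rewrite inE => /orP [/eqP ->|h] //=.
- by rewrite rxy; apply: (IH (y :: b')); rewrite mem_head.
- by apply: IH; rewrite inE h orbT.
- by apply: IH.
Qed.

Lemma chop_adj (x0 : T) r s :
  sorted (fun b b' => ~~ r (last x0 b) (head x0 b')) (chop r s).
Proof.
elim: s => // x [|y s] IH //; rewrite chop_cons.
have [b [l e]] := chop_head r y s; rewrite e in IH *.
case: ifPn => rxy /=; last by rewrite rxy.
by case: l e IH => //= b' l e /andP [h1 h2]; rewrite h1 h2.
Qed.

End Chop.

(** * The table is at least as good as any walk with prescribed endpoints *)

Section Comp.
Variables (R : realFieldType) (ds : seq (seq R)) (XS PB Rs mu : nat).
(** [Wk] is the walk as a list of times and [loc] the point standing for the lowest cell of a time.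
    [a L t] and [b L t] are the endpoints prescribed at level [L] for a strand beginning,
    respectively ending, at time [t]; from one level to the next such an endpoint persists or
    becomes a portal. *)
Variables (U : seq (seq nat)) (Wk : seq nat) (loc : nat -> nat).
Variables (a b : nat -> nat -> nat) (La : nat).
Let N := size U.
Let cs L := lvl L U.
Let same L t t' := samec (cs L) (loc t) (loc t').
Let prt L := portals (cs L) (cs (L - mu)).

Hypothesis dm_ge0 : forall i j, (0 <= dm ds i j)%R.
Hypothesis uW : uniq Wk.
Hypothesis locN : forall t, t \in Wk -> loc t < N.
Hypothesis locr : forall t, t \in Wk -> repr (cs 0) (loc t) = loc t.
Hypothesis a0 : forall t, a 0 t = loc t.
Hypothesis b0 : forall t, b 0 t = loc t.
Hypothesis aS : forall L t, L < La -> t \in Wk ->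
  a L.+1 t = a L t \/ a L.+1 t \in prt L.+1 (loc t).
Hypothesis bS : forall L t, L < La -> t \in Wk ->
  b L.+1 t = b L t \/ b L.+1 t \in prt L.+1 (loc t).
Hypothesis PBP : forall L p, L <= La -> p < N -> size (prt L p) <= PB.
Hypothesis bin : forall L p q r, p < N -> q < N -> r < N -> L < La ->
  samec (cs L.+1) p q -> samec (cs L.+1) p r ->
  [|| samec (cs L) p q, samec (cs L) p r | samec (cs L) q r].

(** The maximal runs of the walk inside one cell of level [L], as lists of times. They are built by
    merging the runs of the level below, because the induction over the table follows this
    merging. *)
Fixpoint seg (L : nat) : seq (seq nat) :=
  if L is L'.+1 then
    [seq flatten g | g <- chop (fun B B' => same L (last 0 B) (head 0 B')) (seg L')]
  else chop (same 0) Wk.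

Definition grp L := chop (fun B B' => same L.+1 (last 0 B) (head 0 B')) (seg L).

Definition segc L t0 := [seq B <- seg L | same L (head 0 B) t0].

Hypothesis segR : forall L t0, L <= La -> t0 \in Wk -> size (segc L t0) <= Rs.
Hypothesis segE : forall L t0, 0 < L -> L <= La -> t0 \in Wk -> exists E,
  [/\ size E <= XS, all (fun x => x < N) E & forall B, B \in segc L t0 ->
      (a L (head 0 B) \in E ++ prt L (loc t0)) /\
      (b L (last 0 B) \in E ++ prt L (loc t0))].

Lemma sizecs L : size (cs L) = N. Proof. by rewrite size_map. Qed.

Lemma flatten_seg L : flatten (seg L) = Wk.
Proof.
elim: L => [|L IH]; first exact: flatten_chop.
rewrite /= -[RHS]IH; set r := (fun B B' => _).
rewrite -[in RHS](flatten_chop r (seg L)).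
by elim: (chop r _) => //= g l ->; rewrite flatten_cat.
Qed.

Lemma seg_nil L : [::] \notin seg L.
Proof.
elim: L => [|L IH]; first exact: chop_nil.
apply/mapP => -[g gc e]; have : g != [::].
  by apply: contraTneq gc => ->; exact: chop_nil.
case: g gc e => // B g gc /= e _.
have : B \in seg L.
  rewrite -(flatten_chop (fun B B' => same L.+1 (last 0 B) (head 0 B')) (seg L)).
  by apply/flattenP; exists (B :: g); rewrite ?mem_head.
by case: B gc e => // _ _ h; rewrite h in IH.
Qed.

Lemma seg_mem L B t : B \in seg L -> t \in B -> t \in Wk.
Proof. by move=> Bs tB; rewrite -(flatten_seg L); apply/flattenP; exists B. Qed.

Lemma grp_mem L g B : g \in grp L -> B \in g -> B \in seg L.
Proof.
move=> gg Bg; rewrite -(flatten_chop (fun B B' => same L.+1 (last 0 B) (head 0 B')) (seg L)).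
by apply/flattenP; exists g.
Qed.

Lemma grp_nil L g : g \in grp L -> g != [::].
Proof. by move=> gg; apply: contraTneq gg => ->; exact: chop_nil. Qed.

Lemma sameS L t t' : t \in Wk -> t' \in Wk -> same L t t' -> same L.+1 t t'.
Proof. by move=> tW tW'; apply: samecS; exact: locN. Qed.

Lemma head_mem (B : seq nat) : B != [::] -> head 0 B \in B.
Proof. by case: B => // x B _; rewrite mem_head. Qed.
Lemma last_mem (B : seq nat) : B != [::] -> last 0 B \in B.
Proof. by case: B => // x B _; rewrite /= mem_last. Qed.

Lemma seg_n0 L B : B \in seg L -> B != [::].
Proof. by move=> h; apply: contraTneq h => ->; exact: seg_nil. Qed.

(** By induction on the level: merged runs share a cell where they touch, and within each part all
    times share a cell already one level below. *)
Lemma seg_same L B t t' : B \in seg L -> t \in B -> t' \in B -> same L t t'.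
Proof.
have key (r : rel nat) (s : seq nat) : equivalence_rel r -> sorted r s ->
    forall t t', t \in s -> t' \in s -> r t t'.
  move=> er so; have [re tr] : reflexive r /\ (forall x y z, r x y -> r y z -> r x z).
    split=> [x|x y z rxy ryz]; first by have [] := er x x x.
    by have [_ ->] := er x y z.
  have sy x y : r x y -> r y x by move=> rxy; have [re' /(_ rxy)] := er x y x; rewrite re' => <-.
  suff hd : forall t, t \in s -> r (head 0 s) t.
    by move=> u u' us us'; apply: tr (hd _ us'); apply: sy; exact: hd.
  case: s so => //= x s; elim: s x => [|y s IH] x //=.
    by move=> _ u; rewrite inE => /eqP ->.
  move=> /andP [rxy p] u; rewrite inE => /orP [/eqP -> //|us].
  by apply: tr rxy _; exact: IH us.
have eqr L' : equivalence_rel (same L').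
  by move=> x y z; split; [exact: samec_refl|rewrite /same /samec => /eqP ->].
elim: L B t t' => [|L IH] B t t'.
  by move=> /chop_path so; exact: key.
move=> /= /mapP [g gc ->].
have hB B' : B' \in g -> forall u u', u \in B' -> u' \in B' -> same L.+1 u u'.
  move=> Bg u u' uB uB'; have Bs := grp_mem gc Bg.
  by apply: sameS; [exact: (seg_mem Bs uB)|exact: (seg_mem Bs uB')|exact: (IH B')].
have n0 B' : B' \in g -> B' != [::] by move=> /(grp_mem gc)/seg_n0.
have := chop_path gc.
have : forall B', B' \in g -> forall u, u \in B' -> same L.+1 (head 0 B') u.
  by move=> B' Bg u uB; apply: (hB B') => //; apply: head_mem; exact: n0.
have [_ tr] : reflexive (same L.+1) /\ transitive (same L.+1).
  by split=> [x|y x z]; [exact: samec_refl|exact: samec_trans].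
move=> hh so; have hd u : u \in flatten g -> same L.+1 (head 0 (head [::] g)) u.
  case: g gc hB n0 hh so => // B0 g _ hB n0 hh /= so.
  elim: g B0 hB n0 hh so => [|B1 g IHg] B0 hB n0 hh /=.
    by move=> _; rewrite cats0; apply: hh; rewrite mem_head.
  move=> /andP [r01 p]; rewrite mem_cat => /orP [uB|uB].
    by apply: hh uB; rewrite mem_head.
  have h1 : same L.+1 (head 0 B0) (head 0 B1).
    apply: (tr (last 0 B0)) => //; apply: hh; rewrite ?mem_head //.
    by apply: last_mem; apply: n0; rewrite mem_head.
  apply: (tr _ _ _ h1); apply: IHg uB => //.
  - by move=> B' Bg; apply: hB; rewrite inE Bg orbT.
  - by move=> B' Bg; apply: n0; rewrite inE Bg orbT.
  - by move=> B' Bg; apply: hh; rewrite inE Bg orbT.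
move=> /hd h1 /hd h2; apply: (tr (head 0 (head [::] g))) => //.
by rewrite /same samec_sym; exact: h1.
Qed.

Lemma seg_adj L :
  sorted (fun B B' => ~~ same L (last 0 B) (head 0 B')) (seg L).
Proof.
case: L => [|L]; first exact: chop_adj.
rewrite /= -/(grp L) sorted_map; have n0 := @grp_nil L; have gm := @grp_mem L.
have := chop_adj [::] (fun B B' => same L.+1 (last 0 B) (head 0 B')) (seg L).
rewrite -/(grp L); case: (grp L) n0 gm => // g l n0 gm /=.
elim: l g n0 gm => //= g' l IH g n0 gm /andP [h1 h2]; apply/andP; split; last first.
  apply: IH => //; first by move=> x xl; apply: n0; rewrite inE xl orbT.
  by move=> x B xl; apply: gm; rewrite inE xl orbT.
have g0 := n0 _ (mem_head g _); have g0' : g' != [::] by apply: n0; rewrite !inE eqxx orbT.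
have -> : last 0 (flatten g) = last 0 (last [::] g).
  have : last [::] g != [::].
    case: g g0 gm {h1 n0} => // B g _ gm; apply: (@seg_n0 L).
    by apply: (gm (B :: g)); rewrite ?mem_head //= mem_last.
  case: (lastP g) g0 => // s x _; rewrite last_rcons flatten_rcons last_cat.
  by case: x.
have -> : head 0 (flatten g') = head 0 (head [::] g').
  case: g' g0' gm {h1 h2 n0} => // B g' _ gm /=.
  have : B != [::] by apply: (@seg_n0 L); apply: (gm (B :: g')); rewrite ?mem_head // !inE eqxx orbT.
  by case: B {gm}.
exact: h1.
Qed.

Local Open Scope ring_scope.

Fixpoint psum (f : nat -> nat -> R) x (s : seq nat) : R :=
  if s is y :: s' then f x y + psum f y s' else 0.
Definition psum0 f s := if s is x :: s' then psum f x s' else 0.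

Lemma psum0_cat f s1 s2 : s1 != [::] -> s2 != [::] ->
  psum0 f (s1 ++ s2) = psum0 f s1 + f (last 0%N s1) (head 0%N s2) + psum0 f s2.
Proof.
case: s1 s2 => // x s1 [//|y s2] _ _ /=.
by elim: s1 x => [|z s1 IH] x /=; rewrite ?add0r // IH !addrA.
Qed.

Lemma plenE q : plen ds q = psum0 (dm ds) q.
Proof. by case: q => // x q /=; elim: q x => //= y q IH x; rewrite IH. Qed.

Definition AA L t : R := \sum_(i < L) dm ds (a i.+1 t) (a i t).
Definition BB L t : R := \sum_(i < L) dm ds (b i t) (b i.+1 t).
(** An edge is charged at the last level below [L] where its ends lie in different cells. It then
    runs between the endpoints prescribed there, and [BB], [AA] are the detours from the true points
    to these endpoints, accumulated over the lower levels. *)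
Fixpoint full L t t' : R := if L is L'.+1 then
    (if same L' t t' then full L' t t'
     else BB L' t + dm ds (b L' t) (a L' t') + AA L' t') else 0.
Lemma fullS L t t' : full L.+1 t t' = if same L t t' then full L t t'
  else BB L t + dm ds (b L t) (a L t') + AA L t'.
Proof. by []. Qed.
Local Arguments full : simpl never.
Definition blen L B : R := psum0 (full L) B + AA L (head 0%N B) + BB L (last 0%N B).
(** Several times may share a lowest cell; credits and star tours are counted once per cell. *)
Definition vis := undup (map loc Wk).
Definition kk L t0 := (\sum_(p <- vis | samec (cs L) p (loc t0)) weight (cs 0) p)%N.
Definition tt L t0 : R :=
  \sum_(p <- vis | samec (cs L) p (loc t0)) plen ds (tour (cs 0) p).

Lemma psum0_eq f g (B : seq nat) :
  (forall t t', t \in B -> t' \in B -> f t t' = g t t') -> psum0 f B = psum0 g B.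
Proof.
case: B => // x B; elim: B x => //= y B IH x h.
rewrite h ?inE ?eqxx ?orbT // IH // => t t' tB tB'.
by apply: h; rewrite in_cons ?tB ?tB' orbT.
Qed.

(** Bookkeeping of one merge: concatenation creates exactly the edges between consecutive runs, and
    these are the edges that [full] begins to charge at level [L.+1]. *)
Lemma strand_len L g (str : seq nat -> seq nat) : g != [::] ->
  (forall B, B \in g -> B \in seg L) ->
  (forall B, B \in g -> [/\ str B != [::], head 0%N (str B) = a L (head 0%N B) &
     last 0%N (str B) = b L (last 0%N B)]) ->
  sorted (fun B B' => ~~ same L (last 0%N B) (head 0%N B')) g ->
  plen ds (flatten (map str g)) + \sum_(B <- g) blen L B =
  psum0 (full L.+1) (flatten g) + AA L (head 0%N (head [::] g)) +
  BB L (last 0%N (last [::] g)) + \sum_(B <- g) plen ds (str B).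
Proof.
case: g => // B g _; elim: g B => [|B1 g IH] B hs hst /=.
  move=> _; rewrite !cats0 !big_seq1 /blen -/(psum0 _ _).
  rewrite (@psum0_eq (full L.+1) (full L)); last first.
    move=> t t' tB tB'; rewrite fullS (@seg_same L B) //.
    by apply: hs; rewrite mem_head.
  by rewrite addrC.
move=> /andP [nr so].
have /= IH' := IH B1 (fun B' h => hs B' (mem_behead (s := B :: B1 :: g) h))
  (fun B' h => hst B' (mem_behead (s := B :: B1 :: g) h)) so.
have [sB hB lB] := hst B (mem_head _ _).
have B1m : B1 \in [:: B, B1 & g] by rewrite !inE eqxx orbT.
have [sB1 hB1 lB1] := hst B1 B1m.
have B0 := seg_n0 (hs _ (mem_head _ _)); have B10 := seg_n0 (hs _ B1m).
rewrite [in LHS]big_cons [in RHS]big_cons.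
have c0 (u v : seq nat) : u != [::] -> u ++ v != [::] by case: u.
have hc (u v : seq nat) : u != [::] -> head 0%N (u ++ v) = head 0%N u by case: u.
rewrite plenE psum0_cat ?c0 // -!plenE hc // hB1 lB psum0_cat ?c0 // hc //.
have -> : full L.+1 (last 0%N B) (head 0%N B1) = BB L (last 0%N B) +
   dm ds (b L (last 0%N B)) (a L (head 0%N B1)) + AA L (head 0%N B1).
  by rewrite fullS (negPf nr).
have -> : psum0 (full L.+1) B = psum0 (full L) B.
  apply: psum0_eq => t t' tB tB'; rewrite fullS (@seg_same L B) //.
  by apply: hs; rewrite mem_head.
move: IH'; rewrite -[str B1 ++ _]/(flatten (map str (B1 :: g))).
rewrite -[B1 ++ _]/(flatten (B1 :: g)) /blen.
set x1 := plen ds (flatten _); set x2 := \sum_(j <- _) _.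
set x3 := psum0 _ (flatten _); set x4 := AA L (head 0%N B1).
set x5 := BB L (last 0%N _); set x6 := \sum_(j <- _) plen _ _ => e.
rewrite [LHS](_ : _ = plen ds (str B) + dm ds (b L (last 0%N B)) (a L (head 0%N B1)) +
  (psum0 (full L) B + AA L (head 0%N B) + BB L (last 0%N B)) + (x1 + x2)).
  by rewrite e; ring.
by ring.
Qed.

(** Each group is preceded by a separator, and separators also pad the word to its fixed length; the
    padding creates only empty strands, which [build] discards. *)
Lemma build_script bl (gs : seq (seq nat)) pad sep : (size bl <= sep)%N ->
  all (all (fun c => c < size bl)%N) gs ->
  build bl (flatten [seq sep :: w | w <- gs] ++ nseq pad sep) =
  [seq q <- [seq flatten [seq nth [::] bl c | c <- w] | w <- gs] | q != [::]].
Proof.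
move=> sz; rewrite /build; set f := bstep bl.
have fs acc : f sep acc = [::] :: acc by rewrite /f /bstep ltnNge sz.
have fw w acc : all (fun c => c < size bl)%N w ->
    foldr f acc w = if w is [::] then acc else
      (flatten [seq nth [::] bl c | c <- w] ++ head [::] acc) :: behead acc.
  elim: w => //= c w IH /andP [cb wb]; rewrite IH //.
  by rewrite {1}/f /bstep cb; case: w {IH wb} => //= [|? ?]; rewrite ?cats0 // -!catA.
elim: gs => [_|w gs IH] /=.
  by elim: pad => //= n IHn; rewrite fs.
move=> /andP [wb gb]; rewrite fs -catA foldr_cat fw //=.
move: (IH gb); case: gs {IH gb} => [|w' gs]; last first.
  set F := foldr f _ (flatten _ ++ _).
  have [acc FE] : exists acc, F = [::] :: acc by rewrite /F /= fs; eexists.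
  by rewrite FE => /= e; case: w wb => [|c w] wb //=; rewrite cats0 e.
move=> _; case: w wb => [|c w] wb /=.
  by elim: pad => //= n IHn; rewrite fs.
case: pad => [|n] /=; first by rewrite cats0.
by rewrite fs /= cats0; congr (if _ then _ :: _ else _); elim: n => //= n IHn; rewrite fs.
Qed.

Lemma flatten_filter (T : eqType) (p : pred (seq T)) (p' : pred T) (s : seq (seq T)) :
  (forall g B, g \in s -> B \in g -> p' B = p g) ->
  flatten (filter p s) = filter p' (flatten s).
Proof.
elim: s => //= g s IH h; rewrite filter_cat -IH; last first.
  by move=> g' B gs; apply: h; rewrite inE gs orbT.
have hg B : B \in g -> p' B = p g by apply: h; rewrite mem_head.
case: ifP => pg /=; first by congr (_ ++ _); rewrite (eq_in_filter (a2 := predT)) ?filter_predT // => B /hg ->.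
by rewrite (eq_in_filter (a2 := pred0)) ?filter_pred0 // => B /hg ->.
Qed.

Lemma uniq_flatten (T : eqType) (s : seq (seq T)) :
  uniq (flatten s) -> [::] \notin s -> uniq s.
Proof.
elim: s => //= g s IH; rewrite cat_uniq inE negb_or => /and3P [ug nh us] /andP [g0 s0].
rewrite IH // andbT; apply/negP => gs; case: g ug nh g0 gs => // x g _ nh _ gs.
case/negP: nh; apply/hasP; exists x; last by rewrite mem_head.
by apply/flattenP; exists (x :: g); rewrite ?mem_head.
Qed.

(** Alphabet: at most [2 * Rs] strands of two items, [PB] portals and one separator. Length: at most
    [Rs] separators, [2 * Rs] portals at the ends of new strands and [2 * Rs] old strands. *)
Definition scr := words (2 * Rs + PB).+1 (5 * Rs).

(** Cell, count and endpoints are met exactly, the length only as an upper bound, since the table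
    keeps a shortest item for each key. *)
Definition compl L t0 := exists it,
  [/\ it \in tableL ds XS PB Rs mu scr U L, it.1 = repr (cs L) (loc t0),
      it.2.1 = kk L t0,
      terms it.2.2 = [seq (a L (head 0%N B), b L (last 0%N B)) | B <- segc L t0] &
      tlen ds it.2.2 <= \sum_(B <- segc L t0) blen L B + tt L t0].

Lemma seg_of L t : t \in Wk -> exists2 B, B \in seg L & t \in B.
Proof. by rewrite -{1}(flatten_seg L) => /flattenP. Qed.

Lemma segc_n0 L t : t \in Wk -> segc L t != [::].
Proof.
move=> /(seg_of L) [B Bs tB]; rewrite -has_filter; apply/hasP; exists B => //.
by apply: (seg_same Bs) => //; apply: head_mem; exact: seg_n0 Bs.
Qed.

(** All times in one lowest cell have the same [loc]: one run is realised by the star tour and each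
    further run by a trivial strand. *)
Lemma compl0 t0 : t0 \in Wk -> compl 0 t0.
Proof.
move=> tW; have pN := locN tW; have rp := locr tW.
have sz := segR (leq0n _) tW; have n0 := segc_n0 0 tW.
have vf : [seq p <- vis | samec (cs 0) p (loc t0)] = [:: loc t0].
  rewrite (@eq_in_filter _ _ (pred1 (loc t0))).
    by rewrite filter_pred1_uniq ?undup_uniq // mem_undup map_f.
  move=> p; rewrite mem_undup => /mapP [t tt ->] /=; apply/idP/eqP => [|->].
    by move=> /repr_eq; rewrite rp locr.
  exact: samec_refl.
exists (loc t0, (weight (cs 0) (loc t0),
  tour (cs 0) (loc t0) :: nseq (size (segc 0 t0)).-1 [:: loc t0])); split=> //=.
- apply/flatten_mapP; exists (loc t0); first by rewrite mem_filter rp eqxx mem_iota0 sizecs.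
  apply/mapP; exists (size (segc 0 t0)).-1 => //; rewrite mem_iota0.
  by case: (segc 0 t0) n0 sz => // B l _ /=.
- by rewrite /kk -big_filter vf big_seq1.
- have -> : last (loc t0) (flatten [seq [:: q; loc t0]
      | q <- [seq q <- iota 0 (size (cs 0)) | samec (cs 0) q (loc t0)]]) = loc t0.
    by elim: (filter _ _) => //= q l ->.
  have -> : (loc t0, loc t0) :: terms (nseq (size (segc 0 t0)).-1 [:: loc t0]) =
      nseq (size (segc 0 t0)) (loc t0, loc t0).
    by case: (segc 0 t0) n0 => // B l _; rewrite /terms map_nseq.
  have -> (T : Type) (x : T) (l : seq (seq nat)) : nseq (size l) x = [seq x | _ <- l].
    by elim: l => //= ? ? ->.
  apply/eq_in_map => B; rewrite mem_filter => /andP [sB Bs].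
  have h t : t \in B -> loc t = loc t0.
    move=> tB; have tW' := seg_mem Bs tB; rewrite -rp -(locr tW'); apply: repr_eq.
    apply: samec_trans sB; apply: (seg_same Bs) => //; apply: head_mem; exact: seg_n0 Bs.
  by rewrite a0 b0 !h //; [apply: last_mem|apply: head_mem]; exact: seg_n0 Bs.
- have -> : tt 0 t0 = plen ds (tour (cs 0) (loc t0)) by rewrite /tt -big_filter vf big_seq1.
  rewrite /tlen big_cons.
  rewrite [\sum_(q <- nseq _ _) _]big1_seq ?addr0; last first.
    by move=> q /andP [_ /nseqP [-> _]].
  rewrite [X in X + _]big1 ?add0r // => B _; rewrite /blen /AA /BB !big_ord0 !addr0.
  case: B => // x B /=; elim: B x => //= y B IH x; by rewrite IH addr0.
Qed.

Lemma terms_nth (st : seq (seq nat)) (l : seq (seq nat)) (f : seq nat -> nat * nat) B :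
  terms st = [seq f B' | B' <- l] -> B \in l ->
  (head 0%N (nth [::] st (index B l)), last 0%N (nth [::] st (index B l))) = f B.
Proof.
move=> e Bl; have sz : size st = size l by move/(congr1 size): e; rewrite !size_map.
have il : (index B l < size l)%N by rewrite index_mem.
have := congr1 (fun s => nth (0%N, 0%N) s (index B l)) e.
by rewrite /terms (nth_map [::]) ?sz // (nth_map [::]) // nth_index.
Qed.

Lemma vis_split (V : nmodType) (w : nat -> V) (P Q1 Q2 : pred nat) :
  (forall t, t \in Wk -> P (loc t) = Q1 (loc t) || Q2 (loc t)) ->
  (forall t, t \in Wk -> Q1 (loc t) -> ~~ Q2 (loc t)) ->
  \sum_(p <- vis | P p) w p = \sum_(p <- vis | Q1 p) w p + \sum_(p <- vis | Q2 p) w p.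
Proof.
move=> h1 h2; rewrite (bigID Q1) /=.
have vm p : p \in vis -> exists2 t, t \in Wk & p = loc t.
  by rewrite mem_undup => /mapP.
congr (_ + _); rewrite -big_filter -[RHS]big_filter;
  congr (\sum_(p <- _) _); apply: eq_in_filter => p /vm [t tW ->].
  by rewrite h1 //; case: (Q1 _); rewrite ?andbF.
rewrite h1 //; case: (Q1 (loc t)) (h2 t tW) => //= h; last by rewrite andbT.
by rewrite (negPf (h _)).
Qed.

(** By [bin] the runs in the parent cell belong to the cell of [t0] and at most one sibling. Both
    have items by induction, and the script that follows the order of the walk joins them; the item
    kept by the table has the same key and is no longer. *)
Lemma complS L t0 : (L < La)%N -> t0 \in Wk -> (forall t, t \in Wk -> compl L t) ->
  compl L.+1 t0.
Proof.
move=> LL tW IH.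
set gs := [seq g <- grp L | same L.+1 (head 0%N (head [::] g)) t0].
set X := [seq B <- seg L | same L.+1 (head 0%N B) t0].
have gflat g : g \in grp L -> flatten g \in seg L.+1 by move=> gg; apply: map_f.
have hflat g : g \in grp L -> head 0%N (flatten g) = head 0%N (head [::] g) /\
    last 0%N (flatten g) = last 0%N (last [::] g).
  move=> gg; have g0 := grp_nil gg; have gm B : B \in g -> B != [::].
    by move=> Bg; apply: (@seg_n0 L); exact: grp_mem gg Bg.
  split; first by case: g g0 gm {gg} => // B g _ /(_ B (mem_head _ _)); case: B.
  case: (lastP g) g0 gm => // s x _ gm; rewrite last_rcons flatten_rcons last_cat.
  by have := gm x; rewrite mem_rcons mem_head => /(_ isT); case: x {gm}.
have fgs : flatten gs = X.
  rewrite /gs (@flatten_filter _ _ (fun B => same L.+1 (head 0%N B) t0)).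
    by rewrite flatten_chop.
  move=> g B gg Bg; have sB := grp_mem gg Bg.
  have hB : head 0%N B \in flatten g.
    by apply/flattenP; exists B => //; apply: head_mem; exact: seg_n0 sB.
  have hg : head 0%N (head [::] g) \in flatten g.
    have [<- _] := hflat _ gg; apply: head_mem; exact: seg_n0 (gflat _ gg).
  have := seg_same (gflat _ gg) hB hg; rewrite /same /samec => /eqP ->.
  by [].
have sgs : segc L.+1 t0 = [seq flatten g | g <- gs].
  rewrite /segc /= -/(grp L) filter_map; congr map; apply: eq_in_filter => g gg /=.
  by have [-> _] := hflat _ gg.
set Bs1 := segc L t0; set Bs2 := [seq B <- X | ~~ same L (head 0%N B) t0].
have XW B : B \in X -> head 0%N B \in Wk /\ B \in seg L.
  rewrite mem_filter => /andP [_ Bs]; split=> //.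
  by apply: (seg_mem Bs); apply: head_mem; exact: seg_n0 Bs.
have Bs1X : Bs1 = [seq B <- X | same L (head 0%N B) t0].
  rewrite /Bs1 /X -filter_predI; apply: eq_in_filter => B Bs /=.
  case h : (same L _ _) => //=; apply/esym; apply: sameS h => //.
  by apply: (seg_mem Bs); apply: head_mem; exact: seg_n0 Bs.
set lst := Bs1 ++ Bs2.
have pX : perm_eq lst X by rewrite /lst Bs1X; apply/permPl; exact: perm_filterC.
have [K [KT K1 K2 K3 K4]] := IH _ tW.
have [J [JT J1 J2 J3 [Bs2R [J4 J5]]]] : exists J, [/\ J \in (K.1, (0%N, [::])) ::
    tableL ds XS PB Rs mu scr U L, samec (cs L.+1) K.1 J.1,
    (K.1 != J.1) || ((J.2.1 == 0%N) && nilp J.2.2),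
    terms J.2.2 = [seq (a L (head 0%N B), b L (last 0%N B)) | B <- Bs2] &
    (size Bs2 <= Rs)%N /\ (K.2.1 + J.2.1)%N = kk L.+1 t0 /\
    tlen ds K.2.2 + tlen ds J.2.2 <= \sum_(B <- lst) blen L B + tt L.+1 t0].
  have K1s : samec (cs L) K.1 (loc t0) by rewrite K1 samec_repr // sizecs locN.
  case E2 : Bs2 => [|B2 l2].
    exists (K.1, (0%N, [::])); rewrite mem_head samec_refl /= orbT; split=> //.
    have sp (V : nmodType) (w : nat -> V) :
      \sum_(p <- vis | samec (cs L.+1) p (loc t0)) w p =
      \sum_(p <- vis | samec (cs L) p (loc t0)) w p.
      rewrite (@vis_split _ w _ (fun p => samec (cs L) p (loc t0)) pred0) //.
        by rewrite [X in _ + X]big_pred0_eq addr0.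
      move=> t tW'; rewrite orbF; apply/idP/idP => [h|]; last exact: sameS.
      apply/negPn/negP => nh; have [B Bs tB] := seg_of L tW'.
      have hB : head 0%N B \in B by apply: head_mem; exact: seg_n0 Bs.
      have := seg_same Bs hB tB => sBt.
      have : B \in Bs2.
        rewrite !mem_filter Bs andbT; apply/andP; split.
          apply: contra nh => h'; apply: samec_trans h'; by rewrite samec_sym.
        apply: samec_trans h; apply: sameS sBt => //; exact: seg_mem Bs hB.
      by rewrite E2.
    split; first by [].
    split; first by rewrite addn0 K2 /kk -sp.
    by rewrite /lst E2 cats0 /tlen big_nil addr0 /tt sp.
  (* The sibling cell is identified by the start of a run outside the cell of [t0]. *)
  pose t2 := head 0%N B2.
  have B2m : B2 \in Bs2 by rewrite E2 mem_head.
  have := B2m; rewrite mem_filter => /andP [nt2 B2X].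
  have [t2W B2s] := XW _ B2X; rewrite -/t2 in t2W nt2.
  have st2 : same L.+1 t2 t0 by move: B2X; rewrite mem_filter => /andP [].
  have cls t : t \in Wk -> same L.+1 t t0 -> ~~ same L t t0 -> same L t t2.
    move=> tW' s1 s2.
    have := @bin L (loc t0) (loc t) (loc t2) (locN tW) (locN tW') (locN t2W) LL.
    rewrite ![samec _ (loc t0) _]samec_sym => /(_ s1 st2) /or3P [h|h|//].
      by rewrite /same h in s2.
    by rewrite /same h in nt2.
  have B2E : segc L t2 = Bs2.
    rewrite /Bs2 /X -filter_predI; apply: eq_in_filter => B Bs /=.
    have hW : head 0%N B \in Wk by apply: (seg_mem Bs); apply: head_mem; exact: seg_n0 Bs.
    apply/idP/andP => [h|[h1 h2]]; last exact: cls.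
    split; first by apply: contra nt2 => h'; apply: samec_trans h'; rewrite samec_sym.
    by apply: samec_trans st2; exact: sameS h.
  have [J [JT J1 J2 J3 J4]] := IH _ t2W.
  have J1s : samec (cs L) J.1 (loc t2) by rewrite J1 samec_repr // sizecs locN.
  have KN : (K.1 < N)%N by rewrite K1 -(sizecs L) repr_lt // sizecs locN.
  have JN : (J.1 < N)%N by rewrite J1 -(sizecs L) repr_lt // sizecs locN.
  have sp (V : nmodType) (w : nat -> V) :
      \sum_(p <- vis | samec (cs L.+1) p (loc t0)) w p =
      \sum_(p <- vis | samec (cs L) p (loc t0)) w p +
      \sum_(p <- vis | samec (cs L) p (loc t2)) w p.
    apply: vis_split => t tW'.
      apply/idP/orP => [h|[h|h]]; last 2 first.
      - exact: sameS.
      - by apply: samec_trans st2; exact: sameS.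
      case h' : (samec (cs L) (loc t) (loc t0)); [by left|right].
      by apply: cls => //; rewrite /same h'.
    move=> h; apply: contra nt2 => h'; apply: samec_trans h.
    by rewrite samec_sym.
  exists J; split.
  - by rewrite inE JT orbT.
  - apply: (@samec_trans _ _ (loc t0)); first exact: samecS (locN tW) K1s.
    rewrite samec_sym; apply: (@samec_trans _ _ (loc t2)) st2.
    exact: samecS (locN t2W) J1s.
  - apply/orP; left; apply: contra nt2 => /eqP e.
    by apply: samec_trans K1s; rewrite e samec_sym.
  - by rewrite J3 B2E E2.
  - split; first by rewrite -E2 -B2E; exact: segR (ltnW LL) t2W.
    split; first by rewrite K2 J2 /kk sp.
    rewrite /lst big_cat /= /tt sp -B2E.
    move: K4 J4; rewrite /tt /Bs1; lra.
have sK : sound (cs L) K by exact: table_sound KT.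
have sJ : sound (cs L) J \/ J = (K.1, (0%N, [::])).
  by move: JT; rewrite inE => /orP [/eqP ->|/table_sound]; [right|left].
set P := prt L.+1 K.1.
have sz1 : size K.2.2 = size Bs1 by move/(congr1 size): K3; rewrite !size_map.
have sz2 : size J.2.2 = size Bs2 by move/(congr1 size): J3; rewrite !size_map.
have szl : (size K.2.2 + size J.2.2)%N = size lst by rewrite size_cat sz1 sz2.
set bl := K.2.2 ++ J.2.2 ++ [seq [:: z] | z <- P].
have szb : size bl = (size lst + size P)%N.
  by rewrite -szl /bl !size_cat size_map addnA.
have ul : uniq lst.
  rewrite (perm_uniq pX) filter_uniq //; apply: uniq_flatten (seg_nil L).
  by rewrite flatten_seg.
pose str B := nth [::] bl (index B lst).
have strE B : B \in lst -> str B = nth [::] (K.2.2 ++ J.2.2) (index B lst).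
  by move=> Bl; rewrite /str /bl catA nth_cat size_cat szl index_mem Bl.
have str_ok B : B \in lst -> [/\ str B != [::], head 0%N (str B) = a L (head 0%N B) &
     last 0%N (str B) = b L (last 0%N B)].
  move=> Bl; have te : terms (K.2.2 ++ J.2.2) =
      [seq (a L (head 0%N B), b L (last 0%N B)) | B <- lst].
    by rewrite /terms map_cat -/(terms _) -/(terms J.2.2) K3 J3 -map_cat.
  have := terms_nth te Bl; rewrite -strE // => -[h1 h2]; split=> //.
  have : str B \in K.2.2 ++ J.2.2 by rewrite strE // mem_nth // size_cat szl index_mem.
  rewrite mem_cat => /orP [|]; first by have [_ _ h _ _] := sK; exact: h.
  by case: sJ => [[_ _ h _ _]|->] //; exact: h.
have K1s : samec (cs L.+1) K.1 (loc t0).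
  have KN : (K.1 < N)%N by rewrite K1 -(sizecs L) repr_lt // sizecs locN.
  by apply: samecS => //; rewrite ?locN // K1 samec_repr // sizecs locN.
have PE t : t \in Wk -> same L.+1 t t0 -> prt L.+1 (loc t) = P.
  move=> tW' st; rewrite /P /prt /portals; apply: eq_filter => q; congr (_ && _).
  rewrite /samec in K1s *; rewrite /same /samec in st.
  by rewrite (eqP K1s) (eqP st).
pose sym z := (size lst + index z P)%N.
have symE z : z \in P -> nth [::] bl (sym z) = [:: z].
  move=> zP; rewrite /bl catA nth_cat size_cat szl /sym ltnNge leq_addr /= addKn.
  by rewrite (nth_map 0%N) ?index_mem // nth_index.
have gsm g : g \in gs -> g \in grp L /\ same L.+1 (head 0%N (head [::] g)) t0.
  by rewrite mem_filter => /andP [].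
have gB g B : g \in gs -> B \in g -> B \in lst.
  by move=> gg Bg; rewrite (perm_mem pX) -fgs; apply/flattenP; exists g.
(* A strand is extended by a portal only if its prescribed endpoint changes at this level. *)
pose pa g := let h := head 0%N (flatten g) in
  if a L.+1 h == a L h then [::] else [:: sym (a L.+1 h)].
pose pb g := let h := last 0%N (flatten g) in
  if b L.+1 h == b L h then [::] else [:: sym (b L.+1 h)].
pose gw g := pa g ++ [seq index B lst | B <- g] ++ pb g.
have aP g : g \in gs -> a L.+1 (head 0%N (flatten g)) != a L (head 0%N (flatten g)) ->
    a L.+1 (head 0%N (flatten g)) \in P.
  move=> /[dup] gg /gsm [gg' sg] ne; have fs := gflat _ gg'.
  have hW : head 0%N (flatten g) \in Wk.
    by apply: (seg_mem fs); apply: head_mem; exact: seg_n0 fs.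
  have [hE _] := hflat _ gg'.
  by case: (aS LL hW) ne => [->|]; rewrite ?eqxx // PE // hE.
have bP g : g \in gs -> b L.+1 (last 0%N (flatten g)) != b L (last 0%N (flatten g)) ->
    b L.+1 (last 0%N (flatten g)) \in P.
  move=> /[dup] gg /gsm [gg' sg] ne; have fs := gflat _ gg'.
  have f0 := seg_n0 fs.
  have hW : last 0%N (flatten g) \in Wk by apply: (seg_mem fs); apply: last_mem.
  have [hE _] := hflat _ gg'.
  case: (bS LL hW) ne => [->|]; rewrite ?eqxx // PE //.
  apply: samec_trans sg; rewrite -hE.
  by apply: (seg_same fs); [apply: last_mem|apply: head_mem].
pose Xg g := [seq x <- [:: a L.+1 (head 0%N (flatten g))] |
     a L.+1 (head 0%N (flatten g)) != a L (head 0%N (flatten g))] ++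
   flatten [seq str B | B <- g] ++ [seq x <- [:: b L.+1 (last 0%N (flatten g))] |
     b L.+1 (last 0%N (flatten g)) != b L (last 0%N (flatten g))].
have gwX g : g \in gs -> flatten [seq nth [::] bl c | c <- gw g] = Xg g.
  move=> gg; rewrite /gw !map_cat !flatten_cat -map_comp /Xg; congr (_ ++ (_ ++ _)).
    rewrite /pa /=; case: ifPn => [//|/negPf ne] /=.
    by rewrite symE // aP // ne.
  rewrite /pb /=; case: ifPn => [//|/negPf ne] /=.
  by rewrite symE // bP // ne.
have gwlt g : g \in gs -> all (fun c => c < size bl)%N (gw g).
  move=> gg; rewrite /gw !all_cat szb; apply/and3P; split.
  - rewrite /pa; case: ifPn => //= ne; rewrite /sym ltn_add2l index_mem aP //.
  - apply/allP => c /mapP [B Bg ->]; rewrite ltn_addr // index_mem; exact: gB Bg.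
  - rewrite /pb; case: ifPn => //= ne; rewrite /sym ltn_add2l index_mem bP //.
have pos : (size P <= PB)%N.
  by apply: PBP => //; rewrite K1 -(sizecs L) repr_lt // sizecs locN.
have szl2 : (size lst <= 2 * Rs)%N.
  by rewrite /lst size_cat mul2n -addnn leq_add // /Bs1 segR // ltnW.
have szg : (size gs <= Rs)%N by rewrite -(size_map flatten) -sgs segR.
set w0 := flatten [seq (2 * Rs + PB)%N :: gw g | g <- gs].
(* Beside its parts, a new strand takes three letters: a separator and at most two portals. *)
have szw : (size w0 <= 5 * Rs)%N.
  have gen l : (size (flatten [seq (2 * Rs + PB)%N :: gw g | g <- l]) <=
      \sum_(g <- l) (3 + size g))%N.
    elim: l => [|g l IHl] //=; rewrite big_cons size_cat; apply: (@leq_add (size (gw g)).+1) => //.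
    rewrite /gw !size_cat size_map /pa /pb; case: ifP; case: ifP => _ _ /=; clear; lia.
  apply: leq_trans (gen gs) _; rewrite big_split /= big_const_seq count_predT iter_addn_0.
  have -> : (\sum_(g <- gs) size g)%N = size lst.
    by rewrite (perm_size pX) -fgs size_flatten /shape sumnE big_map.
  by move: szg szl2; clear; lia.
set w := w0 ++ nseq (5 * Rs - size w0) (2 * Rs + PB)%N.
have szbl : (size bl <= 2 * Rs + PB)%N by rewrite szb leq_add.
have wW : w \in scr.
  rewrite mem_words size_cat size_nseq subnKC // eqxx /= all_cat; apply/andP; split.
    apply/allP => c /flatten_mapP [g gg]; rewrite inE => /orP [/eqP -> //|cg].
    by have /allP/(_ _ cg) := gwlt _ gg; move=> h; apply: (leq_trans h); apply: leqW.
  by apply/allP => c /nseqP [-> _].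
have ok : okc (cs L.+1) K J w.
  rewrite /okc J1 J2 szl /=; apply/andP; split.
    have slp : (size lst <= 2 * Rs + PB)%N by apply: leq_trans szbl; rewrite szb leq_addr.
    have sF : (2 * Rs + PB < size lst)%N = false by rewrite ltnNge slp.
    have symF z : (sym z < size lst)%N = false by rewrite ltnNge leq_addr.
    have -> : [seq c <- w | (c < size lst)%N] = [seq index B lst | B <- X].
      rewrite /w filter_cat [X in _ ++ X](_ : _ = [::]) ?cats0; last first.
        by elim: (5 * Rs - size w0)%N => //= m ->; rewrite sF.
      rewrite -fgs map_flatten /w0 filter_flatten -map_comp; congr flatten.
      apply/eq_in_map => g gg /=; rewrite sF /gw !filter_cat /pa /pb.
      rewrite [X in X ++ _](_ : _ = [::]) ?cat0s; last by case: ifP => //=; rewrite symF.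
      rewrite [X in _ ++ X](_ : _ = [::]) ?cats0; last by case: ifP => //=; rewrite symF.
      apply/all_filterP/allP => c /mapP [B Bg ->]; rewrite index_mem; exact: gB Bg.
    rewrite map_inj_in_uniq -?(perm_uniq pX) // => B B' BX BX' e.
    rewrite -(perm_mem pX) in BX; rewrite -(perm_mem pX) in BX'.
    by rewrite -(nth_index [::] BX) e nth_index.
  apply/allP => c; rewrite mem_iota0 => cl.
  have Bl : nth [::] lst c \in lst by rewrite mem_nth.
  have : nth [::] lst c \in flatten gs by rewrite fgs -(perm_mem pX).
  move=> /flattenP [g gg Bg]; rewrite mem_cat; apply/orP; left.
  apply/flatten_mapP; exists g => //; rewrite inE /gw !mem_cat; apply/orP; right.
  apply/orP; right; apply/orP; left; apply/mapP; exists (nth [::] lst c) => //.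
  by rewrite index_uniq.
pose C := cand (cs L.+1) (cs (L.+1 - mu)) K J w.
have bE : build bl w = [seq Xg g | g <- gs].
  have w0E : w0 = flatten [seq (2 * Rs + PB)%N :: v | v <- [seq gw g | g <- gs]].
    by rewrite /w0 -map_comp.
  rewrite /w w0E build_script //.
    rewrite -map_comp (_ : map _ gs = [seq Xg g | g <- gs]); last first.
      by apply/eq_in_map => g gg /=; rewrite gwX.
    apply/all_filterP/allP => q /mapP [g gg ->]; have [gg' _] := gsm _ gg.
    rewrite /Xg; case: g gg gg' => [|B g] gg gg'; first by have := grp_nil gg'.
    have [|+ _ _] := str_ok B; first by apply: gB gg _; rewrite mem_head.
    by rewrite /=; case: (str B) => // y s _; case: ifP.
  by apply/allP => v /mapP [g gg ->]; exact: gwlt.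
have CE : C.2.2 = [seq Xg g | g <- gs] by rewrite /C /cand /= -bE.
have Xok g : g \in gs -> [/\ head 0%N (Xg g) = a L.+1 (head 0%N (flatten g)),
   last 0%N (Xg g) = b L.+1 (last 0%N (flatten g)) &
   plen ds (Xg g) + \sum_(B <- g) blen L B <=
     blen L.+1 (flatten g) + \sum_(B <- g) plen ds (str B)].
  move=> gg; have [gg' _] := gsm _ gg; have g0 := grp_nil gg'.
  have hs B : B \in g -> B \in seg L by exact: grp_mem.
  have hst B : B \in g -> [/\ str B != [::], head 0%N (str B) = a L (head 0%N B) &
     last 0%N (str B) = b L (last 0%N B)] by move=> Bg; apply: str_ok; exact: gB Bg.
  have so : sorted (fun B B' => ~~ same L (last 0%N B) (head 0%N B')) g.
    have := seg_adj L.
    rewrite -(flatten_chop (fun B B' => same L.+1 (last 0%N B) (head 0%N B')) (seg L)).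
    move: gg'; rewrite /grp; elim: (chop _ _) => //= g1 l IHl.
    rewrite inE => /orP [/eqP ->|gl] /cat_sorted2 [] //; move=> _; exact: IHl.
  have e := strand_len g0 hs hst so; have [hE lE] := hflat _ gg'.
  set F := flatten [seq str B | B <- g] in e.
  have F0 : F != [::].
    rewrite /F; case: g g0 hst {e so hs gg gg' hE lE F} => // B g _ hst /=.
    by have [] := hst B (mem_head _ _); case: (str B).
  have Fh : head 0%N F = a L (head 0%N (flatten g)).
    rewrite hE /F; case: g g0 hst {e so hs gg gg' hE lE F F0} => // B g _ hst /=.
    by have [] := hst B (mem_head _ _); case: (str B).
  have Fl : last 0%N F = b L (last 0%N (flatten g)).
    rewrite lE /F; case: (lastP g) g0 hst {e so hs gg gg' hE lE F F0 Fh} => // s x _ hst.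
    have [] := hst x; first by rewrite mem_rcons mem_head.
    by rewrite last_rcons map_rcons flatten_rcons last_cat; case: (str x).
  rewrite /Xg -/F.
  have AS : AA L.+1 (head 0%N (flatten g)) = AA L (head 0%N (flatten g)) +
     dm ds (a L.+1 (head 0%N (flatten g))) (a L (head 0%N (flatten g))).
    by rewrite /AA big_ord_recr.
  have BS : BB L.+1 (last 0%N (flatten g)) = BB L (last 0%N (flatten g)) +
     dm ds (b L (last 0%N (flatten g))) (b L.+1 (last 0%N (flatten g))).
    by rewrite /BB big_ord_recr.
  rewrite /blen AS BS; rewrite -hE -lE in e.
  move: Fh Fl AS BS e.
  set ha := head 0%N (flatten g); set lb := last 0%N (flatten g) => Fh Fl _ _ e.
  have d1 := dm_ge0 (a L.+1 ha) (a L ha); have d2 := dm_ge0 (b L lb) (b L.+1 lb).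
  have Fb (z : nat) : F ++ [:: z] != [::] by case: F {e Fh Fl} F0.
  have hF (z : nat) : head 0%N (F ++ [:: z]) = head 0%N F by case: F {e Fh Fl Fb} F0.
  have pF z : plen ds (F ++ [:: z]) = plen ds F + dm ds (last 0%N F) z.
    by rewrite !plenE psum0_cat //= addr0.
  have pc x s : s != [::] -> plen_rec ds x s = dm ds x (head 0%N s) + plen ds s.
    by case: s.
  case: (eqVneq (a L.+1 ha) (a L ha)) => ea; case: (eqVneq (b L.+1 lb) (b L lb)) => eb /=.
  - rewrite cats0 Fh Fl ea eb; split=> //; rewrite -ea in d1; rewrite -eb in d2.
    by move: e d1 d2; rewrite ea eb; lra.
  - by rewrite hF last_cat /= Fh ea pF Fl; split=> //; rewrite -ea in d1; move: e d1 d2; rewrite ea; lra.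
  - rewrite cats0 pc // Fh; split=> //; last by rewrite -eb in d2; move: e d1 d2; rewrite eb; lra.
    by rewrite eb -Fl; case: F F0 {e Fh Fl Fb hF pF}.
  - rewrite pc // hF Fh pF Fl; split=> //; last by move: e d1 d2; lra.
    by rewrite last_cat.
have tE : terms C.2.2 = [seq (a L.+1 (head 0%N B), b L.+1 (last 0%N B)) | B <- segc L.+1 t0].
  rewrite CE sgs /terms -!map_comp; apply/eq_in_map => g gg /=.
  by have [-> -> _] := Xok _ gg.
have C1 : C.1 = repr (cs L.+1) (loc t0) by rewrite /C /cand /=; exact: repr_eq.
have sC : sound (cs L.+1) C by exact: cand_sound sK sJ ok.
(* The keys list only counts below [N]. The certificate of soundness avoids index 0, so the count is
   at most [N.-1]. *)
have CN : (C.2.1 < N)%N.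
  have [_ _ _ cx [sc [usc <- msc]]] := sC.
  have h : {subset sc <= iota 1 N.-1}.
    move=> x /msc [x0 /cx [xN _]]; rewrite sizecs in xN; rewrite mem_iota x0 /=; move: xN x0; clear; lia.
  have := uniq_leq_size usc h; rewrite size_iota.
  have : (0 < N)%N by apply: leq_ltn_trans (locN tW).
  by clear; lia.
have kin : keyof C \in keys XS PB Rs (cs L.+1) (cs (L.+1 - mu)).
  have [E [szE aE hE]] := segE (ltn0Sn L) LL tW.
  (* Words have fixed length, so the list of extra points is padded with index 0. *)
  set E' := E ++ nseq (XS - size E) 0%N.
  have aux x : x \in E ++ prt L.+1 (loc t0) ->
     exists2 c, (c < XS + PB)%N & nth 0%N (E' ++ prt L.+1 (loc t0)) c = x.
    have szE' : size E' = XS by rewrite size_cat size_nseq subnKC.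
    rewrite mem_cat => /orP [xE|xP].
      exists (index x E); first by rewrite ltn_addr // (leq_trans _ szE) // index_mem.
      by rewrite /E' -catA nth_cat index_mem xE nth_index.
    exists (XS + index x (prt L.+1 (loc t0)))%N.
      rewrite ltn_add2l (leq_trans _ (PBP LL (locN tW))) // index_mem //.
    by rewrite nth_cat szE' ltnNge leq_addr /= addKn nth_index.
  have sel (f : seq nat -> nat) : (forall B, B \in segc L.+1 t0 ->
       f B \in E ++ prt L.+1 (loc t0)) -> exists2 ca,
       ca \in words (XS + PB) (size (segc L.+1 t0)) &
       [seq nth 0%N (E' ++ prt L.+1 (loc t0)) c | c <- ca] = [seq f B | B <- segc L.+1 t0].
    elim: (segc L.+1 t0) => [|B l IHl] h; first by exists [::]; rewrite ?mem_words.
    have [|c cl ce] := aux (f B); first by apply: h; rewrite mem_head.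
    have [|ca cw ce'] := IHl; first by move=> B' Bl; apply: h; rewrite inE Bl orbT.
    exists (c :: ca); last by rewrite /= ce ce'.
    by move: cw; rewrite !mem_words /= eqSS cl.
  have [|ca caw caE] := sel (fun B => a L.+1 (head 0%N B)); first by move=> B /hE [].
  have [|cb cbw cbE] := sel (fun B => b L.+1 (last 0%N B)); first by move=> B /hE [].
  have pE : portals (cs L.+1) (cs (L.+1 - mu)) C.1 = prt L.+1 (loc t0).
    apply: eq_filter => q; congr (_ && _); rewrite /samec C1.
    have := @samec_repr (cs L.+1) (loc t0); rewrite sizecs => /(_ (locN tW)).
    by rewrite /samec => /eqP ->.
  rewrite /keys; cbv zeta; rewrite sizecs.
  apply/flatten_mapP; exists C.1; first by rewrite mem_iota0; have [] := sC; rewrite sizecs.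
  apply/flatten_mapP; exists C.2.1; first by rewrite mem_iota0.
  apply/flatten_mapP; exists E'.
    rewrite mem_words size_cat size_nseq subnKC // eqxx /= all_cat aE /=.
    by apply/allP => x /nseqP [-> _]; apply: leq_ltn_trans (locN tW).
  apply/flatten_mapP; exists (size (segc L.+1 t0)); first by rewrite mem_iota0 ltnS segR.
  apply/flatten_mapP; exists ca => //; apply/mapP; exists cb => //.
  rewrite /keyof tE pE caE cbE; congr (_, (_, _)).
  by elim: (segc L.+1 t0) => //= B l ->.
have Cin : C \in [seq c <- allcands (cs L.+1) (cs (L.+1 - mu))
    (tableL ds XS PB Rs mu scr U L) scr | keyof c == keyof C].
  by rewrite mem_filter eqxx /=; apply/mem_allcands; exists K, J, w.
have [it itm itl] := pickmin_min ds Cin.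
have itk : keyof it = keyof C.
  by move/pickmin_sub: itm; rewrite mem_filter => /andP [/eqP].
exists it; split.
- by apply/flatten_mapP; exists (keyof C).
- by have := congr1 (fun k : keyt => k.1) itk => /= ->.
- by have := congr1 (fun k : keyt => k.2.1) itk => /= ->; rewrite /C /cand /=.
- by have := congr1 (fun k : keyt => k.2.2) itk => /= ->.
apply: le_trans itl _; rewrite CE sgs /tlen !big_map.
have h1 : \sum_(g <- gs) plen ds (Xg g) + \sum_(B <- lst) blen L B <=
    \sum_(g <- gs) blen L.+1 (flatten g) + \sum_(B <- lst) plen ds (str B).
  rewrite !(perm_big _ pX) /= -fgs !big_flatten /= -!big_split /=.
  by rewrite big_seq [leRHS]big_seq; apply: ler_sum => g gg; have [] := Xok _ gg.
have h2 : \sum_(B <- lst) plen ds (str B) = tlen ds K.2.2 + tlen ds J.2.2.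
  rewrite /tlen -big_cat /= big_seq (eq_bigr (fun B => plen ds (nth [::] (K.2.2 ++ J.2.2) (index B lst)))).
    rewrite -big_seq [RHS](big_nth [::]) [LHS](big_nth [::]) size_cat szl.
    by rewrite big_nat [RHS]big_nat; apply: eq_bigr => i /andP [_ il]; rewrite index_uniq.
  by move=> B Bl; rewrite strE.
by move: h1 h2 J5; lra.
Qed.

Lemma dp_complete L t0 : (L <= La)%N -> t0 \in Wk -> compl L t0.
Proof.
elim: L t0 => [|L IH] t0 LL tW; first exact: compl0.
by apply: complS => // t tW'; apply: IH => //; exact: ltnW.
Qed.

End Comp.
End DP.

(** * Uncrossing a walk on a shifted quadtree *)

Module Walk.
Set Implicit Arguments.
Unset Strict Implicit.
Unset Printing Implicit Defensive.
Import Order.TTheory GRing.Theory Num.Theory.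
Local Open Scope ring_scope.

Section Esum.
Variable V : nmodType.
Implicit Types (f : nat -> nat -> V) (s : seq nat).

Fixpoint esum_rec f x s : V := if s is y :: s' then f x y + esum_rec f y s' else 0.
Definition esum f s : V := if s is x :: s' then esum_rec f x s' else 0.

Lemma esum_cat f s1 s2 : s1 != [::] -> s2 != [::] ->
  esum f (s1 ++ s2) = esum f s1 + f (last 0%N s1) (head 0%N s2) + esum f s2.
Proof.
case: s1 s2 => // x s1 [//|y s2] _ _ /=.
by elim: s1 x => [|z s1 IH] x /=; rewrite ?add0r // IH !addrA.
Qed.

Lemma esum_rev f s : (forall x y, f x y = f y x) -> esum f (rev s) = esum f s.
Proof.
move=> fs; elim: s => // x [|y s] IH //.
rewrite rev_cons -cats1 esum_cat //; last by rewrite rev_cons; case: (rev s).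
by rewrite IH /= addr0 addrC rev_cons last_rcons fs.
Qed.

Lemma esum_nth f s :
  esum f s = \sum_(r < (size s).-1) f (nth 0%N s r) (nth 0%N s r.+1).
Proof.
case: s => [|x s]; first by rewrite big_ord0.
elim: s x => [|y s IH] x /=; first by rewrite big_ord0.
by have /= -> := IH y; rewrite [RHS]big_ord_recl.
Qed.

(** Reversing the section between two edges keeps the inner edges, by symmetry of [f], and
    reconnects the four ends the other way. Both sides are sums without subtraction, so the identity
    serves for counts and for lengths. *)
Lemma esum_2opt f s i j : (forall x y, f x y = f y x) -> (i < j)%N -> (j.+1 < size s)%N ->
  let W' := take i.+1 s ++ rev (drop i.+1 (take j.+1 s)) ++ drop j.+1 s in
  [/\ perm_eq W' s, head 0%N W' = head 0%N s &
   esum f W' + (f (nth 0%N s i) (nth 0%N s i.+1) + f (nth 0%N s j) (nth 0%N s j.+1)) =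
   esum f s + (f (nth 0%N s i) (nth 0%N s j) + f (nth 0%N s i.+1) (nth 0%N s j.+1))].
Proof.
move=> fs ij js; set A := take i.+1 s; set C := drop j.+1 s.
set G := drop i.+1 (take j.+1 s) => W'.
have sE : s = A ++ G ++ C.
  rewrite /A /G /C catA -{1}(cat_take_drop j.+1 s); congr (_ ++ _).
  by rewrite -[LHS](cat_take_drop i.+1) take_takel // ltnW.
have zA : size A = i.+1 by rewrite size_takel // (leq_trans _ (ltnW js)) // ltnS ltnW.
have zG : size G = (j - i)%N by rewrite size_drop size_takel // ltnW.
have zC : (0 < size C)%N by rewrite size_drop subn_gt0.
have nz T (x : seq T) : (0 < size x)%N -> ~~ nilp x by case: x.
have A0 : A != [::] by case: (A) zA.
have G0 : G != [::] by case: (G) zG => //= zG; move: zG ij; clear; lia.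
have C0 : C != [::] by case: (C) zC.
have rG0 : rev G != [::] by rewrite -size_eq0 size_rev size_eq0.
have GC0 : G ++ C != [::] by case: (G) G0.
have rGC0 : rev G ++ C != [::] by case: (rev G) rG0.
have hcat (x y : seq nat) : x != [::] -> head 0%N (x ++ y) = head 0%N x by case: x.
have hr (x : seq nat) : head 0%N (rev x) = last 0%N x by case: (lastP x) => // l y; rewrite rev_rcons last_rcons.
have lr (x : seq nat) : last 0%N (rev x) = head 0%N x by rewrite -hr revK.
have ei : nth 0%N s i = last 0%N A.
  by rewrite sE nth_cat zA ltnSn -nth_last zA.
have ei1 : nth 0%N s i.+1 = head 0%N G.
  by rewrite sE nth_cat zA ltnn subnn nth_cat zG subn_gt0 ij nth0.
have ej : nth 0%N s j = last 0%N G.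
  have h1 : (j < i.+1)%N = false by move: ij; clear; lia.
  have h2 : (j - i.+1 < j - i)%N by move: ij; clear; lia.
  rewrite sE nth_cat zA h1 nth_cat zG h2 -nth_last zG.
  by congr nth; move: ij; clear; lia.
have ej1 : nth 0%N s j.+1 = head 0%N C.
  have h1 : (j.+1 < i.+1)%N = false by move: ij; clear; lia.
  by rewrite sE nth_cat zA h1 nth_cat zG subSS ltnn subnn nth0.
split.
- by rewrite /W' [in X in perm_eq _ X]sE perm_cat2l perm_cat2r perm_rev.
- by rewrite /W' hcat // [in RHS]sE hcat.
- rewrite ei ei1 ej ej1 /W' [in RHS]sE !esum_cat // !hcat // !lr !hr esum_rev //.
  by rewrite !addrA [LHS](AC 7 (1*6*3*7*5*2*4)).
Qed.

End Esum.

(** * Counted crossings, exact crossings and admissible moves *)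

Section Walk.
Local Open Scope nat_scope.
(** Times [0] to [k] index the original path, [Y t] is its grid point at time [t], and [pj t] is the
    piece containing the step from [t] to [t.+1]. A move at level [l] requires its two crossing
    points to share a cell [mM] levels below. *)
Variables (d u k l1 mM : nat) (Y : nat -> nat -> nat) (Ym : nat) (pj : nat -> nat).
Hypothesis YY : forall t i, (Y t i < Ym)%N.
Hypothesis pju : forall t, (pj t < u)%N.
Hypothesis pjm : forall t t', (t <= t')%N -> (pj t <= pj t')%N.

Definition side t i y0 := (Y t i < y0)%N.
Definition sep t t' i y0 := side t i y0 != side t' i y0.
Definition mcnt j i y0 := (\sum_(t < k | pj t == j) sep t t.+1 i y0)%N.
Definition multi j i y0 := (1 < mcnt j i y0)%N.
Definition adjp t t' := (t == t'.+1) || (t' == t.+1).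
(** A crossing is exempt only if it is an original step whose piece crosses the hyperplane exactly
    once: such a crossing cannot be charged to backward movement. Edges between non-adjacent times,
    which only moves create, get no exemption. *)
Definition ctd t t' i y0 :=
  sep t t' i y0 && (~~ adjp t t' || multi (pj (minn t t')) i y0).

Lemma sep_sym t t' i y0 : sep t t' i y0 = sep t' t i y0.
Proof. by rewrite /sep eq_sym. Qed.
Lemma ctd_sym t t' i y0 : ctd t t' i y0 = ctd t' t i y0.
Proof. by rewrite /ctd sep_sym minnC /adjp [_ || (t' == _)]orbC. Qed.

Definition samel l b t t' := [forall i : 'I_d,
  (Y t i + b) %/ 2 ^ l == (Y t' i + b) %/ 2 ^ l].

Lemma samelP l b t t' : reflect
  (forall i, (i < d)%N -> ((Y t i + b) %/ 2 ^ l = (Y t' i + b) %/ 2 ^ l)%N) (samel l b t t').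
Proof.
apply: (iffP forallP) => [h i id|h i]; last by apply/eqP/h.
by have /eqP := h (Ordinal id).
Qed.

Lemma samel_refl l b t : samel l b t t. Proof. by apply/samelP. Qed.
Lemma samel_sym l b t t' : samel l b t t' = samel l b t' t.
Proof. by apply/samelP/samelP => h i /h. Qed.
Lemma samel_trans l b t t' t'' : samel l b t t' -> samel l b t' t'' -> samel l b t t''.
Proof. by move=> /samelP h1 /samelP h2; apply/samelP => i id; rewrite h1 ?h2. Qed.
Lemma samel_le l l' b t t' : (l <= l')%N -> samel l b t t' -> samel l' b t t'.
Proof.
move=> ll /samelP h; apply/samelP => i id.
have -> : (2 ^ l' = 2 ^ l * 2 ^ (l' - l))%N by rewrite -expnD subnKC.
by rewrite !divnMA h.
Qed.

Definition ongrid l b y0 := (2 ^ l %| y0 + b)%N.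

Lemma ongrid_side l b y0 t i : ongrid l b y0 ->
  side t i y0 = ((Y t i + b) %/ 2 ^ l < (y0 + b) %/ 2 ^ l)%N.
Proof.
move=> g; rewrite /side ltn_divLR ?expn_gt0 // divnK //.
by rewrite ltn_add2r.
Qed.

Lemma samel_side l b y0 t t' i : (i < d)%N -> ongrid l b y0 -> samel l b t t' ->
  side t i y0 = side t' i y0.
Proof. by move=> id g /samelP h; rewrite !(ongrid_side _ _ g) h. Qed.

Definition facet l b t i (up : bool) :=
  (((Y t i + b) %/ 2 ^ l + up) * 2 ^ l - b)%N.

Lemma facet_same l b t t' i up : (i < d)%N -> samel l b t t' ->
  facet l b t i up = facet l b t' i up.
Proof. by move=> id /samelP h; rewrite /facet h. Qed.

Lemma facet_coord l b t t' i :
  (Y t i + b) %/ 2 ^ l != (Y t' i + b) %/ 2 ^ l -> exists up,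
  [/\ ongrid l b (facet l b t i up), sep t t' i (facet l b t i up) &
      (facet l b t i up < Ym)%N].
Proof.
move=> ne.
have p2 : (0 < 2 ^ l)%N by rewrite expn_gt0.
have e1 x : ((x %/ 2 ^ l) * 2 ^ l <= x)%N by exact: leq_trunc_div.
have e2 x : (x < (x %/ 2 ^ l).+1 * 2 ^ l)%N by exact: ltn_ceil.
case: (ltngtP ((Y t i + b) %/ 2 ^ l)%N ((Y t' i + b) %/ 2 ^ l)%N) ne => [lt|lt|//] _.
  exists true; rewrite /facet addn1.
  have b1 : (b <= ((Y t i + b) %/ 2 ^ l).+1 * 2 ^ l)%N.
    by move: (e2 (Y t i + b)%N); clear; lia.
  have b2 : (((Y t i + b) %/ 2 ^ l).+1 * 2 ^ l <= Y t' i + b)%N.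
    by apply: leq_trans (e1 _); rewrite leq_mul2r lt orbT.
  split=> //; first by rewrite /ongrid subnK // dvdn_mull.
    by rewrite /sep /side; move: (e2 (Y t i + b)%N) b1 b2; clear; lia.
  by move: (YY t' i) b1 b2; clear; lia.
exists false; rewrite /facet addn0.
have b1 : (Y t' i + b < (Y t i + b) %/ 2 ^ l * 2 ^ l)%N.
  by apply: (leq_trans (e2 _)); rewrite leq_mul2r lt orbT.
have b2 := e1 (Y t i + b)%N.
split=> //; first by rewrite /ongrid subnK ?dvdn_mull //; move: b1; clear; lia.
  by rewrite /sep /side; move: b1 b2; clear; lia.
by move: (YY t i) b1 b2; clear; lia.
Qed.

Lemma nsamel_facet l b t t' : ~~ samel l b t t' -> exists i up,
  [/\ (i < d)%N, ongrid l b (facet l b t i up), sep t t' i (facet l b t i up) &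
      (facet l b t i up < Ym)%N].
Proof.
rewrite negb_forall => /existsP [i /facet_coord [up [h1 h2 h3]]].
by exists i, up.
Qed.

(** An exact exit: an original step leaves [S] through a hyperplane that has all of [S] on the side
    of [t] and that its piece crosses just once. [S] is arbitrary because cells between two quadtree
    levels are needed as well. *)
Definition ex (S : pred nat) t t' : bool := adjp t t' && `[< exists i y0,
  [/\ (i < d)%N, ~~ multi (pj (minn t t')) i y0, (forall s, S s -> side s i y0 = side t i y0) &
      sep t t' i y0] >].

Lemma ex_sub (S S' : pred nat) t t' : {subset S <= S'} -> ex S' t t' -> ex S t t'.
Proof.
move=> sub /andP [ad /asboolP [i [y0 [id nm h sp]]]]; rewrite /ex ad; apply/asboolP.
by exists i, y0; split=> // s Ss; apply: h; exact: sub.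
Qed.

(** This is how the failure of an exact exit is used: every hyperplane separating the edge from [S]
    is then counted. *)
Lemma nex_ctd (S : pred nat) t t' i y0 : ~~ ex S t t' -> (i < d)%N ->
  (forall s, S s -> side s i y0 = side t i y0) -> sep t t' i y0 -> ctd t t' i y0.
Proof.
move=> ne id h sp; rewrite /ctd sp /=; case ad : (adjp t t') => //=.
apply/negPn/negP => nm; case/negP: ne; rewrite /ex ad; apply/asboolP.
by exists i, y0.
Qed.

(* For a fixed piece, S lies entirely before, or entirely after, an exact crossing. *)
Lemma exact_unique (S : pred nat) t1 t2 (w : bool) : (t1 < k)%N -> (t2 < k)%N ->
  pj t1 = pj t2 ->
  S (t1 + w)%N -> S (t2 + w)%N ->
  ex S (t1 + w) (t1 + ~~ w) -> ex S (t2 + w) (t2 + ~~ w) -> t1 = t2.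
Proof.
wlog le : t1 t2 / (t1 <= t2)%N.
  by move=> h *; case: (leqP t1 t2) => [le|/ltnW le]; [|apply/esym]; apply: h.
move=> k1 k2 pe s1 s2 e1 e2; apply/eqP; rewrite eqn_leq le /= leqNgt; apply/negP => lt.
have mn t : minn (t + w) (t + ~~ w) = t by case: w {s1 s2 e1 e2}; rewrite /=; lia.
(* The piece crosses this hyperplane at step [t] only, so its other steps do not change side. *)
have key t i y0 : (t < k)%N -> ~~ multi (pj t) i y0 -> sep t t.+1 i y0 ->
    forall t', (t' < k)%N -> t' != t -> pj t' = pj t -> side t' i y0 = side t'.+1 i y0.
  move=> tk nm sp t' tk' ne pe'; apply: contraNeq nm => sp'; rewrite /multi /mcnt (bigD1 (Ordinal tk)) //= sp.
  by rewrite (bigD1 (Ordinal tk')) /= ?pe' ?eqxx ?(sp' : sep _ _ _ _) //=; apply/eqP => -[]; apply/eqP.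
have con t i y0 a c : (t < k)%N -> ~~ multi (pj t) i y0 -> sep t t.+1 i y0 -> (a <= c)%N ->
    (forall s, a <= s -> s < c -> [/\ s < k, s != t & pj s = pj t])%N -> side a i y0 = side c i y0.
  move=> tk nm sp; elim: c => [|c IH] ac h; first by case: a ac h.
  move: ac; rewrite leq_eqVlt => /orP [/eqP -> //|ac].
  rewrite IH // => [|s as' sc]; last by apply: h => //; exact: ltnW.
  by have [ck ct pc] := h c ac (ltnSn c); apply: (key t).
have pin s : (t1 <= s -> s <= t2 -> pj s = pj t1)%N.
  move=> a1 a2; apply/eqP; by rewrite eqn_leq {1}pe !pjm.
have sp2 t i y0 : sep (t + w) (t + ~~ w) i y0 -> sep t t.+1 i y0.
  by case: w {s1 s2 e1 e2 mn}; rewrite /= addn0 addn1 // sep_sym.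
case: w s1 s2 e1 e2 mn sp2 => s1 s2 e1 e2 mn sp2.
  (* Here the inner points are [t1 + 1] and [t2 + 1]. Both lie in [S], hence on one side of the
     hyperplane of [t2]; but [t1 + 1] precedes step [t2] and so lies on the side of [t2]. *)
  move: e2 => /andP [_ /asboolP [i [y0 [id nm h sp]]]]; rewrite mn in nm.
  have sp3 := sp2 _ _ _ sp; move: (h _ s1) sp3; rewrite !addn1 /sep => <-.
  rewrite (con t2 i y0 t1.+1 t2) // ?eqxx //; first exact: sp2.
  move=> s a1 a2; split; [lia|apply/eqP; lia|rewrite -pe; apply: pin; lia].
move: e1 => /andP [_ /asboolP [i [y0 [id nm h sp]]]]; rewrite mn in nm.
have sp3 := sp2 _ _ _ sp; move: (h _ s2) sp3; rewrite !addn0 /sep => <-.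
rewrite (con t1 i y0 t1.+1 t2) // ?eqxx //; first exact: sp2.
move=> s a1 a2; split; [lia|apply/eqP; lia|apply: pin; lia].
Qed.

(** Facets up to level [l] see the shift only modulo [2 ^ l], so a walk can be repaired at low
    levels before the high bits of the shift are fixed. *)
Lemma ongrid_mod l l' a b y0 : l' <= l -> a = b %[mod 2 ^ l] ->
  ongrid l' a y0 = ongrid l' b y0.
Proof.
move=> ll e; have e' : a = b %[mod 2 ^ l'].
  by rewrite -(modn_dvdm a (dvdn_exp2l 2 ll)) e modn_dvdm // dvdn_exp2l.
by rewrite /ongrid /dvdn -modnDmr e' modnDmr.
Qed.

Lemma ongrid_le l l' b y0 : l' <= l -> ongrid l b y0 -> ongrid l' b y0.
Proof. by move=> ll; apply: dvdn_trans; exact: dvdn_exp2l. Qed.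

Lemma samel_mod l l' a b t t' : l' <= l -> a = b %[mod 2 ^ l] ->
  samel l' a t t' = samel l' b t t'.
Proof.
move=> ll e; have p2 : 0 < 2 ^ l' by rewrite expn_gt0.
suff h x y : x = y %[mod 2 ^ l] -> samel l' x t t' -> samel l' y t t'.
  by apply/idP/idP; apply: h.
move=> exy; apply: contraTT => /nsamel_facet [i [up [id g sp _]]].
apply/negP => sm; case/negP: sp; apply/eqP; apply: (samel_side id _ sm).
by rewrite (ongrid_mod _ ll exy).
Qed.

(** Two edges leave one cell through a common facet, neither exactly, from points close to each
    other. The move joins [p1] to [p2] and [q1] to [q2]: the first new edge is short and the second
    avoids the common facet. *)
Definition mv l b p1 q1 p2 q2 := [/\ samel (l - mM) b p1 p2,
  ~~ ex (samel l b p1) p1 q1, ~~ ex (samel l b p1) p2 q2 &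
  exists i y0, [/\ i < d, ongrid l b y0, y0 < Ym, sep p1 q1 i y0 & sep p2 q2 i y0]].

Section Move.
Variables (l b p1 q1 p2 q2 : nat).
Hypothesis m : mv l b p1 q1 p2 q2.

Lemma mv_same : samel l b p1 p2.
Proof. by case: m => h _ _ _; apply: samel_le h; exact: leq_subr. Qed.

Lemma mv_side i y0 s : i < d -> ongrid l b y0 -> samel l b p1 s ->
  side s i y0 = side p1 i y0.
Proof. by move=> id g h; rewrite (samel_side id g h). Qed.

(** The facet does not separate [p1] from [p2]. If it separates [q1] from [q2], it separates one of
    them from its inner point, and that old crossing was counted because the exit is not exact. *)
Lemma mv_ctd i y0 : i < d -> ongrid l b y0 ->
  ctd p1 p2 i y0 + ctd q1 q2 i y0 <= ctd p1 q1 i y0 + ctd p2 q2 i y0.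
Proof.
move=> id g; have [_ n1 n2 _] := m; have sm := mv_same.
have e2 := mv_side id g sm.
have c12 : ctd p1 p2 i y0 = false by rewrite /ctd /sep e2 eqxx.
have h1 : sep p1 q1 i y0 -> ctd p1 q1 i y0.
  by move=> h; apply: (nex_ctd n1 id _ h) => s; exact: (mv_side id g).
have h2 : sep p2 q2 i y0 -> ctd p2 q2 i y0.
  by move=> h; apply: (nex_ctd n2 id _ h) => s ss; rewrite e2; exact: (mv_side id g).
rewrite c12 add0n; case c : (ctd q1 q2 i y0) => //.
have : sep q1 q2 i y0 by case/andP: c.
move: h1 h2; rewrite /sep e2.
case: (side q1 i y0) (side q2 i y0) (side p1 i y0) => -[] [] // h1 h2 _.
all: try by rewrite (h1 isT) leq_addr.
all: by rewrite (h2 isT) leq_addl.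
Qed.

Lemma mv_facet : exists i y0, [/\ i < d, ongrid l b y0, y0 < Ym &
  ctd p1 p2 i y0 + ctd q1 q2 i y0 + 2 <= ctd p1 q1 i y0 + ctd p2 q2 i y0].
Proof.
have [_ n1 n2 [i [y0 [id g yl s1 s2]]]] := m; have sm := mv_same.
exists i, y0; split=> //; have e2 := mv_side id g sm.
have -> : ctd p1 q1 i y0.
  by apply: (nex_ctd n1 id _ s1) => s; exact: (mv_side id g).
have -> : ctd p2 q2 i y0.
  by apply: (nex_ctd n2 id _ s2) => s ss; rewrite e2; exact: (mv_side id g).
have -> : ctd p1 p2 i y0 = false by rewrite /ctd /sep e2 eqxx.
have -> : ctd q1 q2 i y0 = false.
  rewrite /ctd; move: s1 s2; rewrite /sep e2.
  by case: (side q1 i y0) (side q2 i y0) (side p1 i y0) => -[] [].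
by [].
Qed.

End Move.

Definition wF l b t t' := \sum_(i < d) \sum_(y0 < Ym | ongrid l b y0) ctd t t' i y0.

Lemma mv_wF l b p1 q1 p2 q2 : mv l b p1 q1 p2 q2 ->
  wF l b p1 p2 + wF l b q1 q2 + 2 <= wF l b p1 q1 + wF l b p2 q2.
Proof.
move=> m; have [i0 [y0 [id g yl h]]] := mv_facet m.
rewrite /wF -!big_split /=.
rewrite (bigD1 (Ordinal id)) //= [X in _ <= X](bigD1 (Ordinal id)) //=.
rewrite -addnA [_ + 2]addnC addnA; apply: leq_add; last first.
  apply: leq_sum => i _; rewrite -!big_split; apply: leq_sum => y gy.
  exact: (mv_ctd m (ltn_ord i) gy).
rewrite -!big_split (bigD1 (Ordinal yl)) //= [X in _ <= X](bigD1 (Ordinal yl)) //=.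
rewrite -addnA [_ + 2]addnC addnA; apply: leq_add => //.
by apply: leq_sum => y /andP [gy _]; exact: (mv_ctd m id gy).
Qed.

Definition cr l b t0 t t' : nat := samel l b t0 t != samel l b t0 t'.

(** Repairs at finer levels are not undone: if [q1] or [q2] lies in a cell of level at most [l],
    neither [p1] nor [p2] does, as the common facet separates them. At most the two old crossings
    are then replaced by two. *)
Lemma mv_cr l b p1 q1 p2 q2 l' t0 : mv l b p1 q1 p2 q2 -> l' <= l ->
  cr l' b t0 p1 p2 + cr l' b t0 q1 q2 <= cr l' b t0 p1 q1 + cr l' b t0 p2 q2.
Proof.
move=> m ll; have sm := mv_same m.
have [_ _ _ [i [y0 [id g _ s1 s2]]]] := m.
have nq q : samel l' b t0 q -> sep p1 q i y0 ->
    (samel l' b t0 p1 = false) /\ (samel l' b t0 p2 = false).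
  move=> sq; rewrite /sep => sp; split; apply/negP => h.
    have : samel l b p1 q.
      by apply: (samel_le ll); apply: samel_trans sq; rewrite samel_sym.
    by move/(samel_side id g) => e; rewrite e eqxx in sp.
  have : samel l b p2 q.
    by apply: (samel_le ll); apply: samel_trans sq; rewrite samel_sym.
  move=> /(samel_trans sm) /(samel_side id g) => e; by rewrite e eqxx in sp.
have s2' : sep p1 q2 i y0 by move: s2; rewrite /sep (mv_side id g sm).
rewrite /cr; case h1 : (samel l' b t0 q1).
  by have [-> ->] := nq _ h1 s1; case: (samel _ _ _ q2).
case h2 : (samel l' b t0 q2).
  by have [-> ->] := nq _ h2 s2'.
by case: (samel _ _ _ p1); case: (samel _ _ _ p2).
Qed.

Definition hg l a t t' := [exists i : 'I_d, [exists y0 : 'I_Ym,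
  ongrid l a y0 && ctd t t' i y0]].
(** The scale of the coarsest facet counted for an edge. Portals are spaced relative to the cells
    left, so the detour of an edge will be proportional to [g]; the level [l1.+1] is included. *)
Definition g a t t' := \max_(l < l1.+2 | hg l a t t') 2 ^ l.

Lemma hgP l a t t' : reflect (exists i y0, [/\ i < d, y0 < Ym, ongrid l a y0 & ctd t t' i y0])
  (hg l a t t').
Proof.
apply: (iffP existsP) => [[i /existsP [y /andP [h1 h2]]]|[i [y [id yl h1 h2]]]].
  by exists i, y.
by exists (Ordinal id); apply/existsP; exists (Ordinal yl); rewrite h1.
Qed.

Lemma hg_le a l t t' : l < l1.+2 -> hg l a t t' -> 2 ^ l <= g a t t'.
Proof. by move=> ll h; apply: (leq_bigmax_cond (Ordinal ll)). Qed.

(** Since [p1] and [p2] share a cell of level [l - mM], only finer facets separate them. A facet of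
    level at least [l] counted for [q1], [q2] was counted for an old edge, and coarser than all
    others is the common facet of level [l]. *)
Lemma mv_g l b p1 q1 p2 q2 a : l <= l1 -> mv l b p1 q1 p2 q2 -> a = b %[mod 2 ^ l] ->
  g a p1 p2 * 2 ^ mM <= 2 ^ l /\ g a q1 q2 <= g a p1 q1 + g a p2 q2.
Proof.
move=> ll m ab; split.
  have [ss _ _ _] := m.
  have small l' : hg l' a p1 p2 -> l' < l - mM.
    move=> /hgP [i [y0 [id yl gr c]]]; rewrite ltnNge; apply/negP => le.
    have gr' : ongrid (l - mM) b y0.
      by rewrite -(ongrid_mod y0 (leq_subr mM l) ab); apply: ongrid_le gr.
    have := samel_side id gr' ss => e.
    by move: c; rewrite /ctd /sep e eqxx.
  case: (ltnP mM l) => lM; last first.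
    rewrite (_ : g a p1 p2 = 0) ?mul0n //; apply: big1 => l' /small; lia.
  apply: (@leq_trans (2 ^ (l - mM) * 2 ^ mM)); last by rewrite -expnD subnK // ltnW.
  rewrite leq_mul2r; apply/orP; right; apply/bigmax_leqP => l' /small h.
  by rewrite leq_exp2l // ltnW.
have [_ n1 n2 [i0 [y [id0 gy yl s1 s2]]]] := m.
have [i1 [y1 [id1 gy1 yl1 c1]]] := mv_facet m.
apply/bigmax_leqP => l' /hgP [i [y0 [id y0l gr c]]].
have hc (x : bool) : (x : nat) <= 1 by case: x.
case: (leqP l l') => l'l.
  have gr' : ongrid l b y0 by rewrite -(ongrid_mod y0 (leqnn _) ab); exact: ongrid_le gr.
  have := mv_ctd m id gr'; rewrite c /=.
  case e1 : (ctd p1 q1 i y0).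
    move=> _; apply: (@leq_trans (g a p1 q1)); last exact: leq_addr.
    by apply: hg_le => //; apply/hgP; exists i, y0.
  case e2 : (ctd p2 q2 i y0).
    move=> _; apply: (@leq_trans (g a p2 q2)); last exact: leq_addl.
    by apply: hg_le => //; apply/hgP; exists i, y0.
  by rewrite addn0; case: (ctd p1 p2 i y0).
apply: (@leq_trans (2 ^ l)); first by rewrite leq_exp2l // ltnW.
apply: (@leq_trans (g a p1 q1)); last exact: leq_addr.
apply: hg_le; first by rewrite ltnS leqW.
apply/hgP; exists i1, y1; split=> //; first by rewrite (ongrid_mod y1 (leqnn _) ab).
by move: c1; case: (ctd p1 q1 i1 y1) => //; case: (ctd p2 q2 i1 y1); rewrite ?addn2.
Qed.

Section Real.
Variables (R : realFieldType) (dd : nat -> nat -> R) (D kap : R).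
Hypothesis dd_sym : forall t t', dd t t' = dd t' t.
Hypothesis dd_tri : forall t t' t'', (dd t t'' <= dd t t' + dd t' t'')%R.
Hypothesis D0 : (0 <= D)%R.
Hypothesis kap0 : (0 <= kap)%R.
Hypothesis ddl : forall l b t t', l <= l1 -> samel l b t t' -> (dd t t' <= D * 2 ^+ l)%R.
Hypothesis dd0 : forall b t t', samel 0 b t t' -> (dd t t' <= 0)%R.

Definition l2 a t t' : R := (dd t t' + kap * (g a t t')%:R)%R.
Definition Cst : R := ((2 * D + kap) / 2 ^+ mM)%R.

(** By the triangle inequality the second new edge costs at most the two old ones plus the short
    edge; both the length and the scale of the short edge are smaller than [2 ^ l] by the factor
    [2 ^ mM]. *)
Lemma mv_l2 l b p1 q1 p2 q2 a : l <= l1 -> mv l b p1 q1 p2 q2 -> a = b %[mod 2 ^ l] ->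
  (l2 a p1 p2 + l2 a q1 q2 <= l2 a p1 q1 + l2 a p2 q2 + Cst * 2 ^+ l)%R.
Proof.
move=> ll m ab; have [g1 g2] := mv_g ll m ab; have [ss _ _ _] := m.
have e0 : (0 < 2 ^+ mM :> R)%R by rewrite exprn_gt0.
have d1 : (dd p1 p2 <= D * 2 ^+ l / 2 ^+ mM)%R.
  rewrite ler_pdivlMr //; case: (leqP mM l) => lM.
    have := ddl (leq_trans (leq_subr mM l) ll) ss => h.
    apply: (@le_trans _ _ (D * 2 ^+ (l - mM) * 2 ^+ mM)%R).
      by rewrite ler_pM2r.
    by rewrite -mulrA -exprD subnK.
  have l0 : l - mM = 0 by lia.
  rewrite l0 in ss; have h := dd0 ss.
  apply: (@le_trans _ _ 0%R); first by rewrite pmulr_lle0.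
  by rewrite mulr_ge0 // exprn_ge0.
have d2 : (dd q1 q2 <= dd p1 q1 + dd p1 p2 + dd p2 q2)%R.
  apply: le_trans (dd_tri q1 p2 q2) _; rewrite lerD2r.
  by apply: le_trans (dd_tri q1 p1 p2) _; rewrite (dd_sym q1).
have g1' : ((g a p1 p2)%:R <= 2 ^+ l / 2 ^+ mM :> R)%R.
  by rewrite ler_pdivlMr // -!natrX -natrM ler_nat.
have g2' : ((g a q1 q2)%:R <= (g a p1 q1)%:R + (g a p2 q2)%:R :> R)%R.
  by rewrite -natrD ler_nat.
have := ler_wpM2l kap0 g1'; have := ler_wpM2l kap0 g2'.
rewrite /l2 /Cst mulrDr; move: d1 d2.
have -> : ((2 * D + kap) / 2 ^+ mM * 2 ^+ l = 2 * (D * 2 ^+ l / 2 ^+ mM) +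
   kap * (2 ^+ l / 2 ^+ mM) :> R)%R by field; exact: lt0r_neq0.
lra.
Qed.

(** Only pairs with equal orientation are excluded, both edges leaving the cell or both entering it,
    because reversing a section of the walk reconnects exactly such pairs. *)
Definition light l b (W : seq nat) := forall i j, i < j -> j.+1 < size W ->
  ~ mv l b (nth 0 W i) (nth 0 W i.+1) (nth 0 W j) (nth 0 W j.+1) /\
  ~ mv l b (nth 0 W i.+1) (nth 0 W i) (nth 0 W j.+1) (nth 0 W j).
Definition fH i y0 W : nat := esum (fun t t' => ctd t t' i y0 : nat) W.
Definition F l b W : nat := esum (wF l b) W.
Definition CR l b t0 W : nat := esum (cr l b t0) W.

Lemma wF_sym l b t t' : wF l b t t' = wF l b t' t.
Proof. by apply: eq_bigr => i _; apply: eq_bigr => y _; rewrite ctd_sym. Qed.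
Lemma cr_sym l b t0 t t' : cr l b t0 t t' = cr l b t0 t' t.
Proof. by rewrite /cr eq_sym. Qed.
Lemma g_sym a t t' : g a t t' = g a t' t.
Proof.
apply: eq_bigl => l; apply/hgP/hgP => -[i [y [h1 h2 h3 h4]]]; exists i, y.
  by rewrite ctd_sym.
by rewrite ctd_sym.
Qed.
Lemma l2_sym a t t' : l2 a t t' = l2 a t' t.
Proof. by rewrite /l2 dd_sym g_sym. Qed.

Lemma step_ex l b W : exists W', l <= l1 ->
  [/\ perm_eq W' W, head 0 W' = head 0 W,
   (forall i y0, i < d -> ongrid l b y0 -> fH i y0 W' <= fH i y0 W), light l b W' &
   [/\ F l b W' <= F l b W, (forall l' t0, l' <= l -> CR l' b t0 W' <= CR l' b t0 W) &
    forall a, a = b %[mod 2 ^ l] -> (esum (l2 a) W' <=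
      esum (l2 a) W + Cst * 2 ^+ l * (F l b W - F l b W')%:R)%R]].
Proof.
case: (leqP l l1) => ll; last by exists W.
suff : exists W', [/\ perm_eq W' W, head 0 W' = head 0 W,
   (forall i y0, i < d -> ongrid l b y0 -> fH i y0 W' <= fH i y0 W), light l b W' &
   [/\ F l b W' <= F l b W, (forall l' t0, l' <= l -> CR l' b t0 W' <= CR l' b t0 W) &
    forall a, a = b %[mod 2 ^ l] -> (esum (l2 a) W' <=
      esum (l2 a) W + Cst * 2 ^+ l * (F l b W - F l b W')%:R)%R]].
  by move=> [W' h]; exists W'.
have C0 : (0 <= Cst * 2 ^+ l)%R.
  by rewrite mulr_ge0 ?exprn_ge0 // divr_ge0 ?exprn_ge0 // addr_ge0 // mulr_ge0.
have [n] := ubnP (F l b W); elim: n W => // n IH W Fn.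
case: (pselect (light l b W)) => [li|nl].
  exists W; split=> //; split=> // a _; rewrite subnn mulr0 addr0.
  exact: lexx.
have [i [j [ij js [W1 [pW hW mc]]]]] : exists i j, [/\ i < j, j.+1 < size W &
    exists W1, [/\ perm_eq W1 W, head 0 W1 = head 0 W &
     exists p1 q1 p2 q2, mv l b p1 q1 p2 q2 /\
     forall (V : nmodType) (f : nat -> nat -> V), (forall x y, f x y = f y x) ->
       (esum f W1 + (f p1 q1 + f p2 q2) = esum f W + (f p1 p2 + f q1 q2))%R]].
  apply: contrapT => hn; apply: nl => i j ij js; split=> m; apply: hn; exists i, j; split=> //.
    exists (take i.+1 W ++ rev (drop i.+1 (take j.+1 W)) ++ drop j.+1 W).
    have [e1 e2 _] := @esum_2opt nat (fun _ _ => 0) W i j (fun _ _ => erefl) ij js.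
    split=> //; exists (nth 0 W i), (nth 0 W i.+1), (nth 0 W j), (nth 0 W j.+1); split=> //.
    by move=> V f fs; have [_ _] := esum_2opt fs ij js.
  exists (take i.+1 W ++ rev (drop i.+1 (take j.+1 W)) ++ drop j.+1 W).
  have [e1 e2 _] := @esum_2opt nat (fun _ _ => 0) W i j (fun _ _ => erefl) ij js.
  split=> //; exists (nth 0 W i.+1), (nth 0 W i), (nth 0 W j.+1), (nth 0 W j); split=> //.
  move=> V f fs; have [_ _ e] := esum_2opt fs ij js.
  rewrite [f (nth 0 W i.+1) (nth 0 W i)]fs [f (nth 0 W j.+1) (nth 0 W j)]fs.
  by rewrite [(f (nth 0 W i.+1) _ + _)%R]addrC.
have [p1 [q1 [p2 [q2 [m mE]]]]] := mc.
have eF := mE _ _ (wF_sym l b); have hF := mv_wF m.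
have eF' : F l b W1 + (wF l b p1 q1 + wF l b p2 q2) = F l b W + (wF l b p1 p2 + wF l b q1 q2).
  exact: eF.
have F1 : F l b W1 + 2 <= F l b W by move: eF' hF; clear; lia.
have [|W' [pW' hW' fW' lW' [FW' CW' LW']]] := IH W1; first by move: F1 Fn; clear; lia.
exists W'; split.
- exact: perm_trans pW' pW.
- by rewrite hW'.
- move=> i0 y0 id gr; apply: leq_trans (fW' _ _ id gr) _.
  have e : fH i0 y0 W1 + (ctd p1 q1 i0 y0 + ctd p2 q2 i0 y0) =
     fH i0 y0 W + (ctd p1 p2 i0 y0 + ctd q1 q2 i0 y0).
    by apply: (mE nat (fun t t' => ctd t t' i0 y0 : nat)) => x y; rewrite ctd_sym.
  by move: e (mv_ctd m id gr); clear; lia.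
- by [].
split.
- by move: FW' F1; clear; lia.
- move=> l' t0 l'l; apply: leq_trans (CW' _ _ l'l) _.
  have e : CR l' b t0 W1 + (cr l' b t0 p1 q1 + cr l' b t0 p2 q2) =
     CR l' b t0 W + (cr l' b t0 p1 p2 + cr l' b t0 q1 q2).
    exact: (mE nat (cr l' b t0) (cr_sym l' b t0)).
  by move: e (mv_cr t0 m l'l); clear; lia.
- move=> a ab; apply: le_trans (LW' _ ab) _.
  have e := mE _ _ (l2_sym a); have h := mv_l2 ll m ab.
  have F2 : (F l b W1 - F l b W').+1 <= F l b W - F l b W' by move: F1 FW'; clear; lia.
  have F3 : ((F l b W1 - F l b W')%:R + 1 <= (F l b W - F l b W')%:R :> R)%R.
    by rewrite natr1 ler_nat.
  have := ler_wpM2l C0 F3; rewrite mulrDr mulr1.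
  by move: e h; lra.
Qed.

(** Crossings of one cell by a light walk: two orientations, [(2 ^ mM) ^ d] subcells for the inner
    end, [d * 2] facets and one default, plus two exact crossings per piece. *)
Definition r2 := 2 * ((2 ^ mM) ^ d * (d * 2).+1) + u * 2.

Definition exc (S : pred nat) t t' :=
  [&& S t, ~~ S t' & ex S t t'] || [&& S t', ~~ S t & ex S t' t].

(** Such an edge is an original step up to orientation, and [exact_unique] shows that it is
    determined by its piece and by whether the inner end is the later one. *)
Lemma exact_cnt (S : pred nat) W : uniq W -> all (fun t => t <= k) W ->
  #|[set r : 'I_(size W).-1 | exc S (nth 0 W r) (nth 0 W r.+1)]| <= u * 2.
Proof.
move=> uW aW; set n := (size W).-1.
pose x (r : 'I_n) := nth 0 W r; pose y (r : 'I_n) := nth 0 W r.+1.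
have rs (r : 'I_n) : r.+1 < size W.
  move: (ltn_ord r); rewrite {2}/n; move: (size W) (nat_of_ord r) => z r0.
  by clear; lia.
have rs' (r : 'I_n) : r < size W := ltnW (rs r).
set A3 := [set r : 'I_n | _].
  have -> : u * 2 = #|{: 'I_u * bool}| by rewrite card_prod card_ord card_bool.
  pose mn r := minn (x r) (y r).
  pose ky r : 'I_u * bool := (Ordinal (pju (mn r)), S (mn r).+1).
  rewrite -(@card_in_imset _ _ ky A3) ?max_card // => r r'.
  have xk r0 : x r0 <= k by have /allP := aW; apply; rewrite mem_nth.
  have yk r0 : y r0 <= k by have /allP := aW; apply; rewrite mem_nth.
  have form r0 : r0 \in A3 -> let w := S (mn r0).+1 in [/\ mn r0 < k,
     S (mn r0 + w), ex S (mn r0 + w) (mn r0 + ~~ w) &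
     (x r0 = mn r0 /\ y r0 = (mn r0).+1) \/ (x r0 = (mn r0).+1 /\ y r0 = mn r0)].
    rewrite inE /exc -/(x r0) -/(y r0) /mn => h.
    have ad : adjp (x r0) (y r0).
      by case/orP: h => /and3P [_ _ /andP [h _]] //; rewrite /adjp orbC.
    case/orP: ad => /eqP e; move: h (xk r0) (yk r0); rewrite e.
      have -> : minn (y r0).+1 (y r0) = y r0 by lia.
      move=> /orP [] /and3P [h1 h2 h3] k1 k2.
        by rewrite h1 /= addn1 addn0; split=> //; right.
      by rewrite (negPf h2) /= addn1 addn0; split=> //; right.
    have -> : minn (x r0) (x r0).+1 = x r0 by lia.
    move=> /orP [] /and3P [h1 h2 h3] k1 k2.
      by rewrite (negPf h2) /= addn1 addn0; split=> //; left.
    by rewrite h1 /= addn1 addn0; split=> //; left.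
  move=> /form [m1 s1 x1 f1] /form [m2 s2 x2 f2] [pe we].
  have me : mn r = mn r'.
    rewrite -we in s2 x2; exact: (exact_unique m1 m2 pe s1 s2 x1 x2).
  have nu (i j : nat) : i < size W -> j < size W -> nth 0 W i = nth 0 W j -> i = j.
    by move=> iW jW /eqP; rewrite nth_uniq // => /eqP.
  apply/val_inj => /=.
  case: f1 f2 => -[e1 e2] [] [e3 e4].
  - by apply: nu => //; rewrite -/(x r) -/(x r') e1 e3 me.
  - have a1 : nat_of_ord r = r'.+1 by apply: nu => //; rewrite -/(x r) -/(y r') e1 e4 me.
    have a2 : r.+1 = r' by apply: nu => //; rewrite -/(y r) -/(x r') e2 e3 me.
    by move: a1 a2; clear; lia.
  - have a1 : nat_of_ord r = r'.+1 by apply: nu => //; rewrite -/(x r) -/(y r') e1 e4 me.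
    have a2 : r.+1 = r' by apply: nu => //; rewrite -/(y r) -/(x r') e2 e3 me.
    by move: a1 a2; clear; lia.
  - by apply: nu => //; rewrite -/(x r) -/(x r') e1 e3 me.
Qed.

(** Pigeonhole: two non-exact crossings of equal orientation, with the same subcell for the inner
    end and the same facet, would form a move. *)
Lemma light_CR l b t0 W : light l b W -> uniq W -> all (fun t => t <= k) W ->
  CR l b t0 W <= r2.
Proof.
move=> li uW aW; set S : pred nat := samel l b t0; set n := (size W).-1.
pose x (r : 'I_n) := nth 0 W r; pose y (r : 'I_n) := nth 0 W r.+1.
have rs (r : 'I_n) : r.+1 < size W.
  move: (ltn_ord r); rewrite {2}/n; move: (size W) (nat_of_ord r) => z r0.
  by clear; lia.
have rs' (r : 'I_n) : r < size W := ltnW (rs r).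
pose A1 := [set r : 'I_n | [&& S (x r), ~~ S (y r) & ~~ ex S (x r) (y r)]].
pose A2 := [set r : 'I_n | [&& S (y r), ~~ S (x r) & ~~ ex S (y r) (x r)]].
pose A3 := [set r : 'I_n | [&& S (x r), ~~ S (y r) & ex S (x r) (y r)] ||
   [&& S (y r), ~~ S (x r) & ex S (y r) (x r)]].
have dec : CR l b t0 W <= #|A1| + #|A2| + #|A3|.
  have cE (B : {set 'I_n}) : #|B| = \sum_(r < n) (r \in B).
    by rewrite -sum1_card big_mkcond; apply: eq_bigr => r _; case: (r \in B).
  rewrite /CR esum_nth !cE -!big_split; apply: leq_sum => r _ /=.
  rewrite !inE -/(x r) -/(y r) /cr -/(S (x r)) -/(S (y r)).
  case: (S (x r)); case: (S (y r)) => //=; rewrite ?orbF.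
    by case: (ex S (x r) (y r)).
  by case: (ex S (y r) (x r)).
pose fc p q := [pick iu : 'I_d * bool | [&& ongrid l b (facet l b p iu.1 iu.2),
   sep p q iu.1 (facet l b p iu.1 iu.2) & facet l b p iu.1 iu.2 < Ym]].
have e0 : 0 < 2 ^ mM by rewrite expn_gt0.
pose sk p : {ffun 'I_d -> 'I_(2 ^ mM)} :=
  [ffun i : 'I_d => Ordinal (ltn_pmod ((Y p i + b) %/ 2 ^ (l - mM)) e0)].
have key p q p' q' : S p -> S p' -> ~~ S q -> ~~ S q' -> ~~ ex S p q -> ~~ ex S p' q' ->
    sk p = sk p' -> fc p q = fc p' q' -> mv l b p q p' q'.
  move=> sp sp' nq nq' nx nx' esk efc.
  have spp : samel l b p p' by apply: samel_trans sp'; rewrite samel_sym.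
  have sub : {subset S <= samel l b p}.
    by move=> s ss; rewrite unfold_in; apply: samel_trans ss; rewrite samel_sym.
  have sub' : {subset samel l b p <= S}.
    by move=> s ss; apply: samel_trans sp ss.
  have ns : ~~ samel l b p q by apply: contra nq => h; apply: samel_trans sp h.
  split.
  - apply/samelP => i id; have /ffunP/(_ (Ordinal id)) := esk; rewrite !ffunE => /(congr1 val) /= em.
    set q1 := _ %/ _ in em *; set q2 := (Y p' i + b) %/ _ in em *.
    have le : l - (l - mM) <= mM by move: (leq_subr mM l); clear; lia.
    have em' : q1 %% 2 ^ (l - (l - mM)) = q2 %% 2 ^ (l - (l - mM)).
      by rewrite -(modn_dvdm q1 (dvdn_exp2l 2 le)) em modn_dvdm // dvdn_exp2l.
    have /samelP/(_ i id) := spp.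
    have -> : 2 ^ l = 2 ^ (l - mM) * 2 ^ (l - (l - mM)).
      by rewrite -expnD subnKC // leq_subr.
    rewrite !divnMA -/q1 -/q2 => ed.
    by rewrite (divn_eq q1 (2 ^ (l - (l - mM)))) ed em' -divn_eq.
  - by apply: contra nx; apply: ex_sub.
  - by apply: contra nx'; apply: ex_sub.
  - have [i [up [id g1 g2 g3]]] := nsamel_facet ns.
    move: efc; rewrite /fc; case: pickP => [iu /and3P [h1 h2 h3]|]; last first.
      by move=> /(_ (Ordinal id, up)) /=; rewrite g1 g2 g3.
    case: pickP => // iu' /and3P [h1' h2' h3'] [e]; subst iu'.
    exists iu.1, (facet l b p iu.1 iu.2); split=> //.
    by rewrite (facet_same iu.2 (ltn_ord iu.1) spp).
have cK : #|{: {ffun 'I_d -> 'I_(2 ^ mM)} * option ('I_d * bool)}| =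
    (2 ^ mM) ^ d * (d * 2).+1.
  by rewrite card_prod card_ffun !card_ord card_option card_prod card_ord card_bool.
have c1 : #|A1| <= (2 ^ mM) ^ d * (d * 2).+1.
  rewrite -cK -(@card_in_imset _ _ (fun r => (sk (x r), fc (x r) (y r))) A1) ?max_card //.
  move=> r r' rA rA' [e1 e2]; apply/eqP.
  wlog lt : r r' rA rA' e1 e2 / r < r'.
    move=> h; case: (ltngtP r r') => [lt|lt|/val_inj -> //]; first exact: h.
    by rewrite eq_sym; apply: h.
  move: rA rA'; rewrite !inE => /and3P [a1 a2 a3] /and3P [b1 b2 b3].
  by have [[]] := li r r' lt (rs r'); exact: key.
have c2 : #|A2| <= (2 ^ mM) ^ d * (d * 2).+1.
  rewrite -cK -(@card_in_imset _ _ (fun r => (sk (y r), fc (y r) (x r))) A2) ?max_card //.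
  move=> r r' rA rA' [e1 e2]; apply/eqP.
  wlog lt : r r' rA rA' e1 e2 / r < r'.
    move=> h; case: (ltngtP r r') => [lt|lt|/val_inj -> //]; first exact: h.
    by rewrite eq_sym; apply: h.
  move: rA rA'; rewrite !inE => /and3P [a1 a2 a3] /and3P [b1 b2 b3].
  by have [_ []] := li r r' lt (rs r'); exact: key.
have c3 : #|A3| <= u * 2 := exact_cnt S uW aW.
by apply: leq_trans dec _; rewrite /r2; move: c1 c2 c3; set Q := _ * _.+1; clear; lia.
Qed.

Definition stp l b W := sval (cid (step_ex l b W)).
(** Level [n'] consults only the last [n'] bits of the shift. The walk before level [n] is therefore
    the same for shifts that agree in the low bits, which the averaging below exploits. *)
Fixpoint Wst n a := if n is n'.+1 then stp n' (a %% 2 ^ n') (Wst n' a) else iota 0 k.+1.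

Lemma Wst_mod n a a' : (forall m, m < n -> a = a' %[mod 2 ^ m]) -> Wst n a = Wst n a'.
Proof.
elim: n => //= n IH h; rewrite h // IH // => m mn; apply: h; exact: ltnW.
Qed.

Lemma F_mod l a b W : a = b %[mod 2 ^ l] -> F l a W = F l b W.
Proof.
move=> e; rewrite /F; have fe : wF l a = wF l b; last by rewrite fe.
apply/funext => t; apply/funext => t'; apply: eq_bigr => i _; apply: eq_bigl => y.
exact: ongrid_mod e.
Qed.

Lemma CR_mod l l' a b t0 W : l' <= l -> a = b %[mod 2 ^ l] -> CR l' a t0 W = CR l' b t0 W.
Proof.
move=> ll e; rewrite /CR; have fe : cr l' a t0 = cr l' b t0; last by rewrite fe.
by apply/funext => t; apply/funext => t'; rewrite /cr !(samel_mod _ _ ll e).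
Qed.

Lemma FE l b W : F l b W = \sum_(i < d) \sum_(y0 < Ym | ongrid l b y0) fH i y0 W.
Proof.
rewrite /F esum_nth /wF exchange_big; apply: eq_bigr => i _ /=.
by rewrite exchange_big /=; apply: eq_bigr => y _; rewrite /fH esum_nth.
Qed.

(** The third clause says that top-level hyperplanes free of counted crossings in the original walk
    stay free of them. *)
Lemma Wst_prop n a : n <= l1.+1 -> [/\ perm_eq (Wst n a) (iota 0 k.+1),
  head 0 (Wst n a) = 0,
  (forall i y0, i < d -> ongrid n.-1 a y0 -> ongrid l1.+1 a y0 -> fH i y0 (Wst n a) <= fH i y0 (iota 0 k.+1)),
  (forall l t0, l < n -> CR l a t0 (Wst n a) <= r2) &
  (esum (l2 a) (Wst n a) <= esum (l2 a) (iota 0 k.+1) + Cst *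
     \sum_(j < n) 2 ^+ j * (F j a (Wst j a) - F j a (Wst j.+1 a))%:R)%R].
Proof.
elim: n => [|n IH] nl.
  by split=> //; rewrite big_ord0 mulr0 addr0.
have [P1 P2 P3 P4 P5] := IH (ltnW nl).
have am : a = a %% 2 ^ n %[mod 2 ^ n] by rewrite modn_mod.
have [Q1 Q2 Q3 Q4 [Q5 Q6 Q7]] := svalP (cid (step_ex n (a %% 2 ^ n) (Wst n a))) nl.
rewrite -/(stp n (a %% 2 ^ n) (Wst n a)) in Q1 Q2 Q3 Q4 Q5 Q6 Q7.
rewrite -[stp _ _ _]/(Wst n.+1 a) in Q1 Q2 Q3 Q4 Q5 Q6 Q7 *.
have Q1' := perm_trans Q1 P1.
split=> //.
- by rewrite Q2.
- move=> i y0 id g1 g2; apply: leq_trans (P3 i y0 id _ g2).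
    by apply: Q3 => //; rewrite -(ongrid_mod y0 (leqnn _) am).
  by apply: ongrid_le g1; case: (n).
- move=> l t0; rewrite ltnS leq_eqVlt => /orP [/eqP ->|ln].
    rewrite (CR_mod _ _ (leqnn n) am); apply: light_CR => //.
      by rewrite (perm_uniq Q1') iota_uniq.
    by rewrite (perm_all _ Q1'); apply/allP => t; rewrite mem_iota.
  rewrite (CR_mod _ _ (ltnW ln) am); apply: leq_trans (Q6 _ _ (ltnW ln)) _.
  by rewrite -(CR_mod _ _ (ltnW ln) am); exact: P4.
- have := Q7 a am; rewrite -!(F_mod _ am) => h; apply: le_trans h _.
  rewrite big_ord_recr /= mulrDr addrA mulrA lerD2r; exact: P5.
Qed.

Let A := 2 ^ l1.+1.

Lemma dvd_half j v : (2 ^ j %| v) && ~~ (2 ^ j.+1 %| v) = (2 ^ j.+1 %| v + 2 ^ j).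
Proof.
have p2 : 0 < 2 ^ j by rewrite expn_gt0.
case: (boolP (2 ^ j %| v)) => [/dvdnP [w ->]|nd] /=.
  by rewrite -mulSnr expnS !dvdn_pmul2r // !dvdn2 /= negbK.
apply/esym/negP => h; case/negP: nd.
by rewrite -(dvdn_addl v (dvdnn (2 ^ j))); apply: dvdn_trans h; rewrite dvdn_exp2l.
Qed.

(** The facets of level [j] are those of level [j.+1] for the given shift together with those for
    the shift moved by [2 ^ j]. *)
Lemma F_half j a W : F j a W = F j.+1 a W + F j.+1 (a + 2 ^ j) W.
Proof.
rewrite !FE -big_split; apply: eq_bigr => i _ /=.
rewrite (bigID (fun y0 : 'I_Ym => ongrid j.+1 a y0)) /=; congr (_ + _); apply: eq_bigl => y.
  case g1 : (ongrid j.+1 a y); last by rewrite andbF.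
  by rewrite andbT; apply: ongrid_le g1.
by rewrite /ongrid dvd_half addnA.
Qed.

(** Moving the shift by [2 ^ j] permutes the shifts and leaves [G] unchanged, so the two terms of
    [F_half] have equal sums. *)
Lemma F_avg j (G : nat -> seq nat) : j <= l1 ->
  (forall a a', a = a' %[mod 2 ^ j] -> G a = G a') ->
  2 * \sum_(a < A) F j.+1 a (G a) = \sum_(a < A) F j a (G a).
Proof.
move=> jl Gm; have A0 : 0 < A by rewrite expn_gt0.
pose sg (a : 'I_A) : 'I_A := Ordinal (ltn_pmod (a + 2 ^ j) A0).
have sgi : injective sg.
  move=> a a' /(congr1 val) /= /eqP; rewrite eqn_modDr !modn_small // => /eqP e.
  exact: val_inj.
have dA m : m <= l1.+1 -> 2 ^ m %| A by move=> ml; rewrite dvdn_exp2l.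
rewrite mul2n -addnn {2}(reindex_inj sgi) /= -big_split; apply: eq_bigr => a _ /=.
rewrite [RHS]F_half; congr (_ + _).
have e : (a + 2 ^ j) %% A = a + 2 ^ j %[mod 2 ^ j.+1] by rewrite modn_dvdm // dA.
rewrite (F_mod _ e); congr F; apply: Gm.
by rewrite modn_dvdm ?dA ?leqW // modnDr.
Qed.

Lemma F0 a W : F 0 a W = F 0 0 W.
Proof. by apply: F_mod; rewrite !modn1. Qed.

Lemma F_tot l W : l <= l1.+1 -> 2 ^ l * \sum_(a < A) F l a W = A * F 0 0 W.
Proof.
elim: l => [|l IH] ll.
  rewrite mul1n (eq_bigr (fun=> F 0 0 W)); last by move=> a _; rewrite F0.
  by rewrite sum_nat_const card_ord.
by rewrite expnSr -mulnA F_avg // IH // ltnW.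
Qed.

Let W0 := iota 0 k.+1.
Let TV := F 0 0 W0.

Lemma F_step n a : n <= l1 -> F n a (Wst n.+1 a) <= F n a (Wst n a).
Proof.
move=> nl; have am : a = a %% 2 ^ n %[mod 2 ^ n] by rewrite modn_mod.
have [_ _ _ _ [Q5 _ _]] := svalP (cid (step_ex n (a %% 2 ^ n) (Wst n a))) nl.
by rewrite !(F_mod _ am).
Qed.

(** The weighted total of [2 ^ j] times the crossings at level [j] is preserved from level to level
    by [F_avg], except for what the repairs remove. Hence the charges of all levels together amount
    to at most [TV] per shift, without a factor for the number of levels. *)
Lemma tele n : n <= l1.+1 ->
  \sum_(a < A) \sum_(j < n) 2 ^ j * (F j a (Wst j a) - F j a (Wst j.+1 a)) +
  2 ^ n * \sum_(a < A) F n a (Wst n a) = A * TV.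
Proof.
elim: n => [|n IH] nl.
  rewrite big1 => [|a _]; last by rewrite big_ord0.
  rewrite add0n mul1n (eq_bigr (fun=> TV)); last by move=> a _; rewrite F0.
  by rewrite sum_nat_const card_ord.
rewrite -(IH (ltnW nl)).
have -> : \sum_(a < A) \sum_(j < n.+1) 2 ^ j * (F j a (Wst j a) - F j a (Wst j.+1 a)) =
  \sum_(a < A) (\sum_(j < n) 2 ^ j * (F j a (Wst j a) - F j a (Wst j.+1 a)) +
    2 ^ n * (F n a (Wst n a) - F n a (Wst n.+1 a))).
  by apply: eq_bigr => a _; rewrite big_ord_recr.
rewrite big_split -addnA; congr (_ + _).
rewrite expnSr -mulnA F_avg //; last by move=> a a' e; apply: Wst_mod => m mn;
  rewrite -(modn_dvdm a (dvdn_exp2l 2 (mn : m <= n))) e modn_dvdm // dvdn_exp2l.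
rewrite -big_distrr /= -mulnDr -big_split /=; congr (_ * _); apply: eq_bigr => a _ /=.
by rewrite subnK // F_step.
Qed.

Lemma g_wF a t t' : g a t t' <= \sum_(l < l1.+2) 2 ^ l * wF l a t t'.
Proof.
apply/bigmax_leqP => l /hgP [i [y [id yl gr c]]].
rewrite (bigD1 l) //=; apply: leq_trans (leq_addr _ _).
rewrite leq_pmulr // /wF (bigD1 (Ordinal id)) //= (bigD1 (Ordinal yl)) //=.
by rewrite c.
Qed.

Lemma esumM (c : nat) f W : esum (fun t t' => c * f t t') W = c * esum f W.
Proof. by rewrite !esum_nth big_distrr. Qed.

(** The scale of an edge is at most the sum of [2 ^ l] over its counted facets, and each level
    contributes [TV] on average; this is the place where the number of levels enters as a factor. *)
Lemma g_tot W : \sum_(a < A) esum (g a) W <= l1.+2 * (A * F 0 0 W).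
Proof.
apply: (@leq_trans (\sum_(a < A) \sum_(l < l1.+2) 2 ^ l * F l a W)).
  apply: leq_sum => a _; rewrite esum_nth.
  apply: (@leq_trans (\sum_(r < (size W).-1) \sum_(l < l1.+2)
     2 ^ l * wF l a (nth 0 W r) (nth 0 W r.+1))).
    by apply: leq_sum => r _; exact: g_wF.
  rewrite exchange_big; apply: leq_sum => l _.
  by rewrite -big_distrr /F esum_nth.
rewrite exchange_big /= (eq_bigr (fun=> A * F 0 0 W)); last first.
  by move=> l _; rewrite -big_distrr /= F_tot // -ltnS.
by rewrite sum_nat_const card_ord.
Qed.

(** Over all [2 ^ l1.+1] shifts the counted crossings of top-level facets number [TV <= 2 ^ l1], so
    at least half of the shifts have none. Among these, one has at most twice the average cost. *)
Lemma walk_main : TV <= 2 ^ l1 -> exists a W,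
  [/\ a < A, perm_eq W W0, head 0 W = 0,
   (forall l t0, l <= l1 -> CR l a t0 W <= r2) & F l1.+1 a W = 0 /\
   (esum (l2 a) W <= esum dd W0 + 2 * (kap * l1.+2%:R + Cst) * TV%:R)%R].
Proof.
move=> TVl; set avg := ((kap * l1.+2%:R + Cst) * TV%:R)%R.
pose C a := \sum_(j < l1.+1) 2 ^ j * (F j a (Wst j a) - F j a (Wst j.+1 a)).
pose cost a : R := (kap * (esum (g a) W0)%:R + Cst * (C a)%:R)%R.
have Cst0 : (0 <= Cst)%R by rewrite divr_ge0 ?exprn_ge0 // addr_ge0 // mulr_ge0.
have tot : (\sum_(a < A) cost a <= A%:R * avg)%R.
  rewrite big_split /= -!mulr_sumr -!natr_sum.
  have h1 : ((\sum_(a < A) esum (g a) W0)%:R <= (l1.+2 * (A * TV))%:R :> R)%R.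
    by rewrite ler_nat; exact: g_tot.
  have h2 : ((\sum_(a < A) C a)%:R <= (A * TV)%:R :> R)%R.
    by rewrite ler_nat -(tele (leqnn _)) leq_addr.
  have := ler_wpM2l kap0 h1; have := ler_wpM2l Cst0 h2.
  rewrite /avg !natrM; set n := l1.+2%:R%R; set x := A%:R%R; set y := TV%:R%R.
  set z1 := (kap * _)%R; set z2 := (Cst * _)%R => a1 a2.
  have -> : (x * ((kap * n + Cst) * y) = kap * (n * (x * y)) + Cst * (x * y) :> R)%R by ring.
  by rewrite addrC [leRHS]addrC lerD.
pose good := [pred a : 'I_A | F l1.+1 a W0 == 0].
have cg : 2 ^ l1 <= #|good|.
  have h : \sum_(a < A) F l1.+1 a W0 = TV.
    have := F_tot W0 (leqnn l1.+1); rewrite -/A -/TV => /eqP.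
    by rewrite eqn_pmul2l ?expn_gt0 // => /eqP.
  have b : #|[predC good]| <= TV.
    rewrite -h -sum1_card big_mkcond; apply: leq_sum => a _.
    have -> : (a \in [predC good]) = (0 < F l1.+1 a W0) by rewrite lt0n.
    by case: (F l1.+1 a W0).
  have := cardC good; have -> : #|'I_A| = 2 ^ l1 + 2 ^ l1 by rewrite card_ord /A expnS mul2n addnn.
  by move=> e; rewrite -(leq_add2r (2 ^ l1)) -e leq_add2l; exact: leq_trans b TVl.
have [a ga ca] : exists2 a : 'I_A, good a & (cost a <= 2 * avg)%R.
  apply: contrapT => hn.
  have hgood a : good a -> (2 * avg < cost a)%R.
    by move=> ga; rewrite ltNge; apply/negP => le; apply: hn; exists a.
  have c0 a : (0 <= cost a)%R by rewrite addr_ge0 // mulr_ge0.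
  have : (\sum_(a < A | good a) 2 * avg < \sum_(a < A | good a) cost a)%R.
    apply: ltr_sum => //.
    have : 0 < #|good| by apply: leq_trans cg; rewrite expn_gt0.
    by move=> /card_gt0P [a ag]; apply/hasP; exists a; rewrite ?mem_index_enum.
  rewrite sumr_const => h.
  have : (\sum_(a < A | good a) cost a <= \sum_(a < A) cost a)%R.
    by rewrite [leRHS](bigID good) /= lerDl sumr_ge0.
  have : (A%:R * avg <= (2 * avg) *+ #|good|)%R.
    have AE : (A%:R = (2 ^ l1)%:R * 2 :> R)%R by rewrite /A expnSr natrM.
    rewrite AE -[leRHS]mulr_natl [leRHS]mulrA; apply: ler_wpM2r; last by rewrite ler_wpM2r ?ler_nat.
    by rewrite mulr_ge0 // addr_ge0 // mulr_ge0.
  by move: tot h; lra.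
have [P1 P2 P3 P4 P5] := Wst_prop a (leqnn l1.+1).
exists a, (Wst l1.+1 a); split=> //; split.
  rewrite FE big1 // => i _; rewrite big1 // => y gy.
  have := P3 i y (ltn_ord i) (ongrid_le (leqnSn l1) gy) gy.
  have : fH i y W0 = 0.
    have : F l1.+1 a W0 = 0 by apply/eqP; exact: ga.
    rewrite FE => /eqP; rewrite sum_nat_eq0 => /forallP /(_ i) /=.
    by rewrite sum_nat_eq0 => /forallP /(_ y) /=; rewrite gy => /eqP.
  by rewrite /W0 => ->; rewrite leqn0 => /eqP.
apply: le_trans P5 _.
have e1 : (esum (l2 a) (iota 0 k.+1) = esum dd W0 + kap * (esum (g a) W0)%:R)%R.
  rewrite -/W0 !esum_nth natr_sum mulr_sumr -big_split; exact: eq_bigr.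
have e2 : (\sum_(j < l1.+1) 2 ^+ j * (F j a (Wst j a) - F j a (Wst j.+1 a))%:R = (C a)%:R :> R)%R.
  by rewrite natr_sum; apply: eq_bigr => j _; rewrite natrM natrX.
rewrite e1 e2 -addrA lerD2l; move: ca; rewrite /cost /avg; lra.
Qed.

End Real.

End Walk.
End Walk.

(** * From the uncrossed walk to an item of the table *)

Module Bridge.
Import DP Walk.

Set Implicit Arguments.
Unset Strict Implicit.
Unset Printing Implicit Defensive.
Import Order.TTheory GRing.Theory Num.Theory.
Local Open Scope nat_scope.

Lemma size_hstep L u : 0 < size u -> size (iter L hstep u) = size u.
Proof.
by move=> u0; elim: L => //= L IH; rewrite /hstep size_rcons size_behead IH prednK.
Qed.

Lemma nth_hstep L u j : j < size u -> nth 0 (iter L hstep u) j =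
  nth 0 u ((j + L) %% size u) %/ 2 ^ ((j + L) %/ size u).
Proof.
move=> ju; have u0 : 0 < size u by exact: leq_ltn_trans ju.
elim: L j ju => [|L IH] j ju; first by rewrite addn0 modn_small // (divn_small ju) expn0 divn1.
rewrite iterS /hstep nth_rcons size_behead size_hstep //.
case: ltnP => h; first by rewrite nth_behead IH ?addnS //; move: h u0; clear; lia.
have jE : j = (size u).-1 by apply/eqP; rewrite eqn_leq h andbT; move: ju; clear; lia.
rewrite jE eqxx -nth0 IH // add0n -divn2 -divnMA -expnSr.
have -> : (size u).-1 + L.+1 = L + size u by move: u0; clear; lia.
by rewrite modnDr divnDr ?dvdnn // divnn u0 addn1.
Qed.

Section Seqs.
Variables (same : rel nat) (S : pred nat).

(** Consecutive runs never both lie in [S], so every run in [S] other than the last one is followed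
    by an edge that leaves [S]. *)
Lemma seg_count (s : seq (seq nat)) : [::] \notin s ->
  sorted (fun B B' => ~~ same (last 0 B) (head 0 B')) s ->
  (forall B, B \in s -> S (head 0 B) = S (last 0 B)) ->
  (forall x y, S x -> S y -> same x y) ->
  size [seq B <- s | S (head 0 B)] <=
    (esum (fun t t' => (S t != S t') : nat) (flatten s)).+1.
Proof.
move=> + + + SS; elim: s => // B [|B' s] IH n0 so hS; first by rewrite /=; case: ifP.
have nB : B != [::] by apply: contraNneq n0 => ->; rewrite mem_head.
have nB' : B' != [::] by apply: contraNneq n0 => ->; rewrite !inE eqxx orbT.
have n0' : [::] \notin B' :: s by apply: contra n0 => h; rewrite inE h orbT.
have hS' B0 : B0 \in B' :: s -> S (head 0 B0) = S (last 0 B0).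
  by move=> h; apply: hS; rewrite inE h orbT.
have IHs := IH n0' (path_sorted so) hS'.
have fE : flatten (B' :: s) != [::] by case: (B') nB'.
have hE : head 0 (flatten (B' :: s)) = head 0 B' by case: (B') nB'.
rewrite [flatten (B :: _)]/= -[B' ++ flatten s]/(flatten (B' :: s)).
rewrite esum_cat // hE; rewrite [filter _ (B :: _)]/=.
have sB := hS B (mem_head _ _).
have nsm : ~~ same (last 0 B) (head 0 B') by case/andP: so.
case: ifP => h; last by apply: leq_trans IHs _; rewrite ltnS /GRing.add /= leq_addl.
have lB : S (last 0 B) by rewrite -sB.
have hB' : S (head 0 B') = false by apply/negP => h'; move/negP: nsm; apply; exact: SS.
rewrite lB hB' /=; move: IHs; rewrite /GRing.add /=; lia.
Qed.

Lemma seg_pred (s : seq (seq nat)) B : [::] \notin s ->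
  sorted (fun B B' => ~~ same (last 0 B) (head 0 B')) s -> B \in s ->
  head 0 B = head 0 (flatten s) \/ exists r, [/\ r.+1 < size (flatten s),
    nth 0 (flatten s) r.+1 = head 0 B & ~~ same (nth 0 (flatten s) r) (head 0 B)].
Proof.
move=> n0 so /splitPr sp; case: sp n0 so => s1 s2 n0 so.
have nB : B != [::] by apply: contraNneq n0 => ->; rewrite mem_cat mem_head orbT.
case: (lastP s1) n0 so => [|s' B'] n0 so; first by left; case: (B) nB.
right; have nB' : B' != [::].
  by apply: contraNneq n0 => ->; rewrite mem_cat mem_rcons mem_head.
have ns : ~~ same (last 0 B') (head 0 B).
  move: so; rewrite cat_rcons; case: s' {n0} => [|C s'] /=; first by case/andP.
  by rewrite cat_path /= => /and3P [_ _ /andP []].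
have fE : flatten (rcons s' B' ++ B :: s2) = (flatten s' ++ B') ++ (B ++ flatten s2).
  by rewrite flatten_cat flatten_rcons.
set A := flatten s' ++ B' in fE; have A0 : 0 < size A.
  by rewrite size_cat; case: (B') nB' => //= *; rewrite addnS.
exists (size A).-1; rewrite fE prednK //; split.
- by rewrite !size_cat; case: (B) nB => //= *; lia.
- by rewrite nth_cat ltnn subnn; case: (B) nB.
- rewrite nth_cat prednK // leqnn nth_last /A last_cat.
  by case: (B') nB' ns.
Qed.

Lemma seg_succ (s : seq (seq nat)) B : [::] \notin s ->
  sorted (fun B B' => ~~ same (last 0 B) (head 0 B')) s -> B \in s ->
  last 0 B = last 0 (flatten s) \/ exists r, [/\ r.+1 < size (flatten s),
    nth 0 (flatten s) r = last 0 B & ~~ same (last 0 B) (nth 0 (flatten s) r.+1)].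
Proof.
move=> n0 so /splitPr sp; case: sp n0 so => s1 s2 n0 so.
have nB : B != [::] by apply: contraNneq n0 => ->; rewrite mem_cat mem_head orbT.
case: s2 n0 so => [|B' s'] n0 so.
  by left; rewrite flatten_cat /= cats0 last_cat; case: (B) nB.
right; have nB' : B' != [::].
  by apply: contraNneq n0 => ->; rewrite mem_cat !inE eqxx !orbT.
have ns : ~~ same (last 0 B) (head 0 B').
  move: so; case: s1 {n0} => [|C s1] /=; first by case/andP.
  by rewrite cat_path /= => /and3P [_ _ /andP []].
have fE : flatten (s1 ++ [:: B, B' & s']) = (flatten s1 ++ B) ++ (B' ++ flatten s').
  by rewrite flatten_cat /= !catA.
set A := flatten s1 ++ B in fE; have A0 : 0 < size A.
  by rewrite size_cat; case: (B) nB => //= *; rewrite addnS.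
exists (size A).-1; rewrite fE prednK //; split.
- by rewrite !size_cat; case: (B') nB' => //= *; lia.
- rewrite nth_cat prednK // leqnn nth_last /A last_cat.
  by case: (B) nB.
- by rewrite nth_cat ltnn subnn; case: (B') nB' ns.
Qed.

End Seqs.

(** A geometric series with each power repeated [d] times. The stronger inequality used for the
    induction keeps track of the position [L %% d] in the current block. *)
Lemma geo_sum d L : 0 < d ->
  \sum_(i < L) 2 ^ (i.+1 %/ d) <= 2 * d * 2 ^ (L %/ d).
Proof.
move=> d0.
have h : \sum_(i < L) 2 ^ (i.+1 %/ d) + d <= d * 2 ^ (L %/ d) + (L %% d).+1 * 2 ^ (L %/ d).
  elim: L => [|L IH]; first by rewrite big_ord0 div0n mod0n muln1; lia.
  rewrite big_ord_recr /=; move: IH; set s := \sum_(i < L) _.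
  have lt := ltn_pmod L d0; have e := divn_eq L d.
  case: (ltnP (L %% d).+1 d) => h.
    have [-> ->] : L.+1 %/ d = L %/ d /\ L.+1 %% d = (L %% d).+1.
      rewrite {1 3}e -addnS; split; first by rewrite divnMDl // (divn_small h) addn0.
      by rewrite modnMDl modn_small.
    by rewrite mulSn [in X in _ -> X]mulSn; set x := 2 ^ _; nia.
  have dE : (L %% d).+1 = d by apply/eqP; rewrite eqn_leq h lt.
  have [-> ->] : L.+1 %/ d = (L %/ d).+1 /\ L.+1 %% d = 0.
    rewrite {1 3}e -addnS dE -mulSnr; split; first by rewrite mulnK.
    by rewrite modnMl.
  by rewrite dE mul1n expnS; set x := 2 ^ _; nia.
have lt := ltn_pmod L d0.
have : (L %% d).+1 * 2 ^ (L %/ d) <= d * 2 ^ (L %/ d) by rewrite leq_mul2r lt orbT.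
by move: h; set s := \sum_(i < L) _; set x := d * _; rewrite -mulnA -/x; lia.
Qed.

Section Bridge.
(** [pi] is the point visited at each time, [Yp] the grid coordinates of a point. Two constants
    measure distances: [D] within cells of each level, and [del] within one grid cube, which may be
    0 even if [D] is not. *)
Variables (d u k l1 mM mu' N Ym : nat) (Yp : nat -> nat -> nat) (pi pj : nat -> nat).
Hypothesis d0 : 0 < d.
Hypothesis YpY : forall p i, Yp p i < Ym.
Hypothesis pju : forall t, pj t < u.
Hypothesis pjm : forall t t', t <= t' -> pj t <= pj t'.
Hypothesis piN : forall t, pi t < N.
Hypothesis pi0 : pi 0 = 0.
Hypothesis piI : forall t t', t <= k -> t' <= k -> pi t = pi t' -> t = t'.
Hypothesis mu2 : 2 <= mu'.
Variables (R : realFieldType) (ds : seq (seq R)) (D del : R).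
Hypothesis dm_ge0 : forall i j, (0 <= dm ds i j)%R.
Hypothesis dm_sym : forall i j, i < N -> j < N -> dm ds i j = dm ds j i.
Hypothesis dm_tri : forall i j m, i < N -> j < N -> m < N ->
  (dm ds i m <= dm ds i j + dm ds j m)%R.
Hypothesis dm_ii : forall i, i < N -> dm ds i i = 0%R.
Hypothesis D0 : (0 <= D)%R.
Hypothesis del0 : (0 <= del)%R.
Hypothesis dml : forall l b p q, p < N -> q < N -> l <= l1 ->
  (forall i, i < d -> (Yp p i + b) %/ 2 ^ l = (Yp q i + b) %/ 2 ^ l) ->
  (dm ds p q <= D * 2 ^+ l)%R.
Hypothesis dmdel : forall p q, p < N -> q < N ->
  (forall i, i < d -> Yp p i = Yp q i) -> (dm ds p q <= del)%R.

Definition Ua a := [seq [seq Yp p i + a | i <- iota 0 d] | p <- iota 0 N].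
Definition loc t := repr (lvl 0 (Ua 0)) (pi t).
Definition Yt t i := Yp (pi t) i.
Let mu := d * mu'.

Lemma size_Ua a : size (Ua a) = N. Proof. by rewrite size_map size_iota. Qed.

(** Axis and scale are encoded in one number [x], as its remainder and quotient modulo [d]. A cell
    of level [L] then fixes all data with [L <= x], so monotonicity in [L] is immediate. *)
Lemma samecP a L p q : p < N -> q < N -> reflect
  (forall x, L <= x -> (Yp p (x %% d) + a) %/ 2 ^ (x %/ d) = (Yp q (x %% d) + a) %/ 2 ^ (x %/ d))
  (samec (lvl L (Ua a)) p q).
Proof.
move=> pN qN; have nU r : r < N -> nth [::] (Ua a) r = [seq Yp r i + a | i <- iota 0 d].
  by move=> rN; rewrite (nth_map 0) ?size_iota // nth_iota.
rewrite samec_lvl ?size_Ua // !nU //.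
have sz r : size [seq Yp r i + a | i <- iota 0 d] = d by rewrite size_map size_iota.
have nE r j : r < N -> j < d -> nth 0 (iter L hstep [seq Yp r i + a | i <- iota 0 d]) j =
    (Yp r ((j + L) %% d) + a) %/ 2 ^ ((j + L) %/ d).
  move=> rN jd; rewrite nth_hstep sz // (nth_map 0) ?size_iota ?ltn_pmod //.
  by rewrite nth_iota ?ltn_pmod.
have szh r : size (iter L hstep [seq Yp r i + a | i <- iota 0 d]) = d.
  by rewrite size_hstep sz.
apply: (iffP eqP) => [e x Lx|h]; last first.
  apply: (@eq_from_nth _ 0); rewrite !szh // => j jd.
  by rewrite !nE // h // leq_addl.
have [n xE] : exists n, (x - L) %/ d = n by exists ((x - L) %/ d).
set j := (x - L) %% d; have jd : j < d by rewrite ltn_pmod.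
have xE' : x = n * d + (j + L) by rewrite -xE addnA -divn_eq subnK.
have := congr1 (fun s => nth 0 s j) e; rewrite !nE // => ej.
by rewrite xE' modnMDl divnMDl // [(n + _)%N]addnC expnD !divnMA ej.
Qed.

Lemma samec_le a L L' p q : p < N -> q < N -> L <= L' ->
  samec (lvl L (Ua a)) p q -> samec (lvl L' (Ua a)) p q.
Proof.
move=> pN qN LL /samecP h; apply/samecP => // x Lx; apply: h => //; exact: leq_trans LL Lx.
Qed.

Lemma samec_level a L l p q : p < N -> q < N -> L <= l * d -> samec (lvl L (Ua a)) p q ->
  forall i, i < d -> (Yp p i + a) %/ 2 ^ l = (Yp q i + a) %/ 2 ^ l.
Proof.
move=> pN qN Ll /samecP h i id; have := h pN qN (l * d + i) (leq_trans Ll (leq_addr _ _)).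
by rewrite modnMDl modn_small // divnMDl // (divn_small id) addn0.
Qed.

Lemma level_samec a L l p q : p < N -> q < N -> l * d <= L ->
  (forall i, i < d -> (Yp p i + a) %/ 2 ^ l = (Yp q i + a) %/ 2 ^ l) ->
  samec (lvl L (Ua a)) p q.
Proof.
move=> pN qN lL h; apply/samecP => // x Lx.
have le : l <= x %/ d by rewrite leq_divRL //; exact: leq_trans lL Lx.
by rewrite -(subnKC le) expnD !divnMA h // ltn_pmod.
Qed.

Lemma bin_samec a L p q r : p < N -> q < N -> r < N ->
  samec (lvl L.+1 (Ua a)) p q -> samec (lvl L.+1 (Ua a)) p r ->
  [|| samec (lvl L (Ua a)) p q, samec (lvl L (Ua a)) p r | samec (lvl L (Ua a)) q r].
Proof.
move=> pN qN rN /(samecP _ _ pN qN) hq /(samecP _ _ pN rN) hr.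
pose v s := (Yp s (L %% d) + a) %/ 2 ^ (L %/ d).
have half s : v s %/ 2 = (Yp s ((L + d) %% d) + a) %/ 2 ^ ((L + d) %/ d).
  by rewrite /v -divnMA -expnSr modnDr (divnDr L (dvdnn d)) divnn d0 addn1.
have Ld : L.+1 <= L + d by rewrite -addn1 leq_add2l.
have e1 : v p %/ 2 = v q %/ 2 by rewrite !half hq.
have e2 : v p %/ 2 = v r %/ 2 by rewrite !half hr.
have mk s s' : s < N -> s' < N -> v s = v s' ->
    (forall x, L < x -> (Yp s (x %% d) + a) %/ 2 ^ (x %/ d) = (Yp s' (x %% d) + a) %/ 2 ^ (x %/ d)) ->
    samec (lvl L (Ua a)) s s'.
  move=> sN sN' e h; apply/samecP => // x; rewrite leq_eqVlt => /orP [/eqP <- //|]; exact: h.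
have [e|[e|e]] : v p = v q \/ v p = v r \/ v q = v r by move: e1 e2; clear; lia.
- by rewrite (mk p q) // orbT.
- by rewrite (mk p r) // !orbT.
- by rewrite (mk q r) ?orbT // => x Lx; rewrite -hq // hr.
Qed.

(** Lowest cells are grid points, and a translation does not change which points coincide. *)
Lemma repr_shift a p : p < N -> repr (lvl 0 (Ua a)) p = repr (lvl 0 (Ua 0)) p.
Proof.
move=> pN; have e s : lvl 0 s = s by rewrite /lvl /= map_id.
rewrite !e /repr.
have UE : Ua a = [seq [seq y + a | y <- v] | v <- Ua 0].
  by rewrite /Ua -map_comp; apply: eq_map => q /=; rewrite -map_comp; apply: eq_map => i /=; rewrite addn0.
rewrite UE (nth_map [::]) ?size_Ua // index_map //.
by apply: inj_map; exact: addIn.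
Qed.

Lemma loc_lt t : loc t < N.
Proof. by rewrite -(size_Ua 0) -(size_map (iter 0 hstep)) repr_lt // size_map size_Ua. Qed.

Lemma loc_id a t : repr (lvl 0 (Ua a)) (loc t) = loc t.
Proof. by rewrite repr_shift ?loc_lt // repr_id // size_map size_Ua. Qed.

Lemma loc_samec a t : samec (lvl 0 (Ua a)) (loc t) (pi t).
Proof. by rewrite /loc -(repr_shift a) // samec_repr // size_map size_Ua. Qed.

Lemma loc_Y t i : i < d -> Yp (loc t) i = Yt t i.
Proof.
move=> id; have := samec_level (loc_lt t) (piN t) (leq0n (0 * d)) (loc_samec 0 t) id.
by rewrite !addn0 !divn1.
Qed.

Lemma loc0 : loc 0 = 0.
Proof.
rewrite /loc pi0 /repr; have : 0 < size (lvl 0 (Ua 0)).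
  by rewrite size_map size_Ua; apply: leq_ltn_trans (piN 0).
by case: (lvl 0 (Ua 0)) => //= x s _; rewrite eqxx.
Qed.

(** Induction on the number of halvings: a cell has at most two nonempty children, so [mu] levels
    below there are at most [2 ^ mu] nonempty cells. *)
Lemma portals_le a L p : p < N ->
  size (portals (lvl L (Ua a)) (lvl (L - mu) (Ua a)) p) <= 2 ^ mu.
Proof.
have gen m : forall L p, p < N ->
    size [seq q <- iota 0 N | samec (lvl (L + m) (Ua a)) q p && (repr (lvl L (Ua a)) q == q)] <= 2 ^ m.
  elim: m => [|m IH] {}L {}p pN.
    rewrite addn0; set s := filter _ _.
    have : all (pred1 (repr (lvl L (Ua a)) p)) s.
      by apply/allP => q; rewrite mem_filter => /andP [/andP [h /eqP <-] _]; rewrite inE (repr_eq h).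
    have : uniq s by rewrite filter_uniq // iota_uniq.
    case: s => [|x [|y s]] //= /andP [nx _] /and3P [/eqP e1 /eqP e2 _].
    by rewrite e1 e2 inE eqxx in nx.
  set P := fun q => samec (lvl (L + m.+1) (Ua a)) q p && _.
  case: (boolP (has (fun q => P q && ~~ samec (lvl (L + m) (Ua a)) q p) (iota 0 N))).
    move=> /hasP [q2]; rewrite mem_iota0 => q2N /andP [/andP [h1 _] h2].
    rewrite -(count_predC (fun q => samec (lvl (L + m) (Ua a)) q p)).
    rewrite expnS mul2n -addnn; apply: leq_add.
      apply: leq_trans (IH L p pN); rewrite count_filter -size_filter; apply: uniq_leq_size.
        by rewrite filter_uniq // iota_uniq.
      move=> q; rewrite !mem_filter /= => /andP [/andP [h3 /andP [_ h4]] h5].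
      by rewrite h3 h4 h5.
    apply: leq_trans (IH L q2 q2N); rewrite count_filter -size_filter; apply: uniq_leq_size.
      by rewrite filter_uniq // iota_uniq.
    move=> q; rewrite !mem_filter mem_iota0 /= => /andP [/andP [h3 /andP [h5 h4]] qN].
    rewrite h4 qN !andbT; move: h1 h5; rewrite addnS samec_sym [samec _ q p]samec_sym => h1 h5.
    have := bin_samec pN qN q2N h5 h1.
    by rewrite samec_sym (negPf h3) [samec _ p q2]samec_sym (negPf h2).
  move=> /hasPn hn; apply: (@leq_trans (2 ^ m)); last by rewrite leq_exp2l.
  apply: leq_trans (IH L p pN); apply: uniq_leq_size; first by rewrite filter_uniq // iota_uniq.
  move=> q; rewrite !mem_filter => /andP [Pq qi]; rewrite qi andbT.
  have := hn q qi; rewrite Pq negbK => ->; by case/andP: Pq.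
move=> pN; rewrite /portals size_map size_Ua.
case: (leqP mu L) => h.
  by have := gen mu (L - mu) p pN; rewrite subnK.
rewrite (_ : L - mu = 0); last by apply/eqP; rewrite subn_eq0 ltnW.
by apply: leq_trans (gen L 0 p pN) _; rewrite leq_exp2l // ltnW.
Qed.

Section Fixed.
Variables (a : nat) (W : seq nat).
Hypothesis pW : perm_eq W (iota 0 k.+1).
Hypothesis hW : head 0 W = 0.
Hypothesis CRW : forall l t0, l <= l1 -> CR d Yt l a t0 W <= r2 d u mM.
Hypothesis FW : F d k Yt Ym pj l1.+1 a W = 0.
Let cs L := lvl L (Ua a).
Definition cls L t : pred nat := fun t' => samec (cs L) (loc t) (loc t').
Let exW := ex d k Yt pj.
Let gW := g d k l1 Yt Ym pj a.

Lemma YtY t i : Yt t i < Ym. Proof. exact: YpY. Qed.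
Lemma uniqW : uniq W. Proof. by rewrite (perm_uniq pW) iota_uniq. Qed.
Lemma memW t : (t \in W) = (t <= k). Proof. by rewrite (perm_mem pW) mem_iota0. Qed.
Lemma sizeW : size W = k.+1. Proof. by rewrite (perm_size pW) size_iota. Qed.

Lemma clsE L t t' i x : L <= x -> cls L t t' -> i = x %% d ->
  (Yt t i + a) %/ 2 ^ (x %/ d) = (Yt t' i + a) %/ 2 ^ (x %/ d).
Proof.
move=> Lx /(samecP _ _ (loc_lt t) (loc_lt t')) h ->; have := h x Lx.
by rewrite !loc_Y // ltn_pmod.
Qed.

(** Different cells of level [L] differ on some axis at a scale of at least [L %/ d]; the facet
    found there is counted because the exit is not exact. *)
Lemma cross L t t' : ~~ cls L t t' -> ~~ exW (cls L t) t t' -> exists e i y0,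
  [/\ L %/ d <= e, i < d, y0 < Ym, ongrid e a y0 & ctd k Yt pj t t' i y0].
Proof.
move=> nc ne.
have [x Lx dx] : exists2 x, L <= x &
    (Yt t (x %% d) + a) %/ 2 ^ (x %/ d) != (Yt t' (x %% d) + a) %/ 2 ^ (x %/ d).
  apply: contrapT => hn; case/negP: nc; apply/(samecP _ _ (loc_lt t) (loc_lt t')) => x Lx.
  rewrite !loc_Y ?ltn_pmod //; apply/eqP/negPn/negP => dx; apply: hn; by exists x.
have [up [g1 g2 g3]] := facet_coord YtY dx.
have id : x %% d < d by rewrite ltn_pmod.
exists (x %/ d), (x %% d), (facet Yt (x %/ d) a t (x %% d) up); split=> //.
  exact: leq_div2r.
apply: (nex_ctd ne id _ g2) => s Ss.
by rewrite !(ongrid_side _ _ _ g1) (clsE Lx Ss erefl).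
Qed.

Lemma noF r i y0 : r.+1 < size W -> i < d -> y0 < Ym -> ongrid l1.+1 a y0 ->
  ctd k Yt pj (nth 0 W r) (nth 0 W r.+1) i y0 = false.
Proof.
move=> rW id yY gy; move: FW; rewrite FE => /eqP.
rewrite sum_nat_eq0 => /forallP /(_ (Ordinal id)) /=.
rewrite sum_nat_eq0 => /forallP /(_ (Ordinal yY)) /=; rewrite gy /= /fH esum_nth.
rewrite (sum_nat_eq0 _ _) => /forallP.
have rW' : r < (size W).-1 by move: rW; clear; lia.
by move=> /(_ (Ordinal rW')) /=; case: (ctd _ _ _ _ _ _ _).
Qed.

Definition edge t t' := exists2 r, r.+1 < size W &
  (t = nth 0 W r /\ t' = nth 0 W r.+1) \/ (t' = nth 0 W r /\ t = nth 0 W r.+1).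

(** By [FW] no facet above scale [l1] is counted along the walk, so the facet found by [cross] has a
    level at which [g] records it. *)
Lemma cross_edge L t t' : edge t t' -> ~~ cls L t t' -> ~~ exW (cls L t) t t' ->
  L %/ d <= l1 /\ 2 ^ (L %/ d) <= gW t t'.
Proof.
move=> [r rW e] nc ne; have [e0 [i [y0 [Le id yY gy c]]]] := cross nc ne.
have el : e0 <= l1.
  rewrite leqNgt; apply/negP => lt; have gy' := ongrid_le lt gy.
  have := noF rW id yY gy'; case: e => -[e1 e2]; rewrite e1 e2 in c.
    by rewrite c.
  by rewrite ctd_sym c.
have Ll := leq_trans Le el; split=> //.
apply: hg_le; first by rewrite ltnS leqW.
by apply/hgP; exists i, y0; split=> //; exact: ongrid_le gy.
Qed.

Definition prW t := nth 0 W (index t W).-1.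
Definition suW t := nth 0 W (index t W).+1.
(** An endpoint stays at its true position if the walk starts there or enters exactly there;
    otherwise [tz] moves it to the representative of its cell [mu] levels below, that is, [mu']
    quadtree levels. *)
Definition exa L t := (t == head 0 W) || exW (cls L t) t (prW t).
Definition exb L t := (t == last 0 W) || exW (cls L t) t (suW t).
Definition tz (e : nat -> nat -> bool) L t :=
  if e L t then loc t else repr (cs (L - mu)) (loc t).

Lemma cls_sub L L' t : L <= L' -> {subset cls L t <= cls L' t}.
Proof. by move=> LL t'; apply: samec_le; rewrite ?loc_lt. Qed.

(** An exact exit from a cell is an exact exit from every subcell containing the point, so an
    endpoint that has become a portal never returns to its true position. *)
Lemma exa_le L L' t : L <= L' -> exa L' t -> exa L t.
Proof.
move=> LL /orP [h|h]; rewrite /exa ?h //; apply/orP; right.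
by apply: ex_sub h; exact: cls_sub.
Qed.
Lemma exb_le L L' t : L <= L' -> exb L' t -> exb L t.
Proof.
move=> LL /orP [h|h]; rewrite /exb ?h //; apply/orP; right.
by apply: ex_sub h; exact: cls_sub.
Qed.

Lemma reprz_lt L p : p < N -> repr (cs L) p < N.
Proof. by move=> pN; rewrite -(size_Ua a) -(size_map (iter L hstep)) repr_lt // size_map size_Ua. Qed.

Lemma reprz_same L p : p < N -> samec (cs L) (repr (cs L) p) p.
Proof. by move=> pN; rewrite samec_repr // size_map size_Ua. Qed.

Lemma tz_lt e L t : tz e L t < N.
Proof. by rewrite /tz; case: ifP => _; rewrite ?reprz_lt ?loc_lt. Qed.

Lemma tz_same e L t : samec (cs (L - mu)) (tz e L t) (loc t).
Proof. by rewrite /tz; case: ifP => _; rewrite ?samec_refl ?reprz_same ?loc_lt. Qed.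

Lemma tz0 e t : tz e 0 t = loc t.
Proof. by rewrite /tz sub0n /cs loc_id if_same. Qed.

Lemma tz_portal (e : nat -> nat -> bool) L t t0 : ~~ e L t -> cls L t0 t ->
  tz e L t \in portals (cs L) (cs (L - mu)) (loc t0).
Proof.
move=> ne ct; rewrite /tz (negPf ne) mem_filter mem_iota0 size_map size_Ua reprz_lt ?loc_lt //.
rewrite repr_id ?eqxx ?andbT; last by rewrite size_map size_Ua loc_lt.
apply: (samec_trans (q := loc t)); last by rewrite samec_sym.
by apply: (@samec_le a (L - mu)); rewrite ?reprz_lt ?loc_lt ?leq_subr ?reprz_same ?loc_lt.
Qed.

Lemma tzS (e : nat -> nat -> bool) L t : (e L.+1 t -> e L t) ->
  tz e L.+1 t = tz e L t \/ tz e L.+1 t \in portals (cs L.+1) (cs (L.+1 - mu)) (loc t).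
Proof.
move=> h; case e1 : (e L.+1 t); last by right; apply: tz_portal; rewrite ?e1 // /cls samec_refl.
by left; rewrite /tz e1 h.
Qed.

Local Open Scope ring_scope.
Definition SS (e : nat -> nat -> bool) L t : R := \sum_(i < L) dm ds (tz e i.+1 t) (tz e i t).

Lemma SS_ge (e : nat -> nat -> bool) L t : dm ds (tz e L t) (loc t) <= SS e L t.
Proof.
elim: L => [|L IH]; first by rewrite tz0 /SS big_ord0 dm_ii ?loc_lt.
rewrite /SS big_ord_recr /= -/(SS e L t) addrC.
by apply: le_trans (dm_tri (tz_lt e L.+1 t) (tz_lt e L t) (loc_lt t)) _; rewrite lerD2l.
Qed.

(** At each level the portal moves within a cell [mu'] scales finer, so the detour is a geometric
    sum dominated by its last term. If the endpoint is a portal, the edge still crosses at level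
    [L], and that scale is at most [g]. *)
Lemma SS_bound (e : nat -> nat -> bool) L t t' :
  (forall L L' : nat, (L <= L')%N -> e L' t -> e L t) ->
  (~~ e L t -> (L %/ d <= l1)%N /\ (2 ^ (L %/ d) <= gW t t')%N) ->
  SS e L t <= 4 * d%:R * D / 2 ^+ mu' * (gW t t')%:R.
Proof.
move=> mono hn; have p2 : 0 < 2 ^+ mu' :> R by rewrite exprn_gt0.
have rhs0 : 0 <= 4 * d%:R * D / 2 ^+ mu' * (gW t t')%:R.
  by rewrite !mulr_ge0 // invr_ge0 ltW.
case eL : (e L t).
  rewrite /SS big1 // => i _; rewrite /tz !(mono _ _ _ eL) ?dm_ii ?loc_lt //; exact: ltnW.
have [Ll gl] := hn (negbT eL).
apply: (@le_trans _ _ (\sum_(i < L) 2 * D / 2 ^+ mu' * (2 ^ (i.+1 %/ d))%:R)).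
  apply: ler_sum => i _.
  case: (leqP i.+1 mu) => im.
    rewrite (_ : tz e i.+1 t = loc t); last first.
      have -> : tz e i.+1 t = (if e i.+1 t then loc t else repr (cs 0) (loc t)).
        by rewrite /tz (eqP (im : (_ - _ == 0)%N)).
      by rewrite /cs loc_id if_same.
    rewrite (_ : tz e i t = loc t); last first.
      have -> : tz e i t = (if e i t then loc t else repr (cs 0) (loc t)).
        by rewrite /tz (eqP (ltnW im : (_ - _ == 0)%N)).
      by rewrite /cs loc_id if_same.
    by rewrite dm_ii ?loc_lt // !mulr_ge0 // invr_ge0 ltW.
  (* Old and new portal share a cell of level [i.+1 - mu], and rounding up to a whole quadtree level
     gives this scale. *)
  pose l' := (i.+1 %/ d + 1 - mu')%N.
  have mq : (mu' <= i.+1 %/ d)%N by rewrite leq_divRL // mulnC ltnW.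
  have le1 : (i.+1 - mu <= l' * d)%N.
    rewrite /l' mulnBl [(mu' * d)%N]mulnC -/mu leq_sub2r // addn1; apply: ltnW; exact: ltn_ceil.
  have qL : (i.+1 %/ d <= l1)%N by apply: leq_trans Ll; apply: leq_div2r.
  have l'l : (l' <= l1)%N by rewrite /l'; move: qL mu2; clear; lia.
  have sm : samec (cs (i.+1 - mu)) (tz e i.+1 t) (tz e i t).
    apply: (samec_trans (tz_same e i.+1 t)); rewrite samec_sym.
    by apply: (@samec_le a (i - mu)); rewrite ?tz_lt ?loc_lt ?leq_sub2r ?tz_same.
  have := dml (tz_lt e i.+1 t) (tz_lt e i t) l'l
     (samec_level (tz_lt e i.+1 t) (tz_lt e i t) le1 sm) => h.
  apply: le_trans h _.
  have -> : 2 * D / 2 ^+ mu' * (2 ^ (i.+1 %/ d))%:R = D * (2 ^+ (i.+1 %/ d).+1 / 2 ^+ mu').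
    by rewrite natrX exprS; field; exact: lt0r_neq0.
  rewrite ler_wpM2l // ler_pdivlMr // -exprD /l' addn1 subnK //; exact: leqW.
rewrite -mulr_sumr -natr_sum.
have gs := geo_sum L d0.
have h1 : (\sum_(i < L) 2 ^ (i.+1 %/ d))%:R <= (2 * d * gW t t')%:R :> R.
  by rewrite ler_nat; apply: leq_trans gs _; rewrite leq_mul2l gl orbT.
apply: (@le_trans _ _ (2 * D / 2 ^+ mu' * (2 * d * gW t t')%:R)).
  by rewrite ler_wpM2l // !mulr_ge0 // invr_ge0 ltW.
by rewrite !natrM le_eqVlt; apply/orP; left; apply/eqP; field; exact: lt0r_neq0.
Qed.

(** Four times the bound of [SS_bound]: both ends are displaced, and each displacement is paid once
    as accumulated detour and once in the edge between the displaced ends. *)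
Definition kap : R := 16 * d%:R * D / 2 ^+ mu'.
Let dd t t' := dm ds (loc t) (loc t').

Lemma prW_nth r : (r.+1 < size W)%N -> prW (nth 0%N W r.+1) = nth 0%N W r.
Proof. by move=> rW; rewrite /prW index_uniq // uniqW. Qed.
Lemma suW_nth r : (r.+1 < size W)%N -> suW (nth 0%N W r) = nth 0%N W r.+1.
Proof. by move=> rW; rewrite /suW index_uniq ?uniqW // ltnW. Qed.

Lemma full_bound L r : (r.+1 < size W)%N ->
  full ds (Ua a) loc (tz exa) (tz exb) L (nth 0%N W r) (nth 0%N W r.+1) <=
  l2 d k l1 Yt Ym pj dd kap a (nth 0%N W r) (nth 0%N W r.+1).
Proof.
move=> rW; set t := nth 0%N W r; set t' := nth 0%N W r.+1.
have p2 : 0 < 2 ^+ mu' :> R by rewrite exprn_gt0.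
have kap0 : 0 <= kap by rewrite /kap !mulr_ge0 // invr_ge0 ltW.
elim: L => [|L IH].
  by rewrite /full /l2 addr_ge0 ?dm_ge0 // mulr_ge0.
rewrite fullS; case: ifPn => // nc.
have ed : edge t t' by exists r => //; left.
have ed' : edge t' t by exists r => //; right.
have gs : gW t' t = gW t t' by exact: g_sym.
have A1 : SS exa L t' <= 4 * d%:R * D / 2 ^+ mu' * (gW t t')%:R.
  rewrite -gs; apply: SS_bound; first by move=> L1 L2 h; exact: exa_le.
  rewrite negb_or => /andP [_]; rewrite prW_nth // => nx.
  by apply: cross_edge; rewrite // /cls samec_sym.
have B1 : SS exb L t <= 4 * d%:R * D / 2 ^+ mu' * (gW t t')%:R.
  apply: SS_bound; first by move=> L1 L2 h; exact: exb_le.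
  rewrite negb_or => /andP [_]; rewrite suW_nth // => nx.
  exact: cross_edge.
have AE : AA ds (tz exa) L t' = SS exa L t' by [].
have BE : BB ds (tz exb) L t = SS exb L t.
  by apply: eq_bigr => i _; rewrite dm_sym ?tz_lt.
have t1 := dm_tri (tz_lt exb L t) (loc_lt t) (tz_lt exa L t').
have t2 := dm_tri (loc_lt t) (loc_lt t') (tz_lt exa L t').
have s1 := SS_ge exb L t; have s2 := SS_ge exa L t'.
rewrite dm_sym ?tz_lt ?loc_lt // in s2.
rewrite AE BE /l2 -/gW -/(dd t t') /kap.
have -> : 16 * d%:R * D / 2 ^+ mu' * (gW t t')%:R = 4 * (4 * d%:R * D / 2 ^+ mu' * (gW t t')%:R).
  by field; exact: lt0r_neq0.
move: A1 B1 t1 t2 s1 s2; rewrite -/(dd t t'); lra.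
Qed.

Local Open Scope nat_scope.

Lemma clsP L t t0 : cls L t t0 -> cls L t =1 cls L t0.
Proof. by move=> /eqP h t'; rewrite /cls /samec h. Qed.

(** A cell between two quadtree levels is a union of at most [2 ^ d] cells of level [L %/ d], told
    apart by the parities of the scaled coordinates, and each of them is crossed at most [r2] times.
    Above scale [l1] only exact crossings remain. *)
Lemma cross_count L t0 :
  esum (fun t t' => (cls L t0 t != cls L t0 t') : nat) W <= 2 ^ d * r2 d u mM + u * 2.
Proof.
case: (leqP (L %/ d) l1) => Ll.
  apply: leq_trans (leq_addr _ _); set l := L %/ d in Ll.
  pose pat t : {ffun 'I_d -> bool} := [ffun i : 'I_d => odd ((Yt t i + a) %/ 2 ^ l)].
  pose rp v := if pselect (exists t, cls L t0 t /\ pat t = v) is left h then sval (cid h) else t0.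
  have key' t t' : cls L t0 t -> ~~ cls L t0 t' ->
      samel d Yt l a (rp (pat t)) t /\ ~~ samel d Yt l a (rp (pat t)) t'.
    move=> ct nct; rewrite /rp; case: pselect => [h|[]]; last by exists t.
    case: (cid h) => r [cr_ pr] /=.
    have lL : l * d <= L by rewrite leq_trunc_div.
    have s1 : samel d Yt l a r t.
      apply/samelP => i id.
      have crt : cls L r t by rewrite -(clsP cr_).
      have e1 : (Yt r i + a) %/ 2 ^ l.+1 = (Yt t i + a) %/ 2 ^ l.+1.
        have Lx : L <= l.+1 * d + i.
          apply: leq_trans (leq_addr _ _); apply: ltnW; exact: ltn_ceil.
        have := clsE Lx crt (erefl _).
        by rewrite modnMDl modn_small // divnMDl // (divn_small id) addn0.
      have /ffunP/(_ (Ordinal id)) := pr; rewrite !ffunE /= => e2.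
      move: e1; rewrite expnSr !divnMA !divn2 => e1.
      by rewrite -[LHS]odd_double_half -[RHS]odd_double_half e1 e2.
    split=> //; apply: contra nct => s2.
    apply: samec_trans cr_ _; apply: (@level_samec a L l); rewrite ?loc_lt //.
    by move=> i id; rewrite !loc_Y //; move/samelP: s2 => /(_ i id).
  apply: (@leq_trans (esum (fun t t' => \sum_(v : {ffun 'I_d -> bool}) cr d Yt l a (rp v) t t') W)).
    rewrite !esum_nth; apply: leq_sum => r _.
    set t := nth 0 W r; set t' := nth 0 W r.+1.
    have hh s s' : cls L t0 s -> ~~ cls L t0 s' ->
        1 <= \sum_(v : {ffun 'I_d -> bool}) cr d Yt l a (rp v) s s'.
      move=> c1 c2; rewrite (bigD1 (pat s)) //= /cr; have [-> /negPf ->] := key' _ _ c1 c2.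
      by [].
    case c1 : (cls L t0 t); case c2 : (cls L t0 t') => //.
      by apply: hh; rewrite ?c2.
    rewrite (eq_bigr (fun v => cr d Yt l a (rp v) t' t)); last by move=> v _; rewrite /cr eq_sym.
    by apply: hh; rewrite ?c1.
  rewrite esum_nth exchange_big /=.
  apply: (@leq_trans (\sum_(v : {ffun 'I_d -> bool}) r2 d u mM)).
    by apply: leq_sum => v _; have := CRW (rp v) Ll; rewrite /CR esum_nth.
  by rewrite sum_nat_const card_ffun card_bool card_ord.
apply: leq_trans (leq_addl _ _).
have := @exact_cnt d u k Yt pj pju pjm R D D D0 D0 (cls L t0) W uniqW.
have -> : all (leq^~ k) W by apply/allP => t; rewrite memW.
move=> /(_ isT); apply: leq_trans.
rewrite esum_nth -sum1_card [leqRHS]big_mkcond; apply: leq_sum => r _.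
have rW : r.+1 < size W by move: (ltn_ord r); clear; lia.
rewrite inE /exc; set t := nth 0 W r; set t' := nth 0 W r.+1.
have ed : edge t t' by exists r => //; left.
have ed' : edge t' t by exists r => //; right.
have hx s s' : edge s s' -> cls L t0 s -> ~~ cls L t0 s' -> ex d k Yt pj (cls L t0) s s'.
  move=> e c1 c2; have ce := clsP c1.
  have c2' : ~~ cls L s s' by rewrite -ce.
  apply/negPn/negP => nx; have [|le _] := cross_edge e c2'; last by rewrite leqNgt Ll in le.
  by apply: contra nx; apply: ex_sub => z zS; exact: (etrans (esym (ce z)) zS).
case c1 : (cls L t0 t); case c2 : (cls L t0 t') => //=.
  by rewrite (hx t t') ?c1 ?c2.
by rewrite (hx t' t) ?c1 ?c2.
Qed.

Definition RsB := (2 ^ d * r2 d u mM + u * 2).+1.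

Lemma locNW t : t \in W -> loc t < size (Ua a).
Proof. by rewrite size_Ua loc_lt. Qed.

Lemma segR L t0 : size (segc (Ua a) W loc L t0) <= RsB.
Proof.
have := @seg_count (fun t t' => samec (cs L) (loc t) (loc t')) (cls L t0) (seg (Ua a) W loc L)
  (seg_nil _ _ _ _) (seg_adj _ _ _ _).
rewrite flatten_seg => h; apply: (@leq_trans (esum (fun t t' => (cls L t0 t != cls L t0 t') : nat) W).+1).
  rewrite /segc (eq_filter (a2 := fun B => cls L t0 (head 0 B))); last first.
    by move=> B; rewrite /cls samec_sym.
  apply: h.
    move=> B Bs; have B0 := seg_n0 Bs.
    have := seg_same locNW Bs (head_mem B0) (last_mem B0).
    by rewrite /cls /samec => /eqP ->.
  by move=> x y h1 h2; apply: samec_trans h2; rewrite samec_sym.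
by rewrite ltnS cross_count.
Qed.

(** The endpoints that are not portals are the two ends of the walk and the inner ends of exact
    crossings, two per piece. This explains the value [u * 2 + 2] of [XS]. *)
Lemma segE L t0 : exists E, [/\ size E <= u * 2 + 2, all (fun x => x < size (Ua a)) E &
  forall B, B \in segc (Ua a) W loc L t0 ->
   (tz exa L (head 0 B) \in E ++ portals (cs L) (cs (L - mu)) (loc t0)) /\
   (tz exb L (last 0 B) \in E ++ portals (cs L) (cs (L - mu)) (loc t0))].
Proof.
set S := cls L t0.
pose A3 := [set r : 'I_(size W).-1 | exc d k Yt pj S (nth 0 W r) (nth 0 W r.+1)].
pose inn (r : nat) := if S (nth 0 W r) then nth 0 W r else nth 0 W r.+1.
exists (loc (head 0 W) :: loc (last 0 W) :: [seq loc (inn (nat_of_ord r)) | r <- enum A3]); split.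
- rewrite /= size_map -cardE addn2 !ltnS.
  apply: (exact_cnt d Yt pju pjm D0 D0 S uniqW).
  by apply/allP => t; rewrite memW.
- by rewrite /= size_Ua !loc_lt /=; apply/allP => x /mapP [r _ ->]; rewrite loc_lt.
move=> B; rewrite mem_filter => /andP [sB Bs]; have B0 := seg_n0 Bs.
have S1 : S (head 0 B) by rewrite /S /cls samec_sym.
have S2 : S (last 0 B).
  have := seg_same locNW Bs (head_mem B0) (last_mem B0) => h.
  exact: samec_trans S1 h.
have inE3 (r : nat) : r.+1 < size W -> exc d k Yt pj S (nth 0 W r) (nth 0 W r.+1) ->
    loc (inn r) \in [seq loc (inn (nat_of_ord r)) | r <- enum A3].
  move=> rW h; have r' : r < (size W).-1 by move: rW; clear; lia.
  by apply/mapP; exists (Ordinal r') => //; rewrite mem_enum inE.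
have nS t t' : S t -> ~~ samec (cs L) (loc t) (loc t') -> ~~ S t'.
  by move=> h1; apply: contra => h2; apply: samec_trans h2; rewrite samec_sym.
split; rewrite mem_cat.
  case e : (exa L (head 0 B)); last by rewrite tz_portal ?e ?orbT.
  rewrite /tz e !inE; apply/orP; left.
  have [hE|[r [rW nE ns]]] := seg_pred (seg_nil (Ua a) W loc L) (seg_adj (Ua a) W loc L) Bs.
  - by rewrite hE flatten_seg eqxx.
  rewrite flatten_seg in rW nE ns.
  case h0 : (head 0 B == head 0 W); first by rewrite (eqP h0) eqxx.
  move: e; rewrite /exa h0 /= -nE prW_nth // nE => xe.
  have nr : ~~ S (nth 0 W r) by apply: nS S1 _; rewrite samec_sym.
  have := inE3 r rW; rewrite /inn (negPf nr) nE => -> //; rewrite ?orbT //.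
  rewrite /exc ?nE (negPf nr) S1 /=.
  by apply: ex_sub xe => z zS; exact: (etrans (esym (clsP S1 z)) zS).
case e : (exb L (last 0 B)); last by rewrite tz_portal ?e ?orbT.
rewrite /tz e !inE; apply/orP; left.
have [hE|[r [rW nE ns]]] := seg_succ (seg_nil (Ua a) W loc L) (seg_adj (Ua a) W loc L) Bs.
- by rewrite hE flatten_seg eqxx orbT.
rewrite flatten_seg in rW nE ns.
case h0 : (last 0 B == last 0 W); first by rewrite (eqP h0) eqxx orbT.
move: e; rewrite /exb h0 /= -nE suW_nth // nE => xe.
have nr : ~~ S (nth 0 W r.+1) by exact: nS S2 ns.
have := inE3 r rW; rewrite /inn nE S2 => -> //; rewrite ?orbT //.
rewrite /exc ?nE (negPf nr) S2 /= orbF.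
by apply: ex_sub xe => z zS; exact: (etrans (esym (clsP S2 z)) zS).
Qed.

Lemma psum0_esum (f : nat -> nat -> R) s : psum0 f s = esum f s.
Proof. by case: s => // x s /=; elim: s x => //= y s IH x; rewrite IH. Qed.

Lemma tour_len p : p < N -> (plen ds (tour (cs 0) p) <=
  2 * del * (count (fun q => samec (cs 0) q p) (iota 0 N))%:R)%R.
Proof.
move=> pN; rewrite /tour size_map size_Ua -size_filter.
have : all (fun q => (q < N) && samec (cs 0) q p) [seq q <- iota 0 N | samec (cs 0) q p].
  by apply/allP => q; rewrite mem_filter mem_iota0 andbC.
elim: [seq q <- iota 0 N | samec (cs 0) q p] => [|q s IH] /=; first by rewrite mulr0.
move=> /andP [/andP [qN sq] /IH]; rewrite /= => h.
have : (dm ds p q <= del)%R.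
  apply: dmdel => // i id; rewrite samec_sym in sq.
  have := samec_level pN qN (leq0n (0 * d)) sq id.
  by rewrite !divn1 => /addIn.
have := dm_sym pN qN => <-; move: h; set x := plen_rec _ _ _ => h1 h2.
by rewrite -[(size s).+1%:R%R]natr1 mulrDr; lra.
Qed.

(** A point lies in the lowest cell of at most one element of [vis], namely of its
    representative. *)
Lemma vis_count (P : pred nat) (s : seq nat) : {in s, forall q, q < N} ->
  uniq s -> \sum_(p <- vis W loc) count (fun q => P q && samec (cs 0) q p) s <= size s.
Proof.
move=> sN us.
rewrite (eq_bigr (fun p => \sum_(q <- s) (P q && samec (cs 0) q p))); last first.
  by move=> p _; rewrite -sum1_count big_mkcond; apply: eq_bigr => q _; case: (P q && _).
rewrite exchange_big /= -sum1_size big_seq [leqRHS]big_seq; apply: leq_sum => q qs.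
apply: (@leq_trans (count_mem (repr (cs 0) q) (vis W loc))); last first.
  by rewrite count_uniq_mem ?undup_uniq // leq_b1.
rewrite -sum1_count [leqRHS]big_mkcond [leqLHS]big_seq [leqRHS]big_seq; apply: leq_sum => p.
rewrite mem_undup => /mapP [t _ ->]; case: (P q) => //=; case h : (samec _ _ _) => //.
by rewrite (repr_eq h) loc_id eqxx.
Qed.

(** At level [d * Lam] all points share one cell, so the walk is a single strand whose ends are both
    exact; completeness of the table then gives an item with one strand. *)
Lemma fixed_item Lam : Ym + a <= 2 ^ Lam -> exists it q,
  [/\ it \in tableL ds (u * 2 + 2) (2 ^ mu) RsB mu (scr (2 ^ mu) RsB) (Ua a) (d * Lam),
      it.2.2 = [:: q], head 0 q = 0, k <= it.2.1 &
      (plen ds q <= esum (l2 d k l1 Yt Ym pj dd kap a) W + 2 * del * N%:R)%R].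
Proof.
move=> YL; set La := d * Lam.
have W0 : 0 \in W by rewrite memW.
have all_same t t' : samec (cs La) (loc t) (loc t').
  apply/samecP; rewrite ?loc_lt // => x Lx.
  have sm p i : (Yp p i + a) %/ 2 ^ (x %/ d) = 0.
    rewrite divn_small //; apply: (@leq_trans (2 ^ Lam)).
      by apply: leq_trans YL; rewrite ltn_add2r.
    by rewrite leq_exp2l // leq_divRL // mulnC.
  by rewrite !sm.
have aS L t : L < La -> t \in W -> tz exa L.+1 t = tz exa L t \/
    tz exa L.+1 t \in portals (cs L.+1) (cs (L.+1 - mu)) (loc t).
  by move=> _ _; apply: tzS; exact: exa_le.
have bS L t : L < La -> t \in W -> tz exb L.+1 t = tz exb L t \/
    tz exb L.+1 t \in portals (cs L.+1) (cs (L.+1 - mu)) (loc t).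
  by move=> _ _; apply: tzS; exact: exb_le.
have PBP L p : L <= La -> p < size (Ua a) ->
    size (portals (cs L) (cs (L - mu)) p) <= 2 ^ mu.
  by rewrite size_Ua => _ pN; exact: portals_le.
have bn L p q r : p < size (Ua a) -> q < size (Ua a) -> r < size (Ua a) -> L < La ->
   samec (cs L.+1) p q -> samec (cs L.+1) p r ->
   [|| samec (cs L) p q, samec (cs L) p r | samec (cs L) q r].
  by rewrite size_Ua => pN qN rN _; exact: bin_samec.
have [it [itT it1 itk itt itl]] := @dp_complete R ds (u * 2 + 2) (2 ^ mu) RsB mu (Ua a) W loc
  (tz exa) (tz exb) La dm_ge0 uniqW locNW (fun t _ => loc_id a t) (tz0 exa) (tz0 exb) aS bS PBP bn
  (fun L t0 _ _ => segR L t0) (fun L t0 _ _ _ => segE L t0) La 0 (leqnn _) W0.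
have sg : seg (Ua a) W loc La = [:: W].
  have := seg_adj (Ua a) W loc La; have := flatten_seg (Ua a) W loc La.
  case: (seg _ _ _ _) => [|B [|B' s]] /=; first by move=> e; rewrite -e in W0.
    by rewrite cats0 => ->.
  by move=> _ /andP []; rewrite all_same.
have sgc : segc (Ua a) W loc La 0 = [:: W] by rewrite /segc sg /= all_same.
rewrite sgc in itt itl.
case: it itT it1 itk itt itl => p [kq [|q [|q' st]]] itT it1 itk // itt itl.
have ha : tz exa La 0 = 0 by rewrite /tz /exa hW eqxx loc0.
exists (p, (kq, [:: q])), q; split=> //.
- by move: itt => /= [-> _]; rewrite hW ha.
- rewrite [(_, _).2.1]/= in itk *; rewrite itk /kk.
  rewrite big_seq_cond (eq_bigl (fun p0 => p0 \in vis W loc)); last first.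
    by move=> p0; case h : (p0 \in _) => //=; move: h; rewrite mem_undup => /mapP [t _ ->]; rewrite all_same.
  rewrite -big_seq; pose s := [seq pi t | t <- iota 1 k].
  have us : uniq s.
    rewrite map_inj_in_uniq ?iota_uniq // => t t'; rewrite !mem_iota => /andP [_ h1] /andP [_ h2].
    by apply: piI; rewrite -ltnS -[k.+1]add1n.
  apply: (@leq_trans (\sum_(p0 <- vis W loc) count (fun q0 => samec (cs 0) q0 p0) s)).
    rewrite (eq_bigr (fun p0 => \sum_(q0 <- s) (samec (cs 0) q0 p0))); last first.
      by move=> p0 _; rewrite -sum1_count big_mkcond; apply: eq_bigr => q0 _; case: (samec _ _ _).
    rewrite exchange_big /= -{1}(size_iota 1 k) -(size_map pi) -/s -sum1_size.
    rewrite big_seq [leqRHS]big_seq; apply: leq_sum => q0 /mapP [t tk ->].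
    have tv : loc t \in vis W loc.
      by rewrite mem_undup map_f // memW; move: tk; rewrite mem_iota; clear; lia.
    rewrite (bigD1_seq (loc t)) ?undup_uniq //= samec_sym loc_samec; exact: leq_addr.
  apply: leq_sum => p0 _; rewrite /weight size_map size_Ua -!size_filter.
  apply: uniq_leq_size; first by rewrite filter_uniq.
  move=> q0; rewrite !mem_filter mem_iota0 => /andP [-> /mapP [t tk ->]]; rewrite piN !andbT.
  rewrite lt0n; apply: contraTneq tk => e; rewrite mem_iota; apply/negP => /andP [t1 tk].
  have t0 : t = 0 by apply: piI; rewrite ?pi0 // -ltnS -[k.+1]add1n.
  by rewrite t0 in t1.
have -> : (plen ds q = tlen ds [:: q])%R by rewrite /tlen big_seq1.
apply: le_trans itl _; rewrite big_seq1 /blen; apply: lerD; last first.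
  rewrite /DP.tt; apply: (@le_trans _ _ (\sum_(p0 <- vis W loc) 2 * del *
     (count (fun q0 => true && samec (cs 0) q0 p0) (iota 0 N))%:R)%R); last first.
    rewrite -mulr_sumr -natr_sum; apply: ler_wpM2l; first by rewrite mulr_ge0.
    rewrite ler_nat -{2}(size_iota 0 N); apply: vis_count (iota_uniq _ _).
    by move=> q0; rewrite mem_iota0.
  rewrite big_seq_cond [leRHS]big_seq; apply: (@le_trans _ _ (\sum_(i <- vis W loc | i \in vis W loc) plen ds (tour (cs 0) i))%R).
    rewrite big_mkcond [leRHS]big_mkcond; apply: ler_sum => p0 _.
    case: (p0 \in vis W loc); last exact: lexx.
    case: ifP => _; first exact: lexx.
    rewrite plenE psum0_esum esum_nth; apply: sumr_ge0 => *; exact: dm_ge0.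
  apply: ler_sum => p0; rewrite mem_undup => /mapP [t _ ->]; exact: tour_len (loc_lt t).
have z (e : nat -> nat -> bool) t : (forall L, e L t) -> forall L, tz e L t = loc t.
  by move=> h L; rewrite /tz h.
have za : (AA ds (tz exa) La (head 0 W) = 0)%R.
  by rewrite /AA big1 // => i _; rewrite !z ?dm_ii ?loc_lt // => L; rewrite /exa eqxx.
have zb : (BB ds (tz exb) La (last 0 W) = 0)%R.
  by rewrite /BB big1 // => i _; rewrite !z ?dm_ii ?loc_lt // => L; rewrite /exb eqxx.
rewrite za zb !addr0 psum0_esum !esum_nth; apply: ler_sum => r _; apply: full_bound.
by move: (ltn_ord r); clear; lia.
Qed.

End Fixed.

(** The errors beside the length of the given path are: [2 * del] per step for replacing points by
    representatives of their grid cubes, [2 * del] per point for the star tours, and the cost of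
    uncrossing and of portals. *)
Theorem bridge Lam : Ym + 2 ^ l1.+1 <= 2 ^ Lam ->
  F d k Yt Ym pj 0 0 (iota 0 k.+1) <= 2 ^ l1 -> exists a it q,
  [/\ a < 2 ^ l1.+1,
      it \in tableL ds (u * 2 + 2) (2 ^ mu) RsB mu (scr (2 ^ mu) RsB) (Ua a) (d * Lam),
      it.2.2 = [:: q], head 0 q = 0 /\ k <= it.2.1 &
      (plen ds q <= \sum_(t < k) dm ds (pi t) (pi t.+1) + 2 * del * k%:R + 2 * del * N%:R +
       2 * (kap * l1.+2%:R + Cst mM D kap) * (F d k Yt Ym pj 0 0 (iota 0 k.+1))%:R)%R].
Proof.
move=> YL TVl; pose dd t t' := dm ds (loc t) (loc t').
have p2 : (0 < 2 ^+ mu' :> R)%R by rewrite exprn_gt0.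
have kap0 : (0 <= kap)%R by rewrite /kap !mulr_ge0 // invr_ge0 ltW.
have [||||a [W [aA pW hW CRW [FW esW]]]] := @walk_main d u k l1 mM Yt Ym pj (fun t i => YpY _ _) pju pjm
   R dd D kap _ _ D0 kap0 _ _ TVl.
- by move=> t t'; apply: dm_sym; exact: loc_lt.
- by move=> t t' t''; apply: dm_tri; exact: loc_lt.
- move=> l b t t' ll /samelP h; apply: (dml (loc_lt t) (loc_lt t') ll (b := b)) => i id.
  by rewrite !loc_Y // h.
- move=> b t t' /samelP h; rewrite /dd.
  suff -> : loc t = loc t' by rewrite dm_ii ?loc_lt.
  rewrite -(loc_id b t) -(loc_id b t'); apply: repr_eq; apply: (@level_samec b 0 0); rewrite ?loc_lt //.
  by move=> i id; rewrite !loc_Y // h.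
have [|it [q [h1 h2 h3 h4 h5]]] := @fixed_item a W pW hW CRW FW Lam.
  by apply: leq_trans YL; rewrite leq_add2l ltnW.
exists a, it, q; split=> //; apply: le_trans h5 _.
have e : (esum dd (iota 0 k.+1) <= \sum_(t < k) dm ds (pi t) (pi t.+1) + 2 * del * k%:R)%R.
  rewrite esum_nth size_iota -[k.+1.-1]/k (_ : (2 * del * k%:R = \sum_(t < k) 2 * del)%R); last first.
    by rewrite sumr_const card_ord mulr_natr.
  rewrite -big_split; apply: ler_sum => t _.
  rewrite !nth_iota ?ltnS // ?(ltnW (ltn_ord t)) // !add0n /dd /=.
  have dl s : (dm ds (loc s) (pi s) <= del)%R.
    by apply: dmdel; rewrite ?loc_lt // => i id; rewrite loc_Y.
  have t1 := dm_tri (loc_lt t) (piN t) (loc_lt t.+1).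
  have t2 := dm_tri (piN t) (piN t.+1) (loc_lt t.+1).
  have d1 := dl t; have d2 := dl t.+1; rewrite dm_sym ?loc_lt // in d2.
  by move: t1 t2 d1 d2; lra.
by move: esW e; lra.
Qed.

End Bridge.
End Bridge.

(** * Counted crossings are paid for by backward moves *)

Module Count.
Import Walk.

Set Implicit Arguments.
Unset Strict Implicit.
Unset Printing Implicit Defensive.
Import Order.TTheory GRing.Theory Num.Theory.
Local Open Scope nat_scope.

Section Count.
Variables (d u k Ym : nat) (Y : nat -> nat -> nat) (pj : nat -> nat).
Hypothesis YY : forall t i, Y t i < Ym.
Hypothesis pju : forall t, pj t < u.
Hypothesis pjm : forall t t', t <= t' -> pj t <= pj t'.

(** [side] is true below the hyperplane, so for a piece progressing upwards the backward crossing
    goes from false to true. *)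
Definition bkc (up : bool) (s s' : bool) : bool := if up then ~~ s && s' else s && ~~ s'.

(** Crossings of one hyperplane alternate in direction as long as the piece lasts, so the two
    directions differ by at most one. The times of a piece form an interval, and the invariant
    distinguishes before, inside and after it. *)
Lemma alternate (s : nat -> bool) j : exists b b' : bool,
  \sum_(t < k | pj t == j) (s t && ~~ s t.+1) + b' = \sum_(t < k | pj t == j) (~~ s t && s t.+1) + b.
Proof.
set U := fun n => \sum_(t < n | pj t == j) (s t && ~~ s t.+1).
set V := fun n => \sum_(t < n | pj t == j) (~~ s t && s t.+1).
have US n : U n.+1 = U n + (pj n == j) * (s n && ~~ s n.+1).
  by rewrite /U big_mkcond big_ord_recr /= -big_mkcond; congr (_ + _); case: (pj n == j); rewrite ?mul1n.
have VS n : V n.+1 = V n + (pj n == j) * (~~ s n && s n.+1).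
  by rewrite /V big_mkcond big_ord_recr /= -big_mkcond; congr (_ + _); case: (pj n == j); rewrite ?mul1n.
have st n : (s n && ~~ s n.+1) + s n.+1 = (~~ s n && s n.+1) + s n by case: (s n); case: (s n.+1).
have inv n : (U n = 0 /\ V n = 0 /\ forall t, t < n -> pj t < j) \/
   ((exists b : bool, U n + s n = V n + b) /\ exists2 t, t < n & pj t = j) \/
   ((exists b b' : bool, U n + b' = V n + b) /\ exists2 t, t < n & j < pj t).
  elim: n => [|n IH]; first by left; rewrite /U /V !big_ord0.
  rewrite US VS; case: IH => [[u0 [v0 lt]]|[[[b e] [t tn tj]]|[[b [b' e]] [t tn tj]]]].
  - rewrite u0 v0; case: (ltngtP (pj n) j) => pn; rewrite ?mul0n ?mul1n ?add0n.
    + left; split=> //; split=> // t; rewrite ltnS leq_eqVlt => /orP [/eqP -> //|]; exact: lt.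
    + by right; right; split; [exists false, false|exists n].
    + by right; left; split; [exists (s n); rewrite st|exists n].
  - have := pjm (ltnW tn); rewrite tj leq_eqVlt => /orP [/eqP pn|pn].
      right; left; split; last by exists n.
      by exists b; rewrite -pn eqxx !mul1n; move: (st n) e; lia.
    right; right; split; last by exists n.
    by exists b, (s n); rewrite gtn_eqF // !mul0n !addn0.
  - have pn : j < pj n by apply: leq_trans tj _; apply: pjm; exact: ltnW.
    right; right; split; last by exists n.
    by exists b, b'; rewrite gtn_eqF // !mul0n !addn0.
case: (inv k) => [[u0 [v0 _]]|[[[b e] _]|[[b [b' e]] _]]].
- by exists false, false; rewrite -/(U k) -/(V k) u0 v0.
- by exists b, (s k).
- by exists b, b'.
Qed.

(** The two directions differ by at most one, so with at least two crossings each direction has at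
    least a third of them; three crossings, one of them backward, are the extreme case. *)
Lemma multi_back j i y0 (up : bool) : multi k Y pj j i y0 ->
  mcnt k Y pj j i y0 <=
  3 * \sum_(t < k | pj t == j) bkc up (side Y t i y0) (side Y t.+1 i y0).
Proof.
rewrite /multi; have [b [b' e]] := alternate (fun t => side Y t i y0) j.
have -> : mcnt k Y pj j i y0 =
    \sum_(t < k | pj t == j) (side Y t i y0 && ~~ side Y t.+1 i y0) +
    \sum_(t < k | pj t == j) (~~ side Y t i y0 && side Y t.+1 i y0).
  rewrite /mcnt -big_split; apply: eq_bigr => t _; rewrite /sep.
  by case: (side Y t i y0); case: (side Y t.+1 i y0).
move: e; rewrite /bkc; case: up; set A := \sum_(t < k | _) _; set B := \sum_(t < k | _) _;
  case: b; case: b'; lia.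
Qed.

Lemma sum_cross a b n : a < n ->
  \sum_(y < n) (~~ (a < y) && (b < y)) = a - b.
Proof.
move=> an; have h m : \sum_(y < m) (~~ (a < y) && (b < y)) = minn a m.-1 - b.
  elim: m => [|m IH]; first by rewrite big_ord0 minn0.
  rewrite big_ord_recr /= IH.
  by case: (ltnP a m) => h1; case: (ltnP b m) => h2 /=; lia.
by rewrite h; lia.
Qed.

Definition bkY (up : nat -> nat -> bool) t i :=
  if up (pj t) i then Y t i - Y t.+1 i else Y t.+1 i - Y t i.

(** In the original walk a crossing is counted only if its piece crosses repeatedly, so [multi_back]
    applies piece by piece; a backward step of grid height h makes h backward crossings. *)
Lemma TV_bound (up : nat -> nat -> bool) :
  F d k Y Ym pj 0 0 (iota 0 k.+1) <= 3 * \sum_(t < k) \sum_(i < d) bkY up t i.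
Proof.
rewrite FE.
have fE i y : fH k Y pj i y (iota 0 k.+1) = \sum_(t < k) (sep Y t t.+1 i y && multi k Y pj (pj t) i y).
  rewrite /fH esum_nth size_iota -[k.+1.-1]/k; apply: eq_bigr => t _.
  rewrite !nth_iota ?ltnS ?(ltnW (ltn_ord t)) // !add0n /ctd /adjp eqxx orbT /=.
  by rewrite (minn_idPl (leqnSn _)).
have bE t i : bkY up t i = \sum_(y < Ym) bkc (up (pj t) i) (side Y t i y) (side Y t.+1 i y).
  rewrite /bkY /bkc /side; case: (up _ _); first by rewrite sum_cross.
  by rewrite -(sum_cross _ (YY t.+1 i)); apply: eq_bigr => y _; rewrite andbC.
rewrite [X in 3 * X]exchange_big big_distrr; apply: leq_sum => i _.
rewrite [X in _ <= _ X](eq_bigr (fun t : 'I_k =>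
  \sum_(y < Ym) bkc (up (pj t) i) (side Y t i y) (side Y t.+1 i y))) //.
rewrite [X in _ <= _ X]exchange_big [leqRHS]big_distrr [leqLHS]big_mkcond.
apply: leq_sum => y _; rewrite -[leqRHS]/(3 * _).
case: ifP => // _; rewrite fE.
pose f (t : 'I_k) := Ordinal (pju t).
rewrite [leqLHS](partition_big f xpredT) //= [X in _ <= 3 * X](partition_big f xpredT) //= big_distrr /=.
apply: leq_sum => j _.
have cj (t : 'I_k) : (f t == j) = (pj t == j) by [].
rewrite (eq_bigl _ _ cj) [X in 3 * X](eq_bigl _ _ cj).
rewrite (eq_bigr (fun t : 'I_k => (sep Y t t.+1 i y && multi k Y pj j i y) : nat)); last first.
  by move=> t /eqP ->.
rewrite [X in 3 * X](eq_bigr (fun t : 'I_k => bkc (up j i) (side Y t i y) (side Y t.+1 i y) : nat)); last first.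
  by move=> t /eqP ->.
case m : (multi k Y pj j i y); last by rewrite big1 // => t _; rewrite andbF.
apply: leq_trans (multi_back (up j i) m); rewrite /mcnt; apply: leq_sum => t _; by rewrite andbT.
Qed.

End Count.
End Count.

Require Import Defs.

(** * Excess, slanted coordinates and rounding *)

Module Geo.
Set Implicit Arguments.
Unset Strict Implicit.
Unset Printing Implicit Defensive.
Import Order.TTheory GRing.Theory Num.Theory.
Local Open Scope ring_scope.

Section Vec.
Variables (R : realType) (d : nat).
Implicit Types x y w n : 'rV[R]_d.

Definition dotv x y : R := \sum_(i < d) x 0 i * y 0 i.

Lemma dotvC x y : dotv x y = dotv y x.
Proof. by apply: eq_bigr => i _; rewrite mulrC. Qed.
Lemma dotvDl x y w : dotv (x + y) w = dotv x w + dotv y w.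
Proof. by rewrite -big_split; apply: eq_bigr => i _; rewrite mxE mulrDl. Qed.
Lemma dotvZl c x w : dotv (c *: x) w = c * dotv x w.
Proof. by rewrite mulr_sumr; apply: eq_bigr => i _; rewrite mxE mulrA. Qed.
Lemma dotvNl x w : dotv (- x) w = - dotv x w.
Proof. by rewrite -scaleN1r dotvZl mulN1r. Qed.
Lemma dotvDr x y w : dotv w (x + y) = dotv w x + dotv w y.
Proof. by rewrite !(dotvC w) dotvDl. Qed.
Lemma dotvZr c x w : dotv w (c *: x) = c * dotv w x.
Proof. by rewrite !(dotvC w) dotvZl. Qed.
Lemma dotvNr x w : dotv w (- x) = - dotv w x.
Proof. by rewrite !(dotvC w) dotvNl. Qed.
Lemma dotv_ge0 x : 0 <= dotv x x.
Proof. by apply: sumr_ge0 => i _; rewrite -expr2 sqr_ge0. Qed.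

Lemma enormE x : enorm x = Num.sqrt (dotv x x).
Proof. by rewrite /enorm; congr Num.sqrt; apply: eq_bigr => i _; rewrite expr2. Qed.
Lemma enorm_ge0 x : 0 <= enorm x. Proof. by rewrite enormE sqrtr_ge0. Qed.
Lemma enorm_sqr x : enorm x ^+ 2 = dotv x x.
Proof. by rewrite enormE sqr_sqrtr // dotv_ge0. Qed.

Lemma dotv_eq0 x y : enorm x = 0 -> dotv x y = 0.
Proof.
move=> e; have : dotv x x = 0 by rewrite -enorm_sqr e expr0n.
move/eqP; rewrite psumr_eq0 => [/allP h|i _]; last by rewrite -expr2 sqr_ge0.
apply: big1 => i _; have := h i (mem_index_enum _); rewrite -expr2 sqrf_eq0 => /eqP ->.
by rewrite mul0r.
Qed.

(** The vector [enorm y *: x - enorm x *: y] has nonnegative square. *)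
Lemma CS x y : dotv x y <= enorm x * enorm y.
Proof.
have [x0|x0] := eqVneq (enorm x) 0; first by rewrite dotv_eq0 // x0 mul0r.
have [y0|y0] := eqVneq (enorm y) 0; first by rewrite dotvC dotv_eq0 // y0 mulr0.
have xp : 0 < enorm x by rewrite lt_neqAle eq_sym x0 enorm_ge0.
have yp : 0 < enorm y by rewrite lt_neqAle eq_sym y0 enorm_ge0.
have := dotv_ge0 (enorm y *: x - enorm x *: y).
rewrite dotvDl !dotvDr !dotvNl !dotvNr !dotvZl !dotvZr -!enorm_sqr (dotvC y x) => h.
have h2 : 0 <= enorm x * enorm y * (enorm x * enorm y - dotv x y) by move: h; nra.
by move: h2; rewrite pmulr_rge0 ?mulr_gt0 // subr_ge0.
Qed.

Lemma enormN x : enorm (- x) = enorm x.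
Proof. by rewrite !enormE dotvNl dotvNr opprK. Qed.
Lemma enorm_sub x y : enorm (x - y) = enorm (y - x).
Proof. by rewrite -enormN opprB. Qed.
Lemma enorm0 : enorm (0 : 'rV[R]_d) = 0.
Proof. by rewrite enormE /dotv big1 ?sqrtr0 // => i _; rewrite mxE mul0r. Qed.
Lemma enorm_tri x y : enorm (x + y) <= enorm x + enorm y.
Proof.
rewrite -(ler_pXn2r (n := 2)) ?nnegrE ?addr_ge0 ?enorm_ge0 //.
rewrite enorm_sqr dotvDl !dotvDr (dotvC y x) -!enorm_sqr; have := CS x y; nra.
Qed.
Lemma enorm_tri3 x y w : enorm (x - w) <= enorm (x - y) + enorm (y - w).
Proof. by have := enorm_tri (x - y) (y - w); rewrite addrA subrK. Qed.
Lemma enorm_eq0 x : enorm x = 0 -> x = 0.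
Proof.
move=> e; apply/rowP => i; rewrite mxE.
have : dotv x x = 0 by rewrite -enorm_sqr e expr0n.
move/eqP; rewrite psumr_eq0 => [/allP h|j _]; last by rewrite -expr2 sqr_ge0.
by have := h i (mem_index_enum _); rewrite -expr2 sqrf_eq0 => /eqP.
Qed.

Lemma enorm_sum x : enorm x <= \sum_(i < d) `|x 0 i|.
Proof.
have s0 : 0 <= \sum_(i < d) `|x 0 i| by apply: sumr_ge0 => i _; exact: normr_ge0.
rewrite -(ler_pXn2r (n := 2)) ?nnegrE ?enorm_ge0 // enorm_sqr expr2 big_distrl /=.
apply: ler_sum => i _; rewrite -expr2 -real_normK ?num_real // expr2 ler_wpM2l ?normr_ge0 //.
by rewrite (bigD1 i) //= lerDl; apply: sumr_ge0 => j _; exact: normr_ge0.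
Qed.

(* The excess of a step along the direction w; for w = 0 it is enorm x. *)
Definition excs x w := enorm x - dotv x w / enorm w.

Lemma excs_ge0 x w : 0 <= excs x w.
Proof.
rewrite subr_ge0; have [->|w0] := eqVneq (enorm w) 0; first by rewrite invr0 mulr0 enorm_ge0.
by rewrite ler_pdivrMr ?CS // lt_neqAle eq_sym w0 enorm_ge0.
Qed.

(* enorm (w / enorm w - (th / 2) n) <= 1 *)
Lemma excs_back x w n (th : R) : dotv n n <= 9 / 4 -> 0 < th <= 1 ->
  th * enorm w <= dotv n w -> - dotv n x * (th / 2) <= excs x w.
Proof.
move=> n2 /andP [th0 th1] hw; rewrite /excs.
have nn : enorm n <= 3 / 2.
  rewrite -(ler_pXn2r (n := 2)) ?nnegrE ?enorm_ge0 ?divr_ge0 // enorm_sqr; apply: le_trans n2 _; lra.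
have [w0|w0] := eqVneq (enorm w) 0.
  rewrite w0 invr0 mulr0 subr0 -dotvNl.
  have := CS (- n) x; rewrite enormN; have := enorm_ge0 x; have := enorm_ge0 n => h1 h2 h3.
  have : dotv (- n) x <= 3 / 2 * enorm x by apply: le_trans h3 _; rewrite ler_wpM2r.
  move=> h4; have t2 : 0 <= th / 2 by move: th0; lra.
  have a1 := ler_wpM2r t2 h4; have a2 : enorm x * th <= enorm x by rewrite ler_piMr.
  by move: a1 a2 h2; lra.
have wp : 0 < enorm w by rewrite lt_neqAle eq_sym w0 enorm_ge0.
set v := (enorm w)^-1 *: w - (th / 2) *: n.
have vv : dotv v v <= 1.
  rewrite /v dotvDl !dotvDr !dotvNl !dotvNr !dotvZl !dotvZr -enorm_sqr (dotvC w n).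
  have -> : (enorm w)^-1 * ((enorm w)^-1 * enorm w ^+ 2) = 1 by field.
  have h : th <= (enorm w)^-1 * dotv n w by rewrite mulrC ler_pdivlMr.
  set a := (enorm w)^-1 * dotv n w in h *.
  have -> : (enorm w)^-1 * (th / 2 * dotv n w) = th / 2 * a by rewrite /a; ring.
  have th0' := ltW th0; have b1 := ler_wpM2l th0' h.
  have b2 := ler_wpM2l (mulr_ge0 th0' th0') n2; have b3 := mulr_ge0 th0' th0'.
  move: b1 b2 b3; lra.
have v1 : enorm v <= 1.
  by rewrite -(ler_pXn2r (n := 2)) ?nnegrE ?enorm_ge0 // enorm_sqr expr1n.
(* Testing [x] against a vector of norm at most one turns the movement against [n] into excess. *)
have := CS x v; rewrite /v dotvDr dotvNr !dotvZr (dotvC x n) => h.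
have h2 : enorm x * enorm v <= enorm x by rewrite ler_piMr ?enorm_ge0.
rewrite -/v in h; rewrite [_ / enorm w]mulrC; lra.
Qed.

Section Slant.
Variable z : 'rV[R]_d.
Hypothesis d0 : (0 < d)%N.
Hypothesis z01 : forall j, 0 <= z 0 j <= (2 * d%:R)^-1.

(** All axes are tilted by the same vector [z]. An untilted axis may be almost orthogonal to a
    chord, and backward movement along it would then produce hardly any excess. *)
Definition slant i x : R := x 0 i + dotv z x.

Lemma slantE i x : slant i x = dotv (delta_mx 0 i + z) x.
Proof.
rewrite dotvDl; congr (_ + _); rewrite /dotv (bigD1 i) //= big1 => [|j ji].
  by rewrite mxE !eqxx mul1r addr0.
by rewrite mxE (negPf ji) andbF mul0r.
Qed.

Lemma slant_norm i : dotv (delta_mx 0 i + z) (delta_mx 0 i + z) <= 9 / 4.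
Proof.
have d1 : 1 <= d%:R :> R by rewrite ler1n.
have dp : 0 < d%:R :> R by rewrite ltr0n.
have e : dotv z (delta_mx 0 i) = z 0 i.
  rewrite /dotv (bigD1 i) //= big1 => [|j ji]; first by rewrite mxE !eqxx mulr1 addr0.
  by rewrite mxE (negPf ji) andbF mulr0.
have zi (j : 'I_d) : z 0 j <= 1 / 2.
  have /andP [_ h] := z01 j; apply: le_trans h _; rewrite -[leRHS]mul1r mul1r.
  rewrite -[(1 / 2)%R]/(1 * 2^-1) mul1r lef_pV2 ?posrE ?mulr_gt0 //; lra.
have zz : dotv z z <= 1 / 4.
  have : dotv z z <= \sum_(j < d) (2 * d%:R)^-1 * (1 / 2).
    by apply: ler_sum => j _; have /andP [h1 h2] := z01 j; apply: ler_pM.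
  rewrite sumr_const card_ord -mulr_natr => h; apply: le_trans h _.
  by rewrite le_eqVlt; apply/orP; left; apply/eqP; field; exact: lt0r_neq0.
have ee : dotv (delta_mx 0 i) (delta_mx 0 i) = 1 :> R.
  rewrite /dotv (bigD1 i) //= big1 => [|j ji]; first by rewrite mxE !eqxx mulr1 addr0.
  by rewrite mxE (negPf ji) andbF mulr0.
rewrite dotvDl !dotvDr (dotvC _ z) e ee; have := zi i; lra.
Qed.

Lemma slantB i x y : slant i (x - y) = slant i x - slant i y.
Proof. by rewrite !slantE dotvDr dotvNr. Qed.

(** The tilt can be inverted: [s * (1 + sz)] is a combination of the slanted coordinates with
    weights of sum at most 1/2, so [s] is at most [M / 2], and each plain coordinate is at most
    [2 * M]. *)
Lemma slant_bound x M : (forall i, `|slant i x| <= M) -> enorm x <= 2 * d%:R * M.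
Proof.
move=> h; have dp : 0 < d%:R :> R by rewrite ltr0n.
have M0 : 0 <= M by apply: le_trans (h (Ordinal d0)); exact: normr_ge0.
set s := dotv z x; set sz := \sum_(j < d) z 0 j.
have sz0 : 0 <= sz by apply: sumr_ge0 => j _; case/andP: (z01 j).
have sz1 : sz <= 1 / 2.
  apply: (@le_trans _ _ (\sum_(j < d) (2 * d%:R)^-1)); first by apply: ler_sum => j _; case/andP: (z01 j).
  rewrite sumr_const card_ord -mulr_natr le_eqVlt; apply/orP; left; apply/eqP; field.
  exact: lt0r_neq0.
have sE : s * (1 + sz) = \sum_(j < d) z 0 j * slant j x.
  rewrite /slant (eq_bigr (fun j => z 0 j * x 0 j + z 0 j * s)); last by move=> j _; rewrite mulrDr.
  by rewrite big_split /= -mulr_suml -/sz -/s; rewrite -/(dotv z x) -/s; ring.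
have s1 : `|s| <= M / 2.
  have : `|s * (1 + sz)| <= M / 2.
    rewrite sE; apply: le_trans (ler_norm_sum _ _ _) _.
    apply: (@le_trans _ _ (\sum_(j < d) z 0 j * M)).
      apply: ler_sum => j _; rewrite normrM; have /andP [z0 _] := z01 j.
      by rewrite ger0_norm // ler_wpM2l.
    by rewrite -mulr_suml -/sz; have := ler_wpM2r M0 sz1; lra.
  rewrite normrM [`|1 + sz|]ger0_norm; last by lra.
  by have := mulr_ge0 (normr_ge0 s) sz0; lra.
apply: le_trans (enorm_sum x) _.
apply: (@le_trans _ _ (\sum_(i < d) 2 * M)).
  apply: ler_sum => i _; have -> : x 0 i = slant i x - s by rewrite /slant addrK.
  by apply: le_trans (ler_normB _ _) _; have := h i; move: s1 M0; lra.
by rewrite sumr_const card_ord -mulr_natr; lra.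
Qed.

End Slant.

Variables (u Q : nat).
Hypothesis d0 : (0 < d)%N.
Hypothesis duQ : (d * u < Q)%N.
(** A grid of [Q ^ d] candidate tilts, few enough to be enumerated; [Q] exceeds the number [d * u]
    of conditions to be avoided. *)
Definition zvec (z : {ffun 'I_d -> 'I_Q}) : 'rV[R]_d :=
  \row_j ((z j)%:R / (2 * d%:R * Q%:R)).
Definition theta : R := (4 * d%:R ^+ 2 * Q%:R)^-1.

Lemma zvec01 z j : 0 <= zvec z 0 j <= (2 * d%:R)^-1.
Proof.
have Q0 : 0 < Q%:R :> R by rewrite ltr0n (leq_ltn_trans _ duQ).
have dp : 0 < d%:R :> R by rewrite ltr0n.
rewrite mxE; apply/andP; split; first by apply: divr_ge0 => //; rewrite !mulr_ge0 // ltW.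
rewrite ler_pdivrMr; last by rewrite !mulr_gt0.
have -> : (2 * d%:R)^-1 * (2 * d%:R * Q%:R) = Q%:R :> R by field; exact: lt0r_neq0.
by rewrite ler_nat; exact: ltnW (ltn_ord _).
Qed.

Lemma theta01 : 0 < theta <= 1.
Proof.
have Q1 : 1 <= Q%:R :> R by rewrite ler1n (leq_ltn_trans _ duQ).
have d1 : 1 <= d%:R :> R by rewrite ler1n.
have d2 : 1 <= d%:R ^+ 2 :> R by rewrite exprn_ege1.
have p : 1 <= 4 * d%:R ^+ 2 * Q%:R :> R by apply: mulr_ege1 => //; move: d2; lra.
rewrite /theta invr_gt0 (lt_le_trans ltr01 p) /= invf_le1 //; exact: lt_le_trans ltr01 p.
Qed.

Lemma slant_step (w : 'rV[R]_d) (z z' : {ffun 'I_d -> 'I_Q}) m i :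
  (forall j, j != m -> z j = z' j) ->
  slant (zvec z) i w - slant (zvec z') i w =
  ((z m)%:R - (z' m)%:R) / (2 * d%:R * Q%:R) * w 0 m.
Proof.
move=> h.
have -> : slant (zvec z) i w - slant (zvec z') i w = dotv (zvec z) w - dotv (zvec z') w.
  by rewrite /slant; ring.
rewrite /dotv [X in X - _](bigD1 m) //= [X in _ - X](bigD1 m) //=.
rewrite (eq_bigr (fun j => zvec z' 0 j * w 0 j)); last by move=> j jm; rewrite !mxE h.
rewrite opprD addrACA subrr addr0 !mxE -!mulrBl; congr (_ * _); by rewrite mulrBl.
Qed.

(** Counting. For one axis and one chord, take an entry [m] of the chord of size at least its norm
    over [d]. Two bad tilts differing only in entry [m] would make the slanted coordinate jump too
    far, so a bad tilt is determined by its other entries, and [d * u] such sets cannot cover all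
    tilts. *)
Lemma good_dir (ws : 'I_u -> 'rV[R]_d) : exists z, forall i j,
  theta * enorm (ws j) <= `|slant (zvec z) i (ws j)|.
Proof.
have Q0 : 0 < Q%:R :> R by rewrite ltr0n (leq_ltn_trans _ duQ).
have dp : 0 < d%:R :> R by rewrite ltr0n.
pose bad (ij : 'I_d * 'I_u) : {set {ffun 'I_d -> 'I_Q}} :=
  [set z | `|slant (zvec z) ij.1 (ws ij.2)| < theta * enorm (ws ij.2)].
have cb ij : (#|bad ij| * Q <= Q ^ d)%N.
  case: ij => i j; set w := ws j.
  have [m wm] : exists m, enorm w <= d%:R * `|w 0 m|.
    apply: contrapT => hn; have lt m : d%:R * `|w 0 m| < enorm w.
      by rewrite ltNge; apply/negP => h; apply: hn; exists m.
    have : \sum_(m < d) d%:R * `|w 0 m| < \sum_(m < d) enorm w.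
      apply: ltr_sum => [|m _]; last exact: lt.
      by apply/hasP; exists (Ordinal d0) => //; rewrite mem_index_enum.
    rewrite sumr_const card_ord -mulr_sumr -[enorm w *+ d]mulr_natl ltr_pM2l //.
    by rewrite ltNge enorm_sum.
  pose f (zc : {ffun 'I_d -> 'I_Q} * 'I_Q) : {ffun 'I_d -> 'I_Q} :=
    [ffun x => if x == m then zc.2 else zc.1 x].
  have inj : {in setX (bad (i, j)) [set: 'I_Q] &, injective f}.
    move=> [z c] [z' c']; rewrite !inE /= !andbT => bz bz' /ffunP e.
    have ec : c = c' by have := e m; rewrite !ffunE eqxx.
    have ez (x : 'I_d) : x != m -> z x = z' x by move=> xm; have := e x; rewrite !ffunE (negPf xm).
    suff zm : z m = z' m.
      by rewrite ec; congr (_, _); apply/ffunP => x; case: (eqVneq x m) => [->|/ez].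
    apply/eqP; case: (eqVneq (z m) (z' m)) => // ne; exfalso.
    have st := slant_step w i ez.
    have big : 2 * theta * enorm w <= `|slant (zvec z) i w - slant (zvec z') i w|.
      rewrite st !normrM normfV [`|2 * d%:R * Q%:R|]ger0_norm ?mulr_ge0 //.
      have n1 : 1 <= `|(z m)%:R - (z' m)%:R| :> R.
        have : (z m : nat) != z' m by apply: contra ne => /eqP /val_inj ->.
        rewrite neq_ltn => /orP [lt|lt].
          by rewrite distrC -natrB ?(ltnW lt) // ger0_norm // ler1n subn_gt0.
        by rewrite -natrB ?(ltnW lt) // ger0_norm // ler1n subn_gt0.
      apply: (@le_trans _ _ (1 / (2 * d%:R * Q%:R) * `|w 0 m|)); last first.
        by apply: ler_wpM2r; rewrite ?normr_ge0 // ler_wpM2r // invr_ge0 !mulr_ge0.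
      have -> : 2 * theta * enorm w = 1 / (2 * d%:R * Q%:R) * (enorm w / d%:R).
        by rewrite /theta; field; rewrite !lt0r_neq0.
      apply: ler_wpM2l; first by rewrite divr_ge0 // !mulr_ge0.
      by rewrite ler_pdivrMr // mulrC.
    have := ler_normB (slant (zvec z) i w) (slant (zvec z') i w).
    by move: big bz bz'; rewrite -/w; lra.
  have := max_card (mem (f @: setX (bad (i, j)) [set: 'I_Q])).
  by rewrite (card_in_imset inj) cardsX cardsT card_ord card_ffun !card_ord.
have cu : (#|\bigcup_ij bad ij| * Q < Q ^ d * Q)%N.
  have h : (#|\bigcup_ij bad ij| <= \sum_ij #|bad ij|)%N.
    elim/big_ind2: _ => [|A a B b hA hB|]; rewrite ?cards0 //.
    by apply: leq_trans (leq_add hA hB); rewrite cardsU leq_subr.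
  apply: (@leq_ltn_trans (\sum_(ij : 'I_d * 'I_u) Q ^ d)).
    by apply: (leq_trans (leq_mul h (leqnn Q))); rewrite big_distrl /=; apply: leq_sum => ij _.
  rewrite sum_nat_const card_prod !card_ord mulnC ltn_pmul2l ?duQ //.
  by rewrite expn_gt0 (leq_ltn_trans _ duQ).
have [z zn] : exists z, z \notin \bigcup_ij bad ij.
  apply: contrapT => hn; move: cu; rewrite (_ : \bigcup_ij bad ij = setT).
    by rewrite cardsT card_ffun !card_ord ltnn.
  by apply/setP => z; rewrite inE; apply/negPn/negP => h; apply: hn; exists z.
exists z => i j; rewrite leNgt; apply/negP => h; case/negP: zn.
by apply/bigcupP; exists (i, j) => //; rewrite inE.
Qed.

End Vec.

(** * Compression of large gaps, and floors by subtraction *)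

Section Compress.
Variables (R : realType) (G : R) (vs : seq R).
Hypothesis G0 : 0 < G.

(** Equality of reals is tested by two comparisons, which is what the machine provides. *)
Definition rundup (s : seq R) : seq R :=
  foldl (fun acc x => if has (fun y => (x <= y) && (y <= x)) acc then acc else x :: acc) [::] s.
(** The distance to the next larger value, truncated at [G]; the largest value gets [G]. *)
Definition gapf (a : R) : R :=
  foldl (fun acc b => if b <= a then acc else if acc <= b - a then acc else b - a) G vs.
Definition rsum (s : seq R) : R := foldl (fun acc x => acc + x) 0 s.
(** The truncated gaps below [v] are added up. The range becomes at most [G] times the number of
    values, however far the points are spread, while differences that come out below [G] are
    unchanged. *)
Definition compress (v : R) : R := rsum [seq gapf a | a <- rundup vs & ~~ (v <= a)].

Lemma rsumE s : rsum s = \sum_(x <- s) x.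
Proof.
suff h c : foldl (fun acc x => acc + x) c s = c + \sum_(x <- s) x by rewrite /rsum h add0r.
elim: s c => [|x s IH] c /=; first by rewrite big_nil addr0.
by rewrite IH big_cons addrA.
Qed.

Lemma rundupP s : uniq (rundup s) /\ rundup s =i s.
Proof.
suff h acc : uniq acc -> let r := foldl (fun acc x =>
    if has (fun y => (x <= y) && (y <= x)) acc then acc else x :: acc) acc s in
    uniq r /\ r =i acc ++ s by exact: h.
elim: s acc => [|x s IH] acc ua /=; first by rewrite cats0.
have hE : has (fun y => (x <= y) && (y <= x)) acc = (x \in acc).
  by rewrite -has_pred1; apply: eq_has => y /=; rewrite -eq_le eq_sym.
rewrite hE; case: ifPn => xa.
  have [h1 h2] := IH acc ua; split=> // y; rewrite h2 !mem_cat inE.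
  by case: eqP => [->|]; rewrite ?xa // orbT.
have [|h1 h2] := IH (x :: acc); first by rewrite /= xa.
by split=> // y; rewrite h2 !mem_cat !inE orbCA orbA.
Qed.

Lemma gapfP a : [/\ 0 < gapf a, gapf a <= G, (forall b, b \in vs -> a < b -> gapf a <= b - a) &
  gapf a < G -> exists2 b, b \in vs & a < b /\ gapf a = b - a].
Proof.
suff h g : 0 < g -> g <= G -> (g < G -> exists2 b, b \in vs & a < b /\ g = b - a) ->
    forall s, {subset s <= vs} ->
    let r := foldl (fun acc b => if b <= a then acc else if acc <= b - a then acc else b - a) g s in
    [/\ 0 < r, r <= g, (forall b, b \in s -> a < b -> r <= b - a) &
    r < G -> exists2 b, b \in vs & a < b /\ r = b - a].
  have hG : G < G -> exists2 b, b \in vs & a < b /\ G = b - a by rewrite ltxx.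
  exact: (h G G0 (lexx _) hG vs (fun _ => id)).
move=> + + + s; elim: s g => [|b s IH] g g0 gG ge sv /=; first by split.
have sv' : {subset s <= vs} by move=> x xs; apply: sv; rewrite inE xs orbT.
case: ifPn => [ba|]; last rewrite -ltNge => ab.
  have [h1 h2 h3 h4] := IH g g0 gG ge sv'; split=> // c; rewrite inE => /orP [/eqP ->|]; last exact: h3.
  by rewrite ltNge ba.
case: ifPn => [gb|]; last rewrite -ltNge => gb.
  have [h1 h2 h3 h4] := IH g g0 gG ge sv'; split=> // c; rewrite inE => /orP [/eqP -> _|]; last exact: h3.
  exact: le_trans gb.
have [||||h1 h2 h3 h4] := IH (b - a) => //.
- by rewrite subr_gt0.
- by rewrite ltW // (lt_le_trans gb).
- by move=> _; exists b => //; apply: sv; rewrite mem_head.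
split=> //; first by apply: le_trans h2 _; exact: ltW.
by move=> c; rewrite inE => /orP [/eqP ->|]; last exact: h3.
Qed.

Let S := rundup vs.
Lemma compress_diff v v' : v <= v' ->
  compress v' - compress v = \sum_(a <- S | (v <= a) && (a < v')) gapf a.
Proof.
move=> vv; rewrite /compress !rsumE !big_map !big_filter.
rewrite (bigID (fun a => a < v)) /= [X in X + _ - _](eq_bigl (fun a => ~~ (v <= a))); last first.
  move=> a; rewrite -!ltNge; case: (ltP a v) => h; rewrite ?andbT ?andbF //.
  by rewrite (lt_le_trans h).
rewrite addrAC subrr add0r; apply: eq_bigl => a; rewrite -leNgt -ltNge andbC; by [].
Qed.

Lemma seq_least (s : seq R) v : (exists2 b, b \in s & v < b) ->
  exists v1, [/\ v1 \in s, v < v1 & forall b, b \in s -> v < b -> v1 <= b].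
Proof.
elim: s => [[b //]|x s IH [b bx vb]].
case: (pselect (exists2 b, b \in s & v < b)) => [/IH [v1 [h1 h2 h3]]|hn].
  case: (boolP ((v < x) && (x < v1))) => [/andP [vx xv]|nx].
    exists x; split=> //; rewrite ?mem_head // => c; rewrite inE => /orP [/eqP -> //|cs vc].
    by apply: le_trans (ltW xv) _; exact: h3.
  exists v1; split; rewrite ?inE ?h1 ?orbT // => c; rewrite inE => /orP [/eqP ->|]; last exact: h3.
  by move=> vx; rewrite leNgt; apply: contra nx => ->; rewrite vx.
have bE : b = x.
  by move: bx; rewrite inE => /orP [/eqP //|bs]; exfalso; apply: hn; exists b.
rewrite bE in vb; exists x; split; rewrite ?mem_head // => c; rewrite inE => /orP [/eqP -> //|cs vc].
by exfalso; apply: hn; exists c.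
Qed.

(** Induction on the number of values in between, passing to the least value above [v]. A compressed
    difference below [G] means that no gap on the way was truncated. *)
Lemma compressP v v' : v \in vs -> v' \in vs -> v <= v' ->
  [/\ 0 <= compress v' - compress v, compress v' - compress v <= v' - v &
      compress v' - compress v < G -> compress v' - compress v = v' - v].
Proof.
have [uS mS] := rundupP vs.
have [n] := ubnP (size [seq a <- S | (v <= a) && (a < v')]).
elim: n v => // n IH v cn vv vv' le.
move: (le); rewrite le_eqVlt => /orP [/eqP ->|lt].
  by rewrite !subrr; split.
have [v1 [v1s vv1 v1m]] : exists v1, [/\ v1 \in vs, v < v1 & forall b, b \in vs -> v < b -> v1 <= b].
  by apply: seq_least; exists v'.
have [gp gG gm gx] := gapfP v.
have v1v : v1 <= v' by exact: v1m.
have pm : perm_eq [seq a <- S | (v <= a) && (a < v')] (v :: [seq a <- S | (v1 <= a) && (a < v')]).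
  apply: uniq_perm; first by rewrite filter_uniq.
    by rewrite /= filter_uniq // andbT mem_filter leNgt vv1.
  move=> a; rewrite inE !mem_filter mS; case av : (a \in vs); last first.
    by rewrite !andbF orbF; apply/esym/negP => /eqP e; rewrite e vv in av.
  rewrite !andbT; case: (eqVneq a v) => [->|ne]; first by rewrite lexx lt.
  congr (_ && _); apply/idP/idP => [h|h]; last exact: le_trans (ltW vv1) h.
  by apply: v1m => //; rewrite lt_def ne.
have cE : compress v' - compress v = gapf v + (compress v' - compress v1).
  rewrite (compress_diff le) (compress_diff v1v) -big_filter (perm_big _ pm) /= big_cons.
  by rewrite big_filter.
have cn1 : (size [seq a <- S | (v1 <= a)%R && (a < v')%R] < n)%N by move: cn; rewrite (perm_size pm).
have [h1 h2 h3] := IH v1 cn1 v1s vv' v1v.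
have g1 : gapf v <= v1 - v by exact: gm.
rewrite cE; split; first by rewrite addr_ge0 // ltW.
  by move: g1 h2; lra.
move=> lG; have gl : gapf v < G by move: lG h1; lra.
have [b bs [vb gE]] := gx gl; have v1b := v1m b bs vb.
have -> : compress v' - compress v1 = v' - v1 by apply: h3; move: lG gp; lra.
by move: gE v1b g1; lra.
Qed.

Lemma compress_bound v : 0 <= compress v <= (size vs)%:R * G.
Proof.
have [uS mS] := rundupP vs.
rewrite /compress rsumE big_map; apply/andP; split.
  by apply: sumr_ge0 => a _; apply: ltW; case: (gapfP a).
apply: (@le_trans _ _ (\sum_(a <- S) G)).
  rewrite big_filter big_mkcond; apply: ler_sum => a _; case: ifP => _; last exact: ltW.
  by case: (gapfP a).
rewrite big_const_seq count_predT iter_addr_0 -[leLHS]mulr_natl.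
apply: ler_wpM2r; first exact: ltW.
rewrite ler_nat.
by apply: uniq_leq_size uS _ => a; rewrite mS.
Qed.

End Compress.

Section Floor.
Variables (R : realType) (rho : R).
(** The floor of [x / rho] by counting subtractions; [cap] bounds the number of rounds. *)
Definition fl (cap : nat) (x : R) : nat :=
  (iter cap (fun s : nat * R => if rho <= s.2 then (s.1.+1, s.2 - rho) else s) (0%N, x)).1.

Lemma fl_cap cap x : (fl cap x <= cap)%N.
Proof. by rewrite /fl; elim: cap => //= c IH; case: ifP => // _; exact: leqW. Qed.

Lemma flP cap x : 0 < rho -> 0 <= x -> x < cap%:R * rho ->
  (fl cap x)%:R * rho <= x < (fl cap x).+1%:R * rho.
Proof.
move=> r0 x0 xc.
have inv j : let s := iter j (fun s : nat * R => if rho <= s.2 then (s.1.+1, s.2 - rho) else s) (0%N, x) in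
    [/\ s.1%:R * rho + s.2 = x, 0 <= s.2 & s.2 < rho \/ s.1 = j].
  elim: j => [|j [h1 h2 h3]] /=; first by rewrite mul0r add0r; split=> //; right.
  case: ifPn => h /=; last by split=> //; left; rewrite ltNge.
  split; rewrite ?subr_ge0 //; first by rewrite -natr1; lra.
  by case: h3 => [h3|->]; [rewrite ltNge h in h3|right].
have [h1 h2 h3] := inv cap; rewrite /fl; set s := iter _ _ _ in h1 h2 h3 *.
have h4 : s.2 < rho by case: h3 => // e; move: h1 xc; rewrite e; lra.
by rewrite -natr1; apply/andP; split; lra.
Qed.
End Floor.
End Geo.

(** * The constants, and the total error of at most E/u *)

Module Main.
Import DP Walk Bridge Count Geo.

Set Implicit Arguments.
Unset Strict Implicit.
Unset Printing Implicit Defensive.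
Import Order.TTheory GRing.Theory Num.Theory.
Local Open Scope ring_scope.

Section Core.
Variables (R : realType) (d u n k l1 mM mu' : nat).
Let Q := (d * u).+1.
(** The number 48 makes the rounding error a quarter of the allowance: [2 * (2 * d * rho) * (3 * n)]
    equals [E0 / (4 * u)] for [rho = E0 / Nr]. *)
Let Nr := (48 * n * d * u)%N.
Let N := n.+1.
Let cap := (N * 2 ^ (l1 + 2)).+1.
Hypothesis d0 : (0 < d)%N.
Hypothesis u0 : (0 < u)%N.
Hypothesis n0 : (0 < n)%N.
Hypothesis kn : (k <= n)%N.
(** The three lower bounds on powers of two give, in this order, [TV <= 2 ^ l1], an uncrossing cost
    of at most [E / (4 * u)] and a portal cost of at most [E / (4 * u)]. *)
Hypothesis hl1 : (36 * d ^ 3 * Q * n * Nr <= 2 ^ l1)%N.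
Hypothesis hM : (96 * 108 * d ^ 5 * Q * u <= 2 ^ mM)%N.
Hypothesis hm : (96 * 96 * d ^ 5 * Q * u * l1.+2 <= 2 ^ mu')%N.
Variables (X : nat -> 'rV[R]_d) (pi pj : nat -> nat) (ws : nat -> 'rV[R]_d).
Hypothesis pju : forall t, (pj t < u)%N.
Hypothesis pjm : forall t t', (t <= t')%N -> (pj t <= pj t')%N.
Hypothesis piN : forall t, (pi t < N)%N.
Hypothesis pi0 : pi 0%N = 0%N.
Hypothesis piI : forall t t', (t <= k)%N -> (t' <= k)%N -> pi t = pi t' -> t = t'.
Variable ds : seq (seq R).
Hypothesis dm_ge0 : forall i j, 0 <= dm ds i j.
Hypothesis dmE : forall i j, (i < N)%N -> (j < N)%N -> dm ds i j = enorm (X i - X j).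
Let stepv t := X (pi t.+1) - X (pi t).
Let e t := excs (stepv t) (ws (pj t)).
Variables E E0 : R.
Hypothesis EE : \sum_(t < k) e t <= E.
Hypothesis E00 : 0 < E0.
Hypothesis En : E <= n%:R * E0.
(** Either the scale does not exceed [E], or the path has no excess at all and [E0] is so small that
    points closer than [E0] coincide, whence rounding loses nothing. *)
Hypothesis cases : E0 <= E \/
  (E = 0 /\ forall p q, (p < N)%N -> (q < N)%N -> enorm (X p - X q) < E0 -> enorm (X p - X q) = 0).

Let rho := E0 / Nr%:R.
(** The truncation exceeds the side of every cell of level at most [l1], so points sharing such a
    cell are close before compression as well. *)
Let G := rho * (2 ^ (l1 + 2))%:R.
Definition Yspec (z : {ffun 'I_d -> 'I_Q}) (Yp : nat -> nat -> nat) :=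
  (forall p i, (Yp p i <= cap)%N) /\ forall p (i : 'I_d), (p < N)%N -> Yp p i =
   fl rho cap (compress G [seq slant (zvec R z) i (X q) | q <- iota 0 N] (slant (zvec R z) i (X p))).

Lemma Nr_gt0 : 0 < Nr%:R :> R. Proof. by rewrite ltr0n !muln_gt0 n0 d0 u0. Qed.
Lemma rho_gt0 : 0 < rho. Proof. by rewrite divr_gt0 ?Nr_gt0. Qed.
Lemma G_gt0 : 0 < G. Proof. by rewrite mulr_gt0 ?rho_gt0 // ltr0n expn_gt0. Qed.
Lemma rD0 : 0 <= 2 * d%:R * rho.
Proof. by apply: mulr_ge0; [apply: mulr_ge0|exact: ltW rho_gt0]. Qed.
Lemma duQ : (d * u < Q)%N. Proof. exact: ltnSn. Qed.

Section Z.
Variables (z : {ffun 'I_d -> 'I_Q}) (Yp : nat -> nat -> nat).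
Hypothesis YS : Yspec z Yp.
Let sl (i : 'I_d) p := slant (zvec R z) i (X p).
Let cm (i : 'I_d) p := compress G [seq slant (zvec R z) i (X q) | q <- iota 0 N] (sl i p).

Lemma sl_mem (i : 'I_d) p : (p < N)%N -> sl i p \in [seq slant (zvec R z) i (X q) | q <- iota 0 N].
Proof. by move=> pN; apply: map_f; rewrite mem_iota0. Qed.

Lemma Y_floor (i : 'I_d) p : (p < N)%N ->
  (Yp p i)%:R * rho <= cm i p < (Yp p i).+1%:R * rho.
Proof.
move=> pN; have [_ ->] := YS => //; apply: flP; first exact: rho_gt0.
  by case/andP: (compress_bound [seq slant (zvec R z) i (X q) | q <- iota 0 N] G_gt0 (sl i p)).
have /andP [_ h] := compress_bound [seq slant (zvec R z) i (X q) | q <- iota 0 N] G_gt0 (sl i p).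
apply: le_lt_trans h _; rewrite size_map size_iota /G mulrCA [rho * _]mulrC ltr_pM2r ?rho_gt0 //.
by rewrite -natrM ltr_nat.
Qed.

Lemma Y_diff (i : 'I_d) p q : (p < N)%N -> (q < N)%N -> sl i p <= sl i q ->
  (Yp p i <= Yp q i)%N /\ (Yp q i - Yp p i)%:R * rho <= sl i q - sl i p + rho.
Proof.
move=> pN qN le; have [h1 h2 _] := compressP G_gt0 (sl_mem i pN) (sl_mem i qN) le.
rewrite -/(cm i p) -/(cm i q) in h1 h2.
have /andP [a1 a2] := Y_floor i pN; have /andP [b1 b2] := Y_floor i qN; have r0 := rho_gt0.
have le1 : (Yp p i <= Yp q i)%N.
  rewrite -ltnS -(ltr_nat R) -(ltr_pM2r r0); apply: le_lt_trans a1 _; apply: le_lt_trans b2.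
  by rewrite -subr_ge0.
split=> //; rewrite natrB // mulrBl.
by move: a2 b1 h2; rewrite -natr1 mulrDl mul1r; lra.
Qed.

(** Within such a cell the compressed values differ by less than [G], so compression did not change
    their difference. *)
Lemma sl_close l b (i : 'I_d) p q : (p < N)%N -> (q < N)%N -> (l <= l1)%N ->
  ((Yp p i + b) %/ 2 ^ l = (Yp q i + b) %/ 2 ^ l)%N -> `|sl i p - sl i q| <= (2 ^ l)%:R * rho.
Proof.
wlog le : p q / sl i p <= sl i q.
  move=> h pN qN ll eq; case: (leP (sl i p) (sl i q)) => [|/ltW] le; first exact: h.
  by rewrite distrC; apply: h.
move=> pN qN ll eq; have [h1 h2 h3] := compressP G_gt0 (sl_mem i pN) (sl_mem i qN) le.
rewrite -/(cm i p) -/(cm i q) in h1 h2 h3.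
have /andP [a1 a2] := Y_floor i pN; have /andP [b1 b2] := Y_floor i qN; have r0 := rho_gt0.
have [le1 _] := Y_diff pN qN le.
have dY : ((Yp q i).+1 <= Yp p i + 2 ^ l)%N.
  have p2 : (0 < 2 ^ l)%N by rewrite expn_gt0.
  have := ltn_ceil (Yp q i + b) p2; have := leq_trunc_div (Yp p i + b) (2 ^ l).
  by rewrite eq mulSn; move: ((_ %/ _) * _)%N => m; clear; lia.
have dY' : (Yp q i).+1%:R <= (Yp p i)%:R + (2 ^ l)%:R :> R by rewrite -natrD ler_nat.
have cl : cm i q - cm i p < (2 ^ l)%:R * rho.
  by have := ler_wpM2r (ltW r0) dY'; rewrite mulrDl; move: a1 b2; lra.
have lG : (2 ^ l)%:R * rho <= G.
  rewrite /G mulrC ler_wpM2l ?(ltW r0) // ler_nat leq_exp2l //; exact: leq_trans ll (leq_addr _ _).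
have := h3 (lt_le_trans cl lG) => eqc.
by rewrite distrC ger0_norm ?subr_ge0 // -eqc ltW.
Qed.

Lemma close_dist l b p q : (p < N)%N -> (q < N)%N -> (l <= l1)%N ->
  (forall i, (i < d)%N -> ((Yp p i + b) %/ 2 ^ l = (Yp q i + b) %/ 2 ^ l)%N) ->
  dm ds p q <= 2 * d%:R * rho * 2 ^+ l.
Proof.
move=> pN qN ll h; rewrite dmE // -mulrA [rho * _]mulrC -natrX.
apply: (@slant_bound _ _ (zvec R z) d0) => [j|i]; first exact: (@zvec01 R d u Q d0 duQ).
rewrite slantB.
exact: (sl_close pN qN ll (h i (ltn_ord i))).
Qed.

Hypothesis good : forall (i : 'I_d) (j : 'I_u),
  theta R d Q * enorm (ws j) <= `|slant (zvec R z) i (ws j)|.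
Let th := theta R d Q.
(** The direction of progress on an axis is the sign of the chord there; [good] keeps the chord away
    from zero on every axis. *)
Let up (j i : nat) := if insub i is Some i' then 0 <= slant (zvec R z) i' (ws j) else true.

Lemma e_ge0 t : 0 <= e t. Proof. exact: excs_ge0. Qed.

(** The excess pays for the movement against the chord. Rounding adds at most one grid unit, and
    only if there is backward movement, hence positive excess; thus nothing is added when the excess
    vanishes. *)
Lemma bkY_bound t (i : 'I_d) :
  (bkY (Yt Yp pi) pj up t i)%:R * rho * th <= 2 * e t + rho * th * (nat_of_bool (0 < e t)%R)%:R.
Proof.
have /andP [th0 th1] := theta01 R d0 duQ; rewrite -/th in th0 th1.
have r0 := rho_gt0.
have rhs0 : 0 <= 2 * e t + rho * th * (nat_of_bool (0 < e t)%R)%:R.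
  apply: addr_ge0; first by apply: mulr_ge0 => //; exact: e_ge0.
  by apply: mulr_ge0 => //; apply: mulr_ge0; exact: ltW.
have fin p q : (p < N)%N -> (q < N)%N -> (sl i q - sl i p) * (th / 2) <= e t ->
    (Yp q i - Yp p i)%:R * rho * th <= 2 * e t + rho * th * (nat_of_bool (0 < e t)%R)%:R.
  move=> pN qN he; case: (lerP (sl i q) (sl i p)) => [le|lt].
    have [h _] := Y_diff qN pN le; have -> : (Yp q i - Yp p i = 0)%N by apply/eqP; rewrite subn_eq0.
    by rewrite !mul0r.
  have [_ h] := Y_diff pN qN (ltW lt).
  have ep : 0 < e t by apply: lt_le_trans he; rewrite mulr_gt0 ?subr_gt0 // divr_gt0.
  rewrite ep mulr1; have := ler_wpM2r (ltW th0) h; rewrite mulrDl.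
  by move: he; set x := sl i q - sl i p; lra.
have nn := @slant_norm R d (zvec R z) d0 (@zvec01 R d u Q d0 duQ z) i.
have hg := good i (Ordinal (pju t)); rewrite -/th /= in hg.
rewrite /bkY /Yt /up valK /=; case: (lerP 0 (slant _ _ _)) => sg.
  apply: fin => //; rewrite ger0_norm // slantE in hg.
  have := excs_back (stepv t) nn _ hg; rewrite th0 th1 => /(_ isT).
  by rewrite -slantE slantB opprB.
apply: fin => //; rewrite ltr0_norm // slantE -dotvNl in hg.
have nn' : dotv (- (delta_mx 0 i + zvec R z)) (- (delta_mx 0 i + zvec R z)) <= 9 / 4.
  by rewrite dotvNl dotvNr opprK.
have := excs_back (stepv t) nn' _ hg; rewrite th0 th1 => /(_ isT).
by rewrite dotvNl opprK -slantE slantB.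
Qed.

Let TV := F d k (Yt Yp pi) cap.+1 pj 0 0 (iota 0 k.+1).

Lemma E_ge0 : 0 <= E.
Proof. by apply: le_trans EE; apply: sumr_ge0 => t _; exact: e_ge0. Qed.

(** The factor 9 is the 3 of [TV_bound] times [2 * E] for the moves and [E] for the rounding; [d]
    counts the axes. *)
Lemma TV_real : TV%:R * rho * th <= 9 * d%:R * E.
Proof.
have /andP [th0 th1] := theta01 R d0 duQ; rewrite -/th in th0 th1.
have r0 := rho_gt0; have dp : 0 <= d%:R :> R by [].
have YY t i : (Yt Yp pi t i < cap.+1)%N by have [h _] := YS; rewrite ltnS h.
have := TV_bound d k YY pju pjm up; rewrite -/TV -(ler_nat R) natrM natr_sum => h.
have h1 : TV%:R * rho * th <= 3 * (\sum_(t < k) (\sum_(i < d) bkY (Yt Yp pi) pj up t i)%:R) * rho * th.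
  by apply: ler_wpM2r; [exact: ltW|apply: ler_wpM2r; [exact: ltW|]].
apply: le_trans h1 _.
have h2 : (\sum_(t < k) (\sum_(i < d) bkY (Yt Yp pi) pj up t i)%:R) * rho * th <=
    d%:R * (2 * E + rho * th * k%:R * (nat_of_bool (0 < E)%R)%:R).
  rewrite !mulr_suml.
  apply: (@le_trans _ _ (\sum_(t < k) d%:R * (2 * e t + rho * th * (nat_of_bool (0 < E)%R)%:R))).
    apply: ler_sum => t _; rewrite natr_sum !mulr_suml.
    have et : e t <= E.
      by apply: le_trans EE; rewrite (bigD1 t) //= lerDl; apply: sumr_ge0 => s _; exact: e_ge0.
    apply: (@le_trans _ _ (\sum_(i < d) (2 * e t + rho * th * (nat_of_bool (0 < E)%R)%:R))).
      apply: ler_sum => i _; apply: le_trans (bkY_bound t i) _; rewrite lerD2l; apply: ler_wpM2l; first by rewrite mulr_ge0 // ltW.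
      by rewrite ler_nat; case: ltP => // ep; rewrite (lt_le_trans ep et).
    by rewrite sumr_const card_ord -[leLHS]mulr_natl.
  rewrite -mulr_sumr ler_wpM2l // big_split /= -mulr_sumr sumr_const card_ord -mulr_natr.
  by move: EE; lra.
(* The [k] rounding units amount to at most [E0], because [k <= n <= Nr]. *)
have h3 : rho * th * k%:R * (nat_of_bool (0 < E)%R)%:R <= E.
  case: (ltP 0 E) => Ep; last by rewrite mulr0 E_ge0.
  rewrite mulr1; case: cases => [EE0|[e0 _]]; last by rewrite e0 ltxx in Ep.
  apply: le_trans EE0; rewrite -mulrA mulrC /rho mulrA ler_pdivrMr ?Nr_gt0 // mulrC; apply: ler_wpM2l; first exact: ltW.
  apply: (@le_trans _ _ k%:R); first by rewrite ler_piMl.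
  rewrite ler_nat /Nr; apply: leq_trans kn _; rewrite -!mulnA mulnCA.
  by rewrite leq_pmulr // !muln_gt0 d0 u0.
have := ler_wpM2l dp h3; move: h2; lra.
Qed.

Lemma TV_l1 : (TV <= 2 ^ l1)%N.
Proof.
have /andP [th0 th1] := theta01 R d0 duQ; rewrite -/th in th0 th1.
apply: leq_trans hl1; rewrite -(ler_nat R).
have h := TV_real; have r0 := rho_gt0; have Np := Nr_gt0.
rewrite -(ler_pM2r r0) -(ler_pM2r th0); apply: le_trans h _.
have Qp : 0 < Q%:R :> R by rewrite ltr0n.
have dp : 0 < d%:R :> R by rewrite ltr0n.
apply: (@le_trans _ _ (9 * d%:R * (n%:R * E0))); first by rewrite ler_wpM2l // mulr_ge0.
have -> : (36 * d ^ 3 * Q * n * Nr)%:R = 36 * d%:R ^+ 3 * Q%:R * n%:R * Nr%:R :> R.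
  by rewrite -natrX -!natrM.
rewrite le_eqVlt; apply/orP; left; apply/eqP; rewrite /rho /th /theta.
by field; rewrite !lt0r_neq0.
Qed.

(** Rounding, portals and uncrossing each take at most a quarter of [E / u]; the numbers 48, 96 * 96
    and 96 * 108 are fitted to this. *)
Lemma error_bound (del : R) : del <= 2 * d%:R * rho -> (E = 0 -> del <= 0) ->
  2 * del * k%:R + 2 * del * N%:R +
  2 * (kap d mu' (2 * d%:R * rho) * l1.+2%:R + Cst mM (2 * d%:R * rho) (kap d mu' (2 * d%:R * rho))) *
  TV%:R <= E / u%:R.
Proof.
move=> del1 del2.
have /andP [th0 th1] := theta01 R d0 duQ; rewrite -/th in th0 th1.
have r0 := rho_gt0; have Np := Nr_gt0; have Ep := E_ge0.
have up0 : 0 < u%:R :> R by rewrite ltr0n.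
have dp : 0 < d%:R :> R by rewrite ltr0n.
have Qp : 0 < Q%:R :> R by rewrite ltr0n.
have np : 0 < n%:R :> R by rewrite ltr0n.
have mp : 0 < 2 ^+ mu' :> R by rewrite exprn_gt0.
have Mp : 0 < 2 ^+ mM :> R by rewrite exprn_gt0.
have thE : th = (4 * d%:R ^+ 2 * Q%:R)^-1 by [].
have T : TV%:R * rho <= 36 * d%:R ^+ 3 * Q%:R * E.
  have h := TV_real; rewrite -(ler_pM2r th0); apply: le_trans h _.
  by rewrite le_eqVlt; apply/orP; left; apply/eqP; rewrite thE; field; rewrite !lt0r_neq0.
have p1 : 2 * del * k%:R + 2 * del * N%:R <= E / u%:R / 4.
  case: cases => [EE0|[e0 _]]; last first.
    have d0' := del2 e0; rewrite e0 !mul0r -mulrDr.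
    by rewrite pmulr_lle0 ?mulr_ge0_le0 // ?ltr_pwDr // ?pmulr_rle0 // ltr_wpDl.
  have kN : k%:R + N%:R <= 3 * n%:R :> R.
    by rewrite -natrD -natrM ler_nat /N; move: kn n0; clear; lia.
  have kN0 : 0 <= k%:R + N%:R :> R by rewrite addr_ge0.
  rewrite -mulrDr; apply: (@le_trans _ _ (2 * (2 * d%:R * rho) * (3 * n%:R))).
    apply: le_trans (_ : 2 * (2 * d%:R * rho) * (k%:R + N%:R) <= _).
      by rewrite ler_wpM2r // ler_wpM2l.
    by apply: ler_wpM2l kN; apply: mulr_ge0 => //; exact: rD0.
  have -> : 2 * (2 * d%:R * rho) * (3 * n%:R) = E0 / u%:R / 4.
    by rewrite /rho /Nr !natrM; field; rewrite !lt0r_neq0.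
  by rewrite ler_wpM2r ?invr_ge0 // ler_wpM2r ?invr_ge0.
have hm' : 96 * 96 * d%:R ^+ 5 * Q%:R * u%:R * l1.+2%:R <= 2 ^+ mu' :> R.
  by rewrite -!natrX -!natrM ler_nat.
have hM' : 96 * 108 * d%:R ^+ 5 * Q%:R * u%:R <= 2 ^+ mM :> R.
  by rewrite -!natrX -!natrM ler_nat.
have lp : 0 < l1.+2%:R :> R by rewrite ltr0n.
have p2 : 2 * (kap d mu' (2 * d%:R * rho) * l1.+2%:R) * TV%:R <= E / u%:R / 4.
  rewrite /kap.
  have -> : 2 * (16 * d%:R * (2 * d%:R * rho) / 2 ^+ mu' * l1.+2%:R) * TV%:R =
     64 * d%:R ^+ 2 * l1.+2%:R / 2 ^+ mu' * (TV%:R * rho) by field; rewrite !lt0r_neq0.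
  apply: (@le_trans _ _ (64 * d%:R ^+ 2 * l1.+2%:R / 2 ^+ mu' * (36 * d%:R ^+ 3 * Q%:R * E))).
    by rewrite ler_wpM2l // divr_ge0 ?(ltW mp) // !mulr_ge0 // exprn_ge0.
  have -> : 64 * d%:R ^+ 2 * l1.+2%:R / 2 ^+ mu' * (36 * d%:R ^+ 3 * Q%:R * E) =
     (96 * 96 * d%:R ^+ 5 * Q%:R * u%:R * l1.+2%:R) / 2 ^+ mu' * (E / u%:R / 4).
    by field; rewrite !lt0r_neq0.
  by rewrite ler_piMl ?divr_ge0 ?(ltW up0) // ler_pdivrMr // mul1r.
have p3 : 2 * Cst mM (2 * d%:R * rho) (kap d mu' (2 * d%:R * rho)) * TV%:R <= E / u%:R / 4.
  have k1 : kap d mu' (2 * d%:R * rho) <= 32 * d%:R ^+ 2 * rho.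
    rewrite /kap ler_pdivrMr //; have -> : 16 * d%:R * (2 * d%:R * rho) = 32 * d%:R ^+ 2 * rho * 1 by ring.
    apply: ler_wpM2l; last by apply: exprn_ege1; lra.
    by apply: mulr_ge0; [apply: mulr_ge0 => //; apply: exprn_ge0|exact: ltW].
  have d1 : 1 <= d%:R :> R by rewrite ler1n.
  have dd : d%:R * rho <= d%:R ^+ 2 * rho by rewrite ler_wpM2r ?(ltW r0) // expr2 ler_peMl.
  have c1 : Cst mM (2 * d%:R * rho) (kap d mu' (2 * d%:R * rho)) <= 36 * d%:R ^+ 2 * rho / 2 ^+ mM.
    by rewrite /Cst ler_wpM2r ?invr_ge0 ?(ltW Mp) //; move: k1 dd; lra.
  apply: (@le_trans _ _ (2 * (36 * d%:R ^+ 2 * rho / 2 ^+ mM) * TV%:R)).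
    by rewrite ler_wpM2r // ler_wpM2l.
  have -> : 2 * (36 * d%:R ^+ 2 * rho / 2 ^+ mM) * TV%:R = 72 * d%:R ^+ 2 / 2 ^+ mM * (TV%:R * rho).
    by field; rewrite lt0r_neq0.
  apply: (@le_trans _ _ (72 * d%:R ^+ 2 / 2 ^+ mM * (36 * d%:R ^+ 3 * Q%:R * E))).
    by rewrite ler_wpM2l // divr_ge0 ?(ltW Mp) // mulr_ge0 // exprn_ge0.
  have -> : 72 * d%:R ^+ 2 / 2 ^+ mM * (36 * d%:R ^+ 3 * Q%:R * E) =
     (96 * 108 * d%:R ^+ 5 * Q%:R * u%:R) / 2 ^+ mM * (E / u%:R / 4).
    by field; rewrite !lt0r_neq0.
  by rewrite ler_piMl ?divr_ge0 ?(ltW up0) // ler_pdivrMr // mul1r.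
have pe : 0 <= E / u%:R by rewrite divr_ge0.
by rewrite mulrDr [_ * TV%:R]mulrDl; move: p1 p2 p3 pe; lra.
Qed.

Lemma mu2 : (2 <= mu')%N.
Proof.
rewrite leqNgt; apply/negP => h; have : (2 ^ mu' <= 2)%N by case: (mu') h => [|[|]].
have c : (1 <= d ^ 5 * Q * u * l1.+2)%N by rewrite !muln_gt0 ?expn_gt0 ?d0 ?u0.
have : (96 <= 2 ^ mu')%N.
  by apply: leq_trans hm; rewrite -!mulnA leq_pmulr // !muln_gt0 ?expn_gt0 ?d0 ?u0.
by move=> b1 b2; have := leq_trans b1 b2.
Qed.

Lemma core_z : exists a it q,
  [/\ (a < 2 ^ l1.+1)%N,
      it \in tableL ds (u * 2 + 2) (2 ^ (d * mu')) (RsB d u mM) (d * mu')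
         (scr (2 ^ (d * mu')) (RsB d u mM)) (Ua d N Yp a) (d * (cap.+1 + 2 ^ l1.+1)),
      it.2.2 = [:: q], head 0%N q = 0%N /\ (k <= it.2.1)%N &
      plen ds q <= \sum_(t < k) enorm (stepv t) + E / u%:R].
Proof.
(* For [E = 0] the error must be exactly zero: points rounded alike are closer than [E0] and
   therefore coincide. *)
pose del := if E == 0 then 0 else 2 * d%:R * rho.
have r0 := rho_gt0.
have D0 := rD0.
have del0 : 0 <= del by rewrite /del; case: ifP.
have [YY _] := YS.
have YpY p i : (Yp p i < cap.+1)%N by rewrite ltnS YY.
have ds0 i j : (i < N)%N -> (j < N)%N -> dm ds i j = dm ds j i.
  by move=> iN jN; rewrite !dmE // enorm_sub.
have ds1 i j m : (i < N)%N -> (j < N)%N -> (m < N)%N -> dm ds i m <= dm ds i j + dm ds j m.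
  by move=> iN jN mN; rewrite !dmE // enorm_tri3.
have ds2 i : (i < N)%N -> dm ds i i = 0 by move=> iN; rewrite dmE // subrr enorm0.
have dl p q : (p < N)%N -> (q < N)%N -> (forall i, (i < d)%N -> Yp p i = Yp q i) -> dm ds p q <= del.
  move=> pN qN h; have cl : dm ds p q <= 2 * d%:R * rho.
    have := @close_dist 0 0 p q pN qN (leq0n _); rewrite expr0 mulr1; apply=> i id.
    by rewrite h.
  rewrite /del; case: ifPn => // /eqP e0; case: cases => [EE0|[_ hh]]; first by move: EE0 E00; rewrite e0; lra.
  rewrite dmE // hh // -dmE //; apply: le_lt_trans cl _.
  rewrite /rho mulrA ltr_pdivrMr ?Nr_gt0 // mulrC ltr_pM2l // -natrM ltr_nat /Nr.
  apply: (@leq_trans (48 * d)%N); first by move: d0; clear; lia.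
  by rewrite -!mulnA leq_mul2l /= mulnCA leq_pmulr // muln_gt0 n0 u0.
(* Any [Lam] with all shifted coordinates below [2 ^ Lam] will do, and [x <= 2 ^ x] gives one that
   needs no logarithm. The table then has as many quadtree levels as this bound, still polynomially
   many. *)
have YL : (cap.+1 + 2 ^ l1.+1 <= 2 ^ (cap.+1 + 2 ^ l1.+1))%N by apply: ltnW; exact: ltn_expl.
have [a [it [q [h1 h2 h3 h4 h5]]]] := @bridge d u k l1 mM mu' N cap.+1 Yp pi pj d0 YpY pju pjm piN pi0 piI
  mu2 R ds (2 * d%:R * rho) del dm_ge0 ds0 ds1 ds2 D0 del0 close_dist dl _ YL TV_l1.
exists a, it, q; split=> //; apply: le_trans h5 _.
have -> : \sum_(t < k) dm ds (pi t) (pi t.+1) = \sum_(t < k) enorm (stepv t).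
  by apply: eq_bigr => t _; rewrite dmE // enorm_sub.
rewrite -!addrA lerD2l !addrA; apply: error_bound.
  by rewrite /del; case: ifP.
by move=> e0; rewrite /del e0 eqxx.
Qed.

End Z.

(** The tilt depends only on the chords, so it is fixed before the rounded coordinates are given. *)
Theorem core : exists z : {ffun 'I_d -> 'I_Q}, forall Yp, Yspec z Yp -> exists a it q,
  [/\ (a < 2 ^ l1.+1)%N,
      it \in tableL ds (u * 2 + 2) (2 ^ (d * mu')) (RsB d u mM) (d * mu')
         (scr (2 ^ (d * mu')) (RsB d u mM)) (Ua d N Yp a) (d * (cap.+1 + 2 ^ l1.+1)),
      it.2.2 = [:: q], head 0%N q = 0%N /\ (k <= it.2.1)%N &
      plen ds q <= \sum_(t < k) enorm (stepv t) + E / u%:R].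
Proof.
have [z hz] := good_dir d0 duQ (fun j : 'I_u => ws j).
by exists z => Yp YS; exact: (core_z YS hz).
Qed.

End Core.
End Main.

(** * A logic for timed RAM programs working on lists *)

Module Ram.
Set Implicit Arguments.
Unset Strict Implicit.
Unset Printing Implicit Defensive.
Import Order.TTheory GRing.Theory Num.Theory.
Local Open Scope nat_scope.

(** Powers of [Z + 2] suffice as bounds: since the base is at least 2, constants and sums are
    absorbed by the exponent. *)
Definition polyb (T : nat -> nat) := exists k, forall Z, T Z <= (Z + 2) ^ k.

Lemma polyb_const c : polyb (fun=> c).
Proof.
exists c => Z; apply: (@leq_trans (2 ^ c)); first exact/ltnW/ltn_expl.
by case: c => // c; rewrite leq_exp2r // leq_addl.
Qed.

Lemma polyb_id : polyb id.
Proof. by exists 1 => Z; rewrite expn1 leq_addr. Qed.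

Lemma polyb_mul S T : polyb S -> polyb T -> polyb (fun Z => S Z * T Z).
Proof.
by move=> [a Sa] [b Tb]; exists (a + b) => Z; rewrite expnD leq_mul.
Qed.

Lemma polyb_add S T : polyb S -> polyb T -> polyb (fun Z => S Z + T Z).
Proof.
move=> [a Sa] [b Tb]; exists (a + b).+1 => Z.
have e0 c : 0 < (Z + 2) ^ c by rewrite expn_gt0 addn2.
have la : S Z <= (Z + 2) ^ (a + b).
  by apply: leq_trans (Sa Z) _; rewrite expnD leq_pmulr.
have lb : T Z <= (Z + 2) ^ (a + b).
  by apply: leq_trans (Tb Z) _; rewrite expnD leq_pmull.
apply: leq_trans (leq_add la lb) _.
by rewrite addnn -mul2n expnS leq_mul2r leq_addl orbT.
Qed.

Lemma polyb_comp S T : polyb S -> polyb T -> polyb (fun Z => S (T Z)).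
Proof.
move=> [a Sa] [b Tb]; exists (b.+2 * a) => Z.
apply: leq_trans (Sa _) _; rewrite expnM.
case: a {Sa} => // a; rewrite leq_exp2r //.
have e0 : 0 < (Z + 2) ^ b by rewrite expn_gt0 addn2.
by rewrite !expnS; move: (Tb Z) e0; set X := _ ^ b; nia.
Qed.

Lemma polyb_le S T : (forall Z, S Z <= T Z) -> polyb T -> polyb S.
Proof. by move=> ST [k Tk]; exists k => Z; apply: leq_trans (Tk Z). Qed.

Section Runs.
Variable R : realType.
Notation mem := (memory R).
Implicit Types (m : mem) (c : program).

Definition runs c m T (Q : mem -> Prop) :=
  exists t m', [/\ exec c m t m', t <= T & Q m'].

Lemma runs_weak c m T T' (Q Q' : mem -> Prop) :
  T <= T' -> (forall m', Q m' -> Q' m') -> runs c m T Q -> runs c m T' Q'.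
Proof.
move=> TT' QQ' [t [m' [e le q]]]; exists t, m'; split=> //; last exact: QQ'.
exact: leq_trans TT'.
Qed.

Lemma runs_seq c1 c2 m T1 T2 (Q1 Q : mem -> Prop) :
  runs c1 m T1 Q1 -> (forall m', Q1 m' -> runs c2 m' T2 Q) ->
  runs (Seq c1 c2) m (T1 + T2) Q.
Proof.
move=> [t1 [m1 [e1 l1 q1]]] /(_ _ q1) [t2 [m2 [e2 l2 q2]]].
by exists (t1 + t2), m2; split; [exact: exec_Seq e1 e2|exact: leq_add|].
Qed.

Lemma runs_if b c1 c2 m T Q :
  (eval_test b m -> runs c1 m T Q) -> (~~ eval_test b m -> runs c2 m T Q) ->
  runs (If b c1 c2) m T.+1 Q.
Proof.
move=> h1 h2; case: (boolP (eval_test b m)) => hb.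
  have [t [m' [e l q]]] := h1 hb.
  by exists t.+1, m'; split=> //; exact: exec_IfT.
have [t [m' [e l q]]] := h2 hb.
by exists t.+1, m'; split=> //; exact: exec_IfF.
Qed.

(** The invariant is indexed by the number of rounds left, which gives both termination and the time
    bound. *)
Lemma runs_while b c T (I : nat -> mem -> Prop) :
  (forall j m, I j.+1 m -> eval_test b m /\ runs c m T (I j)) ->
  (forall m, I 0 m -> ~~ eval_test b m) ->
  forall n m, I n m -> runs (While b c) m (n * T.+1).+1 (I 0).
Proof.
move=> IS I0; elim=> [|n IH] m Im.
  by exists 1, m; split=> //; apply: exec_WhileF; exact: I0.
have [bm [t1 [m1 [e1 l1 q1]]]] := IS _ _ Im.
have [t2 [m2 [e2 l2 q2]]] := IH _ q1.
exists (t1 + t2).+1, m2; split=> //; first exact: exec_WhileT e1 e2.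
by rewrite ltnS mulSn; lia.
Qed.

Fixpoint blk (l : seq instr) : program :=
  if l is i :: l' then Seq (Do i) (blk l') else Skip.

Lemma runs_blk l m Q : Q (foldl (fun m i => exec_instr i m) m l) ->
  runs (blk l) m (size l).+1 Q.
Proof.
move=> q; exists (size l).+1, (foldl (fun m i => exec_instr i m) m l).
split=> // {q}; elim: l m => [|i l IH] m /=; first exact: exec_Skip.
by rewrite -add1n; apply: exec_Seq (IH _); apply: exec_Do.
Qed.

Local Arguments blk : simpl never.

(* Even nat cells are registers: 0 and 2 hold the two allocation pointers, 4
   and 6 are scratch.  Odd nat cells are a heap of two-word cells (word 0 is
   the empty list), and the real cells from 3 on are a heap of reals. *)
Definition HP m := nmem m 0.
Definition RP m := nmem m 2.
Definition wf m := odd (HP m) /\ 3 <= RP m.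

(** The heap only grows: nothing below the allocation pointers is overwritten, so represented values
    survive later calls. *)
Definition hext m m' := [/\ HP m <= HP m', RP m <= RP m',
  (forall a, odd a -> a < HP m -> nmem m' a = nmem m a) &
  (forall a, 3 <= a -> a < RP m -> rmem m' a = rmem m a)].

(** Registers from 4 up to [k] belong to the caller; a call at base [k] may use those from [k]
    on. *)
Definition ext k m m' := [/\ wf m', hext m m' &
  forall i, 4 <= i -> i < k -> nmem m' i.*2 = nmem m i.*2].

Lemma hext_refl m : hext m m. Proof. by []. Qed.

Lemma hext_trans m2 m1 m3 : hext m1 m2 -> hext m2 m3 -> hext m1 m3.
Proof.
move=> [h1 r1 a1 b1] [h2 r2 a2 b2]; split=> [||a oa l|a l3 l].
- exact: leq_trans h2.
- exact: leq_trans r2.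
- by rewrite a2 ?a1 //; exact: leq_trans h1.
- by rewrite b2 ?b1 //; exact: leq_trans r1.
Qed.

Lemma ext_trans k m2 m1 m3 : ext k m1 m2 -> ext k m2 m3 -> ext k m1 m3.
Proof.
move=> [w1 h1 r1] [w2 h2 r2]; split=> //; first exact: hext_trans h2.
by move=> i i4 ik; rewrite r2 ?r1.
Qed.

Lemma ext_le k k' m m' : k <= k' -> ext k' m m' -> ext k m m'.
Proof.
by move=> kk [w h r]; split=> // i i4 ik; apply: r => //; apply: leq_trans kk.
Qed.

(** A word represents a value relative to the memory: pairs and nonempty lists by the address of a
    two-word cell, reals by the address of a real cell. Stability under heap growth lets results of
    earlier calls be kept. *)
Class Rep (T : Type) := MkRep {
  rep : memory R -> nat -> T -> Prop;
  rep_mono : forall m m' w x, hext m m' -> rep m w x -> rep m' w x }.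

#[export] Instance nat_Rep : Rep nat.
Proof. by exists (fun _ w x => w = x). Defined.

#[export] Instance bool_Rep : Rep bool.
Proof. by exists (fun _ (w : nat) (x : bool) => w = nat_of_bool x). Defined.

#[export] Instance real_Rep : Rep R.
Proof.
exists (fun m w x => [/\ 3 <= w, w < RP m & rmem m w = x]).
move=> m m' w x [h r a b] [w3 wr <-]; split=> //; last exact: b.
exact: leq_trans r.
Defined.

#[export] Instance prod_Rep A B (rA : Rep A) (rB : Rep B) : Rep (A * B).
Proof.
exists (fun m w x => [/\ odd w, w + 2 < HP m,
    rep m (nmem m w) x.1 & rep m (nmem m (w + 2)) x.2]).
move=> m m' w x hx [ow wl r1 r2].
have [h r a b] := hx; split=> //; first exact: leq_trans h.
- by rewrite a //; [exact: rep_mono r1|lia].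
- by rewrite a ?oddD ?ow //; exact: rep_mono r2.
Defined.

Fixpoint lrep A (rA : Rep A) m w (s : seq A) : Prop :=
  if s is x :: s' then
    [/\ odd w, w + 2 < HP m, rep m (nmem m w) x & lrep rA m (nmem m (w + 2)) s']
  else w = 0.

#[export] Instance seq_Rep A (rA : Rep A) : Rep (seq A).
Proof.
exists (lrep rA).
move=> m m' w s hx; elim: s w => //= x s IH w [ow wl r1 r2].
have [h r a b] := hx; split=> //; first exact: leq_trans h.
- by rewrite a //; [exact: rep_mono r1|lia].
- by rewrite a ?oddD ?ow //; exact: IH.
Defined.

Definition rg m k A (rA : Rep A) (x : A) := rep m (nmem m k.*2) x.
Arguments rg m k {A rA} x.

(* A register is an input of a call at base k and its output. *)
Definition pf A B (rA : Rep A) (rB : Rep B) (P : nat -> A -> Prop)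
    (f : A -> B) := exists T, polyb T /\ forall k, 4 <= k -> exists c,
  forall Z m a, wf m -> P Z a -> rg m k a ->
    runs c m (T Z) (fun m' => ext k m m' /\ rg m' k (f a)).
Arguments pf {A B rA rB} P f.

Lemma pf_pre A B (rA : Rep A) (rB : Rep B) (P Q : nat -> A -> Prop)
    (f : A -> B) : (forall Z a, P Z a -> Q Z a) -> pf Q f -> pf P f.
Proof.
move=> PQ [T [pT h]]; exists T; split=> // k k4; have [c hc] := h k k4.
by exists c => Z m a w /PQ; exact: hc.
Qed.

Lemma pf_ext A B (rA : Rep A) (rB : Rep B) (P : nat -> A -> Prop)
    (f g : A -> B) : (forall a, f a = g a) -> pf P f -> pf P g.
Proof.
move=> fg [T [pT h]]; exists T; split=> // k k4; have [c hc] := h k k4.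
by exists c => Z m a w p r; rewrite -fg; exact: hc.
Qed.

(** The ghost bound may be replaced by a polynomial in it, since polynomial bounds compose. *)
Lemma pf_scale A B (rA : Rep A) (rB : Rep B) (Q : nat -> A -> Prop)
    (f : A -> B) S : polyb S -> pf Q f -> pf (fun Z => Q (S Z)) f.
Proof.
move=> pS [T [pT h]]; exists (fun Z => T (S Z)); split; first exact: polyb_comp.
by move=> k k4; have [c hc] := h k k4; exists c => Z; exact: hc.
Qed.

Lemma pf_id A (rA : Rep A) (P : nat -> A -> Prop) : pf P (fun a => a).
Proof.
exists (fun=> 1); split; first exact: polyb_const.
move=> k k4; exists Skip => Z m a w _ r; exists 1, m; split=> //.
exact: exec_Skip.
Qed.

Lemma pf_comp A B C (rA : Rep A) (rB : Rep B) (rC : Rep C)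
    (P : nat -> A -> Prop) (Q : nat -> B -> Prop) (f : A -> B) (g : B -> C) :
  (forall Z a, P Z a -> Q Z (f a)) -> pf P f -> pf Q g ->
  pf P (fun a => g (f a)).
Proof.
move=> PQ [T1 [p1 h1]] [T2 [p2 h2]]; exists (fun Z => T1 Z + T2 Z).
split; first exact: polyb_add.
move=> k k4; have [c1 hc1] := h1 k k4; have [c2 hc2] := h2 k k4.
exists (Seq c1 c2) => Z m a w p r; apply: (runs_seq (hc1 _ _ _ w p r)).
move=> m1 [e1 r1]; have w1 : wf m1 by case: e1.
apply: runs_weak (leqnn _) _ (hc2 _ _ _ w1 (PQ _ _ p) r1) => m2 [e2 r2].
by split=> //; exact: ext_trans e2.
Qed.

Ltac no_if x := lazymatch x with context [if _ then _ else _] => fail | _ => idtac end.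
Ltac updc := rewrite /= /upd /=; repeat (match goal with
  |- context [@eq_op _ ?x ?y] => no_if x; no_if y;
    first [ have -> : (x == y) = true by apply/eqP; lia
          | have -> : (x == y) = false by apply/eqP; lia
          | case: (x =P y) => ? ] end; rewrite /=); try lia.

Lemma ext_pt k m m' : 4 <= k -> wf m ->
  (forall b, b != 4 -> b != 6 -> (forall i, k <= i -> b != i.*2) ->
     nmem m' b = nmem m b) ->
  (forall b, 3 <= b -> rmem m' b = rmem m b) -> ext k m m'.
Proof.
move=> k4 [w1 w2] nm rm.
have hp : HP m' = HP m by rewrite /HP nm // => i ki; apply/eqP; lia.
have rp : RP m' = RP m by rewrite /RP nm // => i ki; apply/eqP; lia.
split; first by rewrite /wf hp rp.
  split; rewrite ?hp ?rp // => c oc lc; last exact: rm.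
  by apply: nm => [||i ki]; apply/eqP; lia.
by move=> i i4 il; apply: nm => [||j kj]; apply/eqP; lia.
Qed.

Definition move_blk dst src := [:: NConst 4 0; NAdd dst.*2 src.*2 4].
(** The two words go to [HP] and [HP + 2], and [HP] advances by 4, so the heap stays on odd
    addresses and cannot collide with the registers. *)
Definition alloc_blk a b dst := [:: NStore 0 a.*2; NConst 4 2; NAdd 6 0 4;
  NStore 6 b.*2; NConst 4 0; NAdd dst.*2 0 4; NConst 4 4; NAdd 0 0 4].

Lemma runs_move dst src m : 4 <= dst -> 4 <= src -> wf m ->
  runs (blk (move_blk dst src)) m 3 (fun m' =>
    [/\ ext dst m m', nmem m' dst.*2 = nmem m src.*2 &
     forall i, 4 <= i -> i != dst -> nmem m' i.*2 = nmem m i.*2]).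
Proof.
move=> d4 s4 [w1 w2]; apply: runs_blk; split=> /=.
- split=> /=; rewrite /wf /hext /HP /RP /=; first by split; updc.
  + split=> //=; try by updc.
    by move=> a oa _; updc.
  + by move=> i i4 il; updc.
- by updc.
- by move=> i i4 /eqP id; updc.
Qed.

Lemma runs_alloc A B (rA : Rep A) (rB : Rep B) a b dst m (x : A) (y : B) :
  4 <= dst -> 4 <= a -> 4 <= b -> wf m -> rg m a x -> rg m b y ->
  runs (blk (alloc_blk a b dst)) m 9 (fun m' =>
    [/\ ext dst m m', rg m' dst (x, y),
     (forall i, 4 <= i -> i != dst -> nmem m' i.*2 = nmem m i.*2) &
     [/\ odd (nmem m' dst.*2), nmem m' dst.*2 + 2 < HP m',
      nmem m' (nmem m' dst.*2) = nmem m a.*2 &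
      nmem m' (nmem m' dst.*2 + 2) = nmem m b.*2]]).
Proof.
move=> d4 a4 b4 [w1 w2] rx ry; apply: runs_blk.
set m' := foldl _ _ _; rewrite /HP /RP in w1 w2.
have hp : HP m' = HP m + 4 by rewrite /m' /HP; updc.
have rp : RP m' = RP m by rewrite /m' /RP; updc.
have hx : hext m m'.
  split; rewrite ?hp ?rp //; first exact: leq_addr.
  by rewrite /HP => c oc lc; rewrite /m'; updc.
have ed : nmem m' dst.*2 = HP m by rewrite /m' /HP; updc.
have c1 : nmem m' (HP m) = nmem m a.*2 by rewrite /m' /HP; updc.
have c2 : nmem m' (HP m + 2) = nmem m b.*2 by rewrite /m' /HP; updc.
have rgs i : 4 <= i -> i != dst -> nmem m' i.*2 = nmem m i.*2.
  by move=> i4 /eqP ni; rewrite /m'; updc.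
split=> //.
- split=> //; first by split; rewrite ?hp ?rp //; rewrite oddD w1.
  by move=> i i4 il; apply: rgs => //; lia.
- rewrite /rg ed; split; [exact: w1|by move: hp; rewrite /HP; lia| |].
  + by rewrite c1; exact: rep_mono rx.
  + by rewrite c2; exact: rep_mono ry.
- by rewrite ed c1 c2 hp; split; [exact: w1|rewrite /HP; lia| |].
Qed.

Lemma rg_ext k k' m m' A (rA : Rep A) (x : A) : 4 <= k -> k < k' ->
  ext k' m m' -> rg m k x -> rg m' k x.
Proof.
by move=> k4 kk [w h r] rx; rewrite /rg r //; exact: rep_mono rx.
Qed.

(** The argument stays in register [k] while copies of it are evaluated at the bases [k.+1] and
    [k.+2], where neither call can damage what is still needed. *)
Lemma pf_pair A B C (rA : Rep A) (rB : Rep B) (rC : Rep C)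
    (P : nat -> A -> Prop) (f : A -> B) (g : A -> C) :
  pf P f -> pf P g -> pf P (fun a => (f a, g a)).
Proof.
move=> [T1 [p1 h1]] [T2 [p2 h2]].
exists (fun Z => 3 + (T1 Z + (3 + (T2 Z + 9)))).
split; first by do !apply: polyb_add => //; exact: polyb_const.
move=> k k4; have [c1 hc1] := h1 k.+1 (leqW k4).
have [c2 hc2] := h2 k.+2 (leqW (leqW k4)).
exists (Seq (blk (move_blk k.+1 k)) (Seq c1 (Seq (blk (move_blk k.+2 k))
  (Seq c2 (blk (alloc_blk k.+1 k.+2 k)))))) => Z m a w p r.
apply: (runs_seq (runs_move (leqW k4) k4 w)) => m1 [e1 q1 _].
have w1 : wf m1 by case: e1.
have ra1 : rg m1 k.+1 a by rewrite /rg q1; apply: rep_mono r; case: e1.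
have rk1 : rg m1 k a by apply: rg_ext e1 r.
apply: (runs_seq (hc1 _ _ _ w1 p ra1)) => m2 [e2 r2].
have w2 : wf m2 by case: e2.
have rk2 : rg m2 k a by apply: rg_ext e2 rk1.
apply: (runs_seq (runs_move (leqW (leqW k4)) k4 w2)) => m3 [e3 q3 _].
have w3 : wf m3 by case: e3.
have ra3 : rg m3 k.+2 a by rewrite /rg q3; apply: rep_mono rk2; case: e3.
have rf3 : rg m3 k.+1 (f a) by apply: rg_ext e3 r2 => //; lia.
apply: (runs_seq (hc2 _ _ _ w3 p ra3)) => m4 [e4 r4].
have w4 : wf m4 by case: e4.
have rf4 : rg m4 k.+1 (f a) by apply: rg_ext e4 rf3 => //; lia.
apply: runs_weak (leqnn _) _
  (runs_alloc k4 (leqW k4) (leqW (leqW k4)) w4 rf4 r4) => m5 [e5 r5 _ _].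
split=> //; apply: ext_trans e5; apply: (@ext_trans _ m3).
  apply: (@ext_trans _ m2); last by apply: ext_le e3; lia.
  by apply: (@ext_trans _ m1); [apply: ext_le e1|apply: ext_le e2]; lia.
by apply: ext_le e4; lia.
Qed.

Lemma pf_load A B (rA : Rep A) (rB : Rep B) (f : A -> B)
    (P : nat -> A -> Prop) o :
  (forall m w a, rep m w a -> odd (w + o) /\ rep m (nmem m (w + o)) (f a)) ->
  pf P f.
Proof.
move=> hf; exists (fun=> 4); split; first exact: polyb_const.
move=> k k4; exists (blk [:: NConst 4 o; NAdd 6 k.*2 4; NLoad k.*2 6]).
move=> Z m a [w1 w2] _ r; apply: runs_blk; set m' := foldl _ _ _.
have hp : HP m' = HP m by rewrite /m' /HP; updc.
have rp : RP m' = RP m by rewrite /m' /RP; updc.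
have hx : hext m m'.
  by split; rewrite ?hp ?rp // => c oc lc; rewrite /m'; updc.
split.
  split=> //; first by rewrite /wf hp rp.
  by move=> i i4 il; rewrite /m'; updc.
have [ow r'] := hf _ _ _ r.
rewrite /rg; have -> : nmem m' k.*2 = nmem m (nmem m k.*2 + o).
  by rewrite /m'; updc.
exact: rep_mono r'.
Qed.

Lemma pf_fst A B (rA : Rep A) (rB : Rep B) (P : nat -> A * B -> Prop) :
  pf P (fun a => a.1).
Proof. by apply: (@pf_load _ _ _ _ _ _ 0) => m w a /= []; rewrite addn0. Qed.

Lemma pf_snd A B (rA : Rep A) (rB : Rep B) (P : nat -> A * B -> Prop) :
  pf P (fun a => a.2).
Proof.
by apply: (@pf_load _ _ _ _ _ _ 2) => m w a /= [ow]; rewrite oddD ow.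
Qed.

Lemma pf_cast A B (rA : Rep A) (rB : Rep B) (f : A -> B)
    (P : nat -> A -> Prop) :
  (forall m w a, rep m w a -> rep m w (f a)) -> pf P f.
Proof.
move=> hf; exists (fun=> 1); split; first exact: polyb_const.
move=> k k4; exists Skip => Z m a w _ r; exists 1, m; split=> //.
  exact: exec_Skip.
by split=> //; exact: hf.
Qed.

Lemma pf_cons A (rA : Rep A) (P : nat -> A * seq A -> Prop) :
  pf P (fun a => a.1 :: a.2).
Proof. exact: pf_cast. Qed.

Lemma pf_wr A B (rA : Rep A) (rB : Rep B) (P : nat -> A -> Prop)
    (f : A -> B) (l : nat -> seq instr) n :
  (forall k, size (l k) = n) ->
  (forall k m Z a, 4 <= k -> wf m -> P Z a -> rg m k a ->
    let m' := foldl (fun m i => exec_instr i m) m (l k) in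
    ext k m m' /\ rg m' k (f a)) -> pf P f.
Proof.
move=> sl h; exists (fun=> n.+1); split; first exact: polyb_const.
move=> k k4; exists (blk (l k)) => Z m a w p r; rewrite -(sl k).
by apply: runs_blk; exact: (h k m Z a k4 w p r).
Qed.

Lemma pf_word A B (rA : Rep A) (rB : Rep B) (P : nat -> A -> Prop)
    (f : A -> B) (l : nat -> seq instr) n :
  (forall k, size (l k) = n) ->
  (forall k m Z a, 4 <= k -> wf m -> P Z a -> rg m k a ->
    let m' := foldl (fun m i => exec_instr i m) m (l k) in
    [/\ forall b, b != 4 -> b != 6 -> b != k.*2 -> nmem m' b = nmem m b,
     forall b, 3 <= b -> rmem m' b = rmem m b & rep m (nmem m' k.*2) (f a)]) ->
  pf P f.
Proof.
move=> sl h; apply: (pf_wr sl) => k m Z a k4 w p r m'.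
have [nm rm rf] := h k m Z a k4 w p r; rewrite -/m' in nm rm rf.
have hp : HP m' = HP m by rewrite /HP nm //; apply/eqP; lia.
have rp : RP m' = RP m by rewrite /RP nm //; apply/eqP; lia.
have hx : hext m m'.
  split; rewrite ?hp ?rp // => c oc lc; last exact: rm.
  by apply: nm; apply/eqP => e; move: oc; rewrite e ?odd_double.
split; last exact: rep_mono rf.
split=> //; first by rewrite /wf hp rp.
by move=> i i4 il; apply: nm; apply/eqP; lia.
Qed.

Lemma pf_nat A (rA : Rep A) (P : nat -> A -> Prop) (c : nat) : pf P (fun=> c).
Proof.
apply: (@pf_word _ _ _ _ _ _ (fun k => [:: NConst k.*2 c]) 1).
  by [].
move=> k m Z a k4 w _ _ m'; split=> //=; last by updc.
by move=> b _ _ /eqP nb; rewrite /m'; updc.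
Qed.

Lemma pf_nil A B (rA : Rep A) (rB : Rep B) (P : nat -> A -> Prop) :
  pf P (fun=> [::] : seq B).
Proof.
apply: (@pf_word _ _ _ _ _ _ (fun k => [:: NConst k.*2 0]) 1).
  by [].
move=> k m Z a k4 w _ _ m'; split=> //=; last by updc.
by move=> b _ _ /eqP nb; rewrite /m'; updc.
Qed.

(** Heap addresses are odd, hence positive, and the empty list is 0, so truncated subtraction from 1
    decides emptiness. *)
Lemma pf_nilp A (rA : Rep A) (P : nat -> seq A -> Prop) : pf P (fun s => nilp s).
Proof.
apply: (@pf_word _ _ _ _ _ _ (fun k => [:: NConst 4 1; NSub k.*2 4 k.*2]) 2) => //.
move=> k m Z a k4 w _ r m'; split=> //=.
  by move=> b /eqP b4 /eqP b6 /eqP nb; rewrite /m'; updc.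
have e : nmem m' k.*2 = 1 - nmem m k.*2 by rewrite /m'; updc.
change (nmem m' k.*2 = nat_of_bool (nilp a)); rewrite e.
case: a r => [|x s]; rewrite /rg /=; first by move=> ->.
by move=> [ow _ _ _]; move: ow; case: (nmem m k.*2).
Qed.

Lemma pf_add (P : nat -> nat * nat -> Prop) : pf P (fun a => a.1 + a.2).
Proof.
apply: (@pf_word _ _ _ _ _ _ (fun k => [:: NConst 4 2; NAdd 6 k.*2 4;
  NLoad 4 6; NLoad 6 k.*2; NAdd k.*2 6 4]) 5) => //.
move=> k m Z a k4 w _ [ow wl r1 r2] m'; split=> //=.
  by move=> b /eqP b4 /eqP b6 /eqP nb; rewrite /m'; updc.
by rewrite -r1 -r2 /m'; updc.
Qed.

Lemma pf_sub (P : nat -> nat * nat -> Prop) : pf P (fun a => a.1 - a.2).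
Proof.
apply: (@pf_word _ _ _ _ _ _ (fun k => [:: NConst 4 2; NAdd 6 k.*2 4;
  NLoad 4 6; NLoad 6 k.*2; NSub k.*2 6 4]) 5) => //.
move=> k m Z a k4 w _ [ow wl r1 r2] m'; split=> //=.
  by move=> b /eqP b4 /eqP b6 /eqP nb; rewrite /m'; updc.
by rewrite -r1 -r2 /m'; updc.
Qed.

Lemma pf_leq (P : nat -> nat * nat -> Prop) : pf P (fun a => a.1 <= a.2).
Proof.
apply: (@pf_word _ _ _ _ _ _ (fun k => [:: NConst 4 2; NAdd 6 k.*2 4;
  NLoad 4 6; NLoad 6 k.*2; NSub 6 6 4; NConst 4 1; NSub k.*2 4 6]) 7) => //.
move=> k m Z a k4 w _ [ow wl r1 r2] m'; split=> //=.
  by move=> b /eqP b4 /eqP b6 /eqP nb; rewrite /m'; updc.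
have e : nmem m' k.*2 = 1 - (a.1 - a.2) by rewrite -r1 -r2 /m'; updc.
by change (nmem m' k.*2 = nat_of_bool (a.1 <= a.2)); rewrite e; lia.
Qed.

Lemma pf_if A B (rA : Rep A) (rB : Rep B) (P : nat -> A -> Prop)
    (b : A -> bool) (f g : A -> B) :
  pf P b -> pf (fun Z a => P Z a /\ b a) f -> pf (fun Z a => P Z a /\ ~~ b a) g ->
  pf P (fun a => if b a then f a else g a).
Proof.
move=> [T0 [p0 h0]] [T1 [p1 h1]] [T2 [p2 h2]].
exists (fun Z => 3 + (T0 Z + (2 + (T1 Z + T2 Z).+1))).
split.
  do !apply: polyb_add => //; do ?exact: polyb_const.
  apply: (@polyb_le _ (fun Z => 1 + (T1 Z + T2 Z))) => //.
  by do !apply: polyb_add => //; exact: polyb_const.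
move=> k k4; have [c0 hc0] := h0 k.+1 (leqW k4).
have [c1 hc1] := h1 k k4; have [c2 hc2] := h2 k k4.
exists (Seq (blk (move_blk k.+1 k)) (Seq c0 (Seq (blk [:: NConst 4 0])
  (If (NLt 4 k.+1.*2) c1 c2)))) => Z m a w p r.
apply: (runs_seq (runs_move (leqW k4) k4 w)) => m1 [e1 q1 _].
have w1 : wf m1 by case: e1.
have ra1 : rg m1 k.+1 a by rewrite /rg q1; apply: rep_mono r; case: e1.
have rk1 : rg m1 k a by apply: rg_ext e1 r.
apply: (runs_seq (hc0 _ _ _ w1 p ra1)) => m2 [e2 r2].
have w2 : wf m2 by case: e2.
have rk2 : rg m2 k a by apply: rg_ext e2 rk1.
apply: (@runs_seq _ _ _ 2 _ (fun m' => [/\ ext k m2 m', rg m' k a,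
   nmem m' 4 = 0 & nmem m' k.+1.*2 = b a])).
  apply: runs_blk; set m' := foldl _ _ _.
  have hx : ext k m2 m'.
    apply: ext_pt => // aa b4 b6 h; rewrite /m' /= /upd ifN //.
  split=> //; last by rewrite /m' -r2; updc.
  rewrite /rg; have -> : nmem m' k.*2 = nmem m2 k.*2 by rewrite /m'; updc.
  by apply: rep_mono rk2; case: hx.
move=> m3 [e3 rk3 z3 q3]; have w3 : wf m3 by case: e3.
have e03 : ext k m m3.
  apply: (ext_trans _ e3); apply: (@ext_trans _ m1).
    by apply: ext_le e1.
  by apply: ext_le e2.
apply: runs_if => /=; rewrite z3 q3 => hb.
  apply: runs_weak (leq_addr _ _) _ (hc1 _ _ _ w3 _ rk3).
    by move=> m4 [e4 r4]; split; [exact: ext_trans e4|case: (b a) hb r4].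
  by case: (b a) hb.
apply: runs_weak (leq_addl _ _) _ (hc2 _ _ _ w3 _ rk3).
  by move=> m4 [e4 r4]; split; [exact: ext_trans e4|case: (b a) hb r4].
by case: (b a) hb.
Qed.

(** Register [k] holds the environment, [k.+1] the rest of the list, [k.+2] the accumulator, [k.+3]
    a zero for the loop test, and the body is called at [k.+4]. The invariant [I] keeps the
    accumulator in the domain [Q] on which the body has its time bound. *)
Lemma pf_foldl E A B (rE : Rep E) (rA : Rep A) (rB : Rep B)
    (P : nat -> E -> Prop) (Q : nat -> E * B * A -> Prop)
    (I : nat -> E -> B -> Prop)
    (l : E -> seq A) (b0 : E -> B) (body : E * B * A -> B) :
  (forall Z e, P Z e -> size (l e) <= Z) ->
  (forall Z e, P Z e -> I Z e (b0 e)) ->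
  (forall Z e b x, P Z e -> I Z e b -> List.In x (l e) ->
     Q Z (e, b, x) /\ I Z e (body (e, b, x))) ->
  pf P l -> pf P b0 -> pf Q body ->
  pf P (fun e => foldl (fun b x => body (e, b, x)) (b0 e) (l e)).
Proof.
move=> sl i0 iS [T1 [p1 h1]] [T2 [p2 h2]] [T3 [p3 h3]].
pose TB Z := 9 + (3 + (9 + (T3 Z + (3 + 4)))).
exists (fun Z => 3 + (T1 Z + (3 + (T2 Z + (2 + ((Z * (TB Z).+1).+1 + 3)))))).
have pB : polyb TB by do !apply: polyb_add => //; exact: polyb_const.
have pS S : polyb S -> polyb (fun Z => (S Z).+1).
  move=> pS; apply: (@polyb_le _ (fun Z => 1 + S Z)) => //.
  by apply: polyb_add => //; exact: polyb_const.
split.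
  do !apply: polyb_add => //; do ?exact: polyb_const.
  by apply: (pS _); apply: polyb_mul; [exact: polyb_id|exact: (pS _)].
move=> k k4; have k5 : 4 <= k.+1 := leqW k4; have k6 := leqW k5.
have k7 := leqW k6; have k8 := leqW k7; have k9 := leqW k8.
have [c1 hc1] := h1 k.+1 k5; have [c2 hc2] := h2 k.+2 k6.
have [c3 hc3] := h3 k.+4 k8.
exists (Seq (blk (move_blk k.+1 k)) (Seq c1 (Seq (blk (move_blk k.+2 k))
  (Seq c2 (Seq (blk [:: NConst k.+3.*2 0])
  (Seq (While (NLt k.+3.*2 k.+1.*2)
     (Seq (blk (alloc_blk k k.+2 k.+4))
     (Seq (blk [:: NConst 4 0; NLoad k.+4.+1.*2 k.+1.*2])
     (Seq (blk (alloc_blk k.+4 k.+4.+1 k.+4))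
     (Seq c3 (Seq (blk (move_blk k.+2 k.+4))
       (blk [:: NConst 4 2; NAdd 6 k.+1.*2 4; NLoad k.+1.*2 6])))))))
   (blk (move_blk k k.+2)))))))) => Z m e w p r.
apply: (runs_seq (runs_move k5 k4 w)) => m1 [e1 q1 _].
have w1 : wf m1 by case: e1.
have ra1 : rg m1 k.+1 e by rewrite /rg q1; apply: rep_mono r; case: e1.
have rk1 : rg m1 k e by apply: rg_ext e1 r.
apply: (runs_seq (hc1 _ _ _ w1 p ra1)) => m2 [e2 r2].
have w2 : wf m2 by case: e2.
have rk2 : rg m2 k e by apply: rg_ext e2 rk1.
apply: (runs_seq (runs_move k6 k4 w2)) => m3 [e3 q3 _].
have w3 : wf m3 by case: e3.
have ra3 : rg m3 k.+2 e by rewrite /rg q3; apply: rep_mono rk2; case: e3.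
have rl3 : rg m3 k.+1 (l e) by apply: rg_ext e3 r2.
have rk3 : rg m3 k e by apply: rg_ext e3 rk2 => //; lia.
apply: (runs_seq (hc2 _ _ _ w3 p ra3)) => m4 [e4 rb4].
have w4 : wf m4 by case: e4.
have rl4 : rg m4 k.+1 (l e) by apply: rg_ext e4 rl3.
have rk4 : rg m4 k e by apply: rg_ext e4 rk3; lia.
have e04 : ext k m m4.
  apply: (@ext_trans _ m3); last by apply: ext_le e4; lia.
  apply: (@ext_trans _ m2); last by apply: ext_le e3; lia.
  by apply: (@ext_trans _ m1); [apply: ext_le e1|apply: ext_le e2]; lia.
pose J n m' := [/\ ext k m m', rg (rA := rE) m' k e, nmem m' k.+3.*2 = 0 &
  exists s b, [/\ size s = n, rg (rA := seq_Rep rA) m' k.+1 s,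
   rg (rA := rB) m' k.+2 b, I Z e b &
   (forall x, List.In x s -> List.In x (l e)) /\
   foldl (fun b x => body (e, b, x)) b s =
   foldl (fun b x => body (e, b, x)) (b0 e) (l e)]].
apply: (@runs_seq _ _ _ 2 _ (J (size (l e)))).
  apply: runs_blk; set m' := foldl _ _ _.
  have ex : ext k.+3 m4 m'.
    by apply: ext_pt => // aa b4 b6 h; rewrite /m' /= /upd ifN // h.
  have hx : hext m4 m' by case: ex.
  have rgs i : 4 <= i -> i != k.+3 -> nmem m' i.*2 = nmem m4 i.*2.
    by move=> i4 /eqP ni; rewrite /m'; updc.
  have hk j X (rX : Rep X) (x : X) : 4 <= j -> j != k.+3 -> rg m4 j x -> rg m' j x.
    by move=> j4 jk; rewrite /rg rgs //; exact: rep_mono.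
  split.
  - by apply: (ext_trans e04); apply: ext_le ex; lia.
  - by apply: hk rk4 => //; apply/eqP; lia.
  - by rewrite /m'; updc.
  - exists (l e), (b0 e); split=> //.
    + by apply: hk rl4 => //; apply/eqP; lia.
    + by apply: hk rb4 => //; apply/eqP; lia.
    + exact: i0.
move=> m5 J5.
apply: (@runs_seq _ _ _ (Z * (TB Z).+1).+1 _ (J 0)).
  apply: runs_weak (fun _ h => h) (@runs_while _ _ (TB Z) J _ _ _ _ J5).
  - by rewrite ltnS leq_mul2r sl ?orbT.
  - move=> j mm [e6 rk z [s [b [sz rs rb ib [sub eqf]]]]].
    case: s sz rs sub eqf => // x s /= [sz] rs sub eqf.
    have w6 : wf mm by case: e6.
    have [ow wl rx rt] := rs.
    split; first by rewrite z; case: (nmem mm _) ow.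
    apply: (runs_seq (runs_alloc k8 k4 k6 w6 rk rb)) => m7 [e7 rp7 g7 _].
    have w7 : wf m7 by case: e7.
    have hx7 : hext mm m7 by case: e7.
    have rs7 : rg m7 k.+1 (x :: s).
      by rewrite /rg g7 //; [exact: (rep_mono (w := nmem mm k.+1.*2) (x := x :: s) hx7 rs)|apply/eqP; lia].
    have rk7 : rg m7 k e by apply: rg_ext e7 rk; lia.
    apply: (@runs_seq _ _ _ 3 _ (fun m' => [/\ ext k.+4.+1 m7 m' &
       rg (rA := rA) m' k.+4.+1 x])).
      apply: runs_blk; set m' := foldl _ _ _.
      have ex : ext k.+4.+1 m7 m'.
        apply: ext_pt => // aa b4 b6 h; rewrite /m' /= /upd ifN ?ifN //.
        exact: (h k.+4.+1).
      have hx : hext m7 m' by case: ex.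
      split=> //.
      have [ow7 wl7 rx7 rt7] := rs7.
      rewrite /rg; have -> : nmem m' k.+4.+1.*2 = nmem m7 (nmem m7 k.+1.*2).
        by rewrite /m'; updc.
      exact: rep_mono rx7.
    move=> m8 [e8 rx8]; have w8 : wf m8 by case: e8.
    have rp8 : rg m8 k.+4 (e, b) by apply: rg_ext e8 rp7.
    have rs8 : rg m8 k.+1 (x :: s) by apply: rg_ext e8 rs7; lia.
    apply: (runs_seq (runs_alloc k8 k8 k9 w8 rp8 rx8)) => m9 [e9 rp9 g9 _].
    have w9 : wf m9 by case: e9.
    have rs9 : rg m9 k.+1 (x :: s) by apply: rg_ext e9 rs8; lia.
    have [qx ix] : Q Z (e, b, x) /\ I Z e (body (e, b, x)).
      by apply: iS => //; apply: sub; left.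
    apply: (runs_seq (hc3 _ _ _ w9 qx rp9)) => m10 [e10 rp10].
    have w10 : wf m10 by case: e10.
    have rs10 : rg m10 k.+1 (x :: s) by apply: rg_ext e10 rs9; lia.
    have e610 : ext k.+4 mm m10.
      apply: (@ext_trans _ m9) => //; apply: (@ext_trans _ m8) => //.
      by apply: (@ext_trans _ m7) => //; apply: ext_le e8.
    apply: (runs_seq (runs_move k6 k8 w10)) => m11 [e11 q11 g11].
    have w11 : wf m11 by case: e11.
    have rb11 : rg m11 k.+2 (body (e, b, x)).
      by rewrite /rg q11; apply: rep_mono rp10; case: e11.
    have rs11 : rg m11 k.+1 (x :: s) by apply: rg_ext e11 rs10.
    have z11 : nmem m11 k.+3.*2 = 0.
      rewrite g11 //; last by apply/eqP; lia.
      by case: e610 => _ _ ->.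
    have rk11 : rg m11 k e.
      by apply: rg_ext e11 _; [| |apply: rg_ext e610 rk]; lia.
    have e611 : ext k mm m11.
      apply: (@ext_trans _ m10); [apply: ext_le e610|apply: ext_le e11]; lia.
    apply: (@runs_blk [:: _; _; _]); set m' := foldl _ _ _.
    have ex : ext k.+1 m11 m'.
      by apply: ext_pt => // aa b4 b6 h; rewrite /m' /= /upd !ifN // h.
    have hx : hext m11 m' by case: ex.
    have rgs i : 4 <= i -> i != k.+1 -> nmem m' i.*2 = nmem m11 i.*2.
      by move=> i4 /eqP ni; rewrite /m'; updc.
    have hk j' X (rX : Rep X) (y : X) : 4 <= j' -> j' != k.+1 -> rg m11 j' y ->
        rg m' j' y.
      by move=> j4 jk; rewrite /rg rgs //; exact: rep_mono.
    split.
    + by apply: (ext_trans e6); apply: (ext_trans e611); apply: ext_le ex.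
    + by apply: hk rk11 => //; apply/eqP; lia.
    + by rewrite rgs //; apply/eqP; lia.
    + exists s, (body (e, b, x)); split=> //.
      * have [ow' wl' rx' rt'] := rs11.
        rewrite /rg; have -> : nmem m' k.+1.*2 = nmem m11 (nmem m11 k.+1.*2 + 2).
          by rewrite /m'; updc.
        exact: (@rep_mono _ (seq_Rep rA) _ _ _ s hx rt').
      * by apply: hk rb11 => //; apply/eqP; lia.
      * by split=> // y ys; apply: sub; right.
  - move=> mm [e6 rk z [s [b [/size0nil -> rs rb _ _]]]] /=.
    by rewrite z rs.
move=> m6 [e6 rk z [s [b [/size0nil -> rs rb _ [_ eqf]]]]].
have w6 : wf m6 by case: e6.
apply: runs_weak (leqnn _) _ (runs_move k4 k6 w6) => m7 [e7 q7 _].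
split; first exact: ext_trans e7.
by rewrite -eqf /= /rg q7; apply: rep_mono rb; case: e7.
Qed.

Lemma pf_iter E B (rE : Rep E) (rB : Rep B)
    (P : nat -> E -> Prop) (Q : nat -> E * B -> Prop)
    (I : nat -> E -> B -> Prop)
    (n : E -> nat) (b0 : E -> B) (body : E * B -> B) :
  (forall Z e, P Z e -> n e <= Z) ->
  (forall Z e, P Z e -> I Z e (b0 e)) ->
  (forall Z e b, P Z e -> I Z e b -> Q Z (e, b) /\ I Z e (body (e, b))) ->
  pf P n -> pf P b0 -> pf Q body ->
  pf P (fun e => iter (n e) (fun b => body (e, b)) (b0 e)).
Proof.
move=> sl i0 iS [T1 [p1 h1]] [T2 [p2 h2]] [T3 [p3 h3]].
pose TB Z := 9 + (T3 Z + (3 + 3)).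
exists (fun Z => 3 + (T1 Z + (3 + (T2 Z + (2 + ((Z * (TB Z).+1).+1 + 3)))))).
have pB : polyb TB by do !apply: polyb_add => //; exact: polyb_const.
have pS S : polyb S -> polyb (fun Z => (S Z).+1).
  move=> pS; apply: (@polyb_le _ (fun Z => 1 + S Z)) => //.
  by apply: polyb_add => //; exact: polyb_const.
split.
  do !apply: polyb_add => //; do ?exact: polyb_const.
  by apply: (pS _); apply: polyb_mul; [exact: polyb_id|exact: (pS _)].
move=> k k4; have k5 : 4 <= k.+1 := leqW k4; have k6 := leqW k5.
have k7 := leqW k6; have k8 := leqW k7; have k9 := leqW k8.
have [c1 hc1] := h1 k.+1 k5; have [c2 hc2] := h2 k.+2 k6.
have [c3 hc3] := h3 k.+4 k8.
exists (Seq (blk (move_blk k.+1 k)) (Seq c1 (Seq (blk (move_blk k.+2 k))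
  (Seq c2 (Seq (blk [:: NConst k.+3.*2 0])
  (Seq (While (NLt k.+3.*2 k.+1.*2)
     (Seq (blk (alloc_blk k k.+2 k.+4))
     (Seq c3 (Seq (blk (move_blk k.+2 k.+4))
       (blk [:: NConst 4 1; NSub k.+1.*2 k.+1.*2 4])))))
   (blk (move_blk k k.+2)))))))) => Z m e w p r.
apply: (runs_seq (runs_move k5 k4 w)) => m1 [e1 q1 _].
have w1 : wf m1 by case: e1.
have ra1 : rg m1 k.+1 e by rewrite /rg q1; apply: rep_mono r; case: e1.
have rk1 : rg m1 k e by apply: rg_ext e1 r.
apply: (runs_seq (hc1 _ _ _ w1 p ra1)) => m2 [e2 r2].
have w2 : wf m2 by case: e2.
have rk2 : rg m2 k e by apply: rg_ext e2 rk1.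
apply: (runs_seq (runs_move k6 k4 w2)) => m3 [e3 q3 _].
have w3 : wf m3 by case: e3.
have ra3 : rg m3 k.+2 e by rewrite /rg q3; apply: rep_mono rk2; case: e3.
have rl3 : rg m3 k.+1 (n e) by apply: rg_ext e3 r2.
have rk3 : rg m3 k e by apply: rg_ext e3 rk2 => //; lia.
apply: (runs_seq (hc2 _ _ _ w3 p ra3)) => m4 [e4 rb4].
have w4 : wf m4 by case: e4.
have rl4 : rg m4 k.+1 (n e) by apply: rg_ext e4 rl3.
have rk4 : rg m4 k e by apply: rg_ext e4 rk3; lia.
have e04 : ext k m m4.
  apply: (@ext_trans _ m3); last by apply: ext_le e4; lia.
  apply: (@ext_trans _ m2); last by apply: ext_le e3; lia.
  by apply: (@ext_trans _ m1); [apply: ext_le e1|apply: ext_le e2]; lia.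
pose J j m' := [/\ ext k m m', rg (rA := rE) m' k e, nmem m' k.+3.*2 = 0 &
  exists b, [/\ nmem m' k.+1.*2 = j,
   rg (rA := rB) m' k.+2 b, I Z e b &
   iter j (fun b => body (e, b)) b = iter (n e) (fun b => body (e, b)) (b0 e)]].
apply: (@runs_seq _ _ _ 2 _ (J (n e))).
  apply: runs_blk; set m' := foldl _ _ _.
  have ex : ext k.+3 m4 m'.
    by apply: ext_pt => // aa b4 b6 h; rewrite /m' /= /upd ifN // h.
  have hx : hext m4 m' by case: ex.
  have rgs i : 4 <= i -> i != k.+3 -> nmem m' i.*2 = nmem m4 i.*2.
    by move=> i4 /eqP ni; rewrite /m'; updc.
  have hk j X (rX : Rep X) (x : X) : 4 <= j -> j != k.+3 -> rg m4 j x -> rg m' j x.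
    by move=> j4 jk; rewrite /rg rgs //; exact: rep_mono.
  split.
  - by apply: (ext_trans e04); apply: ext_le ex; lia.
  - by apply: hk rk4 => //; apply/eqP; lia.
  - by rewrite /m'; updc.
  - exists (b0 e); split=> //.
    + by rewrite rgs //; apply/eqP; lia.
    + by apply: hk rb4 => //; apply/eqP; lia.
    + exact: i0.
move=> m5 J5.
apply: (@runs_seq _ _ _ (Z * (TB Z).+1).+1 _ (J 0)).
  apply: runs_weak (fun _ h => h) (@runs_while _ _ (TB Z) J _ _ _ _ J5).
  - by rewrite ltnS leq_mul2r sl ?orbT.
  - move=> j mm [e6 rk z [b [sz rb ib eqf]]].
    have w6 : wf mm by case: e6.
    split; first by rewrite /= z sz.
    apply: (runs_seq (runs_alloc k8 k4 k6 w6 rk rb)) => m7 [e7 rp7 g7 _].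
    have w7 : wf m7 by case: e7.
    have hx7 : hext mm m7 by case: e7.
    have rk7 : rg m7 k e by apply: rg_ext e7 rk; lia.
    have [qx ix] := iS _ _ _ p ib.
    apply: (runs_seq (hc3 _ _ _ w7 qx rp7)) => m10 [e10 rp10].
    have w10 : wf m10 by case: e10.
    have e610 : ext k.+4 mm m10 by apply: (@ext_trans _ m7).
    apply: (runs_seq (runs_move k6 k8 w10)) => m11 [e11 q11 g11].
    have w11 : wf m11 by case: e11.
    have rb11 : rg m11 k.+2 (body (e, b)).
      by rewrite /rg q11; apply: rep_mono rp10; case: e11.
    have z11 : nmem m11 k.+3.*2 = 0.
      rewrite g11 //; last by apply/eqP; lia.
      by case: e610 => _ _ ->.
    have s11 : nmem m11 k.+1.*2 = j.+1.
      rewrite g11 //; last by apply/eqP; lia.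
      by case: e610 => _ _ ->; rewrite ?sz //; lia.
    have rk11 : rg m11 k e.
      by apply: rg_ext e11 _; [| |apply: rg_ext e610 rk]; lia.
    have e611 : ext k mm m11.
      apply: (@ext_trans _ m10); [apply: ext_le e610|apply: ext_le e11]; lia.
    apply: (@runs_blk [:: _; _]); set m' := foldl _ _ _.
    have ex : ext k.+1 m11 m'.
      by apply: ext_pt => // aa b4 b6 h; rewrite /m' /= /upd !ifN // h.
    have hx : hext m11 m' by case: ex.
    have rgs i : 4 <= i -> i != k.+1 -> nmem m' i.*2 = nmem m11 i.*2.
      by move=> i4 /eqP ni; rewrite /m'; updc.
    have hk j' X (rX : Rep X) (y : X) : 4 <= j' -> j' != k.+1 -> rg m11 j' y ->
        rg m' j' y.
      by move=> j4 jk; rewrite /rg rgs //; exact: rep_mono.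
    split.
    + by apply: (ext_trans e6); apply: (ext_trans e611); apply: ext_le ex.
    + by apply: hk rk11 => //; apply/eqP; lia.
    + by rewrite rgs //; apply/eqP; lia.
    + exists (body (e, b)); split=> //.
      * by rewrite /m'; updc.
      * by apply: hk rb11 => //; apply/eqP; lia.
      * by rewrite -iterSr.
  - by move=> mm [e6 rk z [b [sz _ _ _]]] /=; rewrite z sz.
move=> m6 [e6 rk z [b [_ rb _ eqf]]].
have w6 : wf m6 by case: e6.
apply: runs_weak (leqnn _) _ (runs_move k4 k6 w6) => m7 [e7 q7 _].
split; first exact: ext_trans e7.
by rewrite -eqf /= /rg q7; apply: rep_mono rb; case: e7.
Qed.

Lemma real_alloc k m m' (x : R) : 4 <= k -> wf m ->
  (forall b, b != 2 -> b != 4 -> b != 6 -> b != k.*2 -> nmem m' b = nmem m b) ->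
  nmem m' 2 = (RP m).+1 -> nmem m' k.*2 = RP m ->
  (forall b, 3 <= b -> b < RP m -> rmem m' b = rmem m b) ->
  rmem m' (RP m) = x -> ext k m m' /\ rg m' k x.
Proof.
move=> k4 [w1 w2] nm rp kk rm rx.
have hp : HP m' = HP m by rewrite /HP nm //; apply/eqP; lia.
split; last by rewrite /rg kk /=; split=> //; rewrite /RP rp.
split; first by rewrite /wf hp /RP rp; split=> //; apply: leqW.
  split; [by rewrite hp|by rewrite /RP rp| |exact: rm].
  by move=> c oc lc; apply: nm; apply/eqP; lia.
by move=> i i4 il; apply: nm; apply/eqP; lia.
Qed.

(** The operands are fetched into the scratch real cells 0 and 1, and the result is stored in a
    fresh real cell whose address becomes the value. *)
Definition rop_blk (op : nat -> nat -> nat -> instr) k :=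
  [:: NLoad 4 k.*2; RLoad 0 4; NConst 4 2; NAdd 6 k.*2 4; NLoad 4 6; RLoad 1 4;
      op 2 0 1; RStore 2 2; NConst 4 0; NAdd k.*2 2 4; NConst 4 1; NAdd 2 2 4].

Lemma pf_rop (op : nat -> nat -> nat -> instr) (g : R -> R -> R)
    (P : nat -> R * R -> Prop) :
  (forall m, exec_instr (op 2 0 1) m = setR m 2 (g (rmem m 0) (rmem m 1))) ->
  pf P (fun a => g a.1 a.2).
Proof.
move=> hop; apply: (@pf_wr _ _ _ _ _ _ (rop_blk op) 12) => //.
move=> k m Z [x y] k4 w _ [ow wl [x3 xl rx] [y3 yl ry]] m'.
have [w1 w2] := w; rewrite /HP /RP /= in w1 w2 wl xl yl rx ry.
apply: real_alloc => //=.
- move=> b /eqP b2 /eqP b4 /eqP b6 /eqP bk; rewrite /m' /rop_blk /= hop.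
  by updc.
- by rewrite /m' /rop_blk /= hop /RP; updc.
- by rewrite /m' /rop_blk /= hop /RP; updc.
- by move=> b b3 bl; rewrite /RP in bl; rewrite /m' /rop_blk /= hop; updc.
- rewrite /m' /rop_blk /= hop /RP; updc.
  by rewrite -rx -ry; congr (g _ _); updc.
Qed.

Lemma pf_radd P : pf P (fun a : R * R => (a.1 + a.2)%R).
Proof. exact: (@pf_rop RAdd +%R). Qed.
Lemma pf_rsub P : pf P (fun a : R * R => (a.1 - a.2)%R).
Proof. exact: (@pf_rop RSub (fun x y => x - y)%R). Qed.
Lemma pf_rmul P : pf P (fun a : R * R => (a.1 * a.2)%R).
Proof. exact: (@pf_rop RMul *%R). Qed.
Lemma pf_rdiv P : pf P (fun a : R * R => (a.1 / a.2)%R).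
Proof. exact: (@pf_rop RDiv (fun x y => x / y)%R). Qed.

Lemma pf_sqrt (P : nat -> R -> Prop) : pf P (fun a : R => Num.sqrt a).
Proof.
apply: (@pf_comp _ _ _ _ _ _ P (fun _ _ => True) (fun a => (a, a))
   (fun a => Num.sqrt a.1)) => //; first by apply: pf_pair; exact: pf_id.
exact: (@pf_rop (fun a b _ => RSqrt a b) (fun x _ => Num.sqrt x)).
Qed.

Lemma pf_rcst A (rA : Rep A) (P : nat -> A -> Prop) (op : nat -> instr) (x : R) :
  (forall m, exec_instr (op 2) m = setR m 2 x) -> pf P (fun=> x).
Proof.
move=> hop; apply: (@pf_wr _ _ _ _ _ _ (fun k => [:: op 2; RStore 2 2;
  NConst 4 0; NAdd k.*2 2 4; NConst 4 1; NAdd 2 2 4]) 6) => //.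
move=> k m Z a k4 w _ _ m'; have [w1 w2] := w; rewrite /HP /RP in w1 w2.
apply: real_alloc => //=.
- by move=> b /eqP b2 /eqP b4 /eqP b6 /eqP bk; rewrite /m' /= hop; updc.
- by rewrite /m' /= hop /RP; updc.
- by rewrite /m' /= hop /RP; updc.
- by move=> b b3 bl; rewrite /RP in bl; rewrite /m' /= hop; updc.
- by rewrite /m' /= hop /RP; updc.
Qed.

Lemma pf_r0 A (rA : Rep A) (P : nat -> A -> Prop) : pf P (fun=> 0%R : R).
Proof. exact: (@pf_rcst _ _ _ RZero). Qed.
Lemma pf_r1 A (rA : Rep A) (P : nat -> A -> Prop) : pf P (fun=> 1%R : R).
Proof. exact: (@pf_rcst _ _ _ ROne). Qed.

Lemma pf_rle (P : nat -> R * R -> Prop) : pf P (fun a => (a.1 <= a.2)%R).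
Proof.
exists (fun=> 7 + 3); split; first exact: polyb_const.
move=> k k4; exists (Seq (blk [:: NLoad 4 k.*2; RLoad 0 4; NConst 4 2;
  NAdd 6 k.*2 4; NLoad 4 6; RLoad 1 4])
  (If (RLe 0 1) (blk [:: NConst k.*2 1]) (blk [:: NConst k.*2 0]))).
move=> Z m [x y] w _ [ow wl [x3 xl rx] [y3 yl ry]].
have [w1 w2] := w; rewrite /HP /RP /= in w1 w2 wl xl yl rx ry.
apply: (@runs_seq _ _ _ 7 _ (fun m' => [/\ ext k m m', rmem m' 0 = x &
  rmem m' 1 = y])).
  apply: runs_blk; set m' := foldl _ _ _; split.
  - apply: ext_pt => // b.
      by move=> /eqP b4 /eqP b6 h; rewrite /m'; updc.
    by move=> b3; rewrite /m'; updc.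
  - by rewrite -rx /m'; updc.
  - by rewrite -ry /m'; updc.
move=> m1 [e1 q0 q1]; have w3 : wf m1 by case: e1.
have ex (c : nat) : ext k m1 (foldl (fun m i => exec_instr i m) m1 [:: NConst k.*2 c]).
  by apply: ext_pt => // b b4 b6 h /=; rewrite /upd ifN // h.
apply: runs_if => /=; rewrite q0 q1 => hb.
  apply: runs_blk; split; first exact: ext_trans (ex _).
  by rewrite /rg /= hb; updc.
apply: runs_blk; split; first exact: ext_trans (ex _).
by rewrite /rg /= (negPf hb); updc.
Qed.

End Runs.
End Ram.

(** * Functions of polynomial time and polynomially bounded results *)

Module Fp2.
Import Ram.

Set Implicit Arguments.
Unset Strict Implicit.
Unset Printing Implicit Defensive.
Import Order.TTheory GRing.Theory Num.Theory.
Local Open Scope nat_scope.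

Arguments pf {R A B rA rB} P f.

(** A hereditary size bound: all naturals and list lengths inside [x] are at most [Z], while reals
    have no size. It is the quantity in which loops are polynomial. *)
Class Hb (T : Type) := MkHb { hb : nat -> T -> Prop;
  hb_mono : forall Z Z' x, Z <= Z' -> hb Z x -> hb Z' x }.
Arguments hb {T Hb} Z x : simpl never.

#[export] Instance nat_Hb : Hb nat.
Proof. by exists (fun Z n => n <= Z) => Z Z' x ZZ h; exact: leq_trans ZZ. Defined.
#[export] Instance bool_Hb : Hb bool.
Proof. by exists (fun _ _ => True). Defined.
#[export] Instance prod_Hb A B (hA : Hb A) (hB : Hb B) : Hb (A * B).
Proof.
exists (fun Z x => hb Z x.1 /\ hb Z x.2) => Z Z' x ZZ [h1 h2].
by split; exact: hb_mono ZZ _.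
Defined.
#[export] Instance seq_Hb A (hA : Hb A) : Hb (seq A).
Proof.
exists (fun Z s => size s <= Z /\ forall x, List.In x s -> hb Z x) => Z Z' x ZZ [h1 h2].
by split; [exact: leq_trans ZZ|move=> y /h2; exact: hb_mono].
Defined.

Lemma hb_natE Z (n : nat) : hb Z n = is_true (n <= Z). Proof. by []. Qed.
Lemma hb_pairE A B (hA : Hb A) (hB : Hb B) Z (a : A) (b : B) : hb Z (a, b) = (hb Z a /\ hb Z b).
Proof. by []. Qed.
Lemma hb_seqE A (hA : Hb A) Z (s : seq A) :
  hb Z s = (size s <= Z /\ forall x, List.In x s -> hb Z x).
Proof. by []. Qed.
Lemma hb_nil A (hA : Hb A) Z : hb Z ([::] : seq A). Proof. by []. Qed.
Lemma In_mem (T : eqType) (x : T) s : List.In x s <-> x \in s.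
Proof.
elim: s => //= y s IH; rewrite inE; split=> [[->|/IH ->]|/orP [/eqP ->|/IH]]; rewrite ?eqxx ?orbT //; auto.
Qed.
Lemma In_take T (x : T) j s : List.In x (take j s) -> List.In x s.
Proof. by elim: s j => // y s IH [|j] //= [->|/IH]; auto. Qed.
Lemma In_rev T (x : T) s : List.In x (rev s) -> List.In x s.
Proof.
suff h t : List.In x (catrev s t) -> List.In x s \/ List.In x t by move=> /h [].
elim: s t => [|y s IH] t; first by right.
by move=> /IH [|[->|]]; [left; right|left; left|right].
Qed.
Lemma In_cat T (x : T) s t : List.In x (s ++ t) -> List.In x s \/ List.In x t.
Proof. by elim: s => [|y s IH] /=; [right|move=> [->|/IH []]; auto]. Qed.
Lemma In_map S T (f : S -> T) y s : List.In y (map f s) -> exists2 x, List.In x s & y = f x.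
Proof. by elim: s => //= x s IH [<-|/IH [x' h1 h2]]; [exists x; auto|exists x'; auto]. Qed.
Lemma In_filter T (p : pred T) x s : List.In x (filter p s) -> List.In x s /\ p x.
Proof. by elim: s => //= y s IH; case: ifP => py //=; [move=> [<-|/IH []]|move=> /IH []]; auto. Qed.

(** Bounds of this shape are closed under sum, product and composition with explicit exponents, so
    existential witnesses can be written down. *)
Definition ub (k Z : nat) := (Z + 2) ^ k.
Lemma ub_le k k' Z : k <= k' -> ub k Z <= ub k' Z.
Proof. by move=> h; rewrite /ub leq_exp2l // addn2. Qed.
Lemma ub_mono k Z Z' : Z <= Z' -> ub k Z <= ub k Z'.
Proof. by case: k => // k h; rewrite /ub leq_exp2r // leq_add2r. Qed.
Lemma ub_ub k l Z : ub l (ub k Z) <= ub (k.+2 * l) Z.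
Proof.
rewrite /ub expnM; case: l => // l; rewrite leq_exp2r // !expnS.
have : 0 < (Z + 2) ^ k by rewrite expn_gt0 addn2.
by move: ((Z + 2) ^ k) => x x0; nia.
Qed.
Lemma ub1 Z : Z <= ub 1 Z. Proof. by rewrite /ub expn1 leq_addr. Qed.
Lemma ub_c c Z : c <= ub c Z.
Proof.
apply: leq_trans (ltnW (ltn_expl c (isT : 1 < 2))) _.
by case: c => // c; rewrite /ub leq_exp2r // leq_addl.
Qed.
Lemma ubM k l Z x y : x <= ub k Z -> y <= ub l Z -> x * y <= ub (k + l) Z.
Proof. by move=> h1 h2; rewrite /ub expnD leq_mul. Qed.
Lemma ubD k l Z x y : x <= ub k Z -> y <= ub l Z -> x + y <= ub (k + l).+1 Z.
Proof.
rewrite /ub expnS expnD.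
have x1 : 0 < (Z + 2) ^ k by rewrite expn_gt0 addn2.
have y1 : 0 < (Z + 2) ^ l by rewrite expn_gt0 addn2.
move: x1 y1; move: ((Z + 2) ^ k) ((Z + 2) ^ l) => a b x1 y1 h1 h2.
by apply: (@leq_trans (2 * (a * b))); [nia|rewrite leq_mul2r leq_addl orbT].
Qed.

Definition bd A B (hA : Hb A) (hB : Hb B) (f : A -> B) := exists k, forall Z a, hb Z a -> hb (ub k Z) (f a).
Arguments bd {A B hA hB} f.

Section Fp.
Variable R : realType.
Local Notation true2 := (fun _ _ => True).
#[export] Instance real_Hb : Hb R. Proof. by exists (fun _ _ => True). Defined.

(** Time and size of the result are carried together, because the time of a composition depends on
    the size of the intermediate value. *)
Definition fp A B (rA : Rep R A) (hA : Hb A) (rB : Rep R B) (hB : Hb B) (f : A -> B) :=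
  bd f /\ pf (fun Z a => hb Z a) f.
Arguments fp {A B rA hA rB hB} f.

Lemma polyb_k k : polyb (ub k). Proof. by exists k. Qed.

Section Basic.
Variables (A B C D : Type) (rA : Rep R A) (hA : Hb A) (rB : Rep R B) (hB : Hb B).
Variables (rC : Rep R C) (hC : Hb C) (rD : Rep R D) (hD : Hb D).

Lemma fp_ext (f g : A -> B) : (forall a, f a = g a) -> fp f -> fp g.
Proof.
move=> e [[k p] h]; split; last exact: pf_ext e h.
by exists k => Z a; rewrite -e; exact: p.
Qed.
Lemma fp_id : fp (fun a : A => a).
Proof. by split; [exists 1 => Z a; apply: hb_mono; exact: ub1|exact: pf_id]. Qed.
Lemma fp_comp (f : A -> B) (g : B -> C) : fp f -> fp g -> fp (fun a => g (f a)).
Proof.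
move=> [[k pf1] h1] [[l pg] h2]; split.
  by exists (k.+2 * l) => Z a /pf1/pg; apply: hb_mono; exact: ub_ub.
apply: (pf_comp (Q := fun Z b => hb (ub k Z) b)) h1 _; first exact: pf1.
exact: (pf_scale (polyb_k k) h2).
Qed.
Lemma fp_pair (f : A -> B) (g : A -> C) : fp f -> fp g -> fp (fun a => (f a, g a)).
Proof.
move=> [[k p1] h1] [[l p2] h2]; split; last exact: pf_pair.
exists (k + l) => Z a ha; rewrite hb_pairE.
by split; [apply: hb_mono (p1 _ _ ha)|apply: hb_mono (p2 _ _ ha)]; apply: ub_le; rewrite ?leq_addr ?leq_addl.
Qed.
Lemma fp_fst : fp (fun a : A * B => a.1).
Proof. by split; [exists 1 => Z a [h _]; apply: hb_mono h; exact: ub1|exact: pf_fst]. Qed.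
Lemma fp_snd : fp (fun a : A * B => a.2).
Proof. by split; [exists 1 => Z a [_ h]; apply: hb_mono h; exact: ub1|exact: pf_snd]. Qed.
Lemma fp_nat (c : nat) : fp (fun _ : A => c).
Proof. by split; [exists c => Z a _; exact: ub_c|exact: pf_nat]. Qed.
Lemma fp_nil : fp (fun _ : A => [::] : seq B).
Proof. by split; [exists 1 => Z a _; exact: hb_nil|exact: pf_nil]. Qed.
Lemma fp_cond (b : A -> bool) (f g : A -> B) : fp b -> fp f -> fp g ->
  fp (fun a => if b a then f a else g a).
Proof.
move=> [_ hb_] [[k p1] h1] [[l p2] h2]; split.
  exists (k + l) => Z a ha; case: (b a); [apply: hb_mono (p1 _ _ ha)|apply: hb_mono (p2 _ _ ha)];
    by apply: ub_le; rewrite ?leq_addr ?leq_addl.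
apply: pf_if => //; [apply: pf_pre h1|apply: pf_pre h2] => Z a [] //.
Qed.
End Basic.

Lemma fp2 A B C D (rA : Rep R A) (hA : Hb A) (rB : Rep R B) (hB : Hb B) (rC : Rep R C) (hC : Hb C)
  (rD : Rep R D) (hD : Hb D) (h : B -> C -> D) (f : A -> B) (g : A -> C) :
  fp (fun p : B * C => h p.1 p.2) -> fp f -> fp g -> fp (fun a => h (f a) (g a)).
Proof. by move=> hh hf hg; apply: (fp_comp (fp_pair hf hg) hh). Qed.

Lemma fp_true A B (rA : Rep R A) (hA : Hb A) (rB : Rep R B) (hB : Hb B) (f : A -> B) :
  (forall Z b, @hb B _ Z b) -> pf (fun Z a => hb Z a) f -> fp f.
Proof. by move=> h1 h2; split=> //; exists 0 => Z a _; exact: h1. Qed.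

Lemma fp_cons0 A (rA : Rep R A) (hA : Hb A) : fp (fun a : A * seq A => a.1 :: a.2).
Proof.
split; last exact: pf_cons.
exists 1 => Z [x s] [h1 [h2 h3]] /=; split.
  by apply: leq_ltn_trans h2 _; rewrite /ub expn1 addn2.
by move=> y /= [<-|/h3]; [apply: hb_mono h1|apply: hb_mono]; exact: ub1.
Qed.
Lemma fp_add0 : fp (fun a : nat * nat => a.1 + a.2).
Proof.
split; last exact: pf_add.
by exists 3 => Z [x y] [h1 h2] /=; apply: (@ubD 1 1); [apply: leq_trans h1 _|apply: leq_trans h2 _]; exact: ub1.
Qed.
Lemma fp_sub0 : fp (fun a : nat * nat => a.1 - a.2).
Proof.
split; last exact: pf_sub.
by exists 1 => Z [x y] [h1 h2] /=; apply: leq_trans (leq_subr _ _) (leq_trans h1 (ub1 _)).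
Qed.
Lemma fp_leq0 : fp (fun a : nat * nat => a.1 <= a.2). Proof. by apply: fp_true => //; exact: pf_leq. Qed.
Lemma fp_radd0 : fp (fun a : R * R => (a.1 + a.2)%R). Proof. by apply: fp_true => //; exact: pf_radd. Qed.
Lemma fp_rsub0 : fp (fun a : R * R => (a.1 - a.2)%R). Proof. by apply: fp_true => //; exact: pf_rsub. Qed.
Lemma fp_rmul0 : fp (fun a : R * R => (a.1 * a.2)%R). Proof. by apply: fp_true => //; exact: pf_rmul. Qed.
Lemma fp_rdiv0 : fp (fun a : R * R => (a.1 / a.2)%R). Proof. by apply: fp_true => //; exact: pf_rdiv. Qed.
Lemma fp_rle0 : fp (fun a : R * R => (a.1 <= a.2)%R). Proof. by apply: fp_true => //; exact: pf_rle. Qed.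
Lemma fp_sqrt0 : fp (fun a : R => Num.sqrt a). Proof. by apply: fp_true => //; exact: pf_sqrt. Qed.
Lemma fp_r0 A (rA : Rep R A) (hA : Hb A) : fp (fun _ : A => 0%R : R).
Proof. by apply: fp_true => //; exact: pf_r0. Qed.
Lemma fp_r1 A (rA : Rep R A) (hA : Hb A) : fp (fun _ : A => 1%R : R).
Proof. by apply: fp_true => //; exact: pf_r1. Qed.
Lemma fp_nilp0 A (rA : Rep R A) (hA : Hb A) : fp (fun s : seq A => nilp s).
Proof. by apply: fp_true => //; exact: pf_nilp. Qed.

Lemma pf_castP A B (rA : Rep R A) (rB : Rep R B) (f : A -> B) (P : nat -> A -> Prop) :
  (forall Z m w a, P Z a -> rep m w a -> rep m w (f a)) -> pf P f.
Proof.
move=> hf; exists (fun=> 1); split; first exact: polyb_const.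
move=> k k4; exists Skip => Z m a w p r; exists 1, m; split=> //.
  exact: exec_Skip.
by split=> //; exact: (hf Z).
Qed.

(** A nonempty list and the pair of its head and tail have the same representation, so no
    instruction is executed. *)
Lemma pf_uncons A (rA : Rep R A) (x0 : A) (P : nat -> seq A -> Prop) :
  (forall Z s, P Z s -> ~~ nilp s) -> pf P (fun s => (head x0 s, behead s)).
Proof. by move=> h; apply: pf_castP => Z m w [|x s] /h. Qed.

Lemma pf_behead A (rA : Rep R A) (P : nat -> seq A -> Prop) : pf P (fun s => behead s).
Proof.
apply: (@pf_ext _ _ _ _ _ _ (fun s => if nilp s then s else behead s)); first by case.
case: (pselect (inhabited A)) => [[x0]|ni].
  apply: pf_if; [exact: pf_nilp|exact: pf_id|].
  apply: (pf_comp (Q := true2) (f := fun s => (head x0 s, behead s)) (g := fun p => p.2)) => //.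
    by apply: pf_uncons => Z s [].
  exact: pf_snd.
apply: (@pf_ext _ _ _ _ _ _ (fun s => s)); last exact: pf_id.
by case=> // x; case: ni.
Qed.

Lemma fp_behead0 A (rA : Rep R A) (hA : Hb A) : fp (fun s : seq A => behead s).
Proof.
split; last exact: pf_behead.
exists 1 => Z [|x s] [h1 h2] //=; split; first by apply: leq_trans (ltnW h1) (ub1 _).
by move=> y ys; apply: hb_mono (ub1 _) (h2 y (or_intror ys)).
Qed.

Lemma fp_head0 A (rA : Rep R A) (hA : Hb A) : fp (fun p : A * seq A => head p.1 p.2).
Proof.
split.
  exists 1 => Z [x [|y s]] [h1 [_ h2]]; apply: hb_mono (ub1 _) _ => //.
  exact: (h2 y (or_introl erefl)).
apply: (@pf_ext _ _ _ _ _ _ (fun p => if nilp p.2 then p.1 else (head p.1 p.2))).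
  by case=> x [].
case: (pselect (inhabited A)) => [[x0]|ni]; last first.
  apply: (@pf_ext _ _ _ _ _ _ (fun p => p.1)); last exact: pf_fst.
  by case=> x; case: ni.
apply: pf_if; [|exact: pf_fst|].
  apply: (pf_comp (Q := true2) (g := fun s => nilp s)) => //; [exact: pf_snd|exact: pf_nilp].
have e : pf (fun Z (a : A * seq A) => hb Z a /\ ~~ nilp a.2) (fun p => (head x0 p.2, behead p.2).1).
  apply: (pf_comp (Q := true2) (f := fun p : A * seq A => (head x0 p.2, behead p.2)) (g := fun p => p.1)) => //; last exact: pf_fst.
  apply: (pf_comp (Q := fun _ s => ~~ nilp s) (f := fun p : A * seq A => p.2) (g := fun s => (head x0 s, behead s))).
  - by move=> Z a [].
  - exact: pf_snd.
  - exact: pf_uncons.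
have [T [pT h]] := e; exists T; split=> // k k4; have [c hc] := h k k4.
exists c => Z m [x [|y s]] w p r; first by case: p.
exact: (hc Z m (x, y :: s) w p r).
Qed.

(* The step-closed invariant of pf_iter is met by counting down inside the state. *)
Lemma pf_iterP E B (rE : Rep R E) (rB : Rep R B) (P : nat -> E -> Prop) (Q : nat -> E * B -> Prop)
    (n : E -> nat) (b0 : E -> B) (body : E * B -> B) :
  (forall Z e, P Z e -> n e <= Z) ->
  (forall Z e j, P Z e -> j < n e -> Q Z (e, iter j (fun b => body (e, b)) (b0 e))) ->
  pf P n -> pf P b0 -> pf Q body ->
  pf P (fun e => iter (n e) (fun b => body (e, b)) (b0 e)).
Proof.
move=> nZ iQ hn h0 hb.
pose stp (p : E * (nat * B)) := if p.2.1 <= 0 then p.2 else (p.2.1 - 1, body (p.1, p.2.2)).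
have e1 e j : j <= n e -> iter j (fun b => stp (e, b)) (n e, b0 e) =
    (n e - j, iter j (fun b => body (e, b)) (b0 e)).
  elim: j => [|j IH] jn; first by rewrite subn0.
  rewrite iterS (IH (ltnW jn)) /stp /=.
  have -> : (n e - j <= 0) = false by rewrite leqn0 subn_eq0 leqNgt jn.
  by rewrite -subnDA addn1.
apply: (@pf_ext _ _ _ _ _ _ (fun e => (iter (n e) (fun b => stp (e, b)) (n e, b0 e)).2)).
  by move=> e; rewrite e1.
apply: (pf_comp (Q := true2) (g := fun p : nat * B => p.2)) => //; last exact: pf_snd.
apply: (pf_iter (Q := fun Z p => p.2.1 = 0 \/ Q Z (p.1, p.2.2))
  (I := fun Z e b => exists2 j, j <= n e & b = (n e - j, iter j (fun b => body (e, b)) (b0 e)))) => //.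
- by move=> Z e _; exists 0 => //; rewrite subn0.
- move=> Z e b pe [j jn ->]; case: (ltngtP j (n e)) jn => // [jn|jn] _.
    split; first by right; exact: iQ.
    rewrite /stp /=; have -> : (n e - j <= 0) = false by rewrite leqn0 subn_eq0 leqNgt jn.
    by exists j.+1 => //; rewrite -subnDA addn1.
  split; first by left; rewrite /= jn subnn.
  by rewrite /stp /= jn subnn /=; exists (n e) => //; rewrite subnn.
- exact: pf_pair.
apply: pf_if.
- apply: (pf_comp (Q := true2) (f := fun p : E * (nat * B) => (p.2.1, 0)) (g := fun p => p.1 <= p.2)) => //; last exact: pf_leq.
  apply: pf_pair; last exact: pf_nat.
  apply: (pf_comp (Q := true2) (f := fun p : E * (nat * B) => p.2) (g := fun p => p.1)) => //; [exact: pf_snd|exact: pf_fst].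
- exact: pf_snd.
apply: pf_pair.
  apply: (pf_comp (Q := true2) (f := fun p : E * (nat * B) => (p.2.1, 1)) (g := fun p => p.1 - p.2)) => //; last exact: pf_sub.
  apply: pf_pair; last exact: pf_nat.
  apply: (pf_comp (Q := true2) (f := fun p : E * (nat * B) => p.2) (g := fun p => p.1)) => //; [exact: pf_snd|exact: pf_fst].
apply: (pf_comp (Q := Q) (f := fun p : E * (nat * B) => (p.1, p.2.2)) (g := body)) => //.
  by move=> Z p [[-> //|]].
apply: pf_pair; first exact: pf_fst.
apply: (pf_comp (Q := true2) (f := fun p : E * (nat * B) => p.2) (g := fun p => p.2)) => //; exact: pf_snd.
Qed.

Lemma foldl_iter (T B : Type) (f : B -> T -> B) b s (x0 : T) : foldl f b s =
  (iter (size s) (fun p : seq T * B => if nilp p.1 then p else (behead p.1, f p.2 (head x0 p.1))) (s, b)).2.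
Proof. by elim: s b => // x s IH b; rewrite iterSr /= IH. Qed.

Lemma foldl_state (T B : Type) (f : B -> T -> B) b s (x0 : T) j : j <= size s ->
  iter j (fun p : seq T * B => if nilp p.1 then p else (behead p.1, f p.2 (head x0 p.1))) (s, b) =
  (drop j s, foldl f b (take j s)).
Proof.
elim: j => [|j IH] js; first by rewrite drop0 take0.
rewrite iterS (IH (ltnW js)) /nilp size_drop subn_eq0 leqNgt js /=.
by rewrite (take_nth x0 js) foldl_rcons -drop1 drop_drop add1n -nth0 nth_drop addn0.
Qed.

(** A size bound for all intermediate states is demanded, since iterating a polynomially bounded
    body may still grow exponentially. *)
Lemma fp_iter E B (rE : Rep R E) (hE : Hb E) (rB : Rep R B) (hB : Hb B)
    (n : E -> nat) (b0 : E -> B) (body : E -> B -> B) :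
  fp n -> fp b0 -> fp (fun p : E * B => body p.1 p.2) ->
  (exists k, forall Z e j, hb Z e -> j <= n e -> hb (ub k Z) (iter j (body e) (b0 e))) ->
  fp (fun e => iter (n e) (body e) (b0 e)).
Proof.
move=> [[kn hn] pn] [_ p0] [_ pbd] [kb hb_].
split; first by exists kb => Z e he; exact: hb_.
pose S Z := ub kn Z + ub kb Z + Z.
(* The ghost bound is enlarged so that it dominates the number of rounds, every intermediate state
   and the environment. *)
apply: (@pf_pre _ _ _ _ _ _ (fun Z e => (fun Z' e => exists2 z, hb z e & S z <= Z') (S Z) e)).
  by move=> Z e eZ; exists Z.
have pS : polyb S by apply: polyb_add; [apply: polyb_add; exact: polyb_k|exact: polyb_id].
apply: (pf_scale (Q := fun Z' e => exists2 z, hb z e & S z <= Z') pS).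
have pp B' (rB' : Rep R B') (h : E -> B') : pf (fun Z e => hb Z e) h ->
    pf (fun Z' e => exists2 z, hb z e & S z <= Z') h.
  apply: pf_pre => Z e [z ez zZ]; apply: hb_mono ez; apply: leq_trans zZ; exact: leq_addl.
apply: (@pf_iterP _ _ _ _ _ (fun Z p => hb Z p) n b0 (fun p => body p.1 p.2)) => //; last 2 first.
- exact: pp.
- exact: pp.
- move=> Z e [z ez zZ]; apply: leq_trans zZ; apply: leq_trans (hn _ _ ez) _.
  by rewrite /S -addnA leq_addr.
move=> Z e j [z ez zZ] jn; rewrite hb_pairE; split.
  by apply: hb_mono ez; apply: leq_trans zZ; exact: leq_addl.
apply: hb_mono (hb_ z e j ez (ltnW jn)); apply: leq_trans zZ.
by rewrite /S addnAC leq_addl.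
Qed.

(** A computable default, needed for taking the head of the remaining list inside a loop. *)
Class Inh (A : Type) (rA : Rep R A) (hA : Hb A) := MkInh {
  inh : A; fp_inh : forall E (rE : Rep R E) (hE : Hb E), fp (fun _ : E => inh) }.
#[export] Instance nat_Inh : Inh (nat_Rep R) nat_Hb.
Proof. by exists 0 => *; exact: fp_nat. Defined.
#[export] Instance real_Inh : Inh (real_Rep R) real_Hb.
Proof. by exists 0%R => *; exact: fp_r0. Defined.
#[export] Instance seq_Inh A (rA : Rep R A) (hA : Hb A) : Inh (seq_Rep rA) (seq_Hb hA).
Proof. by exists [::] => *; exact: fp_nil. Defined.
#[export] Instance prod_Inh A B (rA : Rep R A) (hA : Hb A) (rB : Rep R B) (hB : Hb B)
  (iA : Inh rA hA) (iB : Inh rB hB) : Inh (prod_Rep rA rB) (prod_Hb hA hB).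
Proof. by exists (inh, inh) => *; apply: fp_pair; exact: fp_inh. Defined.

Section Lists.
Variables (E : Type) (rE : Rep R E) (hE : Hb E).
Variables (A : Type) (rA : Rep R A) (hA : Hb A) (iA : Inh rA hA).

Lemma fp_size (l : E -> seq A) : fp l -> fp (fun e => size (l e)).
Proof.
move=> fl; apply: (fp_comp (g := fun s : seq A => size s)) fl _; split.
  by exists 1 => Z s [h _]; apply: leq_trans h (ub1 _).
apply: (@pf_ext _ _ _ _ _ _ (fun s : seq A => foldl (fun b x => (fun p : seq A * nat * A => p.1.2 + 1) (s, b, x)) 0 s)).
  move=> s; suff h c : foldl (fun (b : nat) (_ : A) => b + 1) c s = size s + c by rewrite /= h addn0.
  by elim: s c => //= x s IH c; rewrite IH addn1 addnS.
apply: (@pf_foldl R (seq A) A nat _ _ _ (fun Z s => hb Z s) true2 (fun _ _ _ => True)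
  (fun s => s) (fun=> 0) (fun p : seq A * nat * A => p.1.2 + 1)) => //.
- by move=> Z s [].
- exact: pf_id.
- exact: pf_nat.
apply: (pf_comp (Q := true2) (f := fun p : seq A * nat * A => (p.1.2, 1)) (g := fun p => p.1 + p.2)) => //; last exact: pf_add.
apply: pf_pair; last exact: pf_nat.
apply: (pf_comp (Q := true2) (f := fun p : seq A * nat * A => p.1) (g := fun p => p.2)) => //; [exact: pf_fst|exact: pf_snd].
Qed.

(** Recast as an iteration on the remaining list and the accumulator; the states reached are folds
    over prefixes, and only these have to be bounded. *)
Lemma fp_foldl B (rB : Rep R B) (hB : Hb B) (l : E -> seq A) (b0 : E -> B) (body : E -> B -> A -> B) :
  fp l -> fp b0 -> fp (fun p : E * B * A => body p.1.1 p.1.2 p.2) ->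
  (exists k, forall Z e j, hb Z e -> hb (ub k Z) (foldl (body e) (b0 e) (take j (l e)))) ->
  fp (fun e => foldl (body e) (b0 e) (l e)).
Proof.
move=> fl f0 fb [g hg].
pose x0 : A := @inh _ _ _ iA.
pose bdy e (p : seq A * B) := if nilp p.1 then p else (behead p.1, body e p.2 (head x0 p.1)).
apply: (@fp_ext _ _ _ _ _ _ (fun e => (iter (size (l e)) (bdy e) (l e, b0 e)).2)).
  by move=> e; rewrite (foldl_iter _ _ _ x0).
apply: (fp_comp (g := fun p : seq A * B => p.2)); last exact: fp_snd.
apply: fp_iter => //; [exact: fp_size|exact: fp_pair| |].
  have f21 : fp (fun p : E * (seq A * B) => p.2.1).
    apply: (fp_comp (f := fun p : E * (seq A * B) => p.2) (g := fun p => p.1)); [exact: fp_snd|exact: fp_fst].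
  apply: fp_cond.
  - by apply: (fp_comp (g := fun s => nilp s) f21); exact: fp_nilp0.
  - exact: fp_snd.
  - apply: fp_pair; first by apply: (fp_comp (g := fun s => behead s) f21); exact: fp_behead0.
    apply: (fp_comp (f := fun p : E * (seq A * B) => (p.1, p.2.2, head x0 p.2.1))
      (g := fun p => body p.1.1 p.1.2 p.2)) => //.
    apply: fp_pair; first apply: fp_pair.
    + exact: fp_fst.
    + apply: (fp_comp (f := fun p : E * (seq A * B) => p.2) (g := fun p => p.2)); exact: fp_snd.
    + apply: (fp_comp (f := fun p : E * (seq A * B) => (x0, p.2.1)) (g := fun p => head p.1 p.2)).
        by apply: fp_pair; [exact: fp_inh|].
      exact: fp_head0.
have [[kl pl] _] := fl.
exists (kl + g) => Z e j he jn; rewrite (foldl_state _ _ x0 jn) hb_pairE; split; last first.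
  by apply: hb_mono (hg Z e j he); apply: ub_le; exact: leq_addl.
apply: hb_mono (ub_le _ (leq_addr g kl)) _; have [h1 h2] := pl Z e he; split.
  by rewrite size_drop; apply: leq_trans (leq_subr _ _) h1.
move=> x xd; apply: h2; rewrite -(cat_take_drop j (l e)); elim: (take j (l e)) => //= *; by right.
Qed.

Lemma fp_rev (l : E -> seq A) : fp l -> fp (fun e => rev (l e)).
Proof.
move=> fl; have [[k pl] _] := fl.
have e1 s (t : seq A) : foldl (fun b x => x :: b) t s = rev s ++ t.
  by elim: s t => //= x s IH t; rewrite IH rev_cons cat_rcons.
apply: (@fp_ext _ _ _ _ _ _ (fun e => foldl (fun b x => x :: b) [::] (l e))).
  by move=> e; rewrite e1 cats0.
apply: fp_foldl => //; first exact: fp_nil.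
  apply: (fp_comp (f := fun p : E * seq A * A => (p.2, p.1.2)) (g := fun p => p.1 :: p.2)); last exact: fp_cons0.
  apply: fp_pair; first exact: fp_snd.
  apply: (fp_comp (f := fun p : E * seq A * A => p.1) (g := fun p => p.2)); [exact: fp_fst|exact: fp_snd].
exists k => Z e j he; have [h1 h2] := pl Z e he; rewrite e1 cats0; split.
  by rewrite size_rev size_take_min; apply: leq_trans (geq_minr _ _) h1.
by move=> x xi; apply: h2; exact: (In_take (In_rev xi)).
Qed.

Lemma fp_cat (l l' : E -> seq A) : fp l -> fp l' -> fp (fun e => l e ++ l' e).
Proof.
move=> fl fl'; have [[k pl] _] := fl; have [[k' pl'] _] := fl'.
have e1 s (t : seq A) : foldl (fun b x => x :: b) t s = rev s ++ t.
  by elim: s t => //= x s IH t; rewrite IH rev_cons cat_rcons.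
apply: (@fp_ext _ _ _ _ _ _ (fun e => foldl (fun b x => x :: b) (l' e) (rev (l e)))).
  by move=> e; rewrite e1 revK.
apply: fp_foldl => //; first exact: fp_rev.
  apply: (fp_comp (f := fun p : E * seq A * A => (p.2, p.1.2)) (g := fun p => p.1 :: p.2)); last exact: fp_cons0.
  apply: fp_pair; first exact: fp_snd.
  apply: (fp_comp (f := fun p : E * seq A * A => p.1) (g := fun p => p.2)); [exact: fp_fst|exact: fp_snd].
exists (k + k').+1 => Z e j he; have [h1 h2] := pl Z e he; have [h3 h4] := pl' Z e he; rewrite e1; split.
  rewrite size_cat size_rev; apply: ubD h3; apply: leq_trans h1.
  by rewrite size_take_min size_rev; exact: geq_minr.
move=> x xi0; case: (In_cat xi0) => xi.
  by apply: hb_mono (h2 _ (In_rev (In_take (In_rev xi)))); apply: ub_le; rewrite leqW // leq_addr.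
by apply: hb_mono (h4 _ xi); apply: ub_le; rewrite leqW // leq_addl.
Qed.

End Lists.

Section Ops.
Variables (E : Type) (rE : Rep R E) (hE : Hb E).
Lemma fp_1 A B (rA : Rep R A) (hA : Hb A) (rB : Rep R B) (hB : Hb B) (f : E -> A * B) :
  fp f -> fp (fun e => (f e).1).
Proof. by move=> h; apply: (fp_comp h); exact: fp_fst. Qed.
Lemma fp_2 A B (rA : Rep R A) (hA : Hb A) (rB : Rep R B) (hB : Hb B) (f : E -> A * B) :
  fp f -> fp (fun e => (f e).2).
Proof. by move=> h; apply: (fp_comp h); exact: fp_snd. Qed.
Variables (f g : E -> nat) (x y : E -> R).
Lemma fp_add : fp f -> fp g -> fp (fun e => f e + g e). Proof. exact: fp2 fp_add0. Qed.
Lemma fp_sub : fp f -> fp g -> fp (fun e => f e - g e). Proof. exact: fp2 fp_sub0. Qed.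
Lemma fp_leq : fp f -> fp g -> fp (fun e => f e <= g e). Proof. exact: fp2 fp_leq0. Qed.
Lemma fp_S : fp f -> fp (fun e => (f e).+1).
Proof.
move=> h; apply: (@fp_ext _ _ _ _ _ _ (fun e => f e + 1)); first by move=> e; rewrite addn1.
by apply: (fp2 fp_add0 h); exact: fp_nat.
Qed.
Lemma fp_radd : fp x -> fp y -> fp (fun e => (x e + y e)%R). Proof. exact: fp2 fp_radd0. Qed.
Lemma fp_rsub : fp x -> fp y -> fp (fun e => (x e - y e)%R).
Proof. move=> h1 h2; exact: (fp2 (h := fun a b => (a - b)%R) fp_rsub0 h1 h2). Qed.
Lemma fp_rmul : fp x -> fp y -> fp (fun e => (x e * y e)%R). Proof. exact: fp2 fp_rmul0. Qed.
Lemma fp_rdiv : fp x -> fp y -> fp (fun e => (x e / y e)%R).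
Proof. move=> h1 h2; exact: (fp2 (h := fun a b => (a / b)%R) fp_rdiv0 h1 h2). Qed.
Lemma fp_rle : fp x -> fp y -> fp (fun e => (x e <= y e)%R). Proof. exact: fp2 fp_rle0. Qed.
Lemma fp_sqrt : fp x -> fp (fun e => Num.sqrt (x e)). Proof. by move=> h; exact: (fp_comp h fp_sqrt0). Qed.
Variables (A : Type) (rA : Rep R A) (hA : Hb A).
Lemma fp_cons (a : E -> A) (s : E -> seq A) : fp a -> fp s -> fp (fun e => a e :: s e).
Proof. exact: fp2 (fp_cons0 _ _). Qed.
Lemma fp_nilp (s : E -> seq A) : fp s -> fp (fun e => nilp (s e)).
Proof. by move=> h; exact: (fp_comp h (fp_nilp0 _ _)). Qed.
Lemma fp_behead (s : E -> seq A) : fp s -> fp (fun e => behead (s e)).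
Proof. by move=> h; exact: (fp_comp h (fp_behead0 _ _)). Qed.
Lemma fp_head (a : E -> A) (s : E -> seq A) : fp a -> fp s -> fp (fun e => head (a e) (s e)).
Proof. exact: fp2 (fp_head0 _ _). Qed.
End Ops.

Section Map.
Variables (E A B : Type) (rE : Rep R E) (hE : Hb E) (rA : Rep R A) (hA : Hb A) (iA : Inh rA hA).
Variables (rB : Rep R B) (hB : Hb B) (iB : Inh rB hB).

Lemma fp_map (l : E -> seq A) (h : E -> A -> B) :
  fp l -> fp (fun p : E * A => h p.1 p.2) -> fp (fun e => [seq h e x | x <- l e]).
Proof.
move=> fl fh; have [[k pl] _] := fl; have [[kh ph] _] := fh.
have e1 e s t : foldl (fun b x => h e x :: b) t s = rev (map (h e) s) ++ t.
  by elim: s t => //= x s IH t; rewrite IH rev_cons cat_rcons.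
apply: (@fp_ext _ _ _ _ _ _ (fun e => rev (foldl (fun b x => h e x :: b) [::] (l e)))).
  by move=> e; rewrite e1 cats0 revK.
apply: fp_rev; apply: (@fp_foldl E rE hE A rA hA iA _ _ _ l (fun=> [::]) (fun e b x => h e x :: b)) => //; first exact: fp_nil.
  apply: fp_cons; last by apply: fp_2; exact: fp_fst.
  apply: (fp_comp (f := fun p : E * seq B * A => (p.1.1, p.2)) (g := fun p => h p.1 p.2)) => //.
  by apply: fp_pair; [apply: fp_1; exact: fp_fst|exact: fp_snd].
exists (k + k.+3 * kh) => Z e j he; have [h1 h2] := pl Z e he; rewrite e1 cats0; split.
  rewrite size_rev size_map size_take_min; apply: leq_trans (geq_minr _ _) (leq_trans h1 _).
  by apply: ub_le; exact: leq_addr.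
move=> y yi; have [x xi ->] := In_map (In_rev yi); have xl := In_take xi.
have hx : hb (ub k.+1 Z) (e, x).
  rewrite hb_pairE; split; first by apply: hb_mono he; apply: leq_trans (ub1 _) _; exact: ub_le.
  by apply: hb_mono (h2 _ xl); exact: ub_le.
by apply: hb_mono (ph _ _ hx); apply: leq_trans (ub_ub _ _ _) _; apply: ub_le; exact: leq_addl.
Qed.
End Map.

Section More.
Variables (E A : Type) (rE : Rep R E) (hE : Hb E) (rA : Rep R A) (hA : Hb A) (iA : Inh rA hA).

Lemma fp_filter (l : E -> seq A) (p : E -> A -> bool) :
  fp l -> fp (fun q : E * A => p q.1 q.2) -> fp (fun e => [seq x <- l e | p e x]).
Proof.
move=> fl fh; have [[k pl] _] := fl.
have e1 e s t : foldl (fun b x => if p e x then x :: b else b) t s = rev (filter (p e) s) ++ t.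
  by elim: s t => //= x s IH t; rewrite IH; case: ifP => // _; rewrite rev_cons cat_rcons.
apply: (@fp_ext _ _ _ _ _ _ (fun e => rev (foldl (fun b x => if p e x then x :: b else b) [::] (l e)))).
  by move=> e; rewrite e1 cats0 revK.
apply: fp_rev; apply: (@fp_foldl E rE hE A rA hA iA _ _ _ l (fun=> [::]) (fun e b x => if p e x then x :: b else b)) => //; first exact: fp_nil.
  apply: fp_cond; last by apply: fp_2; exact: fp_fst.
    apply: (fp_comp (f := fun p : E * seq A * A => (p.1.1, p.2)) (g := fun q => p q.1 q.2)) => //.
    by apply: fp_pair; [apply: fp_1; exact: fp_fst|exact: fp_snd].
  by apply: fp_cons; [exact: fp_snd|apply: fp_2; exact: fp_fst].
exists k => Z e j he; have [h1 h2] := pl Z e he; rewrite e1 cats0; split.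
  rewrite size_rev size_filter; apply: leq_trans (count_size _ _) _.
  by rewrite size_take_min; apply: leq_trans (geq_minr _ _) h1.
by move=> y yi; have [xi _] := In_filter (In_rev yi); exact: h2 (In_take xi).
Qed.

Lemma fp_flatten (l : E -> seq (seq A)) : fp l -> fp (fun e => flatten (l e)).
Proof.
move=> fl; have [[k pl] _] := fl.
have e1 (s : seq (seq A)) t : foldl (fun b x => b ++ x) t s = t ++ flatten s.
  by elim: s t => [|x s IH] t /=; rewrite ?cats0 // IH catA.
apply: (@fp_ext _ _ _ _ _ _ (fun e => foldl (fun b x => b ++ x) [::] (l e))).
  by move=> e; rewrite e1.
apply: (@fp_foldl E rE hE _ _ _ (seq_Inh rA hA) _ _ _ l (fun=> [::]) (fun e b x => b ++ x)) => //; first exact: fp_nil.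
  by apply: fp_cat; [apply: fp_2; exact: fp_fst|exact: fp_snd].
exists (k + k) => Z e j he; have [h1 h2] := pl Z e he; rewrite e1 /=.
have : forall s, (forall x, List.In x s -> List.In x (l e)) -> hb (size s * ub k Z) (flatten s).
  elim=> // x s IH sub; have [a1 a2] := IH (fun y ys => sub y (or_intror ys)).
  have [b1 b2] := h2 x (sub x (or_introl erefl)); split.
    by rewrite /= size_cat mulSn leq_add.
  move=> y yi; case: (In_cat (yi : List.In y (x ++ flatten s))) => [/b2|/a2]; apply: hb_mono; by rewrite /= mulSn ?leq_addr ?leq_addl.
move=> h; apply: hb_mono (h _ (fun x => @In_take _ x j (l e))).
rewrite /ub expnD leq_mul2r; apply/orP; right; rewrite size_take_min.
by apply: leq_trans (geq_minr _ _) h1.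
Qed.

Lemma fp_has (l : E -> seq A) (p : E -> A -> bool) :
  fp l -> fp (fun q : E * A => p q.1 q.2) -> fp (fun e => has (p e) (l e)).
Proof.
move=> fl fh; apply: (@fp_ext _ _ _ _ _ _ (fun e => 1 <= size [seq x <- l e | p e x])).
  by move=> e; rewrite size_filter has_count.
by apply: fp_leq; [exact: fp_nat|apply: fp_size; exact: fp_filter].
Qed.
Lemma fp_count (l : E -> seq A) (p : E -> A -> bool) :
  fp l -> fp (fun q : E * A => p q.1 q.2) -> fp (fun e => count (p e) (l e)).
Proof.
move=> fl fh; apply: (@fp_ext _ _ _ _ _ _ (fun e => size [seq x <- l e | p e x])).
  by move=> e; rewrite size_filter.
by apply: fp_size; exact: fp_filter.
Qed.
Lemma fp_all (l : E -> seq A) (p : E -> A -> bool) :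
  fp l -> fp (fun q : E * A => p q.1 q.2) -> fp (fun e => all (p e) (l e)).
Proof.
move=> fl fh; apply: (@fp_ext _ _ _ _ _ _ (fun e => size (l e) <= size [seq x <- l e | p e x])).
  by move=> e; rewrite size_filter all_count eqn_leq count_size.
by apply: fp_leq; apply: fp_size => //; exact: fp_filter.
Qed.
Lemma fp_drop (n : E -> nat) (l : E -> seq A) : fp n -> fp l -> fp (fun e => drop (n e) (l e)).
Proof.
move=> fn fl; have [[k pl] _] := fl.
have e1 j s : iter j (fun s : seq A => behead s) s = drop j s.
  by elim: j s => [|j IH] s; [rewrite drop0|rewrite iterSr IH; case: s => //; rewrite drop_nil].
apply: (@fp_ext _ _ _ _ _ _ (fun e => iter (n e) (fun s => behead s) (l e))); first by move=> e; rewrite e1.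
apply: (@fp_iter E _ _ _ _ _ n l (fun e s => behead s)) => //; first by apply: fp_behead; exact: fp_snd.
exists k => Z e j he _; have [h1 h2] := pl Z e he; rewrite e1; split.
  by rewrite size_drop; apply: leq_trans (leq_subr _ _) h1.
move=> x xd; apply: h2; rewrite -(cat_take_drop j (l e)); elim: (take j (l e)) => //= *; by right.
Qed.
Lemma fp_nth (a : E -> A) (l : E -> seq A) (n : E -> nat) : fp a -> fp l -> fp n ->
  fp (fun e => nth (a e) (l e) (n e)).
Proof.
move=> fa fl fn; apply: (@fp_ext _ _ _ _ _ _ (fun e => head (a e) (drop (n e) (l e)))).
  by move=> e; rewrite -nth0 nth_drop addn0.
by apply: fp_head => //; exact: fp_drop.
Qed.
End More.

Section Nats.
Variables (E : Type) (rE : Rep R E) (hE : Hb E).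
Lemma fp_eqn (f g : E -> nat) : fp f -> fp g -> fp (fun e => f e == g e).
Proof.
move=> ff fg; apply: (@fp_ext _ _ _ _ _ _ (fun e => if f e <= g e then g e <= f e else f e <= g e)).
  by move=> e; rewrite eqn_leq; case: (f e <= g e).
by apply: fp_cond; apply: fp_leq.
Qed.
Lemma fp_and (b c : E -> bool) : fp b -> fp c -> fp (fun e => b e && c e).
Proof.
move=> fb fc; apply: (@fp_ext _ _ _ _ _ _ (fun e => if b e then c e else b e)).
  by move=> e; case: (b e).
exact: fp_cond.
Qed.
Lemma fp_or (b c : E -> bool) : fp b -> fp c -> fp (fun e => b e || c e).
Proof.
move=> fb fc; apply: (@fp_ext _ _ _ _ _ _ (fun e => if b e then b e else c e)).
  by move=> e; case: (b e).
exact: fp_cond.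
Qed.
Lemma fp_not (b : E -> bool) : fp b -> fp (fun e => ~~ b e).
Proof.
move=> fb; apply: (@fp_ext _ _ _ _ _ _ (fun e => if b e then 1 <= 0 else 0 <= 0)).
  by move=> e; case: (b e).
by apply: fp_cond => //; apply: fp_leq; exact: fp_nat.
Qed.
Lemma fp_mul (f g : E -> nat) : fp f -> fp g -> fp (fun e => f e * g e).
Proof.
move=> ff fg; have [[k hk] _] := ff; have [[l hl] _] := fg.
have e1 (e : E) j : iter j (fun b => g e + b) 0 = j * g e by elim: j => //= j ->; rewrite mulSn.
apply: (@fp_ext _ _ _ _ _ _ (fun e => iter (f e) (fun b => g e + b) 0)); first by move=> e; rewrite e1.
apply: (@fp_iter E _ _ _ _ _ f (fun=> 0) (fun e b => g e + b)) => //; first exact: fp_nat.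
  by apply: fp_add; [apply: (fp_comp (fp_fst _ _ _ _) fg)|exact: fp_snd].
exists (k + l) => Z e j he jf; rewrite e1; apply: ubM; last exact: hl.
exact: leq_trans jf (hk _ _ he).
Qed.
(** A counter grows while the double of its successor does not exceed [f e], as the machine cannot
    divide naturals. *)
Lemma fp_half (f : E -> nat) : fp f -> fp (fun e => (f e)./2).
Proof.
move=> ff; have [[k hk] _] := ff.
have e1 (e : E) j : iter j (fun b => if b.+1 + b.+1 <= f e then b.+1 else b) 0 = minn j (f e)./2.
  elim: j => [|j IH]; first by rewrite min0n.
  rewrite iterS IH; have := odd_double_half (f e); rewrite -addnn.
  by move: (f e)./2 (f e) => h x; case: (odd x) => xE; case: ifP; lia.
apply: (@fp_ext _ _ _ _ _ _ (fun e => iter (f e) (fun b => if b.+1 + b.+1 <= f e then b.+1 else b) 0)).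
  by move=> e; rewrite e1; apply/minn_idPr; rewrite -{2}(odd_double_half (f e)) -addnn; lia.
apply: (@fp_iter E _ _ _ _ _ f (fun=> 0) (fun e b => if b.+1 + b.+1 <= f e then b.+1 else b)) => //; first exact: fp_nat.
  have f1 : fp (fun p : E * nat => f p.1) by apply: (fp_comp (fp_fst _ _ _ _) ff).
  by apply: fp_cond; [apply: fp_leq => //; apply: fp_add; apply: fp_S; exact: fp_snd|apply: fp_S; exact: fp_snd|exact: fp_snd].
exists k => Z e j he jf; rewrite e1; apply: leq_trans (geq_minl _ _) (leq_trans jf (hk _ _ he)).
Qed.
Lemma fp_iota (f g : E -> nat) : fp f -> fp g -> fp (fun e => iota (f e) (g e)).
Proof.
move=> ff fg; have [[k hk] _] := ff; have [[l hl] _] := fg.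
have e1 (e : E) j : j <= g e -> iter j (fun b : nat * seq nat => (b.1 - 1, (b.1 - 1) :: b.2)) (f e + g e, [::]) =
   (f e + g e - j, iota (f e + g e - j) j).
  elim: j => [|j IH] jg; first by rewrite subn0.
  rewrite iterS (IH (ltnW jg)) /=; have -> : f e + g e - j - 1 = f e + g e - j.+1 by lia.
  by congr (_, _ :: iota _ _); lia.
apply: (@fp_ext _ _ _ _ _ _ (fun e => (iter (g e) (fun b : nat * seq nat => (b.1 - 1, (b.1 - 1) :: b.2)) (f e + g e, [::])).2)).
  by move=> e; rewrite e1 // addnK.
apply: fp_2; apply: (@fp_iter E _ _ _ _ _ g (fun e => (f e + g e, [::])) (fun e (b : nat * seq nat) => (b.1 - 1, (b.1 - 1) :: b.2))) => //.
- by apply: fp_pair; [exact: fp_add|exact: fp_nil].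
- have f1 : fp (fun p : E * (nat * seq nat) => p.2.1 - 1).
    by apply: fp_sub; [apply: fp_1; exact: fp_snd|exact: fp_nat].
  by apply: fp_pair => //; apply: fp_cons => //; apply: fp_2; exact: fp_snd.
exists (k + l).+1 => Z e j he jg; rewrite e1 // hb_pairE.
have h : f e + g e <= ub (k + l).+1 Z by apply: ubD; [exact: hk|exact: hl].
split; first by apply: leq_trans (leq_subr _ _) h.
split; first by rewrite size_iota; apply: leq_trans jg (leq_trans _ h); exact: leq_addl.
by move=> x /In_mem; rewrite mem_iota => /andP [_ lt]; apply: leq_trans (ltnW lt) _; apply: leq_trans h; lia.
Qed.
End Nats.

End Fp.
Arguments fp {R A B rA hA rB hB} f.
End Fp2.

(** * The table operations as polynomial-time list functions *)

Module Alg.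
Import Ram DP Fp2 Geo.

Set Implicit Arguments.
Unset Strict Implicit.
Unset Printing Implicit Defensive.
Import Order.TTheory GRing.Theory Num.Theory.
Local Open Scope nat_scope.

Ltac fpuser := fail.
(** Syntax-directed: each combinator has one closure lemma, so membership of a function written with
    them follows by recursion on its body. [fpuser] is the hook for functions handled later. *)
Ltac fpt := cbn beta; lazymatch goal with
 | |- @fp _ _ nat _ _ _ _ (fun _ => ?c) => exact: fp_nat
 | |- fp (fun e => e) => exact: fp_id
 | |- fp (@fst _ _) => exact: fp_fst
 | |- fp (@snd _ _) => exact: fp_snd
 | |- fp (@nil _) => exact: fp_nil
 | |- fp (fun e => @nil _) => exact: fp_nil
 | |- fp (fun e => fst (@?f e)) => apply: fp_1; fpt
 | |- fp (fun e => snd (@?f e)) => apply: fp_2; fpt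
 | |- fp (fun e => pair (@?f e) (@?g e)) => apply: fp_pair; fpt
 | |- fp (fun e => cons (@?f e) (@?g e)) => apply: fp_cons; fpt
 | |- fp (fun e => map (@?h e) (@?l e)) => apply: fp_map; fpt
 | |- fp (fun e => filter (@?h e) (@?l e)) => apply: fp_filter; fpt
 | |- fp (fun e => has (@?h e) (@?l e)) => apply: fp_has; fpt
 | |- fp (fun e => all (@?h e) (@?l e)) => apply: fp_all; fpt
 | |- fp (fun e => count (@?h e) (@?l e)) => apply: fp_count; fpt
 | |- fp (fun e => flatten (@?l e)) => apply: fp_flatten; fpt
 | |- fp (fun e => size (@?l e)) => apply: fp_size; fpt
 | |- fp (fun e => rev (@?l e)) => apply: fp_rev; fpt
 | |- fp (fun e => behead (@?l e)) => apply: fp_behead; fpt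
 | |- fp (fun e => nilp (@?l e)) => apply: fp_nilp; fpt
 | |- fp (fun e => cat (@?l e) (@?m e)) => apply: fp_cat; fpt
 | |- fp (fun e => head (@?a e) (@?l e)) => apply: fp_head; fpt
 | |- fp (fun e => nth (@?a e) (@?l e) (@?n e)) => apply: fp_nth; fpt
 | |- fp (fun e => iota (@?f e) (@?g e)) => apply: fp_iota; fpt
 | |- fp (fun e => addn (@?f e) (@?g e)) => apply: fp_add; fpt
 | |- fp (fun e => subn (@?f e) (@?g e)) => apply: fp_sub; fpt
 | |- fp (fun e => muln (@?f e) (@?g e)) => apply: fp_mul; fpt
 | |- fp (fun e => half (@?f e)) => apply: fp_half; fpt
 | |- fp (fun e => S (@?f e)) => apply: fp_S; fpt
 | |- fp (fun e => leq (@?f e) (@?g e)) => apply: fp_leq; fpt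
 | |- fp (fun e => andb (@?f e) (@?g e)) => apply: fp_and; fpt
 | |- fp (fun e => orb (@?f e) (@?g e)) => apply: fp_or; fpt
 | |- fp (fun e => negb (@?f e)) => apply: fp_not; fpt
 | |- fp (fun e => @GRing.zero _) => exact: fp_r0
 | |- fp (fun e => @GRing.one _) => exact: fp_r1
 | |- fp (fun e => GRing.add (@?f e) (GRing.opp (@?g e))) => apply: fp_rsub; fpt
 | |- fp (fun e => GRing.add (@?f e) (@?g e)) => apply: fp_radd; fpt
 | |- fp (fun e => GRing.mul (@?f e) (GRing.inv (@?g e))) => apply: fp_rdiv; fpt
 | |- fp (fun e => GRing.mul (@?f e) (@?g e)) => apply: fp_rmul; fpt
 | |- fp (fun e => Order.le (@?f e) (@?g e)) => apply: fp_rle; fpt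
 | |- fp (fun e => Num.sqrt (@?f e)) => apply: fp_sqrt; fpt
 | |- fp _ => first [eassumption | fpuser; fpt | apply: fp_eqn; fpt | apply: fp_cond; fpt
      | lazymatch goal with
        | |- fp (fun e => ?f (@?g e)) =>
            lazymatch g with (fun x => x) => fail | _ => apply: (fp_comp (f := g) (g := f)); fpt end
        | |- fp (fun e => _) => fail
        | |- @fp ?R ?A ?B ?a ?b ?c ?d ?f => change (@fp R A B a b c d (fun x : A => f x)); fpt
        end | idtac]
 | |- _ => idtac
 end.

Section Impl.
Variable R : realType.
Local Notation itm := (nat * (nat * seq (seq nat)))%type.

(** Operations outside the set of combinators, such as this one and the next three, are rewritten
    with index lists so that [fpt] can treat them. *)
Lemma indexE (T : eqType) (x0 x : T) s :
  index x s = head (size s) [seq i <- iota 0 (size s) | nth x0 s i == x].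
Proof.
elim: s => //= y s IH; case: eqP => //= _.
rewrite -[in iota 1 _](addn0 1) iotaDl filter_map IH.
have -> : [seq i <- iota 0 (size s) | preim (addn 1) (fun i => nth x0 (y :: s) i == x) i] =
   [seq i <- iota 0 (size s) | nth x0 s i == x] by apply: eq_filter => i.
by case: [seq i <- iota 0 (size s) | _] => //= i l.
Qed.

Lemma eqseqE (T : eqType) (x0 : T) (s t : seq T) :
  (s == t) = (size s == size t) && all (fun i => nth x0 s i == nth x0 t i) (iota 0 (size s)).
Proof.
apply/eqP/andP => [->|[/eqP sz /allP h]]; first by rewrite eqxx; split=> //; apply/allP => i _; rewrite eqxx.
by apply: (@eq_from_nth _ x0) => // i il; apply/eqP/h; rewrite mem_iota0.
Qed.

Lemma zipE (S T : Type) (x : S) (y : T) s t :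
  zip s t = [seq (nth x s i, nth y t i) | i <- iota 0 (if size s <= size t then size s else size t)].
Proof.
elim: s t => [|a s IH] [|b t] //=; rewrite ltnS IH.
by case: ifP => _ /=; rewrite -[in iota 1 _](addn0 1) iotaDl -map_comp.
Qed.

Lemma uniqE (s : seq nat) : uniq s =
  all (fun i => all (fun j => (i == j) || ~~ (nth 0 s i == nth 0 s j)) (iota 0 (size s))) (iota 0 (size s)).
Proof.
apply/(uniqP 0)/allP => [h i|h i j il jl e].
  rewrite mem_iota0 => il; apply/allP => j; rewrite mem_iota0 => jl.
  by case: eqP => //= ne; apply/negP => /eqP /(h _ _ il jl).
have /allP/(_ j) := h i ltac:(by rewrite mem_iota0); rewrite mem_iota0 => /(_ jl).
by rewrite e eqxx orbF => /eqP.
Qed.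

Section E.
Variables (E : Type) (rE : Rep R E) (hE : Hb E).

Lemma fp_eqs (s t : E -> seq nat) : fp s -> fp t -> fp (fun e => s e == t e).
Proof.
move=> fs ft; apply: (@fp_ext _ _ _ _ _ _ _ (fun e => (size (s e) == size (t e)) &&
   all (fun i => nth 0 (s e) i == nth 0 (t e) i) (iota 0 (size (s e))))).
  by move=> p; rewrite -eqseqE.
by fpt.
Qed.

Lemma fp_eqp (s t : E -> seq (nat * nat)) : fp s -> fp t -> fp (fun e => s e == t e).
Proof.
move=> fs ft; apply: (@fp_ext _ _ _ _ _ _ _ (fun e => (size (s e) == size (t e)) &&
   all (fun i => ((nth (0,0) (s e) i).1 == (nth (0,0) (t e) i).1) &&
                 ((nth (0,0) (s e) i).2 == (nth (0,0) (t e) i).2)) (iota 0 (size (s e))))).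
  move=> p; rewrite (eqseqE (0,0)); congr andb; apply: eq_all => i; rewrite /= -pair_eqE; by case: (nth _ _ _) (nth _ _ _).
by fpt.
Qed.

Lemma fp_mem (x : E -> nat) (s : E -> seq nat) : fp x -> fp s -> fp (fun e => x e \in s e).
Proof.
move=> fx fs; apply: (@fp_ext _ _ _ _ _ _ _ (fun e => has (fun y => y == x e) (s e))); first by move=> e; rewrite -has_pred1.
by fpt.
Qed.

Lemma fp_uniq (s : E -> seq nat) : fp s -> fp (fun e => uniq (s e)).
Proof.
move=> fs; apply: (@fp_ext _ _ _ _ _ _ _ (fun e => all (fun i => all (fun j => (i == j) || ~~ (nth 0 (s e) i == nth 0 (s e) j)) (iota 0 (size (s e)))) (iota 0 (size (s e))))) => [e|]; first exact/esym/uniqE.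
by fpt.
Qed.

Lemma fp_last (s : E -> seq nat) : fp s -> fp (fun e => last 0 (s e)).
Proof.
move=> fs; apply: (@fp_ext _ _ _ _ _ _ _ (fun e => nth 0 (s e) (size (s e) - 1))) => [e|]; first by rewrite subn1 nth_last.
by fpt.
Qed.

Lemma fp_samec (cs : E -> seq (seq nat)) (p q : E -> nat) :
  fp cs -> fp p -> fp q -> fp (fun e => samec (cs e) (p e) (q e)).
Proof. by move=> f g h; rewrite /samec; apply: fp_eqs; fpt. Qed.
End E.

Lemma fp_repr E (rE : Rep R E) (hE : Hb E) (cs : E -> seq (seq nat)) (p : E -> nat) :
  fp cs -> fp p -> fp (fun e => repr (cs e) (p e)).
Proof.
move=> f g; apply: (@fp_ext _ _ _ _ _ _ _ (fun e => head (size (cs e))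
   [seq i <- iota 0 (size (cs e)) | samec (cs e) i (p e)])).
  by move=> e; rewrite /repr (indexE [::]).
by fpt; apply: fp_samec; fpt.
Qed.

Lemma hb_hstep Z u j : hb Z u -> hb (Z + 1) (iter j hstep u).
Proof.
move=> [h1 h2]; suff [h3 h4] : size (iter j hstep u) <= maxn (size u) 1 /\
   forall x, List.In x (iter j hstep u) -> x <= Z.
  split; first by move: h1 h3; rewrite leq_max; move: (iter _ _ _) => s; clear; lia.
  by move=> x /h4; rewrite hb_natE; lia.
elim: j => [|j [IH1 IH2]]; first by split=> //; rewrite leq_max leqnn.
rewrite iterS /hstep; split; first by rewrite size_rcons size_behead; move: IH1; clear; move: (iter _ _ _) => s; lia.
move=> x /In_mem; rewrite mem_rcons inE => /orP [/eqP ->|]; last first.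
  by move=> xi; apply: IH2; apply/In_mem; move: xi; case: (iter j hstep u) => //= a l; rewrite inE orbC => ->.
case: (iter j hstep u) IH2 => [|a l] //= h; apply: (@leq_trans a); last by apply: h; left.
by rewrite -divn2 leq_div.
Qed.

Lemma fp_lvl E (rE : Rep R E) (hE : Hb E) (L : E -> nat) (U : E -> seq (seq nat)) :
  fp L -> fp U -> fp (fun e => lvl (L e) (U e)).
Proof.
move=> f g; rewrite /lvl; apply: fp_map => //.
apply: (@fp_iter _ _ _ _ _ _ _ (fun p : E * seq nat => L p.1) (fun p => p.2) (fun _ => hstep)); try fpt.
- apply: (@fp_ext _ _ _ _ _ _ _ (fun p : seq nat => behead p ++ [:: (head 0 p)./2])).
    by move=> p; rewrite /hstep cats1.
  by fpt.
exists 1 => Z e j [h1 h2] _; apply: hb_mono (hb_hstep _ h2).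
by rewrite /ub expn1 leq_add2l.
Qed.

(** The script is folded from the left after reversal, since only left folds are loops. *)
Definition bld (bl : seq (seq nat)) v := foldl (fun acc c => bstep bl c acc) [:: [::]] v.
Lemma hb_bld Z bl v : hb Z bl -> [/\ size (bld bl v) <= (size v).+1,
  forall q, List.In q (bld bl v) -> size q <= size v * Z &
  forall q x, List.In q (bld bl v) -> List.In x q -> x <= Z].
Proof.
move=> [h1 h2]; elim/last_ind: v => [|v c [I1 I2 I3]].
  by split=> //= [q [<-|//]|q x [<-|//]].
rewrite /bld foldl_rcons -/(bld bl v) /bstep size_rcons mulSn; case: ifP => cb; last first.
  split=> [|q|q x]; first by rewrite /=.
    by move=> /= [<- //|/I2 h]; apply: leq_trans h _; exact: leq_addl.
  by move=> /= [<- //|/I3]; exact.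
have [n1 n2] : hb Z (nth [::] bl c) by apply: h2; apply/In_mem; exact: mem_nth.
split=> [|q|q x].
- by rewrite /= size_behead; move: I1; clear; move: (bld _ _) => s; lia.
- move=> /= [<-|h]; last first.
    apply: (@leq_trans (size v * Z)); last exact: leq_addl.
    by apply: I2; move: h; case: (bld bl v) => //= a l; right.
  rewrite size_cat; apply: leq_add => //; case: (bld bl v) I2 => [|a l] //= I2; exact: I2 (or_introl erefl).
move=> /= [<-|h]; last by apply: I3; move: h; case: (bld bl v) => //= a l; right.
move=> xi; case: (In_cat xi) => [|h]; first exact: n2.
by case: (bld bl v) h I3 => [|a l] //= h I3; apply: I3 h; left.
Qed.

Lemma fp_build E (rE : Rep R E) (hE : Hb E) (bl : E -> seq (seq nat)) (w : E -> seq nat) :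
  fp bl -> fp w -> fp (fun e => build (bl e) (w e)).
Proof.
move=> f g; apply: (@fp_ext _ _ _ _ _ _ _ (fun e => [seq q <- bld (bl e) (rev (w e)) | ~~ nilp q])).
  by move=> e; rewrite /build /bld foldl_rev; apply: eq_filter => -[].
apply: fp_filter; last by fpt.
apply: (@fp_foldl _ E rE hE nat _ _ _ _ _ _ (fun e => rev (w e)) (fun=> [:: [::]]) (fun e acc c => bstep (bl e) c acc)); try by fpt.
have [[k hk] _] := f; have [[l hl] _] := g.
exists (k + l).+2 => Z e j he; have hbl := hk _ _ he; have [sl _] := hl _ _ he.
have [i1 i2 i3] := hb_bld (take j (rev (w e))) hbl.
have st : size (take j (rev (w e))) <= ub l Z.
  by apply: leq_trans sl; rewrite -(size_rev (w e)) size_take_min geq_minr.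
have z1 x : x <= ub l Z -> x.+1 <= ub (k + l).+2 Z.
  move=> xl; apply: (@leq_trans (ub (l + 1).+1 Z)); last by apply: ub_le; lia.
  by rewrite -addn1; apply: ubD => //; exact: ub_c.
have z2 x : x <= ub k Z -> x <= ub (k + l).+2 Z.
  by move=> xl; apply: leq_trans xl _; apply: ub_le; lia.
split; first by apply: leq_trans i1 _; exact: z1.
move=> q qi; split; last by move=> x xi; apply: z2; exact: i3 qi xi.
apply: leq_trans (i2 _ qi) _; apply: (@leq_trans (ub (l + k) Z)); first exact: ubM.
by apply: ub_le; lia.
Qed.
End Impl.
Ltac fpuser ::= lazymatch goal with
 | |- fp (fun e => samec (@?a e) (@?b e) (@?c e)) => apply: fp_samec
 | |- fp (fun e => repr (@?a e) (@?b e)) => apply: fp_repr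
 | |- fp (fun e => lvl (@?a e) (@?b e)) => apply: fp_lvl
 | |- fp (fun e => build (@?a e) (@?b e)) => apply: fp_build
 | |- fp (fun e => last _ (@?b e)) => apply: fp_last
 | |- fp (fun e => uniq (@?b e)) => apply: fp_uniq
 | |- fp (fun e => is_true _) => fail
 end.

Section Impl2.
Variable R : realType.
Local Notation itm := (nat * (nat * seq (seq nat)))%type.
Variables (E : Type) (rE : Rep R E) (hE : Hb E).

Lemma fp_portals (cs zs : E -> seq (seq nat)) (p : E -> nat) : fp cs -> fp zs -> fp p ->
  fp (fun e => portals (cs e) (zs e) (p e)).
Proof. by move=> f g h; rewrite /portals; fpt. Qed.

Lemma fp_terms (st : E -> seq (seq nat)) : fp st -> fp (fun e => terms (st e)).
Proof. by move=> f; rewrite /terms; fpt. Qed.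

End Impl2.
Section Impl2b.
Variable R : realType.
Local Notation itm := (nat * (nat * seq (seq nat)))%type.
Variables (E : Type) (rE : Rep R E) (hE : Hb E).

Lemma fp_cand (cs zs : E -> seq (seq nat)) (K J : E -> itm) (w : E -> seq nat) :
  fp cs -> fp zs -> fp K -> fp J -> fp w ->
  fp (fun e => (cand (cs e) (zs e) (K e) (J e) (w e) : itm)).
Proof.
move=> f g h i j; rewrite /cand; fpt.
by apply: fp_portals; fpt.
Qed.

Lemma fp_okc (cs : E -> seq (seq nat)) (K J : E -> itm) (w : E -> seq nat) :
  fp cs -> fp K -> fp J -> fp w -> fp (fun e => okc (cs e) (K e) (J e) (w e)).
Proof.
move=> f h i j; rewrite /okc; fpt.
by apply: fp_mem; fpt.
Qed.

Lemma fp_keyeq (c : E -> itm) (k : E -> nat * (nat * seq (nat * nat))) :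
  fp c -> fp k -> fp (fun e => keyof (c e) == k e).
Proof.
move=> f g; apply: (@fp_ext _ _ _ _ _ _ _ (fun e => [&& (c e).1 == (k e).1, (c e).2.1 == (k e).2.1 &
  terms (c e).2.2 == (k e).2.2])).
  by move=> e; rewrite /keyof; case: (k e) => a [b l]; rewrite xpair_eqE xpair_eqE.
by fpt; apply: fp_eqp; fpt; apply: (@fp_terms R _ _ _ id); exact: fp_id.
Qed.

(** The word lists are arguments here: their lengths are not polynomial in the parameters, so they
    are produced separately, under a ghost bound that dominates these lengths. *)
Definition keysW (WN : seq (seq nat)) (WK : seq (seq (seq nat))) (cs zs : seq (seq nat)) :
   seq (nat * (nat * seq (nat * nat))) :=
  let N := size cs in
  flatten [seq flatten [seq flatten [seq flatten [seq flatten [seq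
    [seq (p, (k, zip [seq nth 0 (E ++ portals cs zs p) c | c <- ca]
                     [seq nth 0 (E ++ portals cs zs p) c | c <- cb]))
      | cb <- Wj]
      | ca <- Wj]
      | Wj <- WK]
      | E <- WN]
      | k <- iota 0 N]
      | p <- iota 0 N].

Lemma keysWE XS PB Rs cs zs : keys XS PB Rs cs zs =
  keysW (words (size cs) XS) [seq words (XS + PB) j | j <- iota 0 Rs.+1] cs zs.
Proof.
rewrite /keys /keysW; congr flatten; apply: eq_map => p; congr flatten; apply: eq_map => k.
by congr flatten; apply: eq_map => W; rewrite -map_comp.
Qed.

Lemma fp_keysW (WN cs zs : E -> seq (seq nat)) (WK : E -> seq (seq (seq nat))) :
  fp WN -> fp WK -> fp cs -> fp zs -> fp (fun e => keysW (WN e) (WK e) (cs e) (zs e)).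
Proof.
move=> f g h i; apply: (@fp_ext _ _ _ _ _ _ _ (fun e => 
 flatten [seq flatten [seq flatten [seq flatten [seq flatten [seq
    [seq (p, (k, [seq (nth 0 (E ++ portals (cs e) (zs e) p) (nth 0 ca j), nth 0 (E ++ portals (cs e) (zs e) p) (nth 0 cb j))
       | j <- iota 0 (if size ca <= size cb then size ca else size cb)]))
      | cb <- Wj] | ca <- Wj] | Wj <- WK e] | E <- WN e]
      | k <- iota 0 (size (cs e))] | p <- iota 0 (size (cs e))])).
  move=> e; rewrite /keysW; congr flatten; apply: eq_map => p; congr flatten; apply: eq_map => k.
  congr flatten; apply: eq_map => W; congr flatten; apply: eq_map => V; congr flatten; apply: eq_map => ca.
  apply: eq_map => cb; rewrite (zipE 0 0) !size_map; congr (_, (_, _)); apply/eq_in_map => j.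
  rewrite mem_iota0 => jl; rewrite !(nth_map 0) //; move: jl; case: ifPn; rewrite -?ltnNge; lia.
by fpt; apply: fp_portals; fpt.
Qed.

Lemma fp_leaves (Rs : E -> nat) (cs : E -> seq (seq nat)) : fp Rs -> fp cs ->
  fp (fun e => (leaves (Rs e) (cs e) : seq itm)).
Proof.
move=> f g; apply: (@fp_ext _ _ _ _ _ _ _ (fun e => 
 flatten [seq [seq (p, (count (fun q => (0 < q) && samec (cs e) q p) (iota 0 (size (cs e))),
   (p :: flatten [seq [:: q; p] | q <- [seq q <- iota 0 (size (cs e)) | samec (cs e) q p]])
     :: [seq [:: p] | _ <- iota 0 c]))
    | c <- iota 0 (Rs e)] | p <- [seq p <- iota 0 (size (cs e)) | repr (cs e) p == p]])).
  move=> e; rewrite /leaves; congr flatten; apply: eq_map => p; apply: eq_map => c.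
  rewrite /weight /tour; congr (_, (_, _ :: _)).
  by elim: c (0) => //= c IH i; rewrite IH.
by fpt.
Qed.

Lemma plenE (ds : seq (seq R)) q : plen ds q =
  rsum [seq dm ds (nth 0 q i) (nth 0 q i.+1) | i <- iota 0 (size q - 1)].
Proof.
rewrite rsumE big_map; case: q => [|x q] /=; first by rewrite big_nil.
rewrite subn1 /=; elim: q x => [|y q IH] x /=; first by rewrite big_nil.
by rewrite big_cons IH -[in iota 1 _](addn0 1) iotaDl big_map.
Qed.

Lemma fp_rsum (s : E -> seq R) : fp s -> fp (fun e => rsum (s e)).
Proof.
move=> f; apply: (@fp_foldl _ E rE hE R _ _ _ _ _ _ s (fun=> 0%R) (fun _ a x => (a + x)%R)) => //; try by fpt.
by exists 0.
Qed.
End Impl2b.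

Section Impl3.
Variable R : realType.
Local Notation itm := (nat * (nat * seq (seq nat)))%type.
Variables (E : Type) (rE : Rep R E) (hE : Hb E).

Lemma fp_plen (ds : E -> seq (seq R)) (q : E -> seq nat) : fp ds -> fp q -> fp (fun e => plen (ds e) (q e)).
Proof.
move=> f g; apply: (@fp_ext _ _ _ _ _ _ _ (fun e => rsum [seq nth 0%R (nth [::] (ds e) (nth 0 (q e) i)) (nth 0 (q e) i.+1) | i <- iota 0 (size (q e) - 1)])).
  by move=> e; rewrite plenE.
by apply: fp_rsum; fpt.
Qed.
End Impl3.
Section Impl4.
Variable R : realType.
Local Notation itm := (nat * (nat * seq (seq nat)))%type.
Variables (E : Type) (rE : Rep R E) (hE : Hb E).

Lemma fp_tlen (ds : E -> seq (seq R)) (q : E -> seq (seq nat)) : fp ds -> fp q -> fp (fun e => tlen (ds e) (q e)).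
Proof.
move=> f g; apply: (@fp_ext _ _ _ _ _ _ _ (fun e => rsum [seq plen (ds e) x | x <- q e])).
  by move=> e; rewrite rsumE big_map.
by apply: fp_rsum; fpt; apply: fp_plen; fpt.
Qed.

Lemma size_pickmin (ds : seq (seq R)) l : size (pickmin ds l) <= 1.
Proof.
rewrite /pickmin; suff h a : size a <= 1 -> size (foldl (better ds) a l) <= 1 by apply: h.
elim: l a => //= x l IH a sa; apply: IH; case: a sa => [|b a] //= sa; by case: ifP.
Qed.
End Impl4.
Section Impl5.
Variable R : realType.
Local Notation itm := (nat * (nat * seq (seq nat)))%type.
Variables (E : Type) (rE : Rep R E) (hE : Hb E).

Lemma fp_pickmin (ds : E -> seq (seq R)) (l : E -> seq itm) : fp ds -> fp l ->
  fp (fun e => (pickmin (ds e) (l e) : seq itm)).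
Proof.
move=> f g; pose bdy (ds : seq (seq R)) (acc : seq itm) (c : itm) : seq itm :=
  if nilp acc then [:: c] else
    if (tlen ds (head (0%N, (0%N, [::])) acc).2.2 <= tlen ds c.2.2)%R then acc else [:: c].
have e1 D s : foldl (bdy D) [::] s = pickmin D s.
  rewrite /pickmin; elim: s [::] => //= x s IH a; rewrite IH; congr foldl; by case: a.
apply: (@fp_ext _ _ _ _ _ _ _ (fun e => foldl (bdy (ds e)) [::] (l e))) => //.
apply: (@fp_foldl _ E rE hE itm _ _ _ _ _ _ l (fun=> [::]) (fun e => bdy (ds e))) => //; first by fpt.
  by rewrite /bdy; apply: fp_cond; [fpt|fpt|apply: fp_cond; [apply: fp_rle; apply: fp_tlen; fpt|fpt|fpt]].
have [[k hk] _] := g; exists k.+1 => Z e j he; rewrite e1; have [h1 h2] := hk _ _ he.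
split; first by apply: leq_trans (size_pickmin _ _) _; rewrite /ub expn_gt0 addn2.
move=> x xi; apply: (@hb_mono _ _ (ub k Z)); first exact: ub_le.
apply: h2; apply: (@In_take _ x j); apply/In_mem; apply: (@pickmin_sub _ (ds e)); apply/In_mem; exact: xi.
Qed.

End Impl5.
Section Impl6.
Variable R : realType.
Local Notation itm := (nat * (nat * seq (seq nat)))%type.
Variables (E : Type) (rE : Rep R E) (hE : Hb E).

Definition stepW (ds : seq (seq R)) (WN : seq (seq nat)) WK W (cs zs : seq (seq nat)) (T : seq itm) : seq itm :=
  flatten [seq pickmin ds [seq c <- flatten [seq flatten [seq [seq cand cs zs K J w | w <- [seq w <- W | okc cs K J w]]
     | J <- (K.1, (0, [::])) :: T] | K <- T] | keyof c == key] | key <- keysW WN WK cs zs].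

Lemma stepWE (ds : seq (seq R)) XS PB Rs W cs zs T : stepT ds XS PB Rs W cs zs T =
  stepW ds (words (size cs) XS) [seq words (XS + PB) j | j <- iota 0 Rs.+1] W cs zs T.
Proof. by rewrite /stepT /stepW keysWE. Qed.

Lemma size_stepW ds WN WK W cs zs T : size (stepW ds WN WK W cs zs T) <= size (keysW WN WK cs zs).
Proof.
rewrite /stepW; elim: (keysW _ _ _ _) => //= key l IH; rewrite size_cat -add1n.
by apply: leq_add => //; exact: size_pickmin.
Qed.

Lemma fp_stepW (ds : E -> seq (seq R)) (WN W cs zs : E -> seq (seq nat)) (WK : E -> seq (seq (seq nat))) (T : E -> seq itm) :
  fp ds -> fp WN -> fp WK -> fp W -> fp cs -> fp zs -> fp T ->
  fp (fun e => stepW (ds e) (WN e) (WK e) (W e) (cs e) (zs e) (T e)).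
Proof.
move=> f1 f2 f3 f4 f5 f6 f7; rewrite /stepW.
apply: fp_flatten; apply: fp_map; first exact: fp_keysW.
apply: fp_pickmin; first by fpt.
apply: fp_filter; last by apply: fp_keyeq; fpt.
apply: fp_flatten; apply: fp_map; first by fpt.
apply: fp_flatten; apply: fp_map; first by fpt.
apply: fp_map; last by apply: fp_cand; fpt.
apply: fp_filter; first by fpt.
by apply: fp_okc; fpt.
Qed.
End Impl6.
End Alg.

(** * The guarded table and the geometric data *)

Module Alg2.
Import Ram DP Fp2 Geo Alg.

Set Implicit Arguments.
Unset Strict Implicit.
Unset Printing Implicit Defensive.
Import Order.TTheory GRing.Theory Num.Theory.
Local Open Scope nat_scope.

Local Notation itm := (nat * (nat * seq (seq nat)))%type.

Definition smallit F (it : itm) := [&& it.1 <= F, it.2.1 <= F, size it.2.2 <= F &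
  all (fun q => (size q <= F) && all (fun x => x <= F) q) it.2.2].
(** Closure under iteration asks for bounds on intermediate tables for all arguments; testing the
    size during the run provides them. With the bound of [table_small] as [F], the test always
    succeeds. *)
Definition guard F (T : seq itm) := if all (smallit F) T then T else [::].

Lemma smallit_hb F it : smallit F it -> hb F it.
Proof.
case: it => a [b st] /and4P [/= h1 h2 h3 /allP h4]; split=> //; split=> //; split=> // q qi.
have /andP [s1 /allP s2] := h4 q (proj1 (In_mem _ _) qi).
by split=> // x xi; apply: s2; apply/In_mem.
Qed.

Lemma table_smallit (R : realType) (ds : seq (seq R)) XS PB Rs mu W U L F it :
  all (fun w => size w <= 5 * Rs) W ->
  size U + size U * (2 * size U + 1 + Rs + 5 * Rs * L) <= F ->
  it \in tableL ds XS PB Rs mu W U L -> smallit F it.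
Proof.
move=> aW hF iT; have sm := table_small aW iT.
have [s1 s2 s3 s4 [s [us ss sx]]] := table_sound iT.
have sz : size (lvl L U) = size U by rewrite size_map.
have UF : size U <= F by apply: leq_trans hF; exact: leq_addr.
have fF : size (flatten it.2.2) <= F.
  apply: leq_trans sm _; apply: leq_trans hF; apply: leq_trans (leq_addl _ _).
  by rewrite leq_mul2r (leq_trans (count_size _ _)) ?size_iota ?orbT.
apply/and4P; split.
- by apply: leq_trans UF; rewrite -sz ltnW.
- by rewrite -ss; apply: leq_trans fF; apply: uniq_leq_size => // x /sx [].
- apply: leq_trans fF; rewrite size_flatten; elim: (it.2.2) s3 => //= q l IH h.
  rewrite -add1n; apply: leq_add; first by rewrite lt0n size_eq0 h ?mem_head.
  by apply: IH => r rl; apply: h; rewrite inE rl orbT.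
apply/allP => q qi; apply/andP; split.
  apply: leq_trans fF; rewrite size_flatten; elim: (it.2.2) qi => //= r l IH.
  by rewrite inE => /orP [/eqP ->|/IH h]; [exact: leq_addr|apply: leq_trans h _; exact: leq_addl].
apply/allP => x xq; have [|h _] := s4 x; first by apply/flattenP; exists q.
by apply: leq_trans UF; rewrite -sz ltnW.
Qed.

Section Tab.
Variable R : realType.
Definition tabstep (ds : seq (seq R)) (WN : seq (seq nat)) WK W U mu F (s : nat * seq itm) : nat * seq itm :=
  (s.1.+1, guard F (stepW ds WN WK W (lvl s.1.+1 U) (lvl (s.1.+1 - mu) U) s.2)).
Definition tabW (ds : seq (seq R)) (WN : seq (seq nat)) WK W U mu Rs F L : seq itm :=
  (iter L (tabstep ds WN WK W U mu F) (0, (leaves Rs (lvl 0 U) : seq itm))).2.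

Lemma tabWE ds XS PB Rs mu W U F L : all (fun w => size w <= 5 * Rs) W ->
  size U + size U * (2 * size U + 1 + Rs + 5 * Rs * L) <= F ->
  tabW ds (words (size U) XS) [seq words (XS + PB) j | j <- iota 0 Rs.+1] W U mu Rs F L =
  tableL ds XS PB Rs mu W U L.
Proof.
move=> aW hF; rewrite /tabW; set st := tabstep _ _ _ _ _ _ _.
suff -> : forall j, j <= L -> iter j st (0, (leaves Rs (lvl 0 U) : seq itm)) = (j, tableL ds XS PB Rs mu W U j) by [].
elim=> [|j IH] jL //; rewrite iterS (IH (ltnW jL)) /st /tabstep /=; congr pair.
have sz : size (lvl j.+1 U) = size U by rewrite size_map.
rewrite -[in words _ XS]sz -stepWE /guard.
case: ifPn => // /allPn [it iT] /negP [].
apply: (@table_smallit _ ds XS PB Rs mu W U j.+1) => //.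
by apply: leq_trans hF; rewrite leq_add2l leq_mul2l leq_add2l leq_mul2l jL !orbT.
Qed.

Variables (E : Type) (rE : Rep R E) (hE : Hb E).

Lemma fp_guard (F : E -> nat) (T : E -> seq itm) : fp F -> fp T -> fp (fun e => guard (F e) (T e)).
Proof. by move=> f g; rewrite /guard /smallit; fpt. Qed.
End Tab.

Section Tab2.
Variable R : realType.
Variables (E : Type) (rE : Rep R E) (hE : Hb E).

Lemma fp_tabW (ds : E -> seq (seq R)) (WN W U : E -> seq (seq nat)) (WK : E -> seq (seq (seq nat))) (mu Rs F L : E -> nat) :
  fp ds -> fp WN -> fp WK -> fp W -> fp U -> fp mu -> fp Rs -> fp F -> fp L ->
  fp (fun e => tabW (ds e) (WN e) (WK e) (W e) (U e) (mu e) (Rs e) (F e) (L e)).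
Proof.
move=> f1 f2 f3 f4 f5 f6 f7 f8 f9; rewrite /tabW; apply: fp_2.
have fl : fp (fun e => (leaves (Rs e) (lvl 0 (U e)) : seq itm)) by apply: fp_leaves; fpt.
have fk : fp (fun p : E * nat => keysW (WN p.1) (WK p.1) (lvl p.2.+1 (U p.1)) (lvl (p.2.+1 - mu p.1) (U p.1))).
  by apply: fp_keysW; fpt.
apply: (@fp_iter R E _ _ _ _ _ L (fun e => (0, leaves (Rs e) (lvl 0 (U e)))) (fun e => tabstep (ds e) (WN e) (WK e) (W e) (U e) (mu e) (F e))) => //.
- by fpt.
- by rewrite /tabstep; apply: fp_pair; [fpt|apply: fp_guard; [fpt|apply: fp_stepW; fpt]].
have [[kl hl] _] := fl; have [[kk hk] _] := fk; have [[kF hF] _] := f8; have [[kL hL] _] := f9.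
pose a := (1 + kL).+1.
exists (kl + (a.+2 * kk) + kF + kL).+1 => Z e j he jL.
have j1 : j <= ub kL Z by apply: leq_trans jL _; exact: hL.
have up x k : k <= (kl + (a.+2 * kk) + kF + kL).+1 -> x <= ub k Z -> x <= ub (kl + (a.+2 * kk) + kF + kL).+1 Z.
  by move=> kk' xk; apply: leq_trans xk _; exact: ub_le.
have e1 : (iter j (tabstep (ds e) (WN e) (WK e) (W e) (U e) (mu e) (F e)) (0, leaves (Rs e) (lvl 0 (U e)))).1 = j.
  by elim: (j) => //= i ->.
rewrite [iter _ _ _]surjective_pairing e1; split; first by apply: up j1; rewrite leqW // leq_addl.
case: j jL j1 e1 => [|j] jL j1 _.
  by apply: hb_mono (hl _ _ he); apply: ub_le; rewrite -!addnA leqW // leq_addr.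
rewrite iterS /tabstep [_.2]/=.
have -> : (iter j (tabstep (ds e) (WN e) (WK e) (W e) (U e) (mu e) (F e)) (0, leaves (Rs e) (lvl 0 (U e)))).1 = j.
  by elim: (j) => //= i ->.
rewrite /guard; case: ifPn => [/allP al|_]; last by exact: hb_nil.
split.
  apply: leq_trans (size_stepW _ _ _ _ _ _ _) _.
  have hp : hb (ub a Z) (e, j).
    split; first by apply: hb_mono he; apply: leq_trans (ub1 _) _; exact: ub_le.
    by apply: leq_trans (ltnW j1) _; apply: ub_le; rewrite /a leqW // leq_addl.
  have [h _] := hk _ _ hp; apply: leq_trans h _; apply: leq_trans (ub_ub _ _ _) _.
  by apply: ub_le; move: (a.+2 * kk) => q; clear; lia.
move=> x xi; apply: (@hb_mono _ _ (F e)).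
  by apply: (up _ kF); [rewrite leqW // -addnA addnCA leq_addr|exact: hF].
by apply: smallit_hb; apply: al; apply/In_mem.
Qed.
End Tab2.

Section Geom.
Variable R : realType.

(** Naturals become reals by repeated addition of one, as no instruction converts them. *)
Definition natR (n : nat) : R := iter n (fun x => (x + 1)%R) 0%R.
Lemma natRE n : natR n = n%:R%R.
Proof. by elim: n => //= n ->; rewrite natr1. Qed.

Definition co d (cl : seq R) i j : R := nth 0%R cl (i * d + j).
Definition ddot d cl p q v w : R :=
  rsum [seq ((co d cl q j - co d cl p j) * (co d cl w j - co d cl v j))%R | j <- iota 0 d].
Definition dist d cl p q : R := Num.sqrt (ddot d cl p q p q).
Definition gss d cl p q v w : R := (dist d cl p q - ddot d cl p q v w / dist d cl v w)%R.
(** The candidates for the scale [E0]: all excesses of a step from [p] to [q] along a chord from [v]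
    to [w]. For [v = w] the quotient by zero is zero and the entry is a distance, as needed when the
    path has no excess. *)
Definition gsl N d cl : seq R :=
  flatten [seq flatten [seq flatten [seq [seq gss d cl p q v w | w <- iota 0 N] | v <- iota 0 N] | q <- iota 0 N] | p <- iota 0 N].
Definition dmat N d cl : seq (seq R) := [seq [seq dist d cl i j | j <- iota 0 N] | i <- iota 0 N].
Definition slt d cl (zv : seq R) p i : R :=
  (co d cl p i + rsum [seq (nth 0 zv j * co d cl p j)%R | j <- iota 0 d])%R.
Definition zvl d Q (z : seq nat) : seq R := [seq (natR c / (natR 2 * natR d * natR Q))%R | c <- z].
Definition Ytab N d cl zv rho cap G : seq (seq nat) :=
  [seq [seq fl rho cap (compress G [seq slt d cl zv q i | q <- iota 0 N] (slt d cl zv p i)) | i <- iota 0 d] | p <- iota 0 N].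
(** The least power of two reaching [x], with its exponent. Doubling makes [x] rounds more than
    enough. *)
Definition lgp x : nat * nat := iter x (fun s : nat * nat => if x <= s.2 then s else (s.1.+1, s.2 * 2)) (0, 1).

Lemma lgpP x : [/\ (lgp x).2 = 2 ^ (lgp x).1, x <= (lgp x).2 & (lgp x).2 <= 2 * x + 1].
Proof.
suff h j : let s := iter j (fun s : nat * nat => if x <= s.2 then s else (s.1.+1, s.2 * 2)) (0, 1) in
   [/\ s.2 = 2 ^ s.1, (x <= s.2) || (j < s.2) & s.2 <= 2 * x + 1].
  by have [h1 h2 h3] := h x; split=> //; move: h2 => /orP [//|/ltnW].
elim: j => [|j [h1 h2 h3]] /=; first by split=> //; rewrite ?addn1 ?orbT.
case: ifPn => c /=; first by split=> //; rewrite c.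
split; first by rewrite h1 expnSr.
  by apply/orP; right; move: h2; rewrite (negPf c) /=; move: (iter _ _ _) => s; clear; lia.
by move: c; rewrite -ltnNge; move: (iter _ _ _) => s; clear; lia.
Qed.

Variables (E : Type) (rE : Rep R E) (hE : Hb E).
Lemma fp_natR (n : E -> nat) : fp n -> fp (fun e => natR (n e)).
Proof.
move=> f; apply: (@fp_iter R E R _ _ _ _ n (fun=> 0%R) (fun _ x => (x + 1)%R)) => //; try by fpt.
by exists 0.
Qed.
Lemma fp_co (d i j : E -> nat) (cl : E -> seq R) : fp d -> fp i -> fp j -> fp cl ->
  fp (fun e => co (d e) (cl e) (i e) (j e)).
Proof. by move=> *; rewrite /co; fpt. Qed.

Lemma fp_gapf (G a : E -> R) (vs : E -> seq R) : fp G -> fp a -> fp vs -> fp (fun e => gapf (G e) (vs e) (a e)).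
Proof.
move=> f g h; apply: (@fp_foldl R E rE hE R _ _ _ _ _ _ vs G
  (fun e acc b => if (b <= a e)%R then acc else if (acc <= b - a e)%R then acc else (b - a e)%R)) => //; first by fpt.
by exists 0.
Qed.

Lemma fp_rundup (s : E -> seq R) : fp s -> fp (fun e => rundup (s e)).
Proof.
move=> f; apply: (@fp_foldl R E rE hE R _ _ _ _ _ _ s (fun=> [::])
  (fun e acc x => if has (fun y => (x <= y)%R && (y <= x)%R) acc then acc else x :: acc)) => //; try by fpt.
have [[k hk] _] := f; exists k => Z e j he; have [h _] := hk _ _ he.
split; last by [].
apply: (@leq_trans (size (take j (s e)))); last by apply: leq_trans h; rewrite size_take_min geq_minr.
suff h2 l (a : seq R) : size (foldl (fun acc x => if has (fun y => (x <= y)%R && (y <= x)%R) acc then acc else x :: acc) a l) <= size a + size l.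
  exact: h2.
elim: l a => [|x l IH] a /=; first by rewrite addn0.
apply: leq_trans (IH _) _; case: ifP => _ /=; rewrite ?addSnnS // leq_add2l; exact: leqnSn.
Qed.

Lemma fp_fl (rho x : E -> R) (cap : E -> nat) : fp rho -> fp x -> fp cap -> fp (fun e => fl (rho e) (cap e) (x e)).
Proof.
move=> f g h; rewrite /fl; apply: fp_1.
apply: (@fp_iter R E (nat * R)%type _ _ _ _ cap (fun e => (0, x e)) (fun e s => if (rho e <= s.2)%R then (s.1.+1, (s.2 - rho e)%R) else s)) => //; try by fpt.
have [[k hk] _] := h; exists k => Z e j he jc; split; last by [].
apply: (@leq_trans j); last by apply: leq_trans jc _; exact: hk.
by elim: (j) => //= i IH; case: ifP => _ //=; exact: leqW.
Qed.
Lemma fp_lgp (x : E -> nat) : fp x -> fp (fun e => lgp (x e)).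
Proof.
move=> f; apply: (@fp_iter R E (nat * nat)%type _ _ _ _ x (fun e => (0, 1)) (fun e s => if x e <= s.2 then s else (s.1.+1, s.2 * 2))) => //; try by fpt.
have [[k hk] _] := f; exists (k + k).+2 => Z e j he jx; have hx := hk _ _ he.
have b1 : 2 * x e + 1 <= ub (k + k).+2 Z.
  rewrite mul2n -addnn; apply: (@leq_trans (ub ((k + k).+1 + 0).+1 Z)); last by rewrite addn0.
  apply: ubD => //; exact: ubD.
suff [h1 h2] : (iter j (fun s : nat * nat => if x e <= s.2 then s else (s.1.+1, s.2 * 2)) (0, 1)).1 <= x e /\
  (iter j (fun s : nat * nat => if x e <= s.2 then s else (s.1.+1, s.2 * 2)) (0, 1)).2 <= 2 * x e + 1.
  split; last exact: leq_trans b1.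
  by apply: leq_trans h1 _; apply: leq_trans hx _; apply: ub_le; lia.
set st := fun s : nat * nat => _.
suff: (iter j st (0, 1)).1 < (iter j st (0, 1)).2 /\ (iter j st (0, 1)).1 <= x e /\ (iter j st (0, 1)).2 <= 2 * x e + 1 by case.
elim: (j) => [|i [h1 [h2 h3]]] /=; first by rewrite addn1.
rewrite -!/(st _); move: (iter i st _) h1 h2 h3 => s h1 h2 h3; rewrite /st; case: ifPn => c //=.
by move: c h1 h2 h3; rewrite -ltnNge; clear; lia.
Qed.
End Geom.

Section Geom2.
Variable R : realType.
Variables (E : Type) (rE : Rep R E) (hE : Hb E).
Lemma fp_compress (G v : E -> R) (vs : E -> seq R) : fp G -> fp v -> fp vs -> fp (fun e => compress (G e) (vs e) (v e)).
Proof.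
move=> f g h; rewrite /compress; apply: fp_rsum; apply: fp_map; last by apply: fp_gapf; fpt.
by apply: fp_filter; [apply: fp_rundup|fpt].
Qed.
Lemma fp_ddot (d p q v w : E -> nat) (cl : E -> seq R) : fp d -> fp cl -> fp p -> fp q -> fp v -> fp w ->
  fp (fun e => ddot (d e) (cl e) (p e) (q e) (v e) (w e)).
Proof. by move=> *; rewrite /ddot; apply: fp_rsum; fpt; apply: fp_co; fpt. Qed.
Lemma fp_slt (d p i : E -> nat) (cl zv : E -> seq R) : fp d -> fp cl -> fp zv -> fp p -> fp i ->
  fp (fun e => slt (d e) (cl e) (zv e) (p e) (i e)).
Proof. by move=> *; rewrite /slt; apply: fp_radd; [apply: fp_co; fpt|apply: fp_rsum; fpt; apply: fp_co; fpt]. Qed.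
Lemma fp_zvl (d Q : E -> nat) (z : E -> seq nat) : fp d -> fp Q -> fp z -> fp (fun e => zvl R (d e) (Q e) (z e)).
Proof. by move=> *; rewrite /zvl; fpt; apply: fp_natR; fpt. Qed.
End Geom2.
Section Geom3.
Variable R : realType.
Variables (E : Type) (rE : Rep R E) (hE : Hb E).
Lemma fp_dist (d p q : E -> nat) (cl : E -> seq R) : fp d -> fp cl -> fp p -> fp q ->
  fp (fun e => dist (d e) (cl e) (p e) (q e)).
Proof. by move=> *; rewrite /dist; fpt; apply: fp_ddot; fpt. Qed.
Lemma fp_Ytab (N d cap : E -> nat) (cl zv : E -> seq R) (rho G : E -> R) :
  fp N -> fp d -> fp cl -> fp zv -> fp rho -> fp cap -> fp G ->
  fp (fun e => Ytab (N e) (d e) (cl e) (zv e) (rho e) (cap e) (G e)).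
Proof.
move=> *; rewrite /Ytab; apply: fp_map; first by fpt.
apply: fp_map; first by fpt.
apply: fp_fl; [fpt| |fpt]; apply: fp_compress; [fpt|apply: fp_slt; fpt|].
by apply: fp_map; [fpt|apply: fp_slt; fpt].
Qed.
End Geom3.
Section Geom4.
Variable R : realType.
Variables (E : Type) (rE : Rep R E) (hE : Hb E).
Lemma fp_dmat (N d : E -> nat) (cl : E -> seq R) : fp N -> fp d -> fp cl ->
  fp (fun e => dmat (N e) (d e) (cl e)).
Proof. by move=> *; rewrite /dmat; fpt; apply: fp_dist; fpt. Qed.
Lemma fp_gsl (N d : E -> nat) (cl : E -> seq R) : fp N -> fp d -> fp cl ->
  fp (fun e => gsl (N e) (d e) (cl e)).
Proof.
move=> *; rewrite /gsl /gss; apply: fp_flatten; apply: fp_map; first by fpt.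
apply: fp_flatten; apply: fp_map; first by fpt.
apply: fp_flatten; apply: fp_map; first by fpt.
apply: fp_map; first by fpt.
by apply: fp_rsub; [apply: fp_dist; fpt|apply: fp_rdiv; [apply: fp_ddot; fpt|apply: fp_dist; fpt]].
Qed.
End Geom4.
End Alg2.

(** * The complete algorithm *)

Module Alg3.
Import Ram DP Fp2 Geo Walk Bridge Alg Alg2.

Set Implicit Arguments.
Unset Strict Implicit.
Unset Printing Implicit Defensive.
Import Order.TTheory GRing.Theory Num.Theory.
Local Open Scope nat_scope.

Local Notation itm := (nat * (nat * seq (seq nat)))%type.

(** The word lists of all lengths from [l] down to 0 are kept: each is built from the next shorter
    one, and the keys use every length. *)
Definition wordsL b l : seq (seq (seq nat)) :=
  iter l (fun s => flatten [seq [seq x :: w | w <- head [::] s] | x <- iota 0 b] :: s) [:: [:: [::]]].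

Lemma wordsLE b l : wordsL b l = rev [seq words b j | j <- iota 0 l.+1].
Proof.
have rw k : rev [seq words b j | j <- iota 0 k.+1] = words b k :: rev [seq words b j | j <- iota 0 k].
  by rewrite -[in iota 0 k.+1](addn1 k) iotaD map_cat rev_cat.
elim: l => [|l IH] //; rewrite /wordsL iterS -/(wordsL b l) (rw l.+1) -IH; congr (_ :: _).
by rewrite IH (rw l).
Qed.
Lemma head_wordsL b l : head [::] (wordsL b l) = words b l.
Proof. by rewrite wordsLE -[in iota 0 _](addn1 l) iotaD map_cat rev_cat. Qed.

Lemma hb_wordsL Z b l j : b <= Z -> l <= Z -> b ^ l <= Z -> j <= l -> hb (Z + 2) (wordsL b j).
Proof.
move=> bZ lZ blZ jl; rewrite wordsLE; split; first by rewrite size_rev size_map size_iota; move: jl lZ; clear; lia.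
move=> v vi; have [i ij0 ->] := In_map (In_rev vi).
have ij : i < j.+1 by rewrite -mem_iota0; apply/In_mem.
split.
  rewrite size_words; have [->|b0] := posnP b.
    by case: (i) => [|?]; rewrite ?expn0 ?exp0n // addn2.
  apply: (@leq_trans Z); last exact: leq_addr.
  by apply: leq_trans blZ; rewrite leq_pexp2l //; move: ij jl; clear; lia.
move=> w wi; have := proj1 (In_mem _ _) wi; rewrite mem_words => /andP [/eqP sw /allP aw]; split.
  by rewrite sw; move: ij jl lZ; clear; lia.
by move=> x xi; have xb := aw x (proj1 (In_mem _ _) xi); rewrite hb_natE; move: xb bZ; clear; lia.
Qed.

Section FpP.
Variable R : realType.
(** The output has size about [b ^ l], so polynomial time is claimed only for ghost bounds that
    dominate this power. The exponential part of the running time enters through such calls. *)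
Lemma pf_wordsL : pf (fun Z p => [/\ p.1 <= Z, p.2 <= Z & p.1 ^ p.2 <= Z]) (rA := prod_Rep (nat_Rep R) (nat_Rep R)) (fun p : nat * nat => wordsL p.1 p.2).
Proof.
have fb : fp (R := R) (fun q : (nat * nat) * seq (seq (seq nat)) =>
   flatten [seq [seq x :: w | w <- head [::] q.2] | x <- iota 0 q.1.1] :: q.2) by fpt.
have [_ pb] := fb.
apply: (@pf_iterP _ _ _ _ _ _ (fun Z q => hb (ub 1 Z) q) (fun p => p.2) (fun=> [:: [:: [::]]]) 
  (fun q => flatten [seq [seq x :: w | w <- head [::] q.2] | x <- iota 0 q.1.1] :: q.2)).
- by move=> Z e [].
- move=> Z [b l] j [h1 h2 h3] /= jl; rewrite /ub expn1; split.
    by split; rewrite /= hb_natE; move: h1 h2; rewrite /=; clear; lia.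
  exact: (hb_wordsL h1 h2 h3 (ltnW jl)).
- exact: pf_snd.
- have [_ p] : fp (R := R) (fun e : nat * nat => [:: [:: [::]]] : seq (seq (seq nat))) by fpt.
  by apply: pf_pre p => Z [b l] [h1 h2 _].
- exact: (pf_scale (polyb_k 1) pb).
Qed.

Variables (A : Type) (rA : Rep R A) (hA : Hb A) (P : nat -> A -> Prop).
(** The precondition may demand more of the ghost bound than the size of the argument. *)
Definition fpP B (rB : Rep R B) (hB : Hb B) (f : A -> B) :=
  (exists k, forall Z a, P Z a -> hb (ub k Z) (f a)) /\ pf P f.
Arguments fpP {B rB hB} f.
Variables (B C : Type) (rB : Rep R B) (hB : Hb B) (rC : Rep R C) (hC : Hb C).

Lemma fpP_fp (f : A -> B) : (forall Z a, P Z a -> hb Z a) -> fp f -> fpP f.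
Proof.
move=> hP [[k h] p]; split; first by exists k => Z a /hP /h.
by apply: pf_pre p => Z a /hP.
Qed.
Lemma fpP_ext (f g : A -> B) : (forall a, f a = g a) -> fpP f -> fpP g.
Proof.
move=> e [[k h] p]; split; last exact: pf_ext e p.
by exists k => Z a; rewrite -e; exact: h.
Qed.
Lemma fpP_comp (f : A -> B) (g : B -> C) : fpP f -> fp g -> fpP (fun a => g (f a)).
Proof.
move=> [[k pf1] h1] [[l pg] h2]; split.
  by exists (k.+2 * l) => Z a /pf1/pg; apply: hb_mono; exact: ub_ub.
apply: (pf_comp (Q := fun Z b => hb (ub k Z) b)) h1 _; first exact: pf1.
exact: (pf_scale (polyb_k k) h2).
Qed.
Lemma fpP_pair (f : A -> B) (g : A -> C) : fpP f -> fpP g -> fpP (fun a => (f a, g a)).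
Proof.
move=> [[k h1] p1] [[l h2] p2]; split; last exact: pf_pair.
exists (k + l) => Z a Pa; split; [apply: hb_mono (h1 _ _ Pa)|apply: hb_mono (h2 _ _ Pa)]; apply: ub_le; lia.
Qed.
Lemma fpP_words (b l : A -> nat) : fpP b -> fpP l -> (forall Z a, P Z a -> b a ^ l a <= Z) ->
  fpP (fun a => wordsL (b a) (l a)).
Proof.
move=> [[k h1] p1] [[j h2] p2] h3; pose K := k + j + 1.
have hk Z a : P Z a -> [/\ b a <= ub K Z, l a <= ub K Z & b a ^ l a <= ub K Z].
  move=> Pa; split.
  - by apply: leq_trans (h1 _ _ Pa) _; apply: ub_le; rewrite /K; lia.
  - by apply: leq_trans (h2 _ _ Pa) _; apply: ub_le; rewrite /K; lia.
  - by apply: leq_trans (h3 _ _ Pa) _; apply: leq_trans (ub1 _) _; apply: ub_le; rewrite /K; lia.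
split.
  exists (K + 2).+1 => Z a /hk [e1 e2 e3]; apply: hb_mono (hb_wordsL e1 e2 e3 (leqnn _)).
  by apply: ubD => //; exact: ub_c.
apply: (pf_comp (Q := fun Z p => [/\ p.1 <= ub K Z, p.2 <= ub K Z & p.1 ^ p.2 <= ub K Z]) (f := fun a => (b a, l a)) (g := fun p => wordsL p.1 p.2)) => //.
  exact: pf_pair.
exact: (pf_scale (polyb_k K) pf_wordsL).
Qed.
End FpP.
Arguments fpP {R A rA} P {B rB hB} f.

Section Best.
Variable R : realType.

(** The parameters of the grid and of the table, written in terms of [l1p = 2 ^ l1]: products are
    computed by loops, whereas powers are handed over. *)
Definition capf N l1p := (N * (4 * l1p)).+1.
Definition levf N d l1p := d * ((capf N l1p).+1 + 2 * l1p).
Definition Ff N d l1p Rs := N + N * (2 * N + 1 + Rs + 5 * Rs * levf N d l1p).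
Definition Uaf N d Q Nr cl l1p (e0 : R) z a : seq (seq nat) :=
  [seq [seq y + a | y <- row] | row <- Ytab N d cl (zvl R d Q z) (e0 / natR R Nr)%R (capf N l1p)
     (e0 / natR R Nr * natR R (4 * l1p))%R].
Definition okit (ds : seq (seq R)) B (it : itm) :=
  [&& size it.2.2 == 1, head 0 (head [::] it.2.2) == 0 & (plen ds (head [::] it.2.2) <= B)%R].
(** Exhaustive search over the scale, the tilt and the shift. Every surviving candidate is a path
    from index 0 within the budget, whether or not the guesses were right. *)
Definition cands N d Q Nr cl (B : R) l1p mu Rs WQ WN WK W : seq (nat * seq nat) :=
  flatten [seq flatten [seq flatten [seq
    [seq (it.2.1, head [::] it.2.2) | it <- [seq it <- tabW (dmat N d cl) WN WK W (Uaf N d Q Nr cl l1p e0 z a) mu Rs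
       (Ff N d l1p Rs) (levf N d l1p) | okit (dmat N d cl) B it]]
    | a <- iota 0 (2 * l1p)] | z <- WQ] | e0 <- gsl N d cl].
(** The default [[:: 0]] is the path that stays at the start, so an answer always exists. *)
Definition sel (cs : seq (nat * seq nat)) : nat * seq nat :=
  foldl (fun b c => if c.1 <= b.1 then b else c) (0, [:: 0]) cs.
Definition outf d (cl : seq R) (q : seq nat) : nat * seq R :=
  (size q, flatten [seq [seq co d cl i j | j <- iota 0 d] | i <- q]).

Lemma sel_in cs : sel cs \in (0, [:: 0]) :: cs.
Proof.
rewrite /sel; elim/last_ind: cs => [|cs c IH]; first by rewrite inE.
rewrite foldl_rcons; case: ifP => _; rewrite -rcons_cons mem_rcons inE ?eqxx //.
by rewrite IH orbT.
Qed.
Lemma sel_max cs c : c \in cs -> c.1 <= (sel cs).1.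
Proof.
rewrite /sel; elim/last_ind: cs => [|cs x IH] //; rewrite foldl_rcons mem_rcons inE.
case: ifPn => h /orP [/eqP ->|/IH] //; rewrite -ltnNge in h => h2; exact: leq_trans (ltnW h).
Qed.

Variables (E : Type) (rE : Rep R E) (hE : Hb E).
Lemma fp_sel (cs : E -> seq (nat * seq nat)) : fp cs -> fp (fun e => sel (cs e)).
Proof.
move=> f; apply: (@fp_foldl R E rE hE (nat * seq nat)%type _ _ _ _ _ _ cs (fun=> (0, [:: 0])) (fun _ b c => if c.1 <= b.1 then b else c)) => //; try by fpt.
have [[k hk] _] := f; exists k.+1 => Z e j he; have [_ h2] := hk _ _ he.
have := sel_in (take j (cs e)); rewrite inE => /orP [/eqP|] h.
  rewrite -/(sel _) h; have z1 : 1 <= ub k.+1 Z by rewrite /ub expn_gt0 addn2.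
  by split=> //; split=> // x /= [<-|//].
by apply: hb_mono (h2 _ (In_take (proj2 (In_mem _ _) h))); exact: ub_le.
Qed.
End Best.
Section Best2.
Variable R : realType.
Variables (E : Type) (rE : Rep R E) (hE : Hb E).
Lemma fp_Uaf (N d Q Nr l1p a : E -> nat) (cl : E -> seq R) (e0 : E -> R) (z : E -> seq nat) :
  fp N -> fp d -> fp Q -> fp Nr -> fp cl -> fp l1p -> fp e0 -> fp z -> fp a ->
  fp (fun e => Uaf (N e) (d e) (Q e) (Nr e) (cl e) (l1p e) (e0 e) (z e) (a e)).
Proof.
move=> *; rewrite /Uaf /capf; apply: fp_map; last by fpt.
apply: fp_Ytab; try (by fpt); first (by apply: fp_zvl; fpt).
  by apply: fp_rdiv; [fpt|apply: fp_natR; fpt].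
by apply: fp_rmul; [apply: fp_rdiv; [fpt|apply: fp_natR; fpt]|apply: fp_natR; fpt].
Qed.
Lemma fp_okit (ds : E -> seq (seq R)) (B : E -> R) (it : E -> itm) : fp ds -> fp B -> fp it ->
  fp (fun e => okit (ds e) (B e) (it e)).
Proof.
move=> *; rewrite /okit; apply: fp_and; first by fpt.
by apply: fp_and; [fpt|apply: fp_rle; [apply: fp_plen; fpt|fpt]].
Qed.
Lemma fp_outf (d : E -> nat) (cl : E -> seq R) (q : E -> seq nat) : fp d -> fp cl -> fp q ->
  fp (fun e => outf (d e) (cl e) (q e)).
Proof. by move=> *; rewrite /outf; fpt; apply: fp_co; fpt. Qed.
End Best2.
Section Best3.
Variable R : realType.
Variables (E : Type) (rE : Rep R E) (hE : Hb E).
Lemma fp_cands (N d Q Nr l1p mu Rs : E -> nat) (cl : E -> seq R) (B : E -> R) (WQ WN W : E -> seq (seq nat)) (WK : E -> seq (seq (seq nat))) :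
  fp N -> fp d -> fp Q -> fp Nr -> fp cl -> fp B -> fp l1p -> fp mu -> fp Rs -> fp WQ -> fp WN -> fp WK -> fp W ->
  fp (fun e => cands (N e) (d e) (Q e) (Nr e) (cl e) (B e) (l1p e) (mu e) (Rs e) (WQ e) (WN e) (WK e) (W e)).
Proof.
move=> *; rewrite /cands; apply: fp_flatten; apply: fp_map; first by apply: fp_gsl.
apply: fp_flatten; apply: fp_map; first by fpt.
apply: fp_flatten; apply: fp_map; first by fpt.
apply: fp_map; last by fpt.
apply: fp_filter; last by apply: fp_okit; [apply: fp_dmat; fpt|fpt|fpt].
apply: fp_tabW; try (by fpt); first (by apply: fp_dmat; fpt).
- by apply: fp_Uaf; fpt.
- by rewrite /Ff /levf /capf; fpt.
by rewrite /levf /capf; fpt.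
Qed.
End Best3.

Section AlgF.
Variable R : realType.
Local Notation inp := (nat * (nat * (nat * (R * seq R))))%type.

Definition x1 n d u := 36 * (d * d * d) * (d * u).+1 * n * (48 * n * d * u).
Definition xM d u := 96 * 108 * (d * d * d * d * d) * (d * u).+1 * u.
Definition xm n d u := 96 * 96 * (d * d * d * d * d) * (d * u).+1 * u * (lgp (x1 n d u)).1.+2.
Definition mMf d u := (lgp (xM d u)).1.
Definition muf n d u := (lgp (xm n d u)).1.
Definition l1f n d u := (lgp (x1 n d u)).1.
Definition PBf n d u := 2 ^ (d * muf n d u).
Definition Rsf d u := RsB d u (mMf d u).
(** All powers that the algorithm forms; a ghost bound above them makes everything polynomial. *)
Definition need n d u := 2 ^ d + (2 ^ mMf d u) ^ d + PBf n d u + (d * u).+1 ^ d + n.+1 ^ (u * 2 + 2)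
  + (u * 2 + 2 + PBf n d u) ^ Rsf d u + (2 * Rsf d u + PBf n d u).+1 ^ (5 * Rsf d u).
Definition algq (e : inp) : seq nat :=
  let: (n, (d, (u, (B, cl)))) := e in
  (sel (cands n.+1 d (d * u).+1 (48 * n * d * u) cl B (2 ^ l1f n d u) (d * muf n d u) (Rsf d u)
    (words (d * u).+1 d) (words n.+1 (u * 2 + 2))
    [seq words (u * 2 + 2 + PBf n d u) j | j <- iota 0 (Rsf d u).+1] (words (2 * Rsf d u + PBf n d u).+1 (5 * Rsf d u)))).2.
Definition alg (e : inp) : nat * seq R := outf e.2.1 e.2.2.2.2 (algq e).

Definition preA Z (e : inp) := hb Z e /\ need e.1 e.2.1 e.2.2.1 <= Z.

Lemma fpP_alg : fpP preA alg.
Proof.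
have hP Z a : preA Z a -> hb Z a by case.
have nd Z a x : preA Z a -> x <= need a.1 a.2.1 a.2.2.1 -> x <= Z by move=> [_ h] h2; exact: leq_trans h.
have f1 : fp (fun e : inp => lgp (x1 e.1 e.2.1 e.2.2.1)) by apply: fp_lgp; rewrite /x1; fpt.
have fM : fp (fun e : inp => lgp (xM e.2.1 e.2.2.1)) by apply: fp_lgp; rewrite /xM; fpt.
have fm : fp (fun e : inp => lgp (xm e.1 e.2.1 e.2.2.1)).
  by apply: fp_lgp; rewrite /xm; apply: fp_mul; [fpt|apply: fp_S; apply: fp_S; apply: fp_1].
have fi : fpP preA (fun e : inp => e) by apply: fpP_fp => //; fpt.
have w1 : fpP preA (fun e : inp => wordsL 2 e.2.1).
  apply: fpP_words; try (by apply: fpP_fp => //; fpt).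
  by move=> Z a /nd; apply; rewrite /need -!addnA leq_addr.
have w2 : fpP preA (fun e : inp => wordsL (lgp (xM e.2.1 e.2.2.1)).2 e.2.1).
  apply: fpP_words; try (by apply: fpP_fp => //; fpt).
  move=> Z a /nd; apply; have [-> _ _] := lgpP (xM a.2.1 a.2.2.1).
  by rewrite /need /mMf; lia.
have w3 : fpP preA (fun e : inp => wordsL 2 (e.2.1 * (lgp (xm e.1 e.2.1 e.2.2.1)).1)).
  apply: fpP_words; try (by apply: fpP_fp => //; fpt).
  by move=> Z a /nd; apply; rewrite /need /PBf /muf; lia.
have w4 : fpP preA (fun e : inp => wordsL (e.2.1 * e.2.2.1).+1 e.2.1).
  apply: fpP_words; try (by apply: fpP_fp => //; fpt).
  by move=> Z a /nd; apply; rewrite /need; lia.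
have w5 : fpP preA (fun e : inp => wordsL e.1.+1 (e.2.2.1 * 2 + 2)).
  apply: fpP_words; try (by apply: fpP_fp => //; fpt).
  by move=> Z a /nd; apply; rewrite /need; lia.
(* Powers are obtained as lengths of word lists. *)
have pPB : fpP preA (fun e : inp => PBf e.1 e.2.1 e.2.2.1).
  have g : fp (R := R) (fun s : seq (seq (seq nat)) => size (head [::] s)) by fpt.
  have [h1 h2] := fpP_comp w3 g; split.
    by have [k hk] := h1; exists k => Z a /hk; rewrite head_wordsL size_words.
  by apply: pf_ext h2 => a; rewrite head_wordsL size_words.
have pRs : fpP preA (fun e : inp => Rsf e.2.1 e.2.2.1).
  have g : fp (R := R) (fun s : inp * (seq (seq (seq nat)) * seq (seq (seq nat))) =>
     (size (head [::] s.2.1) * (2 * (size (head [::] s.2.2) * (s.1.2.1 * 2).+1) + s.1.2.2.1 * 2) + s.1.2.2.1 * 2).+1) by fpt.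
  have E a : (size (head [::] (wordsL 2 a.2.1)) * (2 * (size (head [::] (wordsL (lgp (xM a.2.1 a.2.2.1)).2 a.2.1)) * (a.2.1 * 2).+1) + a.2.2.1 * 2) + a.2.2.1 * 2).+1 = Rsf a.2.1 a.2.2.1 :> nat.
    by rewrite !head_wordsL !size_words /Rsf /RsB /r2 /mMf; have [-> _ _] := lgpP (xM a.2.1 a.2.2.1).
  have [h1 h2] := fpP_comp (fpP_pair fi (fpP_pair w1 w2)) g; split.
    by have [k hk] := h1; exists k => Z a /hk /=; rewrite E.
  by apply: pf_ext h2 => a /=; exact: E.
have p3 : fpP preA (fun e : inp => (e, (PBf e.1 e.2.1 e.2.2.1, Rsf e.2.1 e.2.2.1))).
  by apply: fpP_pair => //; exact: fpP_pair.
have w6 : fpP preA (fun e : inp => wordsL (e.2.2.1 * 2 + 2 + PBf e.1 e.2.1 e.2.2.1) (Rsf e.2.1 e.2.2.1)).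
  apply: fpP_words => //; last by move=> Z a /nd; apply; rewrite /need; lia.
  have g : fp (R := R) (fun s : inp * (nat * nat) => s.1.2.2.1 * 2 + 2 + s.2.1) by fpt.
  exact: fpP_comp p3 g.
have w7 : fpP preA (fun e : inp => wordsL (2 * Rsf e.2.1 e.2.2.1 + PBf e.1 e.2.1 e.2.2.1).+1 (5 * Rsf e.2.1 e.2.2.1)).
  apply: fpP_words; last by move=> Z a /nd; apply; rewrite /need; lia.
    have g : fp (R := R) (fun s : inp * (nat * nat) => (2 * s.2.2 + s.2.1).+1) by fpt.
    exact: fpP_comp p3 g.
  have g : fp (R := R) (fun s : inp * (nat * nat) => 5 * s.2.2) by fpt.
  exact: fpP_comp p3 g.
pose W3 := seq (seq (seq nat)).
have g : fp (R := R) (fun s : (inp * (nat * nat)) * (W3 * (W3 * (W3 * W3))) =>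
   let e := s.1.1 in
   outf e.2.1 e.2.2.2.2 (sel (cands e.1.+1 e.2.1 (e.2.1 * e.2.2.1).+1 (48 * e.1 * e.2.1 * e.2.2.1) e.2.2.2.2 e.2.2.2.1
     (lgp (x1 e.1 e.2.1 e.2.2.1)).2 (e.2.1 * (lgp (xm e.1 e.2.1 e.2.2.1)).1) s.1.2.2
     (head [::] s.2.1) (head [::] s.2.2.1) (rev s.2.2.2.1) (head [::] s.2.2.2.2))).2).
  cbv zeta; apply: fp_outf; [by fpt|by fpt|]; apply: fp_2; apply: fp_sel; apply: fp_cands; try by fpt.
  - by apply: fp_2; apply: fp_lgp; rewrite /x1; fpt.
  - by apply: fp_mul; [fpt|apply: fp_1; apply: (fp_comp (f := fun s : (inp * (nat * nat)) * (W3 * (W3 * (W3 * W3))) => s.1.1) (g := fun e : inp => lgp (xm e.1 e.2.1 e.2.2.1))) => //; fpt].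
have h := fpP_comp (fpP_pair p3 (fpP_pair w4 (fpP_pair w5 (fpP_pair w6 w7)))) g.
apply: (fpP_ext _ h) => -[n [d [u [B cl]]]]; rewrite /alg /algq.
have [a1 _ _] := lgpP (x1 n d u).
by cbn [fst snd]; rewrite !head_wordsL wordsLE revK a1.
Qed.
End AlgF.
End Alg3.

(** * Input, output and the number of pieces on the machine *)

Module Wrap.
Import Ram DP Fp2 Geo Walk Bridge Alg Alg2 Alg3.

Set Implicit Arguments.
Unset Strict Implicit.
Unset Printing Implicit Defensive.
Import Order.TTheory GRing.Theory Num.Theory.
Local Open Scope nat_scope.

Arguments blk : simpl never.
Ltac um := rewrite /= /upd /=.

Lemma runs_seqw (R : realType) c1 c2 (m : memory R) T1 T1' T2 Q1 Q : T1 <= T1' -> runs c1 m T1 Q1 ->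
  (forall m', Q1 m' -> runs c2 m' T2 Q) -> runs (Seq c1 c2) m (T1' + T2) Q.
Proof.
move=> le h1 h2; apply: (runs_weak _ (fun _ h => h) (runs_seq h1 h2)).
by rewrite leq_add2r.
Qed.

Section Wrap.
Variable R : realType.
Notation mem := (memory R).
Local Notation inp := (nat * (nat * (nat * (R * seq R))))%type.

(** A real is represented by its address, so a list of addresses is at the same time a list of
    reals. The coordinates stay where the input has them, except the first, which is moved from
    scratch cell 2 to [e.2.2.2 + 2]. *)
Definition mkin (e : nat * (nat * (nat * nat))) : nat * (nat * (nat * (nat * seq nat))) :=
  (e.1, (e.2.1, (e.2.2.1, (e.2.2.2, (e.2.2.2 + 2) :: iota 3 (e.2.2.2 - 3))))).
Lemma fp_mkin : fp (R := R) mkin.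
Proof. by rewrite /mkin; fpt. Qed.

(** The end of the input is found by adding [d] once per point, since naturals have no
    multiplication instruction. *)
Definition b1 := [:: NConst 3 0; NAdd 8 0 3; NAdd 10 1 3; NConst 12 1; NConst 14 2; NAdd 16 8 12; NConst 18 0].
Definition l1 := [:: NAdd 14 14 10; NSub 16 16 12].
(** [B], [delta] and the first coordinate occupy the scratch cells 0 to 2 and are moved behind the
    input. The loop over [l2] then finds [u] as the number of additions of [delta] that reach 1. *)
Definition b2 := [:: NAdd 20 14 12; NAdd 22 20 12; NAdd 2 22 12; RStore 14 0; RStore 20 1; RStore 22 2;
  RLoad 2 20; ROne 1; RZero 0; NConst 24 0].
Definition l2 := [:: RAdd 0 0 2; NAdd 24 24 12].
(** The tuple [(n, (d, (u, M0)))] is laid out by hand in the odd cells 1 to 11, and the heap starts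
    at 13. *)
Definition b3 := [:: NAdd 1 24 18; NAdd 3 14 18; NAdd 5 10 18; NConst 7 1; NAdd 9 8 18; NConst 11 5; NConst 0 13; NConst 8 9].
(** The answer is first copied above the heap and only then moved to the front, since the cells at
    the front may still hold coordinates of the answer. *)
Definition b4 := [:: NLoad 10 8; NConst 12 2; NAdd 14 8 12; NLoad 14 14; NConst 16 0; NAdd 18 2 16; NConst 20 1; NAdd 22 2 16].
Definition l4 := [:: NLoad 24 14; RLoad 0 24; RStore 18 0; NAdd 18 18 20; NAdd 26 14 12; NLoad 14 26].
(** Real cell 0 serves as the transfer cell, so the first coordinate is parked behind the others and
    restored at the very end by [b6]. *)
Definition b5 := [:: RLoad 0 22; RStore 18 0; NConst 16 1; NAdd 22 22 20].
Definition l5 := [:: RLoad 0 22; RStore 16 0; NAdd 16 16 20; NAdd 22 22 20].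
Definition b6 := [:: RLoad 0 18; NConst 4 0; NAdd 0 10 4].

Definition prog cm ca := (Seq (Seq (blk b1) (While (NLt 18 16) (blk l1))) (Seq (Seq (blk b2) (While (RLt 0 1) (blk l2)))
  (Seq (blk b3) (Seq cm (Seq ca (Seq (Seq (blk b4) (While (NLt 16 14) (blk l4)))
   (Seq (blk b5) (Seq (While (NLt 22 18) (blk l5)) (blk b6))))))))).

Section In.
Variables (d n u : nat) (iv : seq R) (B delta : R) (cl : seq R).
Hypothesis d0 : 0 < d.
Hypothesis dl0 : (0 < delta)%R.
Hypothesis u1 : (u.-1%:R * delta < 1)%R.
Hypothesis u2 : (1 <= u%:R * delta)%R.
Hypothesis scl : size cl = n.+1 * d.
Variable M0 : nat.
Hypothesis M0E : M0 = 2 + n.+1 * d.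
Let ival a := nth 0%R (B :: delta :: cl) a.

Definition base_ok (m : mem) := [/\ nmem m 8 = n, nmem m 10 = d, nmem m 12 = 1, nmem m 14 = M0 & nmem m 18 = 0].
Definition real_ok (m : mem) := [/\ M0 + 3 <= nmem m 2, rmem m M0 = B, rmem m (M0 + 1) = delta, rmem m (M0 + 2) = ival 2 &
  forall a, 3 <= a -> a < M0 -> rmem m a = ival a].

Lemma M03 : 3 <= M0. Proof. by rewrite M0E; move: d0; clear; nia. Qed.

Lemma run1 (m : mem) : nmem m 0 = n -> nmem m 1 = d -> rmem m = ival ->
  runs (Seq (blk b1) (While (NLt 18 16) (blk l1))) m (8 + (n.+1 * 4).+1) (fun m' => base_ok m' /\ rmem m' = ival).
Proof.
move=> h0 h1 hr.
pose I j (m' : mem) := [/\ nmem m' 8 = n, nmem m' 10 = d, nmem m' 12 = 1, nmem m' 18 = 0 &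
  [/\ nmem m' 16 = j, nmem m' 14 + j * d = M0 & rmem m' = ival]].
apply: (runs_seq (Q1 := I n.+1)).
  apply: runs_blk; rewrite /I /= /upd /= h0 h1 !addn0; split=> //; split=> //; by rewrite ?addn1 ?M0E.
move=> m1 i1; apply: (runs_weak (leqnn _) _ (runs_while (T := 3) (I := I) _ _ i1)).
- by move=> m' [e1 e2 e3 e4 [e5 e6 e7]]; split=> //; split=> //; move: e6; rewrite mul0n addn0.
- move=> j m' [e1 e2 e3 e4 [e5 e6 e7]]; rewrite /= e4 e5; split=> //.
  apply: runs_blk; rewrite /I /= /upd /= e1 e2 e3 e4 e5; split=> //; split=> //; first by rewrite subn1.
  by rewrite -e6 mulSn addnA.
- by move=> m' [e1 e2 e3 e4 [e5 e6 e7]]; rewrite /= e4 e5.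
Qed.

Lemma run2 (m : mem) : base_ok m -> rmem m = ival ->
  runs (Seq (blk b2) (While (RLt 0 1) (blk l2))) m (11 + (u * 4).+1)
   (fun m' => [/\ base_ok m', real_ok m' & nmem m' 24 = u]).
Proof.
move=> [e1 e2 e3 e4 e5] hr; have m3 := M03.
pose I j (m' : mem) := [/\ base_ok m', real_ok m', j <= u, nmem m' 24 = u - j &
  [/\ rmem m' 0 = ((u - j)%:R * delta)%R, rmem m' 1 = 1%R & rmem m' 2 = delta]].
have ne x y : x != y -> (x == y) = false by move/negPf.
apply: (runs_seq (Q1 := I u)).
  apply: runs_blk.
  have f0 : (M0 == 0) = false by apply/eqP; lia.
  have f1 : (M0 + 1 + 1 == M0 + 1) = false by apply/eqP; lia.
  have f2 : (M0 + 1 + 1 == M0) = false by apply/eqP; lia.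
  have f3 : (M0 + 1 == M0) = false by apply/eqP; lia.
  have a0 x : (M0 + x == 0) = false by apply/eqP; lia.
  have a1 x : (M0 + x == 1) = false by apply/eqP; lia.
  have a2 x : (M0 + x == 2) = false by apply/eqP; lia.
  have c1 : (M0 == 1) = false by apply/eqP; lia.
  have c2 : (M0 == 2) = false by apply/eqP; lia.
  have r0 : (0 == M0) = false by apply/eqP; lia.
  have r1 : (1 == M0) = false by apply/eqP; lia.
  have r2 : (2 == M0) = false by apply/eqP; lia.
  have s1 x : (1 == M0 + x) = false by apply/eqP; lia.
  have s2 x : (2 == M0 + x) = false by apply/eqP; lia.
  have t1 : (M0 + 2 == M0 + 1) = false by apply/eqP; lia.
  have t2 : (M0 + 2 == M0) = false by apply/eqP; lia.
  have t3 : (M0 + 2 == M0 + 1 + 1) by apply/eqP; lia.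
  have t4 : (M0 + 1 == M0 + 1 + 1) = false by apply/eqP; lia.
  have t5 : (M0 == M0 + 1 + 1) = false by apply/eqP; lia.
  have t6 : (M0 == M0 + 1) = false by apply/eqP; lia.
  have t7 : (2 == M0 + 1 + 1) = false by apply/eqP; lia.
  have t8 : (1 == M0 + 1 + 1) = false by apply/eqP; lia.
  have S := (f0, f1, f2, f3, a0, a1, a2, (c1, c2, r0, r1, r2), (t7, t8, s1, s2, t1, t2), (t3, t4, t5, t6)).
  rewrite /I /base_ok /real_ok /= /upd /= e1 e2 e3 e4 e5 hr subnn mul0r.
  split; [by []| |by []|by []|by split; rewrite ?S ?eqxx ?S].
  split; [by clear; lia|by rewrite ?S ?eqxx ?S|by rewrite ?S ?eqxx ?S|by rewrite ?S ?eqxx ?S|].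
  move=> a a3 aM.
  have -> : (a == 0) = false by apply/eqP; lia.
  have -> : (a == 1) = false by apply/eqP; lia.
  have -> : (a == 2) = false by apply/eqP; lia.
  have -> : (a == M0 + 1 + 1) = false by apply/eqP; lia.
  have -> : (a == M0 + 1) = false by apply/eqP; lia.
  by have -> : (a == M0) = false by apply/eqP; lia.
move=> m1 i1; apply: (runs_weak (leqnn _) _ (runs_while (T := 3) (I := I) _ _ i1)).
- by move=> m' [q1 q2 _ q3 _]; split=> //; rewrite q3 subn0.
- move=> j m' [[q1 q2 q3 q4 q5] [w1 w2 w3 w4 w5] ju q6 [q7 q8 q9]]; rewrite /= q7 q8; split.
    apply: le_lt_trans u1; rewrite ler_wpM2r ?(ltW dl0) // ler_nat; lia.
  apply: runs_blk; split; um.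
  + by split; um; rewrite ?q1 ?q2 ?q3 ?q4 ?q5.
  + have f0 x : (M0 + x == 0) = false by apply/eqP; lia.
    have f1 : (M0 == 0) = false by apply/eqP; lia.
    split; um; rewrite ?f0 ?f1 // => a a3 aM.
    have -> : (a == 0) = false by apply/eqP; lia.
    exact: w5.
  + exact: ltnW.
  + by rewrite q6 q3; lia.
  + split; um => //; rewrite q7 q9 (_ : u - j = (u - j.+1).+1); last by lia.
    by rewrite -natr1 mulrDl mul1r.
- move=> m' [_ _ _ _ [q7 q8 _]]; rewrite /= q7 q8 subn0 -leNgt; exact: u2.
Qed.

Let ad := M0 + 2 :: iota 3 (M0 - 3).

Lemma cl_ad : cl = [seq (if a == M0 + 2 then ival 2 else ival a) | a <- ad].
Proof.
have m3 := M03; apply: (@eq_from_nth _ 0%R) => [|i il].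
  by rewrite size_map /= size_iota scl; move: m3; rewrite M0E; clear; lia.
have il2 : i < size ad by move: il; rewrite /= size_iota scl; move: m3; rewrite M0E; clear; lia.
rewrite (nth_map 0) //; case: i il il2 => [|i] il il2 /=; first by rewrite eqxx.
move: il2; rewrite /= ltnS size_iota => il2; rewrite nth_iota //.
have -> : (3 + i == M0 + 2) = false by apply/eqP; move: il2; clear; lia.
by [].
Qed.

Lemma run3 (m : mem) : base_ok m -> real_ok m -> nmem m 24 = u ->
  runs (blk b3) m 9 (fun m' => [/\ wf m', @rg R m' 4 _ _ (n, (d, (u, M0))) & real_ok m']).
Proof.
move=> [e1 e2 e3 e4 e5] [r1 r2 r3 r4 r5] e6; apply: runs_blk; split.
- by split; rewrite /HP /RP; um => //; move: r1; clear; lia.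
- rewrite /rg; um; rewrite /HP; um; rewrite ?e1 ?e2 ?e4 ?e5 ?e6 ?addn0; do !split=> //.
- by split; um.
Qed.

(** One word, two readings: the list of addresses is reinterpreted as the list of reals stored
    there, without executing anything. *)
Lemma rep_in (m : mem) w : real_ok m ->
  rep m w ((n, (d, (u, (M0, ad)))) : nat * (nat * (nat * (nat * seq nat)))) ->
  rep m w ((n, (d, (u, (B, cl)))) : inp).
Proof.
move=> [r1 r2 r3 r4 r5] [h1 h2 h3 [i1 i2 i3 [j1 j2 j3 [k1 k2 k3 k4]]]].
have m3 := M03.
split=> //; split=> //; split=> //; split=> //=.
  by split; rewrite ?k3 /RP //=; move: r1 m3; clear; lia.
rewrite cl_ad; move: k4; rewrite [snd _]/=.
have : all (fun a => (a == M0 + 2) || (3 <= a < M0)) ad.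
  rewrite /ad /= eqxx; apply/allP => a; rewrite mem_iota => ha; apply/orP; right; move: ha m3; clear; lia.
elim: ad (nmem m _) => [|a l IH] v //= /andP [ha al] [l1' l2' l3' l4']; split=> //; last exact: IH.
rewrite /= in l3'; rewrite l3'; split; rewrite /RP.
- by move: ha m3 r1 => /orP [/eqP ->|]; clear; lia.
- by move: ha m3 r1 => /orP [/eqP ->|]; clear; lia.
- by move: ha; case: eqP => [->|_ /= /andP [a3 aM]]; [rewrite r4|rewrite r5].
Qed.
End In.

Section Out.
Variables (cnt : nat) (xs : seq R).

Lemma run4 (m : mem) : wf m -> @rg R m 4 _ _ (cnt, xs) ->
  runs (Seq (blk b4) (While (NLt 16 14) (blk l4))) m (9 + (size xs * 8).+1)
   (fun m' => [/\ nmem m' 10 = cnt, nmem m' 18 = nmem m' 22 + size xs, 3 <= nmem m' 22, nmem m' 20 = 1 &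
      forall i, i < size xs -> rmem m' (nmem m' 22 + i) = nth 0%R xs i]).
Proof.
move=> [w1 w2] [o1 o2 o3 o4]; rewrite /= in o1 o2 o3 o4.
have e4 : 4.*2 = 8 by []; rewrite e4 in o1 o2 o3 o4.
pose I j (m' : mem) := [/\ hext m m', nmem m' 2 = nmem m 2 /\ nmem m' 0 = nmem m 0, j <= size xs,
   [/\ nmem m' 10 = cnt, nmem m' 12 = 2, nmem m' 16 = 0, nmem m' 20 = 1 & nmem m' 22 = RP m] &
   [/\ nmem m' 18 = RP m + (size xs - j), lrep (real_Rep R) m' (nmem m' 14) (drop (size xs - j) xs) &
     forall i, i < size xs - j -> rmem m' (RP m + i) = nth 0%R xs i]].
apply: (@runs_seqw R (blk b4) (While (NLt 16 14) (blk l4)) m 9 9 (size xs * 8).+1 (I (size xs)) _ (leqnn _)).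
  have e8 : (nmem m 8 + 2 == 10) = false by apply/eqP; move: o1; clear; lia.
  have e9 : (nmem m 8 + 2 == 12) = false by apply/eqP; move: o1; clear; lia.
  have e10 : (nmem m 8 + 2 == 14) = false by apply/eqP; move: o1; clear; lia.
  apply: runs_blk; set m2 := foldl _ _ _.
  have hx : hext m m2.
    split; rewrite /m2 /HP /RP /= /upd //= => a oa _.
    by do ?(case: eqP => [e|_]; first by move: oa; rewrite e).
  have n14 : nmem m2 14 = nmem m (nmem m 8 + 2) by rewrite /m2 /= /upd /= ?e8 ?e9 ?e10.
  split; [exact: hx|by []|by []|by split; rewrite /m2 /= /upd /= ?addn0|split].
  - by rewrite /m2 /= /upd /= subnn !addn0.
  - by rewrite n14 subnn drop0; exact: (@rep_mono R _ (seq_Rep (real_Rep R)) _ _ _ _ hx o4).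
  - by rewrite subnn.
move=> m1 i1; apply: (runs_weak (leqnn _) _ (runs_while (T := 7) (I := I) _ _ i1)).
- move=> m' [_ _ _ [q1 q2 q3 q4 q5] [q6 q7 q8]]; rewrite subn0 in q6 q8; split=> //.
  + by rewrite q6 q5.
  + by rewrite q5.
  + by move=> i il; rewrite q5 q8.
- move=> j m' [hx [hR hH] js [q1 q2 q3 q4 q5] [q6 q7 q8]].
  have sj : size xs - j.+1 < size xs by lia.
  move: q7; rewrite (drop_nth 0%R sj) => -[/= p1 p2 [p3 p4 p5] p6].
  rewrite /= q3; split; first by case: (nmem m' 14) p1.
  have sE : size xs - j = (size xs - j.+1).+1 by lia.
  have e14 : (nmem m' 14 == 24) = false by apply/eqP; move: p1; clear; lia.
  have f14 : (nmem m' 14 == 26) = false by apply/eqP; move: p1; clear; lia.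
  have g14 x : ~~ odd x -> (nmem m' 14 + 2 == x) = false by move=> ox; apply/eqP => e; move: ox; rewrite -e oddD p1.
  have RPm : RP m' = RP m by rewrite /RP.
  apply: runs_blk; set m2 := foldl _ _ _.
  have hx2 : hext m' m2.
    split; rewrite /m2 /HP /RP /= /upd //= => a oa la.
      by do ?(case: eqP => [e|_]; first by move: oa; rewrite e).
    have -> : (a == nmem m' 18) = false by apply/eqP; move: la; rewrite q6 -[nmem m' 2]/(RP m') RPm; clear; lia.
    by have -> : (a == 0) = false by apply/eqP; move: oa; clear; lia.
  have n14 : nmem m2 14 = nmem m' (nmem m' 14 + 2).
    by rewrite /m2 /= /upd /= q2 (g14 26 isT) (g14 18 isT) (g14 24 isT).
  split.
  + exact: hext_trans hx2.
  + by split; rewrite /m2 /= /upd /=.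
  + exact: ltnW.
  + by split; rewrite /m2 /= /upd /=.
  + split.
    * by rewrite /m2 /= /upd /= q6 q4 sE addn1 addnS.
    * by rewrite n14 sE; exact: (@rep_mono R _ (seq_Rep (real_Rep R)) _ _ _ _ hx2 p6).
    * move=> i; rewrite sE ltnS leq_eqVlt /m2 /= /upd /= q6 => /orP [/eqP ->|il].
        by rewrite eqxx p5.
      have -> : (RP m + i == RP m + (size xs - j.+1)) = false by apply/eqP; move: il; clear; lia.
      have -> : (RP m + i == 0) = false by apply/eqP; move: w2; clear; lia.
      by rewrite q8.
- by move=> m' [_ _ _ [_ _ q3 _ _] [_ q7 _]]; move: q7; rewrite subn0 drop_size /= => ->; rewrite q3.
Qed.

Lemma run5 (m : mem) : 0 < size xs -> nmem m 10 = cnt -> nmem m 18 = nmem m 22 + size xs -> 3 <= nmem m 22 -> nmem m 20 = 1 ->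
   (forall i, i < size xs -> rmem m (nmem m 22 + i) = nth 0%R xs i) ->
  runs (Seq (blk b5) (Seq (While (NLt 22 18) (blk l5)) (blk b6))) m (5 + ((size xs * 6).+1 + 4))
   (fun m' => nmem m' 0 = cnt /\ forall i, i < size xs -> rmem m' i = nth 0%R xs i).
Proof.
move=> s0 h1 h2; set b := nmem m 22 => h3 h4 h5.
pose I j (m' : mem) := [/\ nmem m' 10 = cnt, nmem m' 18 = b + size xs, nmem m' 20 = 1, j < size xs &
  [/\ nmem m' 16 = size xs - j, nmem m' 22 = b + (size xs - j), rmem m' (b + size xs) = nth 0%R xs 0,
   forall i, 0 < i -> i < size xs - j -> rmem m' i = nth 0%R xs i &
   forall i, size xs - j <= i -> i < size xs -> rmem m' (b + i) = nth 0%R xs i]].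
have s1 : size xs - (size xs).-1 = 1 by lia.
apply: (runs_seq (Q1 := I (size xs).-1)).
  apply: runs_blk; split; um; rewrite ?h1 ?h2 ?h4 //; first by lia.
  rewrite s1; split; um; rewrite ?h1 ?h2 ?h4 -/b ?addn1 //.
  - by rewrite eqxx; have := h5 0 s0; rewrite addn0.
  - by move=> i i0 i1; exfalso; move: i0 i1; clear; lia.
  move=> i i1 il; have -> : (b + i == b + size xs) = false by apply/eqP; move: il; clear; lia.
  have -> : (b + i == 0) = false by apply/eqP; move: h3; clear; lia.
  exact: h5.
move=> m1 i1.
have i1' : exists2 j, j <= size xs & I j m1 by exists (size xs).-1 => //; lia.
apply: (runs_seq (Q1 := I 0)).
  apply: (runs_weak _ _ (runs_while (T := 5) (I := I) _ _ i1)) => //.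
  - by rewrite ltnS leq_mul2r; lia.
  - move=> j m' [q1 q2 q3 q4 [q5 q6 q7 q8 q9]].
    have sE : size xs - j = (size xs - j.+1).+1 by lia.
    rewrite /= q6 q2; split; first by rewrite ltn_add2l; lia.
    apply: runs_blk; split; um; rewrite ?q1 ?q2 ?q3 //; first exact: ltnW.
    rewrite sE; split; um; rewrite ?q3 ?q5 ?q6 ?addn1 ?addnS ?addn1 //.
    + have -> : (b + size xs == size xs - j.+1) = false by apply/eqP; move: h3; clear; lia.
      have -> : (b + size xs == 0) = false by apply/eqP; move: h3; clear; lia.
      by [].
    + move=> i i0; rewrite ltnS leq_eqVlt => /orP [/eqP ->|il].
        by rewrite eqxx q9 //; lia.
      have -> : (i == size xs - j.+1) = false by apply/eqP; move: il; clear; lia.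
      have -> : (i == 0) = false by apply/eqP; move: i0; clear; lia.
      exact: q8.
    + move=> i ij il.
      have -> : (b + i == size xs - j.+1) = false by apply/eqP; move: h3 ij; clear; lia.
      have -> : (b + i == 0) = false by apply/eqP; move: h3; clear; lia.
      by apply: q9 => //; exact: ltnW.
  - by move=> m' [q1 q2 q3 q4 [q5 q6 q7 q8 q9]]; rewrite /= q6 q2 subn0 ltnn.
move=> m2 [q1 q2 q3 q4 [q5 q6 q7 q8 q9]]; apply: runs_blk; split; um; rewrite ?q1 ?q2 ?addn0 // => i il.
case: eqP => [->|/eqP i0]; first exact: q7.
by apply: q8; rewrite ?subn0 ?lt0n.
Qed.
End Out.

(** The ghost bound is [need] plus the sizes of the input. All phases are polynomial in it, and [kp]
    is an exponent for their sum, independent of the input. *)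
Lemma wrapper : exists (A : program) (kp : nat), forall (d n u : nat) (B delta : R) (cl : seq R),
  0 < d -> (0 < delta)%R -> (u.-1%:R * delta < 1)%R -> (1 <= u%:R * delta)%R -> size cl = n.+1 * d ->
  0 < size (alg (n, (d, (u, (B, cl))))).2 ->
  exists (t : nat) (m : mem),
   [/\ exec A (Memory (nth 0 [:: n; d]) (nth 0%R (B :: delta :: cl))) t m,
    t <= (need n d u + (n.+1 * d + d + u + n + 10)) ^ kp, nmem m 0 = (alg (n, (d, (u, (B, cl))))).1 &
    forall i, i < size (alg (n, (d, (u, (B, cl))))).2 -> rmem m i = nth 0%R (alg (n, (d, (u, (B, cl))))).2 i].
Proof.
have [[ka ha] [Ta [pTa hTa]]] := fpP_alg R.
have [_ [Tm [pTm hTm]]] := fp_mkin.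
have [ca hca] := hTa 4 isT; have [cm hcm] := hTm 4 isT.
exists (prog cm ca).
pose TT Z := (8 + (Z * 4).+1) + ((11 + (Z * 4).+1) + (9 + (Tm Z + (Ta Z + ((9 + (ub ka Z * 8).+1) + (5 + ((ub ka Z * 6).+1 + 4))))))).
have pS S : polyb S -> polyb (fun Z => (S Z).+1).
  by move=> pS; apply: (@polyb_le _ (fun Z => 1 + S Z)) => //; apply: polyb_add => //; exact: polyb_const.
have [kp hkp] : polyb TT.
  by rewrite /TT; do ?[exact: pTm|exact: pTa|exact: polyb_k|exact: polyb_const|exact: polyb_id|apply: polyb_add|apply: pS|apply: polyb_mul].
exists kp => d n u B delta cl d0 dl0 u1 u2 scl s0.
set e := (n, (d, (u, (B, cl)))) in s0 *.
pose Z := need n d u + (n.+1 * d + d + u + n + 8).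
have pe : preA Z e.
  split; last by rewrite /= /Z leq_addr.
  have nd : n.+1 * d + d + u + n + 8 <= Z by rewrite leq_addl.
  split; first by rewrite /= hb_natE; move: nd; clear; lia.
  split; first by rewrite /= hb_natE; move: nd; clear; lia.
  split; first by rewrite /= hb_natE; move: nd; clear; lia.
  by split=> //; split=> //; rewrite /= scl; move: nd; clear; lia.
have hin : hb Z (n, (d, (u, 2 + n.+1 * d))).
  have nd : n.+1 * d + d + u + n + 8 <= Z by rewrite leq_addl.
  by split; [|split; [|split]]; rewrite /= hb_natE; move: nd; clear; lia.
have sx : size (alg e).2 <= ub ka Z by have [_ [h _]] := ha _ _ pe.
have nZ : n.+1 <= Z by rewrite /Z; move: (need n d u); clear; lia.
have uZ : u <= Z by rewrite /Z; move: (need n d u); clear; lia.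
suff [t [m [h1 h2 [h3 h4]]]] : runs (prog cm ca) (Memory (nth 0 [:: n; d]) (nth 0%R (B :: delta :: cl))) (TT Z)
   (fun m' => nmem m' 0 = (alg e).1 /\ forall i, i < size (alg e).2 -> rmem m' i = nth 0%R (alg e).2 i).
  exists t, m; split=> //; apply: leq_trans h2 _; apply: leq_trans (hkp Z) _.
  by rewrite /Z -!addnA.
rewrite /prog /TT; apply: (runs_seqw _ (@run1 d n B delta cl (2 + n.+1 * d) erefl (Memory (nth 0 [:: n; d]) (nth 0%R (B :: delta :: cl))) erefl erefl erefl)).
  by rewrite leq_add2l ltnS leq_mul2r nZ.
move=> m1 [k1 k2]; have r2 : runs (Seq (blk b2) (While (RLt 0 1) (blk l2))) m1 (11 + (u * 4).+1)
    (fun m' => [/\ base_ok d n (2 + n.+1 * d) m', real_ok B delta cl (2 + n.+1 * d) m' & nmem m' 24 = u]).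
  exact: (run2 d0 dl0 u1 u2 scl erefl k1 k2).
apply: (runs_seqw _ r2).
  by rewrite leq_add2l ltnS leq_mul2r uZ.
move=> m2 [k3 k4 k5]; have r3 := run3 k3 k4 k5; apply: (runs_seq r3) => m3 [k6 k7 k8].
apply: (runs_seq (hcm Z m3 _ k6 hin k7)) => m4 [[k9 k10 k11] k12].
have k13 : @rg R m4 4 _ _ e.
  apply: (rep_in (delta := delta) d0 scl erefl) k12; have [y1 y2 y3 y4 y5] := k8; have [z1 z2 z3 z4] := k10.
  have M3 : 3 <= 2 + n.+1 * d by move: d0; clear; nia.
  have gg i : i < 3 -> rmem m4 (2 + n.+1 * d + i) = rmem m3 (2 + n.+1 * d + i).
    by move=> i3; apply: z4; [apply: leq_trans M3 (leq_addr _ _)|apply: leq_trans y1; rewrite ltn_add2l].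
  split; [exact: leq_trans y1 z2|by have := gg 0 isT; rewrite addn0 => ->|by rewrite gg|by rewrite gg|].
  move=> a a3 aM; have -> : rmem m4 a = rmem m3 a; last exact: y5.
  by apply: z4 => //; apply: leq_trans y1; apply: (leq_trans aM); exact: leq_addr.
apply: (runs_seq (hca Z m4 e k9 pe k13)) => m5 [[k14 _ _] k15].
move: k15; rewrite [alg e]surjective_pairing => k15.
apply: (runs_seqw _ (run4 k14 k15)).
  by rewrite leq_add2l ltnS leq_mul2r sx.
move=> m6 [v1 v2 v3 v4 v5].
apply: (runs_weak _ _ (run5 s0 v1 v2 v3 v4 v5)) => //.
by rewrite leq_add2l leq_add2r ltnS leq_mul2r sx.
Qed.
End Wrap.
End Wrap.

(** * Soundness and near-optimality of the selected path *)

Module Glue.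
Import DP Walk Bridge Count Geo Main Alg Alg2 Alg3.

Set Implicit Arguments.
Unset Strict Implicit.
Unset Printing Implicit Defensive.
Import Order.TTheory GRing.Theory Num.Theory.
Local Open Scope ring_scope.

Section Paths.
Variables (R : realType) (d : nat).
Implicit Types (x y : 'rV[R]_d) (p q : seq 'rV[R]_d).

Fixpoint plr x p : R := if p is y :: p' then enorm (y - x) + plr y p' else 0.

Lemma path_lengthE x p : path_length (x :: p) = plr x p.
Proof.
rewrite /path_length /=; elim: p x => [|y p IH] x /=; first by rewrite big_ord0.
by rewrite big_ord_recl /= -IH.
Qed.
Lemma plr_ge0 x p : 0 <= plr x p.
Proof. by elim: p x => //= y p IH x; rewrite addr_ge0 ?enorm_ge0. Qed.
Lemma plr_tri x y p : plr x p <= enorm (y - x) + plr y p.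
Proof.
case: p => [|z p] /=; first by rewrite addr0 enorm_ge0.
by rewrite addrA lerD2r addrC; exact: enorm_tri3.
Qed.
(** Skipping points does not lengthen a path, by the triangle inequality; an optimal path is thereby
    reduced to its distinct visited points. *)
Lemma plr_subseq x p q : subseq p q -> plr x p <= plr x q.
Proof.
elim: q x p => [|y q IH] x [|z p] //=; first by rewrite addr_ge0 ?enorm_ge0 ?plr_ge0.
case: eqP => [->|_] h; first by rewrite lerD2l IH.
by apply: le_trans (plr_tri x y (z :: p)) _; rewrite lerD2l; exact: IH.
Qed.
Lemma plrE x p : plr x p = \sum_(t < size p) enorm (nth 0 (x :: p) t.+1 - nth 0 (x :: p) t).
Proof.
elim: p x => [|y p IH] x /=; first by rewrite big_ord0.
by rewrite big_ord_recl /= IH.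
Qed.
End Paths.

Section Coords.
Variables (R : realType) (d : nat) (l : seq 'rV[R]_d).
Let cl := flatten [seq coords p | p <- l].
Let X i := nth 0 l i.

Lemma size_coords (p : 'rV[R]_d) : size (coords p) = d.
Proof. by rewrite size_map size_enum_ord. Qed.
Lemma size_cl : size cl = (size l * d)%N.
Proof. by rewrite /cl; elim: l => //= p l' IH; rewrite size_cat IH size_coords mulSn. Qed.
Lemma coE i (j : 'I_d) : (i < size l)%N -> co d cl i j = X i 0 j.
Proof.
rewrite /co /cl /X; elim: l i => // p l' IH [|i] /= il.
  by rewrite mul0n add0n nth_cat size_coords ltn_ord (nth_map j) ?size_enum_ord // nth_ord_enum.
rewrite mulSn -addnA nth_cat size_coords ltnNge leq_addr /= addKn; exact: IH.
Qed.
Lemma rsum_ord (F : nat -> R) : rsum [seq F j | j <- iota 0 d] = \sum_(j < d) F j.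
Proof. by rewrite rsumE big_map -(big_mkord xpredT F) /index_iota subn0. Qed.

Lemma ddotE p q v w : (p < size l)%N -> (q < size l)%N -> (v < size l)%N -> (w < size l)%N ->
  ddot d cl p q v w = dotv (X q - X p) (X w - X v).
Proof.
by move=> h1 h2 h3 h4; rewrite /ddot rsum_ord; apply: eq_bigr => j _; rewrite !mxE !coE.
Qed.
Lemma distE p q : (p < size l)%N -> (q < size l)%N -> dist d cl p q = enorm (X q - X p).
Proof. by move=> h1 h2; rewrite /dist ddotE // enormE. Qed.
Lemma gssE p q v w : (p < size l)%N -> (q < size l)%N -> (v < size l)%N -> (w < size l)%N ->
  gss d cl p q v w = excs (X q - X p) (X w - X v).
Proof. by move=> h1 h2 h3 h4; rewrite /gss !distE // ddotE. Qed.
Lemma dmatE i j : (i < size l)%N -> (j < size l)%N -> dm (dmat (size l) d cl) i j = enorm (X i - X j).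
Proof.
move=> il jl; rewrite /dm /dmat (nth_map 0%N) ?size_iota // nth_iota // add0n.
by rewrite (nth_map 0%N) ?size_iota // nth_iota // add0n distE // enorm_sub.
Qed.
Lemma dmat_ge0 i j : 0 <= dm (dmat (size l) d cl) i j.
Proof.
have [il|il] := ltnP i (size l); last by rewrite /dm (nth_default [::]) ?size_map ?size_iota // nth_nil.
have [jl|jl] := ltnP j (size l); first by rewrite dmatE // enorm_ge0.
by rewrite /dm /dmat (nth_map 0%N) ?size_iota // nth_default // size_map size_iota.
Qed.
Lemma mem_gsl p q v w : (p < size l)%N -> (q < size l)%N -> (v < size l)%N -> (w < size l)%N ->
  excs (X q - X p) (X w - X v) \in gsl (size l) d cl.
Proof.
move=> h1 h2 h3 h4; rewrite -gssE // /gsl; apply/flatten_mapP; exists p; first by rewrite mem_iota0.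
apply/flatten_mapP; exists q; first by rewrite mem_iota0.
apply/flatten_mapP; exists v; first by rewrite mem_iota0.
by apply: map_f; rewrite mem_iota0.
Qed.
Lemma sltE Q (z : {ffun 'I_d -> 'I_Q}) p (i : 'I_d) : (p < size l)%N ->
  slt d cl (zvl R d Q [seq nat_of_ord (z j) | j <- enum 'I_d]) p i = slant (zvec R z) i (X p).
Proof.
move=> pl; rewrite /slt /slant coE //; congr (_ + _); rewrite rsum_ord /dotv; apply: eq_bigr => j _.
rewrite coE // mxE; congr (_ * _); rewrite /zvl -map_comp (nth_map j) ?size_enum_ord //= nth_ord_enum.
by rewrite !natRE add0r.
Qed.
Lemma plen_path q : all (fun i => i < size l)%N q -> q != [::] ->
  plen (dmat (size l) d cl) q = path_length [seq X i | i <- q].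
Proof.
case: q => // x q al _ /=; rewrite path_lengthE; move: al => /= /andP [xl al].
elim: q x xl al => //= y q IH x xl /andP [yl al]; rewrite dmatE // enorm_sub; congr (_ + _); exact: IH.
Qed.
End Coords.

Section Sound.
Variables (R : realType) (d : nat) (P : seq 'rV[R]_d) (s : 'rV[R]_d) (B : R) (u : nat).
Hypothesis d0 : (0 < d)%N.
Hypothesis uP : uniq P.
Hypothesis B0 : 0 < B.
Let n := size P.
Let l := s :: P.
Let cl := flatten [seq coords p | p <- l].
Let X i := nth 0 l i.
Let ds := dmat n.+1 d cl.
Let Rs := Rsf d u.
Let PB := PBf n d u.
Let l1p := (2 ^ l1f n d u)%N.
Let Nr := (48 * n * d * u)%N.
Let W := words (2 * Rs + PB).+1 (5 * Rs).
Let CS_ := cands n.+1 d (d * u).+1 Nr cl B l1p (d * muf n d u) Rs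
    (words (d * u).+1 d) (words n.+1 (u * 2 + 2))
    [seq words (u * 2 + 2 + PB) j | j <- iota 0 Rs.+1] W.

Lemma size_Uaf e0 z a : size (Uaf n.+1 d (d * u).+1 Nr cl l1p e0 z a) = n.+1.
Proof. by rewrite /Uaf size_map size_map size_iota. Qed.

Lemma tab_eq e0 z a : tabW ds (words n.+1 (u * 2 + 2)) [seq words (u * 2 + 2 + PB) j | j <- iota 0 Rs.+1] W
   (Uaf n.+1 d (d * u).+1 Nr cl l1p e0 z a) (d * muf n d u) Rs (Ff n.+1 d l1p Rs) (levf n.+1 d l1p) =
  tableL ds (u * 2 + 2) PB Rs (d * muf n d u) W (Uaf n.+1 d (d * u).+1 Nr cl l1p e0 z a) (levf n.+1 d l1p).
Proof.
rewrite -[in words n.+1](size_Uaf e0 z a); apply: tabWE; last by rewrite size_Uaf.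
by apply/allP => w; rewrite mem_words => /andP [/eqP -> _].
Qed.

(** Credited indices are distinct and positive, and the enumeration [P] is duplicate-free, so they
    stand for as many distinct points of [P] on the path. *)
Lemma cands_sound c : c \in (0%N, [:: 0%N]) :: CS_ ->
  [/\ c.2 != [::], head 0%N c.2 = 0%N, all (fun i => i < n.+1)%N c.2,
      plen ds c.2 <= B & (c.1 <= num_visited P [seq X i | i <- c.2])%N].
Proof.
rewrite inE => /orP [/eqP ->|]; first by split=> //=; exact: ltW.
move=> /flatten_mapP [e0 _ /flatten_mapP [z _ /flatten_mapP [a _ /mapP [it]]]].
rewrite mem_filter => /andP [/and3P [/eqP s1 /eqP h0 hB]]; rewrite tab_eq => iT ->.
have [t1 t2 t3 t4 [v [uv sv hv]]] := table_sound iT.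
case: (it.2.2) s1 h0 hB t3 t4 hv => [|q [|]] //= _ h0 hB t3 t4 hv.
rewrite cats0 in t4 hv.
have sz : size (lvl (levf n.+1 d l1p) (Uaf n.+1 d (d * u).+1 Nr cl l1p e0 z a)) = n.+1 by rewrite size_map size_Uaf.
have qn x : x \in q -> (x < n.+1)%N by move=> xq; have [h _] := t4 x xq; rewrite -sz; exact: h.
split=> //; [by apply: t3; rewrite mem_head|by apply/allP|].
rewrite -sv /num_visited -size_filter.
have inj : {in v &, injective X}.
  move=> x y /hv [x0 xq] /hv [y0 yq]; rewrite /X /l.
  case: x y x0 y0 xq yq => [//|x] [//|y] _ _ /qn xn /qn yn /= /eqP.
  by rewrite nth_uniq // => /eqP ->.
rewrite -(size_map X v); apply: uniq_leq_size; first by rewrite map_inj_in_uniq.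
move=> _ /mapP [x xv ->]; have [x0 xq] := hv x xv; rewrite mem_filter; apply/andP; split; first exact: map_f.
by rewrite /X /l; case: x x0 xq {xv} => // x _ /qn xn /=; exact: mem_nth.
Qed.

Lemma cands_complete e0 (z : {ffun 'I_d -> 'I_((d * u).+1)}) a it q : e0 \in gsl n.+1 d cl ->
  (a < 2 * l1p)%N ->
  it \in tableL ds (u * 2 + 2) PB Rs (d * muf n d u) W
    (Uaf n.+1 d (d * u).+1 Nr cl l1p e0 [seq nat_of_ord (z j) | j <- enum 'I_d] a) (levf n.+1 d l1p) ->
  it.2.2 = [:: q] -> head 0%N q = 0%N -> plen ds q <= B -> (it.2.1, q) \in CS_.
Proof.
move=> he ha iT iq h0 hB; apply/flatten_mapP; exists e0 => //.
apply/flatten_mapP; exists [seq nat_of_ord (z j) | j <- enum 'I_d].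
  rewrite mem_words size_map size_enum_ord eqxx; apply/allP => _ /mapP [j _ ->]; exact: ltn_ord.
apply/flatten_mapP; exists a; first by rewrite mem_iota0.
apply/mapP; exists it; last by rewrite iq.
by rewrite mem_filter tab_eq iT /okit iq /= h0 hB.
Qed.
End Sound.

(** * Cutting an optimal path and dropping the interior of one piece *)

Section Complete.
Variables (R : realType) (d : nat) (P : seq 'rV[R]_d) (s : 'rV[R]_d) (B : R) (u : nat).
Hypothesis d0 : (0 < d)%N.
Hypothesis uP : uniq P.
Hypothesis B0 : 0 < B.
Hypothesis u0 : (0 < u)%N.
Let n := size P.
Let l := s :: P.
Let cl := flatten [seq coords p | p <- l].
Let X i := nth 0 l i.
Variables (v : seq 'rV[R]_d).
Hypothesis uv : uniq v.
Hypothesis vP : {subset v <= P}.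
Hypothesis vB : plr s v <= B.
Let k := size v.
Hypothesis k0 : (0 < k)%N.
Let y t := nth 0 (s :: v) t.
(** The ceiling of [k / u]. The last pieces may be shorter or empty, which is why the starts [st]
    are capped at [k]. *)
Let c := ((k + u.-1) %/ u)%N.
Let st (j : nat) := minn (j * c) k.
Let wd (j : nat) := y (st j.+1) - y (st j).
Let stp t := y t.+1 - y t.
Let pc t := minn (t %/ c) u.-1.
Let e t := excs (stp t) (wd (pc t)).
Let E := \sum_(t < k) e t.
Let Ep j := \sum_(st j <= t < st j.+1) enorm (stp t) - enorm (wd j).

Lemma kn : (k <= n)%N. Proof. exact: uniq_leq_size. Qed.
Lemma c0 : (0 < c)%N. Proof. by rewrite /c divn_gt0 //; move: k0 u0; clear; lia. Qed.
Lemma kuc : (k <= u * c)%N.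
Proof.
have := divn_eq (k + u.-1) u; rewrite -/c; have := ltn_pmod (k + u.-1) u0.
by move: u0; clear; nia.
Qed.
(** A piece has at most [c.-1] interior points, so dropping them loses at most a [u]-th part. *)
Lemma cku : (c.-1 * u <= k)%N.
Proof.
have := leq_trunc_div (k + u.-1) u; rewrite -/c; have := c0; move: u0 k0; clear.
case: c => // c' ; nia.
Qed.
Lemma st_le j : (st j <= st j.+1)%N. Proof. by rewrite /st leq_min geq_minr andbT geq_min leq_mul2r leqnSn orbT. Qed.
Lemma st_k j : (st j <= k)%N. Proof. exact: geq_minr. Qed.
Lemma pc_st j t : (j < u)%N -> (st j <= t)%N -> (t < st j.+1)%N -> pc t = j.
Proof.
move=> ju; rewrite /st !(leq_min, geq_min, ltn_min) => h1 /andP [h2 h3].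
have h4 : (j * c <= t)%N by move: h1 h3; clear; case/orP => //; lia.
rewrite /pc; have -> : (t %/ c = j)%N.
  apply/eqP; rewrite eqn_leq leq_divRL ?c0 // h4 andbT -ltnS ltn_divLR ?c0 //.
by apply/minn_idPl; move: ju; clear; lia.
Qed.
Lemma sum_stp a b : (a <= b)%N -> \sum_(a <= t < b) stp t = y b - y a.
Proof. by move=> ab; rewrite telescope_sumr. Qed.
(** Inside a piece the components along the chord add up to the chord, so the excesses of its steps
    add up to its length minus its chord. *)
Lemma EpE j : (j < u)%N -> Ep j = \sum_(st j <= t < st j.+1) e t.
Proof.
move=> ju; have -> : \sum_(st j <= t < st j.+1) e t = \sum_(st j <= t < st j.+1) excs (stp t) (wd j).
  by apply: eq_big_nat => t /andP [h1 h2]; rewrite /e (@pc_st j).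
rewrite /Ep /excs big_split /= sumrN; congr (_ - _).
rewrite -mulr_suml.
have -> : \sum_(st j <= t < st j.+1) dotv (stp t) (wd j) = dotv (wd j) (wd j).
  rewrite {2}/wd -sum_stp ?st_le //; elim: (index_iota _ _) => [|t r IH].
    by rewrite !big_nil /dotv big1 // => i _; rewrite mxE mul0r.
  by rewrite big_cons IH -dotvDl; congr dotv; rewrite big_cons.
rewrite -enorm_sqr expr2; have [->|w0] := eqVneq (enorm (wd j)) 0; first by rewrite !mul0r.
by rewrite mulfK.
Qed.
Lemma e_ge0 t : 0 <= e t. Proof. exact: excs_ge0. Qed.
Lemma E_ge0 : 0 <= E. Proof. by apply: sumr_ge0 => t _; exact: e_ge0. Qed.
Lemma E_sum : E = \sum_(j < u) Ep j.
Proof.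
have h m : (m <= u)%N -> \sum_(j < m) Ep j = \sum_(0 <= t < st m) e t.
  elim: m => [|m IH] mu; first by rewrite big_ord0 /st mul0n min0n big_geq.
  by rewrite big_ord_recr /= IH ?(ltnW mu) // EpE // -big_cat_nat // st_le.
rewrite h // /E -(big_mkord xpredT e); congr (\sum_(0 <= t < _) _).
by rewrite /st; apply/esym/minn_idPr; exact: kuc.
Qed.
Lemma Ep_max : exists2 j, (j < u)%N & E <= u%:R * Ep j.
Proof.
have [j _ hj] := @arg_maxP _ _ _ (Ordinal u0) xpredT (fun j : 'I_u => Ep j) isT.
exists j => //; rewrite E_sum; apply: (@le_trans _ _ (\sum_(i < u) Ep j)); first by apply: ler_sum => i _; exact: hj.
by rewrite sumr_const card_ord mulr_natl.
Qed.

Let pi0 t := if t is t'.+1 then (if t' < k then (index (nth 0%R v t') P).+1 else 0)%N else 0%N.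
Lemma pi0_lt t : (pi0 t < n.+1)%N.
Proof.
case: t => //= t; case: ifP => // tk; rewrite ltnS index_mem; apply: vP; exact: mem_nth.
Qed.
Lemma X_pi0 t : (t <= k)%N -> X (pi0 t) = y t.
Proof.
case: t => //= t tk; rewrite tk /X /y /= nth_index //; apply: vP; exact: mem_nth.
Qed.
Lemma pi0_inj t t' : (t <= k)%N -> (t' <= k)%N -> pi0 t = pi0 t' -> t = t'.
Proof.
case: t t' => [|t] [|t'] //= tk tk'; rewrite ?tk ?tk' // => -[] h.
have e1 : nth 0 v t = nth 0 v t'.
  by rewrite -(nth_index 0 (vP (mem_nth 0 tk))) h nth_index //; apply: vP; exact: mem_nth.
by move/eqP: e1; rewrite nth_uniq // => /eqP ->.
Qed.

(** Some piece carries at least a [u]-th of the excess. Replacing it by its chord frees that much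
    length and does not increase the total excess, so the error [E / u] allowed by [core] fits into
    the budget. The first alternative, all points equal, is the case without a positive scale. *)
Theorem complete : (forall i j, (i < n.+1)%N -> (j < n.+1)%N -> X i = X j) \/
  (k <= (sel (cands n.+1 d (d * u).+1 (48 * n * d * u) cl B (2 ^ l1f n d u) (d * muf n d u) (Rsf d u)
    (words (d * u).+1 d) (words n.+1 (u * 2 + 2))
    [seq words (u * 2 + 2 + PBf n d u) j | j <- iota 0 (Rsf d u).+1] (words (2 * Rsf d u + PBf n d u).+1 (5 * Rsf d u)))).1 + c.-1)%N.
Proof.
have [j ju hj] := Ep_max.
have n0 : (0 < n)%N by apply: leq_trans k0 kn.
pose a := st j; pose b := st j.+1.
have ab : (a <= b)%N := st_le j.
have bk : (b <= k)%N := st_k _.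
pose m := (b - a).-1.
have mc : (m <= c.-1)%N.
  rewrite /m /a /b /st; have : (minn (j.+1 * c) k - minn (j * c) k <= c)%N by rewrite mulSn; move: (j * c)%N; clear; lia.
  by clear; lia.
(* Times after [a] are shifted by [m]: the interior points are skipped, and the chord of the piece
   becomes the single step at [a]. *)
pose sg t := (if t <= a then t else t + m)%N.
pose k2 := (k - m)%N.
have sgk t : (t <= k2)%N -> (sg t <= k)%N.
  by rewrite /sg /k2 /m; case: ifP => h1 h2; move: h1 h2 ab bk; clear; lia.
have sgm t t' : (t <= t')%N -> (sg t <= sg t')%N.
  by rewrite /sg => tt; case: ifP => h1; case: ifP => h2; move: tt h1 h2; clear; lia.
have sgi t t' : sg t = sg t' -> t = t'.
  by rewrite /sg; case: ifP => h1; case: ifP => h2; move: h1 h2; clear; lia.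
pose pi t := pi0 (sg t).
pose pj t := pc (sg t).
pose stp2 t := X (pi t.+1) - X (pi t).
have splitS (f2 f : nat -> R) : (forall t, (t < a)%N -> f2 t = f t) -> (forall t, (a < t)%N -> (t < k2)%N -> f2 t = f (t + m)%N) ->
   (a < b)%N -> \sum_(t < k2) f2 t = \sum_(t < k) f t - \sum_(a <= t < b) f t + f2 a.
  move=> h1 h2 lt; rewrite -(big_mkord xpredT f2) -(big_mkord xpredT f).
  have ak : (a < k2)%N by rewrite /k2 /m; move: lt bk; clear; lia.
  rewrite (@big_cat_nat _ _ _ a) //=; last exact: ltnW.
  rewrite (@big_cat_nat _ _ _ a 0%N k) //=; last by move: lt bk; clear; lia.
  rewrite (@big_cat_nat _ _ _ b a k) //=.
  rewrite (big_ltn ak) (_ : \sum_(a.+1 <= t < k2) f2 t = \sum_(b <= t < k) f t); last first.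
    have -> : b = (a.+1 + m)%N by rewrite /m; move: lt; clear; lia.
    have -> : k = (k2 + m)%N by rewrite /k2 /m; move: lt bk; clear; lia.
    rewrite big_addn addnK; apply: eq_big_nat => t /andP [t1 t2]; exact: h2.
  rewrite (@eq_big_nat _ _ _ 0%N a f2 f); last by move=> t /andP [_ h]; exact: h1.
  by ring.
have sg1 t : (t < a)%N -> sg t = t /\ sg t.+1 = t.+1 by move=> h; rewrite /sg (ltnW h) h.
have sg2 t : (a < t)%N -> sg t = (t + m)%N /\ sg t.+1 = (t + m).+1.
  by move=> h; rewrite /sg (leqNgt t) h (leqNgt t.+1) (ltn_trans h (ltnSn t)) /= addSn.
have st2 t : (t < k2)%N -> stp2 t = y (sg t.+1) - y (sg t).
  by move=> h; rewrite /stp2 /pi !X_pi0 // sgk // ltnW.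
have key : \sum_(t < k2) excs (stp2 t) (wd (pj t)) <= E /\
    \sum_(t < k2) enorm (stp2 t) + E / u%:R <= B.
  have vB' : \sum_(t < k) enorm (stp t) <= B by move: vB; rewrite plrE.
  have up : 0 < u%:R :> R by rewrite ltr0n.
  have Eu : E / u%:R <= Ep j by rewrite ler_pdivrMr // mulrC.
  (* The chosen piece may be empty; then [Ep j] vanishes, nothing is dropped and no allowance is
     used. *)
  have [ba|lt] := leqP b a.
    have m0 : m = 0%N by rewrite /m; move: ba; clear; lia.
    have sgid t : sg t = t by rewrite /sg m0 addn0; case: ifP.
    have e1 t : (t < k2)%N -> stp2 t = stp t by move=> h; rewrite st2 // !sgid.
    have kk : k2 = k by rewrite /k2 m0 subn0.
    have Ej : Ep j = 0.
      rewrite EpE // big_geq //.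
    split; last first.
      rewrite (eq_bigr (fun t : 'I_k2 => enorm (stp t))) => [|t _]; last by rewrite e1.
      by rewrite kk; move: Eu; rewrite Ej => Eu; apply: le_trans vB'; rewrite gerDl.
    rewrite (eq_bigr (fun t : 'I_k2 => e t)) => [|t _]; last by rewrite e1 // /pj sgid.
    by rewrite kk.
  have ak : (a < k2)%N by rewrite /k2 /m; move: lt bk; clear; lia.
  have sa : sg a = a /\ sg a.+1 = b by rewrite /sg leqnn ltnn /m; split=> //; move: lt; clear; lia.
  have sta : stp2 a = wd j by rewrite st2 //; case: sa => -> ->.
  have pja : pj a = j by rewrite /pj; case: sa => -> _; apply: pc_st.
  have q1 t : (t < a)%N -> stp2 t = stp t.
    by move=> h; rewrite st2; [case: (sg1 t h) => -> ->|exact: ltn_trans ak].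
  have q2 t : (a < t)%N -> (t < k2)%N -> stp2 t = stp (t + m).
    by move=> h h2; rewrite st2 //; case: (sg2 t h) => -> ->.
  split.
    rewrite (@splitS (fun t => excs (stp2 t) (wd (pj t))) e) //.
    (* A chord has no excess along itself. *)
    - rewrite sta pja -EpE // (_ : excs (wd j) (wd j) = 0) ?addr0.
        by rewrite gerBl EpE // sumr_ge0 // => t _; exact: e_ge0.
      rewrite /excs -enorm_sqr expr2; have [->|w0] := eqVneq (enorm (wd j)) 0; first by rewrite !mul0r subrr.
      by rewrite mulfK // subrr.
    - by move=> t h; rewrite q1 // /pj; case: (sg1 t h) => ->.
    - by move=> t h h2; rewrite q2 // /pj; case: (sg2 t h) => ->.
  rewrite (@splitS (fun t => enorm (stp2 t)) (fun t => enorm (stp t))) //.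
  - rewrite sta; apply: le_trans vB'; move: Eu; rewrite /Ep -/a -/b.
    by move: (\sum_(a <= t < b) _) (\sum_(t < k) _) (enorm _) (E / _) => A1 A2 A3 A4; lra.
  - by move=> t h; rewrite q1.
  - by move=> t h h2; rewrite q2.
case: key => key1 key2.
have [triv|nontriv] := pselect (forall i j, (i < n.+1)%N -> (j < n.+1)%N -> X i = X j); [by left|right].
(* The scale will be the largest excess of a single step, which is at least [E / k], or, without
   excess, the smallest positive distance between input points. *)
suff hE : exists e0, [/\ 0 < e0, E <= n%:R * e0, e0 \in gsl n.+1 d cl & e0 <= E \/
    (E = 0 /\ forall p q, (p < n.+1)%N -> (q < n.+1)%N -> enorm (X p - X q) < e0 -> enorm (X p - X q) = 0)].
  have [e0 [e1 e2 e3 e4]] := hE.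
  have [L1 L2 _] := lgpP (x1 n d u); have [M1 M2 _] := lgpP (xM d u); have [m1 m2 _] := lgpP (xm n d u).
  have d3 : (d ^ 3 = d * d * d)%N by rewrite !expnS expn0 muln1 mulnA.
  have d5 : (d ^ 5 = d * d * d * d * d)%N by rewrite !expnS expn0 muln1 !mulnA.
  have [z hz] := @core R d u n k2 (l1f n d u) (mMf d u) (muf n d u) d0 u0 n0
     (leq_trans (leq_subr _ _) kn) ltac:(by rewrite d3 -L1; exact: L2) ltac:(by rewrite d5 -M1; exact: M2)
     ltac:(by rewrite d5 -m1; exact: m2) X pi pj wd
     ltac:(by move=> t; rewrite /pj /pc; move: u0; clear; lia)
     ltac:(by move=> t t' /sgm h; rewrite /pj /pc leq_min geq_minr andbT geq_min leq_div2r)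
     ltac:(by move=> t; exact: pi0_lt) erefl
     ltac:(by move=> t t' h h' hh; apply: sgi; apply: (pi0_inj (sgk _ h) (sgk _ h') hh))
     (dmat n.+1 d cl) ltac:(exact: (dmat_ge0 l)) ltac:(by move=> i i' hi hi'; rewrite (dmatE (l := l)))
     E e0 key1 e1 e2 e4.
  pose zl := [seq nat_of_ord (z j) | j <- enum 'I_d].
  pose YT := Ytab n.+1 d cl (zvl R d (d * u).+1 zl) (e0 / natR R (48 * n * d * u)) (capf n.+1 (2 ^ l1f n d u))
     (e0 / natR R (48 * n * d * u) * natR R (4 * 2 ^ l1f n d u)).
  have p4 : (2 ^ (l1f n d u + 2) = 4 * 2 ^ l1f n d u)%N by rewrite expnD mulnC.
  have Yn p i : (p < n.+1)%N -> (i < d)%N -> nth 0%N (nth [::] YT p) i = fl (e0 / natR R (48 * n * d * u)) (capf n.+1 (2 ^ l1f n d u))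
     (compress (e0 / natR R (48 * n * d * u) * natR R (4 * 2 ^ l1f n d u)) [seq slt d cl (zvl R d (d * u).+1 zl) q i | q <- iota 0 n.+1]
        (slt d cl (zvl R d (d * u).+1 zl) p i)).
    move=> pn id; rewrite /YT /Ytab (nth_map 0%N) ?size_iota // nth_iota // add0n.
    by rewrite (nth_map 0%N) ?size_iota // nth_iota.
  have YS : Yspec n (l1f n d u) X e0 z (fun p i => nth 0%N (nth [::] YT p) i).
    split=> [p i|p i pn]; rewrite p4.
      have [pn|pn] := ltnP p n.+1; last by rewrite (nth_default [::]) ?nth_nil // size_map size_iota.
      have [id|id] := ltnP i d; first by rewrite Yn //; exact: fl_cap.
      by rewrite nth_default // /YT /Ytab (nth_map 0%N) ?size_iota // size_map size_iota.
    rewrite Yn // !natRE (sltE (l := l)) //; congr (fl _ _ (compress _ _ _)).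
    by apply/eq_in_map => q; rewrite mem_iota0 => qn; rewrite (sltE (l := l)).
  have [a' [it [q [h1 h2 h3 [h4 h4'] h5]]]] := hz _ YS.
  have UE : Ua d n.+1 (fun p i => nth 0%N (nth [::] YT p) i) a' =
     Uaf n.+1 d (d * u).+1 (48 * n * d * u) cl (2 ^ l1f n d u) e0 zl a'.
    rewrite /Ua /Uaf -/YT; apply: (@eq_from_nth _ [::]); first by rewrite !size_map.
    move=> p; rewrite size_map size_iota => pn; rewrite (nth_map 0%N) ?size_iota // nth_iota // add0n.
    rewrite (nth_map [::]) ?size_map ?size_iota //; apply: (@eq_from_nth _ 0%N).
      by rewrite !size_map size_iota /YT /Ytab (nth_map 0%N) ?size_iota // size_map size_iota.
    move=> i; rewrite size_map size_iota => id; rewrite (nth_map 0%N) ?size_iota // nth_iota // add0n.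
    by rewrite (nth_map 0%N) // /YT /Ytab (nth_map 0%N) ?size_iota // size_map size_iota.
  have mem : (it.2.1, q) \in cands n.+1 d (d * u).+1 (48 * n * d * u) cl B (2 ^ l1f n d u) (d * muf n d u) (Rsf d u)
    (words (d * u).+1 d) (words n.+1 (u * 2 + 2))
    [seq words (u * 2 + 2 + PBf n d u) j | j <- iota 0 (Rsf d u).+1] (words (2 * Rsf d u + PBf n d u).+1 (5 * Rsf d u)).
    apply: (@cands_complete R d P s B u e0 z a' it q e3) => //.
    - by move: h1; rewrite expnS.
    - by move: h2; rewrite UE p4 (expnS 2 (l1f n d u)); exact.
    - exact: le_trans h5 key2.
  have := sel_max mem; rewrite /= => h6.
  apply: (@leq_trans (k2 + m)); first by rewrite /k2; clear; lia.
  by apply: leq_add mc; apply: leq_trans h4' h6.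
have in_gsl p q v' w' : (p < n.+1)%N -> (q < n.+1)%N -> (v' < n.+1)%N -> (w' < n.+1)%N ->
   excs (X q - X p) (X w' - X v') \in gsl n.+1 d cl := @mem_gsl R d l p q v' w'.
have [E0|Epos] := eqVneq E 0; last first.
  have Ep0 : 0 < E by rewrite lt_neqAle eq_sym Epos E_ge0.
  have [t _ ht] := @arg_maxP _ _ _ (Ordinal k0) xpredT (fun t : 'I_k => e t) isT.
  have E1 : E <= k%:R * e t.
    rewrite /E; apply: (@le_trans _ _ (\sum_(i < k) e t)); first by apply: ler_sum => i _; exact: ht.
    by rewrite sumr_const card_ord mulr_natl.
  have et0 : 0 < e t.
    rewrite lt_neqAle e_ge0 andbT eq_sym; apply: contraTneq E1 => ->; by rewrite mulr0 -ltNge.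
  exists (e t); split=> //.
  - by apply: le_trans E1 _; rewrite ler_wpM2r ?(ltW et0) // ler_nat kn.
  - rewrite /e /stp /wd -(X_pi0 (t := t.+1)) // -(X_pi0 (t := t)) ?(ltnW (ltn_ord t)) //.
    by rewrite -!(X_pi0 (st_k _)); apply: in_gsl; exact: pi0_lt.
  - left; rewrite /E (bigD1 t) //= lerDl sumr_ge0 // => i _; exact: e_ge0.
have [i0 [j0 [hi hj0 hX]]] : exists i j, [/\ (i < n.+1)%N, (j < n.+1)%N & X i != X j].
  apply: contrapT => H; apply: nontriv => x x' hx hx'.
  by apply/eqP; apply/negP => /negP ne; apply: H; exists x, x'.
pose D (p : 'I_n.+1 * 'I_n.+1) := enorm (X p.1 - X p.2).
have D0 : 0 < D (Ordinal hi, Ordinal hj0).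
  rewrite lt_neqAle enorm_ge0 andbT eq_sym; apply: contraNneq hX => /enorm_eq0 /eqP; by rewrite subr_eq0.
have [p hp hmin] := @arg_minP _ _ _ (Ordinal hi, Ordinal hj0) (fun p => 0 < D p) D D0.
exists (D p); split=> //.
- by rewrite E0 mulr_ge0 // ltW.
(* A distance is an excess along a zero chord, hence an entry of [gsl]. *)
- have -> : D p = excs (X p.1 - X p.2) (X 0%N - X 0%N).
    by rewrite /D /excs subrr dotvC dotv_eq0 ?enorm0 // mul0r subr0.
  by apply: in_gsl; rewrite ?ltn_ord.
- right; split=> // x x' hx hx' lt; apply/eqP; apply: contraTT lt => ne; rewrite -leNgt.
  apply: (hmin (Ordinal hx, Ordinal hx')); by rewrite lt_neqAle enorm_ge0 andbT eq_sym.
Qed.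
End Complete.
End Glue.

From mathcomp Require Import all_classical all_reals all_analysis.

(** * The running time *)

Module Time.
Import Ram DP Fp2 Geo Walk Bridge Alg Alg2 Alg3.

Set Implicit Arguments.
Unset Strict Implicit.
Unset Printing Implicit Defensive.
Import Order.TTheory GRing.Theory Num.Theory.
Local Open Scope nat_scope.

Section NeedBound.
Variables (n d u : nat).
Hypothesis d0 : 0 < d.
Hypothesis u2 : 1 < u.
(** All bounds are expressed by [w] and [g = w * l]. Since [l] is logarithmic in [n] and [w], powers
    of [g] turn into powers of [ln n]. *)
Let w := d * u.
Let l := (l1f n d u).+2.
Let g := w * l.

Lemma w_ge2 : 2 <= w. Proof. by rewrite /w -(mul1n 2) leq_mul. Qed.
Lemma d_le : d <= w. Proof. by rewrite /w leq_pmulr // ltnW. Qed.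
Lemma u_le : u <= w. Proof. by rewrite /w leq_pmull. Qed.
Lemma w_le_g : w <= g. Proof. by rewrite /g leq_pmulr. Qed.
Lemma w2_le_g : 2 * w <= g. Proof. by rewrite /g mulnC leq_mul2l /l orbT. Qed.
Lemma g_ge4 : 4 <= g.
Proof. by have := w_ge2; have := w2_le_g; lia. Qed.
Lemma pow2_w k : 2 ^ k <= w ^ k. Proof. by case: k => // k; rewrite leq_exp2r // w_ge2. Qed.
Lemma wexp a b : a <= b -> w ^ a <= w ^ b.
Proof. by move=> h; rewrite leq_pexp2l // ltnW // w_ge2. Qed.
Lemma gexp a b : a <= b -> g ^ a <= g ^ b.
Proof. by move=> h; rewrite leq_pexp2l // (leq_trans _ g_ge4). Qed.
Lemma wg a : w ^ a <= g ^ a. Proof. by case: a => // a; rewrite leq_exp2r // w_le_g. Qed.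
Lemma w_gt0 a : 0 < w ^ a. Proof. by rewrite expn_gt0 (leq_trans _ w_ge2). Qed.
Lemma g_gt0 a : 0 < g ^ a. Proof. by rewrite expn_gt0 (leq_trans _ g_ge4). Qed.

(** The numerical constants are at most [2 ^ 7], and as [w >= 2] every power of two is absorbed by a
    power of [w]. *)
Lemma xb c1 c2 (x y : nat) : c1 <= 2 ^ 7 -> c2 <= 2 ^ 7 -> x <= y -> 0 < y ->
  2 * (c1 * c2 * (d * d * d * d * d) * (d * u).+1 * u * x) + 1 <= w ^ 24 * y.
Proof.
move=> h1 h2 xy y0.
have h : c1 * c2 * (d * d * d * d * d) * (d * u).+1 * u * x <= 2 ^ 7 * 2 ^ 7 * (w * w * w * w * w) * (2 * w) * w * y.
  have h3 : (d * u).+1 <= 2 * w by have := w_ge2; rewrite /w; lia.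
  by rewrite !leq_mul ?d_le ?u_le.
have e : 2 ^ 7 * 2 ^ 7 * (w * w * w * w * w) * (2 * w) * w * y = 2 ^ 15 * (w ^ 7 * y).
  have e15 : 2 ^ 15 = 2 ^ 7 * 2 ^ 7 * 2 by rewrite -expnD -expnSr.
  by rewrite e15 !(expnS w) expn0; move: (2 ^ 7) (w) => q w'; clear; first [ring|nia].
have p : 0 < w ^ 7 * y by rewrite muln_gt0 w_gt0.
have h4 : 2 ^ 17 * (w ^ 7 * y) <= w ^ 24 * y.
  have e24 : w ^ 24 = w ^ 17 * w ^ 7 by rewrite -expnD.
  by rewrite mulnA e24 leq_mul2r leq_mul2r pow2_w !orbT.
apply: leq_trans h4; rewrite (_ : 2 ^ 17 = 2 ^ 15 * 4); last by rewrite -(expnD 2 15 2).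
move: h; rewrite e; have : 0 < 2 ^ 15 by rewrite expn_gt0.
by move: p; move: (2 ^ 15) (w ^ 7 * y) (c1 * _ * _ * _ * _ * _) => a b c; clear; nia.
Qed.

Lemma mM_bound : 2 ^ mMf d u <= w ^ 24.
Proof.
rewrite /mMf; have [<- _ h] := lgpP (xM d u); apply: leq_trans h _.
have := @xb 96 108 1 1 isT isT isT isT; rewrite !muln1; exact.
Qed.
Lemma mu_bound : 2 ^ muf n d u <= g ^ 24.
Proof.
rewrite /muf; have [<- _ h] := lgpP (xm n d u); apply: leq_trans h _.
apply: leq_trans (@xb 96 96 l l isT isT (leqnn _) isT) _.
by rewrite /g expnMn leq_mul2l -{1}(expn1 l) leq_pexp2l // orbT.
Qed.
Lemma PB_bound : PBf n d u <= g ^ (24 * d).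
Proof. by rewrite /PBf mulnC expnM [24 * d]mulnC [d * 24]mulnC expnM; rewrite leq_exp2r //; exact: mu_bound. Qed.
Lemma MMd_bound : (2 ^ mMf d u) ^ d <= w ^ (24 * d).
Proof. by rewrite expnM; case: (d) d0 mM_bound => // d' _ h; rewrite leq_exp2r. Qed.

Lemma Rs_bound : Rsf d u <= w ^ (31 * d).
Proof.
rewrite /Rsf /RsB /r2.
have h1 := pow2_w d; have h2 := MMd_bound; have w2 := w_ge2; have du := d_le; have uu := u_le.
have e1 : (d * 2).+1 <= w ^ 3 by rewrite !expnS expn0; move: du w2; clear; nia.
have e2 : u * 2 <= w ^ 2 by rewrite !expnS expn0; move: uu w2; clear; nia.
have p24 := w_gt0 (24 * d).
have h3 : 2 * ((2 ^ mMf d u) ^ d * (d * 2).+1) + u * 2 <= w ^ (24 * d + 5).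
  rewrite (_ : 24 * d + 5 = 24 * d + 3 + 1 + 1); last by rewrite -!addnA.
  apply: (@leq_trans (2 * (w ^ (24 * d + 3)) + w ^ 2)).
    by apply: leq_add => //; rewrite leq_mul2l /= expnD leq_mul.
  apply: (@leq_trans (w ^ (24 * d + 3 + 1) + w ^ (24 * d + 3 + 1))).
    by apply: leq_add; [rewrite addn1 expnS leq_mul2r w2 orbT|apply: wexp; lia].
  by rewrite addnn -mul2n [24 * d + 3 + 1 + 1]addn1 expnS leq_mul2r w2 orbT.
apply: (@leq_trans (w ^ (25 * d + 6))); last by apply: wexp; move: d0; clear; lia.
apply: (@leq_trans (w ^ d * w ^ (24 * d + 5) + w ^ 3)).
  rewrite -addnS; apply: leq_add; first exact: leq_mul.
  by rewrite expnS; move: e2 w2; have := w_gt0 2; clear; nia.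
rewrite -expnD (_ : d + (24 * d + 5) = 25 * d + 5); last by clear; lia.
apply: (@leq_trans (w ^ (25 * d + 5) + w ^ (25 * d + 5))); first by rewrite leq_add2l; apply: wexp; lia.
by rewrite addnn -mul2n (_ : 25 * d + 6 = (25 * d + 5).+1) ?addnS // expnS leq_mul2r w2 orbT.
Qed.

(** The base [n.+1] comes from guessing the extra endpoints, with one more factor for the size of
    the input. The remaining powers have base at most a power of [g] and exponent of order [d * Rs],
    which is a power of [w] of degree O(d). *)
Lemma need_bound : need n d u + (n.+1 * d + d + u + n + 10) <= n.+1 ^ (2 * u + 3) * g ^ (w ^ (40 * d)).
Proof.
have g4 := g_ge4; have RB := Rs_bound; have PB := PB_bound.
have R1 : 0 < Rsf d u by [].
have G1 := g_gt0 (31 * d).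
have RG : Rsf d u <= g ^ (31 * d) by apply: leq_trans RB (wg _).
have PG : PBf n d u <= g ^ (31 * d) by apply: leq_trans PB _; apply: gexp; rewrite leq_mul2r orbT.
have gS : 4 * g ^ (31 * d) <= g ^ (32 * d).
  apply: (@leq_trans (g ^ (31 * d).+1)); first by rewrite expnS leq_mul2r g4 orbT.
  by apply: gexp; move: d0; clear; lia.
have b1 : (2 * Rsf d u + PBf n d u).+1 <= g ^ (32 * d).
  by apply: leq_trans gS; move: RG PG G1; clear; lia.
have b2 : u * 2 + 2 + PBf n d u <= g ^ (32 * d).
  apply: leq_trans gS; have : u * 2 + 2 <= 2 * g by have := u_le; have := w2_le_g; have := w_ge2; clear; lia.
  have : g <= g ^ (31 * d) by rewrite -{1}(expn1 g); apply: gexp; move: d0; clear; lia.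
  by move: PG; clear; lia.
set X := g ^ (32 * d * (5 * Rsf d u)).
have toX a : a <= 32 * d -> g ^ a <= X.
  by move=> h; apply: gexp; apply: leq_trans h _; rewrite leq_pmulr // muln_gt0.
have X1 : 2 ^ d <= X.
  apply: leq_trans (pow2_w d) _; apply: leq_trans (wg d) _; apply: toX; rewrite leq_pmull //.
have X2 : (2 ^ mMf d u) ^ d <= X.
  apply: leq_trans MMd_bound _; apply: leq_trans (wg _) _; apply: toX; by rewrite leq_mul2r orbT.
have X3 : PBf n d u <= X by apply: leq_trans PB _; apply: toX; rewrite leq_mul2r orbT.
have X4 : (d * u).+1 ^ d <= X.
  apply: (@leq_trans (g ^ d)); last by apply: toX; rewrite leq_pmull.
  by rewrite leq_exp2r //; apply: leq_trans w2_le_g; have := w_ge2; rewrite -/w; move: (w) => w'; clear; lia.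
have X5 : (u * 2 + 2 + PBf n d u) ^ Rsf d u <= X.
  apply: (@leq_trans ((g ^ (32 * d)) ^ Rsf d u)); first by rewrite leq_exp2r.
  by rewrite -expnM; apply: gexp; rewrite leq_mul2l leq_pmull ?orbT.
have X6 : (2 * Rsf d u + PBf n d u).+1 ^ (5 * Rsf d u) <= X.
  apply: (@leq_trans ((g ^ (32 * d)) ^ (5 * Rsf d u))); first by rewrite leq_exp2r ?muln_gt0.
  by rewrite -expnM.
set A := n.+1 ^ (u * 2 + 2).
have A1 : 0 < A by rewrite expn_gt0.
have Xp : 0 < X by exact: g_gt0.
have h1 : need n d u <= 7 * (A * X).
  have AX : A <= A * X by rewrite leq_pmulr.
  have XA : X <= A * X by rewrite leq_pmull.
  have sum7 q1 q2 q3 q4 q5 q6 q7 x y : q1 <= x -> q2 <= x -> q3 <= x -> q4 <= x -> q6 <= x -> q7 <= x ->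
    q5 <= y -> x <= y -> q1 + q2 + q3 + q4 + q5 + q6 + q7 <= 7 * y by clear; lia.
  exact: sum7 X1 X2 X3 X4 X5 X6 AX XA.
have h2 : n.+1 * d + d + u + n + 10 <= n.+1 * g ^ 3.
  have e : d + d + u + 11 <= g ^ 3.
    have := d_le; have := u_le; have := w_le_g; move: g4; rewrite !expnS expn0; move: (g) => G; clear; nia.
  apply: (@leq_trans (n.+1 * (d + d + u + 11))); last by rewrite leq_mul2l e orbT.
  by move: d0 u2; clear; nia.
apply: (@leq_trans (n.+1 * A * (X * g ^ 4))).
  have g3 : 64 <= g ^ 3 by rewrite (_ : 64 = 4 ^ 3) // leq_exp2r.
  apply: (@leq_trans (7 * (A * X) + n.+1 * g ^ 3)); first exact: leq_add.
  apply: (@leq_trans (n.+1 * A * (X * (7 + g ^ 3)))).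
    rewrite mulnDr mulnDr; apply: leq_add.
      have -> : n.+1 * A * (X * 7) = n.+1 * (7 * (A * X)) by move: (A) (X) (n.+1) => q1 q2 q3; clear; ring.
      by rewrite leq_pmull.
    by rewrite -mulnA leq_mul2l mulnA leq_pmull ?orbT // muln_gt0 A1.
  rewrite !leq_mul2l; apply/orP; right; apply/orP; right.
  by rewrite (expnS g 3); move: g3 g4; clear; nia.
rewrite (_ : n.+1 * A = n.+1 ^ (2 * u + 3)); last by rewrite /A -expnS; congr (_ ^ _); clear; lia.
rewrite leq_mul2l; apply/orP; right; rewrite -expnD; apply: gexp.
apply: (@leq_trans (2 ^ 8 * (w * w ^ (31 * d)))).
  have : d * Rsf d u <= w * w ^ (31 * d) by rewrite leq_mul // d_le.
  have : 0 < d * Rsf d u by rewrite muln_gt0 d0.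
  rewrite (_ : 32 * d * (5 * Rsf d u) = 160 * (d * Rsf d u)); last by clear; nia.
  rewrite (_ : 2 ^ 8 = 160 + 96) //.
  by move: (d * _) (w * _) => a b; clear; lia.
apply: (@leq_trans (w ^ 8 * (w * w ^ (31 * d)))); first by rewrite leq_mul2r pow2_w orbT.
by rewrite -expnS -expnD; apply: wexp; move: d0; clear; lia.
Qed.

Lemma l_bound N : 0 < N -> n <= N -> 2 ^ l <= w ^ 22 * (N * N).
Proof.
move=> N0 nN; have [e _ h] := lgpP (x1 n d u).
have -> : 2 ^ l = 4 * (lgp (x1 n d u)).2 by rewrite e /l /l1f !expnS mulnA.
have hx : x1 n d u <= 2 ^ 13 * (w ^ 5 * (N * N)).
  have h3 : (d * u).+1 <= 2 * w by have := w_ge2; rewrite /w; lia.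
  apply: (@leq_trans (2 ^ 6 * (w * w * w) * (2 * w) * N * (2 ^ 6 * N * w))).
    rewrite /x1 -(mulnA (48 * n)) -/w !leq_mul ?d_le //.
  rewrite (_ : 2 ^ 13 = 2 ^ 6 * 2 ^ 6 * 2); last by rewrite -expnD -expnSr.
  by rewrite !(expnS w) expn0; move: (2 ^ 6); clear; nia.
have p : 0 < w ^ 5 * (N * N) by rewrite muln_gt0 w_gt0 muln_gt0 N0.
apply: (@leq_trans (2 ^ 17 * (w ^ 5 * (N * N)))).
  rewrite (_ : 2 ^ 17 = 2 ^ 13 * 16); last by rewrite -(expnD 2 13 4).
  have : 0 < 2 ^ 13 by rewrite expn_gt0.
  by move: hx h p; move: (2 ^ 13) (w ^ 5 * _) (x1 _ _ _) => a b c; clear; nia.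
have e22 : w ^ 22 = w ^ 17 * w ^ 5 by rewrite -expnD.
by rewrite mulnA leq_mul2r e22 leq_mul2r pow2_w !orbT.
Qed.
End NeedBound.

Section RealTime.
Variable R : realType.
Local Open Scope ring_scope.

(** The inverse of the inequality [1 + y <= expR y] at [y = - x]. *)
Lemma expR_upper (x : R) : 0 <= x < 1 -> expR x <= (1 - x)^-1.
Proof.
move=> /andP [x0 x1]; have p : 0 < 1 - x by lra.
rewrite -[expR x]invrK -expRN lef_pV2 ?posrE ?expR_gt0 //.
by have := expR_ge1Dx (- x).
Qed.
(** Bounding the sixth root of e by 6/5 gives e at most 2.985984, just below 3; a coarser root would
    not suffice with this estimate. *)
Lemma ln3_gt1 : 1 < ln (3 : R).
Proof.
rewrite -ltr_expR lnK ?posrE //.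
have h : expR (6^-1 : R) <= 6 / 5.
  apply: le_trans (expR_upper _) _; first by apply/andP; split; lra.
  by rewrite (_ : (1 - 6^-1)^-1 = 6 / 5 :> R) //; field.
have -> : expR (1 : R) = expR (6^-1 : R) ^+ 6.
  by rewrite -expRM_natl; congr expR; field.
apply: (@le_lt_trans _ _ ((6 / 5) ^+ 6)); last by rewrite !exprS expr0; lra.
by rewrite lerXn2r ?nnegrE ?expR_ge0 //; lra.
Qed.
Lemma ln2_ge : 2^-1 <= ln (2 : R).
Proof.
rewrite -ler_expR lnK ?posrE //.
apply: le_trans (expR_upper _) _; first by apply/andP; split; lra.
by rewrite (_ : (1 - 2^-1)^-1 = 2 :> R) //; field.
Qed.

(** Bernoulli's inequality. Applied to [ln 3] it gives an exponent [K] by which constants become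
    powers of [ln N]. *)
Lemma pow_ge2 (x : R) : 1 < x -> exists K : nat, 2 <= x ^+ K.
Proof.
move=> x1; have y0 : 0 < x - 1 by lra.
pose K := (Num.truncn (x - 1)^-1).+1; exists K.
have i0 : 0 <= (x - 1)^-1 by rewrite invr_ge0 ltW.
have /andP [_ hK] := truncn_itv i0; rewrite -/K in hK.
have b m : 1 + m%:R * (x - 1) <= x ^+ m.
  elim: m => [|m IH]; first by rewrite mul0r addr0 expr0.
  rewrite exprS -natr1; apply: (@le_trans _ _ (x * (1 + m%:R * (x - 1)))); last by rewrite ler_wpM2l //; lra.
  have : 0 <= m%:R * (x - 1) * (x - 1) by rewrite !mulr_ge0 // ltW.
  by lra.
apply: le_trans (b K); suff : 1 <= K%:R * (x - 1) by lra.
by rewrite -ler_pdivrMr // mul1r ltW.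
Qed.

(** If [w > 2] then [d / delta >= 2] and [w <= (d / delta) ^ 2], so powers of [w] become powers of
    [d / delta] with doubled exponent. For [d = 1] and [u = 2] the quotient may be close to 1, but
    then the exponent of the logarithm is the constant [2 ^ c] and is absorbed by the power of [N],
    hence the second summand of the first constant. *)
Lemma time_main (kp : nat) : exists c1 c2 : nat, forall (n d u : nat) (delta : R),
  (0 < d)%N -> 0 < delta < 1 -> u.-1%:R * delta < 1 -> 1 <= u%:R * delta ->
  (((need n d u + (n.+1 * d + d + u + n + 10)) ^ kp)%N)%:R <= time_bound c1 c2 n d delta.
Proof.
have [K hK] := pow_ge2 ln3_gt1.
have [c cE] : exists c, c = (46 + K + kp)%N by exists (46 + K + kp)%N.
exists (16 * kp + 2 ^ c)%N, (2 * c)%N.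
move=> n d u delta d0 /andP [dl0 dl1] hu1 hu2.
have u2 : (1 < u)%N.
  case: u hu2 {hu1} => [|[|//]]; first by rewrite mul0r; lra.
  by rewrite mul1r; lra.
rewrite /time_bound; set N := maxn n 3; set NR : R := N%:R; set L := ln NR.
set w := (d * u)%N.
have N3 : 3 <= NR by rewrite ler_nat leq_maxr.
have N1 : 1 <= NR by lra.
have L3 : ln 3 <= L by rewrite ler_ln ?posrE //; lra.
have L1 : 1 <= L by have := ln3_gt1; lra.
have w2 : (2 <= w)%N by exact: w_ge2.
have w2R : 2 <= w%:R :> R by rewrite ler_nat.
have wpos : 0 < w%:R :> R by lra.
have LK m : 2 ^+ m <= L ^+ (K * m).
  rewrite exprM lerXn2r ?nnegrE //; first by rewrite exprn_ge0 //; lra.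
  by apply: le_trans hK _; rewrite lerXn2r ?nnegrE //; have := ln3_gt1; lra.
set l := (l1f n d u).+2; set g := (w * l)%N.
have lb : l%:R <= 48 * w%:R * L :> R.
  have h : (2 ^ l)%:R <= (w ^ 22 * (N * N))%:R :> R.
    by rewrite ler_nat; apply: l_bound => //; rewrite /N leq_max ?leqnn ?orbT.
  move: h; rewrite natrM !natrX natrM -/NR.
  have a1 : 0 < 2 ^+ l :> R by rewrite exprn_gt0.
  have a2 : 0 < w%:R ^+ 22 :> R by rewrite exprn_gt0.
  have a3 : 0 < NR by lra.
  have a4 : 0 < NR * NR by rewrite mulr_gt0.
  have a5 : 0 < w%:R ^+ 22 * (NR * NR) by rewrite mulr_gt0.
  have a6 : 0 < 2 :> R by [].
  rewrite -ler_ln ?posrE // lnM ?posrE // lnM ?posrE // (lnXn _ a6) (lnXn _ wpos).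
  rewrite -/L -[ln 2 *+ l]mulr_natl -[_ *+ 22]mulr_natl => h.
  have lw : ln w%:R <= w%:R :> R by apply: ltW; exact: ln_sublinear.
  have l0 : 0 <= l%:R :> R by [].
  have p1 : l%:R * 2^-1 <= l%:R * ln 2 :> R by rewrite ler_wpM2l // ln2_ge.
  have p2 : w%:R <= w%:R * L by rewrite ler_peMr // ltW.
  have p3 : L <= w%:R * L by rewrite ler_peMl //; lra.
  by rewrite -mulrA; move: h p1 p2 p3 lw; lra.
(* [48 * w ^ 2] is at most [w ^ 8], and [w] itself is at most [L ^ (K * w)], so [g] becomes a power
   of [L] whose exponent is a power of [w]. *)
have gb : g%:R <= L ^+ (w ^ (5 + K)) :> R.
  have e1 : g%:R <= w%:R ^+ 8 * L :> R.
    rewrite /g natrM; apply: (@le_trans _ _ (w%:R * (48 * w%:R * L))); first by apply: ler_wpM2l; [exact: ltW|exact: lb].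
    have : 2 ^+ 6 <= w%:R ^+ 6 :> R by rewrite lerXn2r ?nnegrE //; lra.
    rewrite (_ : w%:R ^+ 8 = w%:R ^+ 6 * (w%:R * w%:R)); last by ring.
    rewrite (_ : 2 ^+ 6 = 64 :> R); last by ring.
    move=> w6; rewrite (_ : w%:R * (48 * w%:R * L) = 48 * (w%:R * w%:R * L)); last by ring.
    rewrite -[X in _ <= X]mulrA; apply: ler_wpM2r; first by rewrite !mulr_ge0 //; lra.
    by move: w6; lra.
  have e2 : w%:R <= L ^+ (K * w).
    apply: le_trans (LK w); rewrite -natrX ler_nat; exact: ltnW (ltn_expl _ _).
  apply: le_trans e1 _; apply: (@le_trans _ _ (L ^+ (K * w * 8).+1)).
    rewrite [X in _ <= X]exprSr; apply: ler_wpM2r; first by lra.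
    by rewrite exprM lerXn2r ?nnegrE ?(ltW wpos) // exprn_ge0 //; lra.
  rewrite ler_weXn2l //; apply: (@leq_trans (16 * (2 ^ K * w))%N).
    have kk : (K < 2 ^ K)%N by exact: ltn_expl.
    have k2 : (K * w <= 2 ^ K * w)%N by rewrite leq_mul2r ltnW ?orbT.
    have k3 : (0 < 2 ^ K * w)%N by rewrite muln_gt0 expn_gt0 /= ltnW.
    by rewrite mulnC; move: k2 k3; move: (K * w)%N (2 ^ K * w)%N => x y; clear; lia.
  rewrite expnD (expnS w 4) (_ : 16 = 2 ^ 4)%N //.
  have a1 := @pow2_w d u d0 u2 4; have a2 := @pow2_w d u d0 u2 K.
  by rewrite mulnCA [(2 ^ 4 * w)%N]mulnC [(w * w ^ 4 * _)%N]mulnC leq_mul // leq_mul.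
have step1 : (((need n d u + (n.+1 * d + d + u + n + 10)) ^ kp)%N)%:R <=
   NR ^+ (8 * u * kp) * L ^+ (w ^ (c * d)).
  apply: (@le_trans _ _ (((n.+1 ^ (2 * u + 3) * g ^ (w ^ (40 * d))) ^ kp)%N)%:R).
    rewrite ler_nat; case: (kp) => // k'; rewrite leq_exp2r //; exact: need_bound.
  rewrite expnMn natrM; apply: ler_pM => //.
    rewrite -expnM natrX; apply: (@le_trans _ _ ((NR ^+ 2) ^+ ((2 * u + 3) * kp))).
      rewrite lerXn2r ?nnegrE //; first by rewrite exprn_ge0 //; lra.
      apply: (@le_trans _ _ (NR + 1)); last by rewrite expr2; apply: (@le_trans _ _ (3 * NR)); [lra|rewrite ler_wpM2r //; lra].
      by rewrite -natr1 lerD2r ler_nat leq_maxl.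
    rewrite -exprM ler_weXn2l // mulnA leq_mul2r; apply/orP; right; move: u2; clear; lia.
  rewrite -expnM natrX; apply: (@le_trans _ _ ((L ^+ (w ^ (5 + K))) ^+ (w ^ (40 * d) * kp))).
    by rewrite lerXn2r ?nnegrE // exprn_ge0 //; lra.
  rewrite -exprM ler_weXn2l //.
  apply: (@leq_trans (w ^ (5 + K) * (w ^ (40 * d) * w ^ kp))%N).
    rewrite leq_mul2l leq_mul2l; apply/orP; right; apply/orP; right.
    by apply: leq_trans (@pow2_w d u d0 u2 kp); exact: ltnW (ltn_expl _ _).
  by rewrite -!expnD; apply: (@wexp d u d0 u2); rewrite cE !mulnDl; have := leq_pmulr K d0; have := leq_pmulr kp d0; move: d0; move: (K * d)%N (kp * d)%N; clear; lia.
apply: le_trans step1 _.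
have ud : u%:R <= 2 / delta.
  rewrite ler_pdivlMr //; have : u%:R = u.-1%:R + 1 :> R by rewrite natr1 prednK // ltnW.
  by move=> e; rewrite e mulrDl mul1r; move: hu1 dl1; lra.
have NP x y : x <= y -> NR `^ x <= NR `^ y by move=> h; exact: ler_powR.
have N0 : 0 <= NR by lra.
have L0 : 0 <= L by lra.
have [w2e|w3] := eqVneq w 2%N.
  have d1 : d = 1%N.
    case: (ltnP 1 d) => [d2|]; last by move: d0; clear; lia.
    by have := leq_mul d2 u2; rewrite -/w w2e.
  have ue : u = 2%N by move: w2e; rewrite /w d1 mul1n.
  rewrite w2e d1 ue muln1.
  apply: (@le_trans _ _ (NR `^ ((16 * kp + 2 ^ c)%N%:R / delta) * 1)).
    rewrite mulr1; apply: (@le_trans _ _ (NR ^+ (16 * kp + 2 ^ c))).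
      rewrite exprD (_ : (8 * 2 * kp = 16 * kp)%N) //; apply: ler_wpM2l; first exact: exprn_ge0.
      by rewrite lerXn2r ?nnegrE //; apply: ltW; apply: ln_sublinear; lra.
    rewrite -powR_mulrn //; apply: NP; rewrite ler_pdivlMr //.
    by rewrite ler_piMr // ltW.
  by apply: ler_wpM2l; [exact: powR_ge0|rewrite -[leLHS](powRr0 L) ler_powR // powR_ge0].
(* In dimension one, [u = 2] being excluded, [u.-1 >= 2] and therefore [2 * delta < 1]. *)
have D2 : 2 <= d%:R / delta.
  rewrite ler_pdivlMr //; have [d2|d2] := leqP 2 d.
    have : 2 <= d%:R :> R by rewrite ler_nat. 
    by move: dl1; lra.
  have d1 : d = 1%N by move: d0 d2; clear; lia.
  have u3 : (2 <= u.-1)%N by move: w3 u2; rewrite /w d1 mul1n; clear; move=> /eqP; lia.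
  have : 2 <= u.-1%:R :> R by rewrite ler_nat.
  by move=> x2; rewrite d1; apply: ltW; apply: le_lt_trans hu1; rewrite ler_pM2r.
apply: ler_pM; rewrite ?exprn_ge0 //.
  rewrite -powR_mulrn //; apply: NP.
  rewrite !natrM natrD natrM; apply: (@le_trans _ _ (16 * kp%:R / delta)).
    rewrite (_ : 16 * kp%:R / delta = 8 * kp%:R * (2 / delta)); last by field; rewrite lt0r_neq0.
    by rewrite mulrAC; apply: ler_wpM2l => //; rewrite mulr_ge0.
  by rewrite ler_pM2r ?invr_gt0 // lerDl.
rewrite -powR_mulrn //; apply: ler_powR => //.
rewrite -natrM powR_mulrn; last by lra.
rewrite natrX -mulnA [X in _ <= X]exprM lerXn2r ?nnegrE //.
  by rewrite exprn_ge0 //; lra.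
apply: (@le_trans _ _ (d%:R * (2 / delta))); first by rewrite /w natrM ler_wpM2l.
rewrite (_ : d%:R * (2 / delta) = 2 * (d%:R / delta)); last by ring.
by rewrite expr2 ler_wpM2r //; lra.
Qed.
End RealTime.
End Time.

(** * Joining program, correctness and running time *)

Import Ram DP Fp2 Geo Walk Bridge Main Alg Alg2 Alg3 Wrap Glue Time.

Set Implicit Arguments.
Unset Strict Implicit.
Unset Printing Implicit Defensive.
Import Order.TTheory GRing.Theory Num.Theory.
Local Open Scope ring_scope.

Lemma nth_flatten_uniform (T S : Type) (x0 : T) (y0 : S) (f : S -> seq T) d (q : seq S) i j :
  (forall y, size (f y) = d) -> (i < size q)%N -> (j < d)%N ->
  nth x0 (flatten [seq f y | y <- q]) (i * d + j) = nth x0 (f (nth y0 q i)) j.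
Proof.
move=> sf; elim: q i => // y q IH [|i] /= il jd; first by rewrite mul0n add0n nth_cat sf jd.
by rewrite mulSn -addnA nth_cat sf ltnNge leq_addr /= addKn IH.
Qed.

Lemma ceil_inv (R : realType) (delta : R) : 0 < delta -> exists u : nat,
  [/\ (0 < u)%N, u.-1%:R * delta < 1 & 1 <= u%:R * delta].
Proof.
move=> d0; have ex : exists m : nat, 1 <= m%:R * delta.
  have i0 : 0 <= delta^-1 by rewrite invr_ge0 ltW.
  have /andP [_ h] := truncn_itv i0; exists (Num.truncn delta^-1).+1.
  by rewrite -ler_pdivrMr // mul1r ltW.
case: (ex_minnP ex) => u hu umin; exists u.
have u0 : (0 < u)%N by case: u hu {umin} => //; rewrite mul0r; lra.
split=> //; rewrite ltNge; apply/negP => /umin; rewrite leqNgt ltn_predL u0; exact: notF.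
Qed.

Theorem theorem1 (R : realType) :
  exists (A : program) (c1 c2 : nat),
    forall (d : nat) (P : seq 'rV[R]_d) (s : 'rV[R]_d) (B delta : R),
      (0 < d)%N -> uniq P -> 0 < B -> 0 < delta < 1 ->
      exists (t : nat) (m : memory R),
        [/\ exec A (input_memory P s B delta) t m,
            t%:R <= time_bound c1 c2 (size P) d delta,
            starts_at s (output_path d m),
            path_length (output_path d m) <= B
          & (1 - delta) * (k_opt P s B)%:R
              <= (num_visited P (output_path d m))%:R].
Proof.
have [A [kp hA]] := wrapper R; have [c1 [c2 hT]] := time_main R kp.
exists A, c1, c2 => d P s B delta d0 uP B0 /andP [dl0 dl1].
have [u [u0 u1 u2]] := ceil_inv dl0.
set n := size P; pose cl := flatten [seq coords p | p <- s :: P].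
pose q := algq (n, (d, (u, (B, cl)))).
pose CS := cands n.+1 d (d * u).+1 (48 * n * d * u) cl B (2 ^ l1f n d u) (d * muf n d u) (Rsf d u)
    (words (d * u).+1 d) (words n.+1 (u * 2 + 2))
    [seq words (u * 2 + 2 + PBf n d u) j | j <- iota 0 (Rsf d u).+1] (words (2 * Rsf d u + PBf n d u).+1 (5 * Rsf d u)).
have [q1 q2 q3 q4 q5] : [/\ q != [::], head 0%N q = 0%N, all (fun i => i < n.+1)%N q,
    plen (dmat n.+1 d cl) q <= B & ((sel CS).1 <= num_visited P [seq nth 0%R (s :: P) i | i <- q])%N]
  := cands_sound uP B0 (sel_in CS).
have aE : alg (n, (d, (u, (B, cl)))) = outf d cl q by [].
clearbody q.
have scl : size cl = (n.+1 * d)%N by rewrite /cl size_cl.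
have sq : (0 < size q)%N by rewrite lt0n size_eq0.
have so : size (outf d cl q).2 = (size q * d)%N.
  rewrite /outf /= size_flatten /shape -map_comp (@eq_map _ _ _ (fun=> d)); last first.
    by move=> i /=; rewrite size_map size_iota.
  by elim: (q) => //= x q' ->; rewrite mulSn.
have s0 : (0 < size (alg (n, (d, (u, (B, cl))))).2)%N by rewrite aE so muln_gt0 sq d0.
have [t [m [h1 h2 h3 h4]]] := hA d n u B delta cl d0 dl0 u1 u2 scl s0.
rewrite aE in h3 h4; have {}h3 : nmem m 0 = size q := h3.
exists t, m.
have oE : output_path d m = [seq nth 0 (s :: P) i | i <- q].
  apply: (@eq_from_nth _ 0); first by rewrite size_mkseq size_map h3.
  rewrite size_mkseq h3 => i iq; rewrite nth_mkseq ?h3 // (nth_map 0%N) //.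
  apply/rowP => j; rewrite mxE h4; last first.
    rewrite so; apply: (@leq_trans (i * d + d)); first by rewrite ltn_add2l.
    by rewrite addnC -mulSn leq_mul2r iq orbT.
  rewrite [(outf _ _ _).2]/= (nth_flatten_uniform 0 0%N) //; last by move=> y; rewrite size_map size_iota.
  rewrite (nth_map 0%N) ?size_iota // nth_iota // add0n (@coE R d (s :: P)) //.
  by apply: (allP q3); exact: mem_nth.
rewrite oE; split.
- exact: h1.
- by apply: le_trans (hT n d u delta d0 _ u1 u2); rewrite ?ler_nat // dl0 dl1.
- by rewrite /starts_at; case: (q) q1 q2 => //= x q' _ ->.
- by rewrite -(@plen_path R d (s :: P) q q3 q1).
have vis0 : s \in [seq nth 0 (s :: P) i | i <- q].
  by apply/mapP; exists 0%N => //; case: (q) q1 q2 => //= x q' _ ->; rewrite mem_head.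
(* The maximum is reached through its members: the bound holds for 0, passes to maxima and is shown
   for each attained value. *)
rewrite /k_opt; elim/big_ind: _ => [|x y hx hy|k /asboolP [p0 [st len nv]]].
- by rewrite mulr0.
- by rewrite /maxn; case: ifP.
case: p0 st len nv => // s' p1 [->]; rewrite path_lengthE => len nv.
have [->|k0] := posnP k; first by rewrite mulr0.
(* The competing path is reduced to its distinct points of [P]; being a subsequence, they form a
   path that is no longer. *)
pose v := undup [seq x <- s :: p1 | x \in P].
have uv : uniq v := undup_uniq _.
have vP : {subset v <= P} by move=> x; rewrite mem_undup mem_filter => /andP [].
have sv : size v = k.
  rewrite -nv /num_visited -size_filter; apply: perm_size; apply: uniq_perm => //; first exact: filter_uniq.
  by move=> x; rewrite mem_undup !mem_filter andbC.
have vB : plr s v <= B.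
  apply: le_trans (plr_subseq s (subseq_trans (undup_subseq _) (filter_subseq _ (s :: p1)))) _.
  by rewrite /= subrr enorm0 add0r.
have kv : (0 < size v)%N by rewrite sv.
have kR : 0 <= (k%:R : R) by [].
have [triv|cm] : _ \/ _ := ltac:(first [exact (complete d0 u0 uv vP vB kv)|exact (complete d0 uP u0 uv vP vB kv)|exact (complete d0 B0 u0 uv vP vB kv)|exact (complete d0 uP B0 u0 uv vP vB kv)]).
  (* All points coincide with the start, so the answer visits all of them. *)
  apply: (@le_trans _ _ (k%:R)); first by rewrite ler_piMl //; lra.
  rewrite ler_nat -sv; apply: leq_trans (kn uv vP) _.
  rewrite /num_visited (_ : count _ P = size P) //; apply/eqP; rewrite -all_count; apply/allP => x xP.
  have -> : x = s; last exact: vis0.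
  by have := triv (index x P).+1 0%N; rewrite /= nth_index //; apply => //; rewrite ltnS index_mem.
have cu := cku u0 kv; rewrite sv in cm cu.
set c' := ((k + u.-1) %/ u).-1 in cm cu.
have cR : c'%:R * u%:R <= (k%:R : R) by rewrite -natrM ler_nat.
(* This is where [u] as the ceiling of [1 / delta] enters: [c' * u <= k] and [1 <= u * delta]. *)
have c2' : c'%:R <= delta * k%:R.
  apply: (@le_trans _ _ (c'%:R * (u%:R * delta))); first by rewrite ler_peMr.
  by rewrite mulrA mulrC ler_wpM2l // ltW.
have : (k%:R : R) <= (num_visited P [seq nth 0 (s :: P) i | i <- q])%:R + c'%:R.
  by rewrite -natrD ler_nat; apply: leq_trans cm _; rewrite leq_add2r; exact: q5.
by rewrite mulrBl mul1r; move: c2'; lra.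
Qed.
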